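(* Let $p>1$. Assume that there are a constant $\lambda\ge0$, a nonnegative process $f\in\mathcal H^p$ and a function $\psi\in\mathbf S$ such that for every $n\ge1$ the generator $g_n$ satisfies, $d\mathbb P\times dt$-a.e., for all $(y,z)\in\mathbb R\times\mathbb R^d$, $|g_n(\omega,t,y,z)|\le f_t(\omega)+\psi_t(\omega,|y|)+\lambda|z|$ (the same $f,\psi,\lambda$ for all $n$). Let $V\in\mathcal V^p$, $\xi\in\mathbb L^p(\mathcal F_T)$, and $L\in\mathcal S$ with $L_T\le\xi$. For each $n\ge1$ let $(Y^n,Z^n,K^n)\in\mathcal S^p\times\mathrm M^p\times\mathcal V^{+,p}$ be a solution of the reflected BSDE $(\xi,g_n+dV,L)$. Suppose that $Y^n$ increases or decreases in $n$, that $g_n$ tends locally uniformly in $(y,z)$ to the generator $g$ as $n\to\infty$, and that there is a random variable $\eta\in\mathbb L^1(\mathcal F_T)$ such that for each $n\ge1$ and $t\in[0,T]$, $$\mathbb E\Big[\sup_{s\in[t,T]}|Y^n_s|^p+\Big(\int_t^T|Z^n_s|^2ds\Big)^{p/2}+|K^n_T-K^n_t|^p+\Big(\int_t^T|g_n(s,Y^n_s,Z^n_s)|ds\Big)^p\,\Big|\,\mathcal F_t\Big]\le\mathbb E[\eta\,|\,\mathcal F_t].$$ Then there exists a triple $(Y,Z,K)\in\mathcal S^p\times\mathrm M^p\times\mathcal V^{+,p}$ which solves the reflected BSDE $(\xi,g+dV,L)$, $$\lim_{n\to\infty}\left(\|Y^n-Y\|_{\mathcal S^p}+\|Z^n-Z\|_{\mathrm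 M^p}\right)=0,$$ and there exists a subsequence $\{K^{n_j}\}$ of $\{K^n\}$ such that $\lim_{j\to\infty}\sup_{t\in[0,T]}|K^{n_j}_t-K_t|=0$. Furthermore, if $K^n$ increases or decreases in $n$, then $\lim_{n\to\infty}\|K^n-K\|_{\mathcal S^p}=0$.
   Context: Setting: $T>0$ and an integer $d\ge1$ are fixed. $(\Omega,\mathcal F,\mathbb P)$ is a complete probability space carrying a standard $d$-dimensional Brownian motion $B$, $(\mathcal F_t)$ is the completed filtration generated by $B$, and $\mathcal F=\mathcal F_T$. All equalities and inequalities between random elements (including the almost sure limit of the $K^{n_j}$) are understood to hold $\mathbb P$-a.s. A generator is a random function $g:\Omega\times[0,T]\times\mathbb R\times\mathbb R^d\to\mathbb R$ such that $g(\cdot,y,z)$ is $(\mathcal F_t)$-progressively measurable for each $(y,z)$. $\mathbb R_+=[0,\infty)$. Spaces (for $p>1$): $\mathbb L^q(\mathcal F_T)$, $q\ge1$: $\mathcal F_T$-measurable $\xi$ with $\mathbb E|\xi|^q<\infty$. $\mathcal S$: continuous progressively measurable processes; $\mathcal S^p$: $Y\in\mathcal S$ with $\|Y\|_{\mathcal S^p}:=(\mathbb E[\sup_{t\in[0,T]}|Y_t|^p])^{1/p}<\infty$. $\mathrm M^p$: progressively measurable $\mathbb R^d$-valued $Z$ with $\|Z\|_{\mathrm M^p}:=(\mathbb E[(\int_0^T|Z_t|^2dt)^{p/2}])^{1/p}<\infty$. $\mathcal H$: progressively measurable $X$ with $\int_0^T|X_t|dt<\infty$ a.s.; $\mathcal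 H^p$: those with $\mathbb E[(\int_0^T|X_t|dt)^p]<\infty$. $\mathcal V^p$: continuous progressively measurable finite variation processes $V$ whose total variation $|V|_T$ on $[0,T]$ satisfies $\mathbb E[|V|_T^p]<\infty$; $\mathcal V^{+,p}$: the increasing processes in $\mathcal V^p$. $\mathbf S$: nonnegative functions $\psi_t(\omega,r):\Omega\times[0,T]\times\mathbb R_+\to\mathbb R_+$ such that $d\mathbb P\times dt$-a.e. $r\mapsto\psi_t(\omega,r)$ is increasing with $\psi_t(\omega,0)=0$, and $\psi_\cdot(r)\in\mathcal H$ for each $r\ge0$. A solution of the reflected BSDE $(\xi,g+dV,L)$ is a triple $(Y,Z,K)$ of progressively measurable processes with $t\mapsto|g(t,Y_t,Z_t)|\in L^1(0,T)$, $t\mapsto|Z_t|\in L^2(0,T)$, and $$Y_t=\xi+\int_t^Tg(s,Y_s,Z_s)ds+\int_t^TdV_s+\int_t^TdK_s-\int_t^TZ_sdB_s,\quad Y_t\ge L_t,\quad t\in[0,T],$$ where $K$ is nondecreasing, continuous, $K_0=0$ and $\int_0^T(Y_t-L_t)dK_t=0$.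
   Formalization: The limit generator g is additionally assumed continuous in (y,z), dP×dt-a.e. (nothing is assumed of the g_n); without this the claim fails, since g_n(t,Y^n,Z^n) need not converge to g(t,Y,Z) for a discontinuous g. *)

(* Defs.v *)
From HB Require Import structures.
From mathcomp Require Import all_boot all_order all_algebra.
From mathcomp Require Import all_classical all_reals all_analysis measurable_realfun.

Set Implicit Arguments.
Unset Strict Implicit.
Unset Printing Implicit Defensive.

Import Order.TTheory GRing.Theory Num.Theory.
Import numFieldNormedType.Exports.

Local Open Scope classical_set_scope.
Local Open Scope ring_scope.

(* A process indexed by [0, T] is a function R -> Omega -> _ (time first); its
   values outside [0, T] are junk that no definition below looks at.
   As is usual, processes are identified when they are indistinguishable: path
   properties (continuity, monotonicity, bounded variation) are required for
   almost every path. *)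

Section Brownian.
Context {R : realType} {d : nat} {disp : measure_display}
        {Omega : measurableType disp}.
Implicit Types (P : probability Omega R) (T : R) (B : R -> Omega -> 'rV[R]_d).

Definition enorm (z : 'rV[R]_d) : R := Num.sqrt (\sum_(i < d) z 0 i ^+ 2).

Definition brownian_events B (t : R) : set (set Omega) :=
  [set E | exists s i (A : set (measurableTypeR R)),
     [/\ 0 <= s <= t, measurable A & E = [set w | A (B s w 0 i)]]].

Definition brownian_filtration P B (t : R) : set (set Omega) :=
  <<s brownian_events B t `|` [set N | measurable N /\ P N = 0%E] >>.

Definition increment_event B (s t : R)
    (A : 'I_d -> set (measurableTypeR R)) : set Omega :=
  [set w | forall i, A i (B t w 0 i - B s w 0 i)].

(* Second argument of normal_prob: standard deviation. *)
Definition brownian_motion P T B : Prop :=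
  [/\ (forall t i, 0 <= t <= T -> measurable_fun setT (fun w => B t w 0 i)),
      {ae P, forall w, B 0 w = 0},
      {ae P, forall w, {within `[0, T], continuous (B ^~ w)}},
      (forall s t A, 0 <= s -> s < t -> t <= T -> (forall i, measurable (A i)) ->
         P (increment_event B s t A) =
         (\prod_(i < d) normal_prob 0 (Num.sqrt (t - s)) (A i))%E) &
      (forall s t A E, 0 <= s -> s < t -> t <= T -> (forall i, measurable (A i)) ->
         <<s brownian_events B s >> E ->
         P (E `&` increment_event B s t A) =
         (P E * P (increment_event B s t A))%E)].

End Brownian.

Section Processes.
Context {R : realType} {d : nat} {disp : measure_display}
        {Omega : measurableType disp}.
Variables (P : probability Omega R) (T : R) (F : R -> set (set Omega)).
Implicit Types (X Y K V L f : R -> Omega -> R) (Z : R -> Omega -> 'rV[R]_d).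
Implicit Types (psi : R -> Omega -> R -> R).
Implicit Types (g : R -> Omega -> R -> 'rV[R]_d -> R).

(* Time integrals are taken for the completed measure: a generator is regular in
   (y, z) only dP x dt-a.e., so t |-> g t w (Y t w) (Z t w) is in general
   Lebesgue measurable but not Borel measurable. *)
Local Notation leb := (@completed_lebesgue_measure R).

Definition ae_PT (Q : Omega -> R -> Prop) : Prop :=
  {ae (P \x (@lebesgue_measure R))%E,
    forall wt : Omega * measurableTypeR R, 0 <= wt.2 <= T -> Q wt.1 wt.2}.

Definition progressive X : Prop :=
  forall t, 0 <= t <= T ->
    measurable_fun
      ([set` `[0, t]] `*` setT : set (measurableTypeR R * g_sigma_algebraType (F t)))
      (fun sw => X sw.1 sw.2).

Definition progressive_vec Z : Prop :=
  forall i, progressive (fun t w => Z t w 0 i).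

Definition generator g : Prop :=
  forall y z, progressive (fun t w => g t w y z).

Definition continuous_paths X : Prop :=
  {ae P, forall w, {within `[0, T], continuous (X ^~ w)}}.

Definition nondecreasing_paths X : Prop :=
  {ae P, forall w, forall s t, 0 <= s -> s <= t -> t <= T -> X s w <= X t w}.

Definition sup_from (t : R) (x : R -> R) : \bar R :=
  ereal_sup [set (x s)%:E | s in `[t, T]].

Definition int_from (t : R) (x : R -> R) : \bar R :=
  (\int[leb]_(s in `[t, T]) (x s)%:E)%E.

Definition Lqspace (q : R) (xi : Omega -> R) : Prop :=
  measurable_fun (setT : set (g_sigma_algebraType (F T))) xi /\
  (\int[P]_w (`|xi w| `^ q)%:E < +oo)%E.

Definition Sspace X : Prop := progressive X /\ continuous_paths X.

Definition Snorm (p : R) X : \bar R :=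
  ((\int[P]_w sup_from 0 (fun t => `|X t w| `^ p)%R) `^ p^-1)%E.

Definition Spspace (p : R) X : Prop := Sspace X /\ (Snorm p X < +oo)%E.

Definition Mnorm (p : R) Z : \bar R :=
  ((\int[P]_w (int_from 0 (fun t => enorm (Z t w) ^+ 2)%R `^ (p / 2))) `^ p^-1)%E.

Definition Mpspace (p : R) Z : Prop :=
  progressive_vec Z /\ (Mnorm p Z < +oo)%E.

Definition Hspace X : Prop :=
  progressive X /\
  {ae P, forall w, (int_from 0 (fun t => `|X t w|)%R < +oo)%E}.

Definition Hpspace (p : R) X : Prop :=
  Hspace X /\ (\int[P]_w (int_from 0 (fun t => `|X t w|)%R `^ p) < +oo)%E.

Definition Vpspace (p : R) V : Prop :=
  [/\ Sspace V,
      {ae P, forall w, bounded_variation 0 T (V ^~ w)} &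
      (\int[P]_w (total_variation 0 T (V ^~ w) `^ p) < +oo)%E].

Definition Vincpspace (p : R) V : Prop :=
  Vpspace p V /\ nondecreasing_paths V.

Definition Psispace psi : Prop :=
  [/\ (forall t w r, 0 <= t <= T -> 0 <= r -> 0 <= psi t w r),
      ae_PT (fun w t => (forall r1 r2, 0 <= r1 -> r1 <= r2 ->
                           psi t w r1 <= psi t w r2) /\ psi t w 0 = 0) &
      (forall r, 0 <= r -> Hspace (fun t w => psi t w r))].

Definition cvg_to0_in_probability (X : nat -> Omega -> \bar R) : Prop :=
  forall e : R, 0 < e ->
    (fun n => P [set w | (e%:E <= X n w)%E]) @ \oo --> 0%E.

(* The simple integrand \sum_(k < m) a_k 1_(]t_k, t_(k.+1)]), with bounded
   F_(t_k)-measurable a_k, and its stochastic integral against B. *)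
Definition simple_integrand (m : nat) (t : nat -> R) (a : nat -> Omega -> 'rV[R]_d)
    : Prop :=
  [/\ t 0%N = 0, (forall k, (k < m)%N -> t k <= t k.+1), t m = T &
      forall k, (k < m)%N ->
        (forall i, measurable_fun (setT : set (g_sigma_algebraType (F (t k))))
           (fun w => a k w 0 i)) /\
        (exists C, forall w, enorm (a k w) <= C)].

Definition simple_process (m : nat) (t : nat -> R) (a : nat -> Omega -> 'rV[R]_d)
    (s : R) (w : Omega) : 'rV[R]_d :=
  \sum_(k < m) if t k < s <= t k.+1 then a k w else 0.

Definition simple_integral (B : R -> Omega -> 'rV[R]_d)
    (m : nat) (t : nat -> R) (a : nat -> Omega -> 'rV[R]_d)
    (s : R) (w : Omega) : R :=
  \sum_(k < m) \sum_(i < d)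
    a k w 0 i * (B (Num.min (t k.+1) s) w 0 i - B (Num.min (t k) s) w 0 i).

(* I is the process t |-> \int_0^t Z dB: the limit, uniformly in time and in
   probability, of the integrals of simple integrands H_n such that
   \int_0^T |H_n - Z|^2 dt tends to 0 in probability.  This determines I up to
   indistinguishability. *)
Definition ito_integral (B : R -> Omega -> 'rV[R]_d) Z (I : R -> Omega -> R)
    : Prop :=
  Sspace I /\
  exists (m : nat -> nat) (t : nat -> nat -> R)
         (a : nat -> nat -> Omega -> 'rV[R]_d),
    [/\ (forall n, simple_integrand (m n) (t n) (a n)),
        cvg_to0_in_probability (fun n w => int_from 0 (fun s =>
          enorm (simple_process (m n) (t n) (a n) s w - Z s w) ^+ 2)) &
        cvg_to0_in_probability (fun n w => sup_from 0 (fun s =>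
          `|simple_integral B (m n) (t n) (a n) s w - I s w|))].

(* \int_0^T h dk = c for a path k that is nondecreasing and continuous on
   [0, T]; k0 extends k to the line, and its values off [0, T] are irrelevant. *)
Definition is_stieltjes_integral (k h : R -> R) (c : \bar R) : Prop :=
  exists k0 : cumulative R R,
    (forall t, 0 <= t <= T -> k0 t = k t) /\
    (\int[lebesgue_stieltjes_measure k0]_(t in `]0%R, T]) (h t)%:E = c)%E.

(* (Y, Z, K) solves the reflected BSDE (xi, g + dV, L) driven by B. *)
Definition rbsde_solution (B : R -> Omega -> 'rV[R]_d) (xi : Omega -> R) g V L
    Y Z K : Prop :=
  [/\ progressive Y, progressive_vec Z & progressive K] /\
  [/\ {ae P, forall w,
        leb.-integrable `[0, T] (fun t => (g t w (Y t w) (Z t w))%:E)},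
      {ae P, forall w, leb.-integrable `[0, T] (fun t => (enorm (Z t w) ^+ 2)%:E)},
      (exists2 I, ito_integral B Z I &
        {ae P, forall w, forall t, 0 <= t <= T ->
          Y t w = xi w + (\int[leb]_(s in `[t, T]) g s w (Y s w) (Z s w))
                  + (V T w - V t w) + (K T w - K t w) - (I T w - I t w)}) &
      {ae P, forall w, forall t, 0 <= t <= T -> L t w <= Y t w}] /\
  [/\ nondecreasing_paths K, continuous_paths K, {ae P, forall w, K 0 w = 0} &
      {ae P, forall w,
        is_stieltjes_integral (K ^~ w) (fun t => Y t w - L t w) 0%E}].

Definition is_cond_exp (G : set (set Omega)) (X X' : Omega -> \bar R) : Prop :=
  [/\ P.-integrable setT X,
      P.-integrable setT X',
      measurable_fun (setT : set (g_sigma_algebraType G)) X' &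
      forall A, <<s G >> A -> (\int[P]_(w in A) X' w = \int[P]_(w in A) X w)%E].

(* E[X | G] <= E[X' | G] almost surely. *)
Definition cond_exp_le (G : set (set Omega)) (X X' : Omega -> \bar R) : Prop :=
  exists U U', [/\ is_cond_exp G X U, is_cond_exp G X' U' &
                   {ae P, forall w, (U w <= U' w)%E}].

Definition increases (X : nat -> R -> Omega -> R) : Prop :=
  forall n, {ae P, forall w, forall t, 0 <= t <= T -> X n t w <= X n.+1 t w}.

Definition decreases (X : nat -> R -> Omega -> R) : Prop :=
  forall n, {ae P, forall w, forall t, 0 <= t <= T -> X n.+1 t w <= X n t w}.

Definition continuous_generator g : Prop :=
  ae_PT (fun w t => continuous (fun yz : R * 'rV[R]_d => g t w yz.1 yz.2)).

Definition tends_locally_uniformly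
    (gn : nat -> R -> Omega -> R -> 'rV[R]_d -> R) g : Prop :=
  ae_PT (fun w t =>
    {family compact, (fun n (yz : R * 'rV[R]_d) => gn n t w yz.1 yz.2) @ \oo -->
                     (fun yz : R * 'rV[R]_d => g t w yz.1 yz.2)}).

End Processes.

(* Main.v *)
Require Import Defs.
From HB Require Import structures.
From mathcomp Require Import all_boot all_order all_algebra.
From mathcomp Require Import all_classical all_reals all_analysis measurable_realfun.
From mathcomp Require Import ring lra.

Set Implicit Arguments.
Unset Strict Implicit.
Unset Printing Implicit Defensive.

Import Order.TTheory GRing.Theory Num.Theory.
Import numFieldNormedType.Exports.

Local Open Scope classical_set_scope.
Local Open Scope ring_scope.

(** With X = Y^n - Y^m, the Skorokhod conditions make X d(K^n - K^m) nonpositive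
    up to the oscillation of X, and on {sup_n |Y^n_0| <= k}, before the first time
    at which some |Y^n| exceeds k or the integral of 2 f + 2 psi(k) exceeds k', the
    generators differ by at most 2 f + 2 psi(k) + lambda (|Z^n| + |Z^m|).  Expanding
    X^2 along fine partitions bounds E[X_t^2 + int_t^tau |Z^n - Z^m|^2 ; A], A in
    F_t, by the same expectation of X_tau^2 + 2 int |X| (2 f + 2 psi(k) + ...).
    As |X| <= |Y^n - Y| by monotonicity, the latter tends to 0 by dominated
    convergence and Young's inequality.  Taking for A the events of first passage
    of |X| above a level, Y^n is Cauchy in probability uniformly in time; moreover
    int |Z^n - Z^m|^2 tends to 0 in probability, hence, by Lenglart's inequality,
    int Z^n dB is Cauchy as well.
    Conditioning the moment estimate at the first time int_0^t |Z^n|^2 exceeds N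
    bounds E[((int |Z^n|^2 - N)^+)^(p/2)] by E[|eta| ; int |Z^n|^2 >= N]: this is the
    uniform integrability which turns convergence in probability into convergence
    in M^p.  Along a rapidly converging subsequence all limits are almost sure, and
    K is read off the equation. *)

(** For [p < 2] neither [sup |Y^n|] nor the norm of [Z^n] need have a second moment, while the
    energy method is quadratic: hence the localization, chosen once for all pairs [(n, m)]. Leaving
    it again costs uniform integrability, which the two processes obtain differently. For [Y^n] it
    comes from monotonicity: [|Y^n - Y^0|] grows with [n], so monotone convergence turns the moment
    bound into one integrable majorant of all [sup |Y^n|^p]. For [Z^n] no such majorant is at hand,
    and this is why the moment hypothesis is used in its conditional form. Of Ito's formula only an
    inequality is required, with errors small against a process [Lam] of finite variation, so the
    algebra of squares along partitions suffices. The exponent [p > 1] enters through the cross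
    terms [|X| |Z^n|]: when the norm of [Z^n] is large they are paid for by its moment of order [p],
    with a factor that tends to 0 because [p] exceeds 1. The limits are defined as pointwise upper
    limits, so they are progressive by construction. *)

Section Arithmetic.
Context {R : realFieldType}.
Implicit Types a b c e x y : R.

Lemma le_two_two x y c : x <= c -> y <= c -> 2 * x + 2 * y <= 4 * c.
Proof. lra. Qed.

Lemma lt_quarters x y c e : x < c -> y < e / 4 -> c <= e / 4 -> 2 * x + 2 * y < e.
Proof. lra. Qed.

Lemma diff_of_sums (a b c e a' b' c' e' gi gi' v k k' : R) :
  a - b + (c - e) = gi + v + k -> a' - b' + (c' - e') = gi' + v + k' ->
  a - a' - (b - b') + (c - c' - (e - e')) = gi - gi' + (k - k').
Proof.
move=> h h'; have -> : gi - gi' + (k - k') = (gi + v + k) - (gi' + v + k') by ring.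
by rewrite -h -h'; ring.
Qed.

End Arithmetic.

(** A sub-sigma-algebra is kept as a plain set of sets, so measurability goes through the type
    generated by it; [gmeasE] undoes the generation when [G] is already a sigma-algebra. *)
Definition gmeas {Om : pointedType} {disp' : measure_display} {Y : measurableType disp'}
    (G : set (set Om)) (X : Om -> Y) : Prop :=
  measurable_fun (setT : set (g_sigma_algebraType G)) X.

(** * Sub-sigma-algebras containing the null sets *)

Section SubSigma.
Context {R : realType} {disp : measure_display} {Omega : measurableType disp}.
Variables (P : probability Omega R).
Hypothesis hP : measure_is_complete P.

(** Containing the null sets is what makes almost sure statements usable inside the filtration: as
    [P] is complete, the set where such a statement holds belongs to every [F t], so exceptional
    paths can be cut off already at time 0. *)
Record subsigma (G : set (set Omega)) : Prop := SubSigma {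
  subsigma_sigma : sigma_algebra setT G;
  subsigma_meas : forall A, G A -> measurable A;
  subsigma_null : forall N, measurable N -> P N = 0%E -> G N }.

Lemma gmeasE disp' (Y : measurableType disp') (G : set (set Omega)) (X : Omega -> Y) :
  subsigma G -> gmeas G X <-> forall A, measurable A -> G (X @^-1` A).
Proof.
move=> [sG _ _]; rewrite /gmeas /measurable_fun; split.
  move=> h A mA; have := h measurableT A mA.
  by rewrite setTI /measurable /= sigma_algebra_id.
move=> h _ A mA; rewrite setTI.
by apply: sub_sigma_algebra; exact: h.
Qed.

Lemma gmeas_meas disp' (Y : measurableType disp') (G : set (set Omega)) (X : Omega -> Y) :
  subsigma G -> gmeas G X -> measurable_fun setT X.
Proof.
move=> hG /(gmeasE _ hG) h _ A mA; rewrite setTI.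
by apply: (subsigma_meas hG); exact: h.
Qed.

Lemma gmeas_sub disp' (Y : measurableType disp') (G G' : set (set Omega)) (X : Omega -> Y) :
  subsigma G -> subsigma G' -> G `<=` G' -> gmeas G X -> gmeas G' X.
Proof.
move=> hG hG' GG' /(gmeasE _ hG) h; apply/(gmeasE _ hG') => A mA.
exact/GG'/h.
Qed.

Lemma subsigma_negl G N : subsigma G -> P.-negligible N -> G N.
Proof.
move=> hG nN; have mN := hP nN.
by apply: (subsigma_null hG) => //; apply/negligibleP.
Qed.

Lemma subsigmaC G A : subsigma G -> G A -> G (~` A).
Proof. by move=> [[_ hC _] _ _] /hC; rewrite setTD. Qed.

Lemma subsigma_bigcup G (A : (set Omega)^nat) :
  subsigma G -> (forall n, G (A n)) -> G (\bigcup_n A n).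
Proof. by move=> [[_ _ hU] _ _]; exact: hU. Qed.

Lemma subsigmaT G : subsigma G -> G setT.
Proof. by move=> hG; rewrite -setC0; apply: subsigmaC => //; case: hG => [[]]. Qed.

Lemma subsigmaU G A B : subsigma G -> G A -> G B -> G (A `|` B).
Proof.
move=> hG GA GB; rewrite -bigcup2E; apply: subsigma_bigcup => // -[|[|n]] //=.
by case: hG => [[]].
Qed.

Lemma subsigmaI G A B : subsigma G -> G A -> G B -> G (A `&` B).
Proof.
move=> hG GA GB; rewrite -[_ `&` _]setCK setCI; apply: subsigmaC => //.
by apply: subsigmaU => //; exact: subsigmaC.
Qed.

(** The two preimages differ by a part of a null set, and completeness of [P] puts every such part
    into [G]. *)
Lemma gmeas_ae_eq disp' (Y : measurableType disp') G (X X' : Omega -> Y) :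
  subsigma G -> gmeas G X -> {ae P, forall w, X w = X' w} -> gmeas G X'.
Proof.
move=> hG /(gmeasE _ hG) mX hXX'; apply/(gmeasE _ hG) => A mA.
have nN : P.-negligible (~` [set w | X w = X' w]) by [].
have -> : X' @^-1` A = (X @^-1` A `&` [set w | X w = X' w]) `|`
                       (X' @^-1` A `&` ~` [set w | X w = X' w]).
  apply/seteqP; split => w /=.
    move=> AX'; case: (pselect (X w = X' w)) => e; last by right.
    by left; rewrite e.
  by move=> [[+ e]|[//]]; rewrite e.
apply: subsigmaU => //.
  apply: subsigmaI => //; first exact: mX.
  by rewrite -[X in G X]setCK; apply: subsigmaC => //; exact: subsigma_negl.
apply: subsigma_negl => //.
by apply: negligibleS nN => w [].
Qed.

Lemma gmeas_cvg G (Xn : nat -> Omega -> R) (X : Omega -> R) :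
  subsigma G -> (forall n, gmeas G (Xn n)) ->
  {ae P, forall w, Xn ^~ w @ \oo --> X w} -> gmeas G X.
Proof.
move=> hG mXn [N [mN N0 hN]].
(* Multiplying by the indicator of the complement of the null set makes the sequence converge
   everywhere. *)
pose C : set (g_sigma_algebraType G) := ~` N.
have GC : G C by apply: subsigmaC => //; exact: subsigma_null.
have mC : measurable C by exact: sub_sigma_algebra.
apply: (@gmeas_ae_eq _ _ _ (fun w => X w * \1_C w)) => //; last first.
  exists N; split => // w /= h; apply: contrapT => Nw; apply: h.
  by rewrite indicE mem_set// mulr1.
have mI : measurable_fun (setT : set (g_sigma_algebraType G)) (\1_C : _ -> R).
  exact: measurable_indic.
rewrite /gmeas.
apply: (@measurable_fun_cvg _ (g_sigma_algebraType G) R setT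
  (fun n w => Xn n w * \1_C w)) => //.
- by move=> n; apply: measurable_funM => //; exact: mXn.
- move=> w _; rewrite indicE; case: (boolP (w \in C)) => wC.
    rewrite mulr1; under eq_fun do rewrite mulr1.
    by apply: contrapT => h; move: wC; rewrite inE => /(_ (hN _ h)).
  rewrite mulr0; under eq_fun do rewrite mulr0; exact: cvg_cst.
Qed.

End SubSigma.

Import HBNNSimple.

(** * Integrals against a measure with a density *)

Section Density.
Context {R : realType} {d : measure_display} {T : measurableType d}.
Variables (mu nu : {measure set T -> \bar R}) (p : T -> R).
Hypotheses (p0 : forall x, 0 <= p x) (mp : measurable_fun setT p)
  (nuE : forall A, measurable A -> nu A = (\int[mu]_(x in A) (p x)%:E)%E).

(** [nuE] is the case of an indicator; linearity extends it to the simple functions [g n] increasing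
    to [phi], and monotone convergence is applied on both sides. *)
Lemma ge0_integral_density (phi : T -> R) : (forall x, 0 <= phi x) ->
  measurable_fun setT phi ->
  (\int[nu]_x (phi x)%:E = \int[mu]_x (phi x * p x)%:E)%E.
Proof.
move=> phi0 mphi.
have mphi' : measurable_fun setT (EFin \o phi) by exact/measurable_EFinP.
pose g := nnsfun_approx measurableT mphi'.
have gE n (x : T) : (g n x)%:E =
    (\sum_(y \in range (g n)) y%:E * (\1_(g n @^-1` [set y]) x)%:E)%E.
  rewrite {1}(fimfunE (g n) x) -fsumEFin//.
have key n : (\int[nu]_x (g n x)%:E = \int[mu]_x (g n x * p x)%:E)%E.
  under eq_integral do rewrite gE.
  under [RHS]eq_integral => x _.
    rewrite EFinM gE ge0_mule_fsuml; last first.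
      by move=> y; exact: nnfun_muleindic_ge0.
    over.
  rewrite ge0_integral_fsum //; last 2 first.
  - by move=> r; exact/measurable_EFinP/measurableT_comp.
  - by move=> r /= z _; exact: nnfun_muleindic_ge0.
  rewrite ge0_integral_fsum //; last 2 first.
  - move=> r; apply/emeasurable_funM; last exact/measurable_EFinP.
    by exact/measurable_EFinP/measurableT_comp.
  - by move=> r /= z _; rewrite mule_ge0 ?lee_fin//; exact: nnfun_muleindic_ge0.
  apply: eq_fsbigr => r; rewrite inE => -[z _ <-{r}].
  rewrite ge0_integralZl//; last 2 first.
  - exact/measurable_EFinP.
  - by rewrite lee_fin.
  under [RHS]eq_integral do rewrite -muleA.
  rewrite ge0_integralZl//; last 3 first.
  - apply/emeasurable_funM; last exact/measurable_EFinP.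
    exact/measurable_EFinP.
  - by move=> x _; rewrite mule_ge0// lee_fin.
  - by rewrite lee_fin.
  congr (_ * _)%E; rewrite integral_indic// setIT nuE// integral_mkcond/=.
  apply: eq_integral => x _; rewrite patchE indicE; case: ifPn => _.
    by rewrite mul1e.
  by rewrite mul0e.
have h1 : (\int[nu]_x (g n x)%:E)%E @[n --> \oo] --> (\int[nu]_x (phi x)%:E)%E.
  rewrite (_ : (fun x => (phi x)%:E) = fun x => limn (fun n => (g n x)%:E)); last first.
    apply/funext => x; apply/esym/cvg_lim => //.
    by apply: (cvg_nnsfun_approx measurableT mphi') => // y _; rewrite lee_fin.
  apply: (@cvg_monotone_convergence _ _ _ nu setT measurableT (fun n x => (g n x)%:E)) => //.
  - by move=> n; exact/measurable_EFinP.
  - by move=> n x _; rewrite lee_fin.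
  - by move=> x _ a b ab; rewrite lee_fin; exact/lefP/nd_nnsfun_approx.
have h2 : (\int[nu]_x (g n x)%:E)%E @[n --> \oo] --> (\int[mu]_x (phi x * p x)%:E)%E.
  rewrite (_ : (fun x => (phi x * p x)%:E) = fun x => limn (fun n => (g n x * p x)%:E)); last first.
    apply/funext => x; apply/esym/cvg_lim => //.
    under eq_fun do rewrite EFinM.
    rewrite EFinM; apply: cvgeZr => //.
    by apply: (cvg_nnsfun_approx measurableT mphi') => // y _; rewrite lee_fin.
  under eq_fun do rewrite key.
  apply: (@cvg_monotone_convergence _ _ _ mu setT measurableT (fun n x => (g n x * p x)%:E)) => //.
  - by move=> n; apply/measurable_EFinP; apply: measurable_funM.
  - by move=> n x _; rewrite lee_fin mulr_ge0.
  - move=> x _ a b ab; rewrite lee_fin ler_wpM2r//; exact/lefP/nd_nnsfun_approx.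
exact: (cvg_unique _ h1 h2).
Qed.

End Density.

(** * First two moments of the centred normal law *)

Section NormalMoments.
Context {R : realType}.
Variable (s : R).
Hypothesis s0 : 0 < s.
Local Notation mu := (@lebesgue_measure R).
Local Notation p := (@normal_pdf R 0 s).
Local Notation nu := (@normal_prob R 0 s).

Let sn0 : s != 0. Proof. by rewrite gt_eqF. Qed.

Let pE : p = fun x => normal_peak s * normal_fun 0 s x.
Proof. by rewrite normal_pdfE. Qed.

Let p0 x : 0 <= p x. Proof. exact: normal_pdf_ge0. Qed.

Let cp : continuous p. Proof. exact: continuous_normal_pdf. Qed.

Let mp : measurable_fun setT p. Proof. exact: measurable_normal_pdf. Qed.

Let pN x : p (- x) = p x.
Proof. by rewrite pE /normal_fun !subr0 sqrrN. Qed.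

Let dp (x : R) : is_derive x 1 (p : R^o -> R^o) (- (x / s ^+ 2) * p x).
Proof.
rewrite pE /normal_fun.
rewrite (_ : (fun _ => _) = normal_peak s *: (expR \o
    ((- (s ^+ 2 *+ 2)^-1) *: ((@id R : R^o -> R^o) ^+ 2)))); last first.
  apply/funext => y; rewrite /GRing.scale /= /GRing.scale /= subr0 exprfctE.
  by rewrite mulNr [X in - X]mulrC -mulNr.
have h1 := @is_deriveX _ _ (@id R : R^o -> R^o) 2%N x 1 1 (is_derive_id x (1 : R^o)).
have h2 := is_deriveZ (- (s ^+ 2 *+ 2)^-1) h1.
have h3 := is_derive1_comp (is_derive_expR _) h2.
have h4 := is_deriveZ (normal_peak s) h3.
apply: (is_derive_eq h4).
rewrite /= /GRing.scale /= !subr0 /GRing.scale /= exprfctE.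
rewrite [X in expR X](_ : _ = - x ^+ 2 / (s ^+ 2 *+ 2)); last first.
  by rewrite mulNr [X in - X]mulrC -mulNr.
set e := expR _; set k := normal_peak s.
rewrite mulr1 expr1 -mulr_natr; field.
done.
Qed.

(** Since [p' = - (x / s^2) p], this is a primitive of [(x^2 - s^2) p] that vanishes at 0 and at
    infinity; hence [x^2] and [s^2] have the same integral against [p] over the half line. *)
Let F : R -> R := fun x => - s ^+ 2 * (x * p x).

Let dF (x : R) : is_derive x 1 (F : R^o -> R^o) ((x ^+ 2 - s ^+ 2) * p x).
Proof.
rewrite (_ : F = - s ^+ 2 *: ((@id R : R^o -> R^o) * (p : R^o -> R^o))); last first.
  by apply/funext.
have h := is_deriveM (is_derive_id x (1 : R^o)) (dp x).
have h2 := is_deriveZ (- s ^+ 2) h.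
apply: (is_derive_eq h2).
rewrite /= /GRing.scale /=; field.
done.
Qed.

(** From [exp y >= 1 + y >= y], that is [exp (- y) <= 1 / y]; this quadratic decay suffices for [F]
    to vanish at infinity. *)
Let p_ub x : 0 < x -> p x <= normal_peak s * (s ^+ 2 *+ 2) / x ^+ 2.
Proof.
move=> x0; rewrite pE /normal_fun subr0 -mulrA ler_wpM2l ?normal_peak_ge0//.
have k0 : 0 < s ^+ 2 *+ 2 by rewrite pmulrn_lgt0// exprn_gt0.
rewrite mulNr expRN -[leRHS]invrK invf_div lef_pV2 ?posrE ?expR_gt0 ?divr_gt0 ?exprn_gt0//.
by apply: le_trans (expR_ge1Dx _); rewrite lerDr.
Qed.

Let Fcvg : F x @[x --> +oo] --> (0 : R).
Proof.
pose C := s ^+ 2 * (normal_peak s * (s ^+ 2 *+ 2)).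
have h : (fun x : R => C * x^-1) x @[x --> +oo] --> (0 : R).
  rewrite -[X in _ --> X](mulr0 C); apply: cvgMr; 
  suff : (fun x : R => x^-1) @ +oo --> (0 : R) by [].
  by apply/(@gtr0_cvgV0 _ _ _ _ (@id R)); [exact: nbhs_pinfty_gt|exact: cvg_id].
apply/norm_cvg0P.
apply: (@squeeze_cvgr _ _ _ _ (fun=> 0) (fun x => C * x^-1)) => //; last exact: cvg_cst.
near=> x.
have x0 : 0 < x by near: x; exact: nbhs_pinfty_gt.
rewrite normr_ge0/= /F normrM normrN normrX (ger0_norm (ltW s0)) normrM (gtr0_norm x0).
rewrite (ger0_norm (p0 _)) /C -mulrA ler_wpM2l ?exprn_ge0 ?(ltW s0)//.
apply: le_trans (ler_wpM2l (ltW x0) (p_ub x0)) _.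
by rewrite le_eqVlt; apply/orP; left; apply/eqP; field; rewrite gt_eqF.
Unshelve. all: by end_near. Qed.

Let mx2 : measurable_fun setT (fun x : R => x ^+ 2 * p x).
Proof. by apply: measurable_funM => //; exact: measurable_funX. Qed.

Let cont2 : continuous (fun x : R => (x ^+ 2 - s ^+ 2) * p x).
Proof.
move=> x; apply: cvgM; last exact: cp.
by apply: cvgB; [exact: sqr_continuous|exact: cvg_cst].
Qed.

Let Fd x : derivable F x 1. Proof. by case: (dF x). Qed.
Let Fc : continuous F.
Proof. by move=> x; apply: differentiable_continuous; apply/derivable1_diffP. Qed.
Let F'E x : F^`()%classic x = (x ^+ 2 - s ^+ 2) * p x.
Proof. by rewrite derive1E; case: (dF x). Qed.

(** The half line is cut at [s], where [x^2 - s^2] changes sign, so that the tail is a nonnegative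
    integral to which the improper form of the fundamental theorem applies. *)
Let Itail : (\int[mu]_(x in `[s, +oo[) ((x ^+ 2 - s ^+ 2) * p x)%:E = (- F s)%:E)%E.
Proof.
rewrite (@ge0_continuous_FTC2y _ _ F s 0) ?EFinN ?sub0e//.
- move=> x sx; rewrite mulr_ge0// subr_ge0 lerXn2r// nnegrE ?(ltW s0)//.
  exact: le_trans (ltW s0) sx.
- exact: continuous_subspaceT.
- by apply: cvg_at_right_filter; exact: Fc.
Qed.

Let Ihead : (\int[mu]_(x in `[0%R, s]) ((s ^+ 2 - x ^+ 2) * p x)%:E = (- F s)%:E)%E.
Proof.
rewrite (@continuous_FTC2 _ _ (\- F)) //.
- by rewrite /F /= mul0r mulr0 oppr0 sube0.
- apply: continuous_subspaceT => x; apply: cvgM; last exact: cp.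
  by apply: cvgB; [exact: cvg_cst|exact: sqr_continuous].
- split => [x _||].
  + by apply: derivableN.
  + apply: cvg_at_right_filter; apply: cvgN; exact: Fc.
  + apply: cvg_at_left_filter; apply: cvgN; exact: Fc.
- move=> x _; rewrite derive1E deriveN// -derive1E F'E -mulNr opprB//.
Qed.


(** [Ihead] and [Itail] have the same value, so they compensate each other: over [[0, +oo[] the
    integral of [x^2 p] is [s^2] times that of [p], which is one half by symmetry. Moving terms
    across the equations keeps every integral nonnegative. *)
Lemma normal_moment2 : (\int[nu]_x (x ^+ 2)%:E = (s ^+ 2)%:E)%E.
Proof.
have msqr : measurable_fun setT (fun x : R => x ^+ 2) by exact: measurable_funX.
have mpE (D : set (measurableTypeR R)) : measurable_fun D (fun x => (p x)%:E).
  exact/measurable_EFinP/measurable_funTS.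
have mpsE D : measurable_fun D (fun x => (s ^+ 2)%:E * (p x)%:E)%E.
  by apply: emeasurable_funM => //; exact: mpE.
have mx2E (D : set (measurableTypeR R)) : measurable_fun D (fun x => (x ^+ 2 * p x)%:E).
  exact/measurable_EFinP/measurable_funTS.
have w0 : 0 <= - F s.
  by rewrite /F mulNr opprK mulr_ge0 ?exprn_ge0 ?mulr_ge0 ?(ltW s0).
have x2p0 x : (0 <= (x ^+ 2 * p x)%:E)%E by rewrite lee_fin mulr_ge0// sqr_ge0.
have sp0 x : (0 <= (s ^+ 2)%:E * (p x)%:E)%E by rewrite mule_ge0// lee_fin// sqr_ge0.
rewrite (@ge0_integral_density _ _ _ mu nu p)//; last by move=> x; exact: sqr_ge0.
have half : (\int[mu]_(x in `[0%R, +oo[) (p x)%:E = (2^-1)%:E)%E.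
  have := @ge0_symfun_integralT R p p0 cp (fun x => esym (pN x)).
  rewrite integral_normal_pdf => h.
  have -> : [set` `[0, +oo[%R] = [set x : R | 0 <= x] by rewrite set_itvcy.
  have h2 : ((2^-1)%:E * 1%:E = (2^-1)%:E * (2%:E * \int[mu]_(x in [set x : R | (0 <= x)%R]) (p x)%:E))%E.
    by rewrite -h.
  by rewrite mule1 muleA -EFinM mulVf// mul1e in h2.
have split0 (f : R -> R) : measurable_fun setT f -> (forall x, 0 <= f x) ->
    (\int[mu]_(x in `[0%R, +oo[) (f x)%:E =
     \int[mu]_(x in `[0%R, s]) (f x)%:E + \int[mu]_(x in `[s, +oo[) (f x)%:E)%E.
  move=> mf f0; rewrite -(integral_itv_obnd_cbnd (r := s)); last first.
    exact/measurable_EFinP/measurable_funTS.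
  have -> : [set` `[0, +oo[%R] = [set` `[0, s]%R] `|` [set` `]s, +oo[%R].
    apply/seteqP; split => x /=; rewrite !in_itv/= ?andbT.
      by move=> x0; case: (leP x s) => xs; [left; rewrite x0|right].
    by move=> [/andP[]//|/(lt_trans s0)/ltW].
  rewrite ge0_integral_setU//=.
  - exact/measurable_EFinP/measurable_funTS.
  - by move=> x _; rewrite lee_fin.
  - apply/disj_setPS => x /= []; rewrite !in_itv/= andbT => /andP[_ xs] sx.
    by have := lt_le_trans sx xs; rewrite ltxx.
have h1 : (\int[mu]_(x in `[0%R, s]) (x ^+ 2 * p x)%:E + (- F s)%:E =
    (s ^+ 2)%:E * \int[mu]_(x in `[0%R, s]) (p x)%:E)%E.
{   rewrite -Ihead -ge0_integralD//; last 2 first.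
  - move=> x; rewrite /= in_itv/= => /andP[x0 xs].
    by rewrite lee_fin mulr_ge0// subr_ge0 lerXn2r// nnegrE (le_trans x0).
  - apply/measurable_EFinP/measurable_funTS.
    by apply: measurable_funM => //; apply: measurable_funB.
  rewrite -ge0_integralZl//; last 2 first.
  - by move=> x _; rewrite lee_fin.
  - by rewrite lee_fin sqr_ge0.
  apply: eq_integral => x _; rewrite -EFinD -EFinM; congr EFin; ring.
  all: by first [exact: mpE | exact: mx2E | exact: mpsE]. }
have h2 : (\int[mu]_(x in `[s, +oo[) (x ^+ 2 * p x)%:E =
    (- F s)%:E + (s ^+ 2)%:E * \int[mu]_(x in `[s, +oo[) (p x)%:E)%E.
{   rewrite -Itail -ge0_integralZl//; last 2 first.
  - by move=> x _; rewrite lee_fin.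
  - by rewrite lee_fin sqr_ge0.
  rewrite -ge0_integralD//; last 3 first.
  - move=> x; rewrite /= in_itv/= andbT => sx.
    by rewrite lee_fin mulr_ge0// subr_ge0 lerXn2r// nnegrE ?(ltW s0)// (le_trans (ltW s0)).
  - apply/measurable_EFinP/measurable_funTS.
    by apply: measurable_funM => //; apply: measurable_funB.
  - exact: mpsE.
  apply: eq_integral => x _; rewrite -EFinM -EFinD; congr EFin; ring.
  all: by first [exact: mpE | exact: mx2E | exact: mpsE]. }
have h3 : (\int[mu]_(x in `[0%R, +oo[) (x ^+ 2 * p x)%:E = (s ^+ 2 / 2)%:E)%E.
  rewrite split0//.
  rewrite h2 addeA h1 -muleDr//; first by rewrite -split0// half -EFinM.
  by apply: ge0_adde_def; rewrite inE integral_ge0// => x _; rewrite lee_fin.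
have h4 := @ge0_symfun_integralT R (fun x => x ^+ 2 * p x).
rewrite h4; first last.
- by move=> x /=; rewrite sqrrN pN.
- by move=> x; apply: cvgM; [exact: sqr_continuous|exact: cp].
- by move=> x; rewrite mulr_ge0// sqr_ge0.
rewrite -set_itvcy h3 -EFinM; congr EFin; by field.
Qed.

Lemma normal_integrable2 : nu.-integrable setT (fun x => (x ^+ 2)%:E).
Proof.
apply/integrableP; split; first by apply/measurable_EFinP; exact: measurable_funX.
under eq_integral do rewrite /= ger0_norm ?sqr_ge0//.
by rewrite normal_moment2 ltry.
Qed.

Lemma normal_integrable1 : nu.-integrable setT (fun x => x%:E).
Proof.
apply: (@le_integrable _ _ _ nu setT measurableT _ (cst 1%E \+ (fun x => (x ^+ 2)%:E))%E).
- by apply/measurable_EFinP.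
- move=> x _; rewrite [X in (_ <= `|X|)%E](_ : _ = (1 + x ^+ 2)%:E)// !abse_EFin lee_fin (ger0_norm (_ : 0 <= 1 + x ^+ 2)); last first.
    by rewrite addr_ge0// sqr_ge0.
  rewrite -real_normK ?num_real//; nra.
- apply: integrableD => //; last exact: normal_integrable2.
  exact: finite_measure_integrable_cst.
Qed.

(** The positive and the negative part are exchanged by [x -> - x], which preserves [p]; both have
    finite integrals, so they cancel. *)
Lemma normal_moment1 : (\int[nu]_x x%:E = 0)%E.
Proof.
pose f (x : R) := Num.max x 0.
pose h (x : R) := Num.max (- x) 0.
have f0 x : 0 <= f x by rewrite /f le_max lexx orbT.
have h0 x : 0 <= h x by rewrite /h le_max lexx orbT.
have mf : measurable_fun setT f by exact: measurable_maxr.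
have mh : measurable_fun setT h.
  by apply: measurable_maxr => //; exact: measurable_funN.
have fh : (\int[nu]_x (f x)%:E = \int[nu]_x (h x)%:E)%E.
  rewrite !(@ge0_integral_density _ _ _ mu nu p)//.
  have spl (D : set R) (k : R -> R) : measurable D -> measurable_fun setT k ->
      (forall x, 0 <= k x) -> (forall x, ~ D x -> k x = 0) ->
      (\int[mu]_x (k x * p x)%:E = \int[mu]_(x in D) (k x * p x)%:E)%E.
    move=> mD mk k0 kD; rewrite [RHS]integral_mkcond; apply: eq_integral => x _.
    by rewrite patchE; case: ifPn => //; rewrite notin_setE => /kD ->; rewrite mul0r.
  rewrite (spl [set` `[0, +oo[%R])//; last first.
    move=> x /=; rewrite in_itv/= andbT => /negP; rewrite -ltNge => x0.
    by rewrite /f max_r// ltW.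
  rewrite (spl [set` `]-oo, 0]%R])//; last first.
    move=> x /=; rewrite in_itv/= => /negP; rewrite -ltNge => x0.
    by rewrite /h max_r// oppr_le0 ltW.
  have := @ge0_integration_by_substitutionNy R (fun x => h x * p x) 0.
  rewrite oppr0 => ->; last 2 first.
  - apply: continuous_subspaceT => x; apply: cvgM; last exact: cp.
    rewrite /h; apply: continuous_max; [exact: opp_continuous|exact: cvg_cst].
  - by move=> x _; rewrite mulr_ge0.
  by apply: eq_integral => x _; rewrite /f /h /= opprK pN.
have xE x : (x%:E = (f x)%:E - (h x)%:E)%E.
  rewrite -EFinB /f /h; case: (leP 0 x) => x0.
    by rewrite (@max_r _ _ (- x)) ?subr0// oppr_le0.
  by rewrite (@max_l _ _ (- x)) ?opprK ?add0r// oppr_ge0 ltW.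
under eq_integral do rewrite xE.
have i1 : nu.-integrable setT (EFin \o f).
  apply: (le_integrable measurableT _ _ normal_integrable1).
  - exact/measurable_EFinP.
  - move=> x _ /=; rewrite lee_fin ger0_norm//.
    by rewrite /f ge_max ler_norm normr_ge0.
rewrite integralB_EFin//; last first.
  apply: (le_integrable measurableT _ _ normal_integrable1).
  - exact/measurable_EFinP.
  - move=> x _ /=; rewrite lee_fin ger0_norm//.
    by rewrite /h ge_max -normrN ler_norm normr_ge0.
rewrite fh subee// -fh; apply: integrable_fin_num => //.
Qed.

End NormalMoments.

(** * Integration of a factor independent of a sigma-algebra *)

Section Independence.
Context {R : realType} {disp : measure_display} {Omega : measurableType disp}.
Variables (P : probability Omega R) (G : set (set Omega)).
Hypothesis mG : forall A, <<s G >> A -> measurable A.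
Variables (xi : Omega -> R) (nu : probability (measurableTypeR R) R).
Hypotheses (mxi : measurable_fun setT xi)
  (ind : forall E A, <<s G >> E -> measurable A ->
     P (E `&` xi @^-1` A) = (P E * nu A)%E).

(** [idm] is the identity seen as a map onto the coarser space, so [PG] is [P] restricted to [G],
    and independence says exactly that the law of [theta] is the product of [PG] and [nu]. *)
Let OmG := g_sigma_algebraType G.
Let idm : Omega -> OmG := idfun.
Let midm : measurable_fun setT idm.
Proof. by move=> _ A mA; rewrite setTI; exact: mG. Qed.
Let theta : Omega -> OmG * measurableTypeR R := fun w => (idm w, xi w).
Let mtheta : measurable_fun setT theta.
Proof. exact: measurable_fun_pair. Qed.
HB.instance Definition _ := isMeasurableFun.Build _ _ _ _ idm midm.
HB.instance Definition _ := isMeasurableFun.Build _ _ _ _ theta mtheta.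
Let PG := distribution P idm.
Let PT := distribution P theta.

Let PTE A : measurable A -> (PG \x nu)%E A = PT A.
Proof. by apply: product_measure_unique => E C mE mC; exact: ind. Qed.

(** After transport to the law of [theta], which is a product by [PTE], this is Tonelli's
    theorem. *)
Lemma indep_ge0_integral (zeta : Omega -> R) (phi : R -> R) :
  gmeas G zeta -> measurable_fun setT phi ->
  (forall w, 0 <= zeta w) -> (forall x, 0 <= phi x) ->
  (\int[P]_w (zeta w * phi (xi w))%:E =
   (\int[P]_w (zeta w)%:E) * \int[nu]_x (phi x)%:E)%E.
Proof.
move=> mz mphi z0 phi0.
have mf : measurable_fun setT (fun z : OmG * measurableTypeR R => (zeta z.1 * phi z.2)%:E).
  apply/measurable_EFinP/measurable_funM.
    by apply: (measurableT_comp mz); exact: measurable_fst.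
  by apply: (measurableT_comp mphi); exact: measurable_snd.
transitivity (\int[PT]_z (zeta z.1 * phi z.2)%:E)%E.
  rewrite ge0_integral_distribution//.
  by move=> y; rewrite lee_fin mulr_ge0.
have eqm A : measurable A -> A `<=` setT -> PT A = (PG \x nu)%E A.
  by move=> mA _; rewrite -PTE.
rewrite (eq_measure_integral _ eqm).
rewrite fubini_tonelli1 /fubini_F//=; last by move=> z; rewrite lee_fin mulr_ge0.
under eq_integral => x _.
  under eq_integral do rewrite EFinM.
  rewrite ge0_integralZl//; last 3 first.
  - exact/measurable_EFinP.
  - by move=> y _; rewrite lee_fin.
  - by rewrite lee_fin.
  over.
rewrite ge0_integralZr//; last 3 first.
- exact/measurable_EFinP.
- by move=> y _; rewrite lee_fin.
- by apply: integral_ge0 => y _; rewrite lee_fin.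
by rewrite ge0_integral_distribution//; exact/measurable_EFinP.
Qed.

Lemma indep_integral (zeta : Omega -> R) (phi : R -> R) :
  gmeas G zeta -> measurable_fun setT phi ->
  P.-integrable setT (EFin \o zeta) -> nu.-integrable setT (EFin \o phi) ->
  P.-integrable setT (fun w => (zeta w * phi (xi w))%:E) /\
  (\int[P]_w (zeta w * phi (xi w))%:E =
   (\int[P]_w (zeta w)%:E) * \int[nu]_x (phi x)%:E)%E.
Proof.
move=> mz mphi iz iphi.
have mz' : measurable_fun setT zeta by move: iz => /integrableP[/measurable_EFinP].
have mf : measurable_fun setT (fun z : OmG * measurableTypeR R => (zeta z.1 * phi z.2)%:E).
  apply/measurable_EFinP/measurable_funM.
    by apply: (measurableT_comp mz); exact: measurable_fst.
  by apply: (measurableT_comp mphi); exact: measurable_snd.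
have i1 : P.-integrable setT (fun w => (zeta w * phi (xi w))%:E).
  apply/integrableP; split.
    by apply/measurable_EFinP; apply: measurable_funM => //; exact: measurableT_comp.
  under eq_integral do rewrite /= normrM.
  (* Integrability is the nonnegative case applied to the absolute values. *)
  have := @indep_ge0_integral (fun w => `|zeta w|) (fun x => `|phi x|).
  move=> ->//; last 2 first.
  - exact: measurableT_comp.
  - exact: measurableT_comp.
  move: iz iphi => /integrableP[_ iz] /integrableP[_ iphi].
  by rewrite lte_mul_pinfty// ?ge0_fin_numE//; apply: integral_ge0 => x _; rewrite lee_fin.
split=> //.
have i2 : PT.-integrable setT (fun z => (zeta z.1 * phi z.2)%:E).
  exact: integrable_pushforward.
transitivity (\int[PT]_z (zeta z.1 * phi z.2)%:E)%E.
  by rewrite integral_distribution.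
have eqm A : measurable A -> A `<=` setT -> PT A = (PG \x nu)%E A.
  by move=> mA _; rewrite -PTE.
rewrite (eq_measure_integral _ eqm).
have i3 : (PG \x nu)%E.-integrable setT (fun z => (zeta z.1 * phi z.2)%:E).
  move/integrableP : i2 => [_ h]; apply/integrableP; split => //.
  by rewrite -(eq_measure_integral _ eqm).
rewrite -integral12_prod_meas1// /fubini_F/=.
have [c cE] : exists c, (\int[nu]_x (phi x)%:E = c%:E)%E.
  exists (fine (\int[nu]_x (phi x)%:E)%E); rewrite fineK//.
  exact: (integrable_fin_num _ iphi).
under eq_integral => x _.
  under eq_integral do rewrite EFinM.
  rewrite integralZl// cE.
  over.
rewrite cE integralZr//.
  rewrite integral_distribution//; exact/measurable_EFinP.
by apply: integrable_pushforward => //; exact/measurable_EFinP.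
Qed.

End Independence.

(** * Brownian increments *)

Section BrownianMoments.
Context {R : realType} {disp : measure_display} {Omega : measurableType disp}.
Variables (P : probability Omega R).
Hypothesis hP : measure_is_complete P.

Record filtration (T : R) (F : R -> set (set Omega)) : Prop := Filtration {
  filtration_sub : forall t, 0 <= t <= T -> subsigma P (F t);
  filtration_mono : forall s t, 0 <= s -> s <= t -> t <= T -> F s `<=` F t }.

Definition integ (X : Omega -> R) : Prop := P.-integrable setT (EFin \o X).

(** Independence is assumed for the raw sigma-algebra of [B] only, whereas the filtration is
    completed. The sets that agree with a raw event outside a null set form a sigma-algebra
    containing both kinds of generators. *)
Lemma sigma_algebra_null_mod (G : set (set Omega)) E :
  (forall A, G A -> measurable A) ->
  <<s G `|` [set N | measurable N /\ P N = 0%E] >> E ->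
  exists E' N, [/\ <<s G >> E', measurable N, P N = 0%E & E `+` E' `<=` N].
Proof.
move=> mG.
pose C := [set E | exists E' N, [/\ <<s G >> E', measurable N, P N = 0%E & E `+` E' `<=` N]].
apply: (smallest_sub (X := C) (C := sigma_algebra setT)); last first.
  move=> A [GA|[mA A0]].
    exists A, set0; split => //; [exact: sub_sigma_algebra|by rewrite setYK].
  exists set0, A; split => //; [exact: sigma_algebra0|by rewrite setY0].
split.
- exists set0, set0; split => //; [exact: sigma_algebra0|by rewrite setYK].
- move=> A [E' [N [GE mN N0 AN]]]; exists (~` E'), N; split => //.
    by rewrite -setTD; exact: sigma_algebraCD.
  move=> w [[[_ nA] /contrapT E'w]|[nE' /= h]]; apply: AN; [by right|].
  by left; split => //; apply: contrapT => nA; apply: h.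
- move=> A hA; have /choice[f hf] := hA.
  have /choice[N hN] := hf.
  exists (\bigcup_n f n), (\bigcup_n N n); split.
  + by apply: sigma_algebra_bigcup => n; have [] := hN n.
  + by apply: bigcupT_measurable => n; have [] := hN n.
  + have mU : measurable (\bigcup_n N n).
      by apply: bigcupT_measurable => n; have [] := hN n.
    apply/(negligibleP P mU); apply: negligible_bigcup => n.
    by have [_ mNn N0 _] := hN n; apply/(negligibleP P mNn).
  + move=> w [[[n _ Anw] nE]|[[n _ Enw] nA]]; exists n => //; have [_ _ _] := hN n; apply.
      by left; split => // Enw; apply: nE; exists n.
    by right; split => // Anw; apply: nA; exists n.
Qed.

Lemma measure_eq_mod_null (E E' N I : set Omega) : measurable E -> measurable E' ->
  measurable N -> measurable I -> P N = 0%E -> E `+` E' `<=` N ->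
  P (E `&` I) = P (E' `&` I).
Proof.
move=> mE mE' mN mI N0 EN.
have mD : measurable (~` N) by exact: measurableC.
have key A : measurable A -> P A = P (A `&` ~` N).
  move=> mA; rewrite -[in LHS](setIT A) -(setUv N) setIUr measureU//.
  - rewrite [X in (X + _)%E](_ : _ = 0%E) ?add0e//.
    by apply: (subset_measure0 (B := N)) => //; exact: measurableI.
  - exact: measurableI.
  - exact: measurableI.
  - by rewrite setIACA setICr setI0.
rewrite key; last exact: measurableI.
rewrite [RHS]key; last exact: measurableI.
congr (P _); apply/seteqP; split => w [[Ew Iw] Nw]; split => //; split => //.
  by apply: contrapT => h; apply: Nw; apply: EN; left.
by apply: contrapT => h; apply: Nw; apply: EN; right.
Qed.

Context {d : nat}.
Variables (T : R) (B : R -> Omega -> 'rV[R]_d).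
Hypothesis hB : brownian_motion P T B.
Let F := brownian_filtration P B.

Lemma brownian_events_meas t A : 0 <= t <= T -> <<s brownian_events B t >> A -> measurable A.
Proof.
move=> /andP[t0 tT]; apply: smallest_sub; first exact: sigma_algebra_measurable.
move=> E [s [i [C [/andP[s0 st] mC ->]]]].
have [h _ _ _ _] := hB.
rewrite -[X in measurable X]setTI; apply: (h s i _ measurableT _ mC).
by rewrite s0 (le_trans st).
Qed.

Lemma brownian_filtrationP : filtration T F.
Proof.
split=> [t /andP[t0 tT]|s t s0 st tT]; last first.
  apply: sub_smallest2r => // A [[r [i [C [/andP[r0 rs] mC ->]]]]|]; last by right.
  by left; exists r, i, C; split => //; rewrite r0 (le_trans rs).
split.
- exact: smallest_sigma_algebra.
- apply: smallest_sub; first exact: sigma_algebra_measurable.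
  move=> A [hA|[]//]; apply: (@brownian_events_meas t); first by rewrite t0.
  exact: sub_sigma_algebra.
- by move=> N mN N0; apply: sub_sigma_algebra; right.
Qed.

Lemma increment_event_indep u v A E : 0 <= u -> u < v -> v <= T ->
  (forall i, measurable (A i)) -> F u E ->
  P (E `&` increment_event B u v A) =
  (P E * \prod_(i < d) normal_prob 0 (Num.sqrt (v - u)) (A i))%E.
Proof.
move=> u0 uv vT mA FE.
have [mB _ _ hlaw hind] := hB.
have uT : 0 <= u <= T by rewrite u0 (le_trans (ltW uv)).
have [|E' [N [GE' mN N0 EN]]] := sigma_algebra_null_mod _ FE.
  by move=> C hC; apply: (brownian_events_meas uT); exact: sub_sigma_algebra.
have mE : measurable E.
  by apply: (subsigma_meas (filtration_sub brownian_filtrationP uT)).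
have mE' : measurable E' by exact: (brownian_events_meas uT).
have mI : measurable (increment_event B u v A).
  rewrite (_ : increment_event B u v A =
     \bigcap_(i in [set: 'I_d]) ((fun w => B v w 0 i - B u w 0 i) @^-1` A i)); last first.
    by apply/seteqP; split => w h; [move=> i _; exact: h|move=> i; exact: (h i)].
  apply: fin_bigcap_measurable => //.
  move=> i _; rewrite -[X in measurable X]setTI.
  have mD : measurable_fun setT (fun w => B v w 0 i - B u w 0 i).
    apply: measurable_funB; apply: mB => //.
    by rewrite vT andbT (le_trans u0 (ltW uv)).
  exact: (mD measurableT _ (mA i)).
rewrite (measure_eq_mod_null mE mE' mN mI N0 EN).
have := measure_eq_mod_null mE mE' mN measurableT N0 EN.
rewrite !setIT => ->.
by rewrite hind// hlaw.
Qed.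


Lemma brownian_adapted t i : 0 <= t <= T -> gmeas (F t) (fun w => B t w 0 i).
Proof.
move=> /andP[t0 tT].
have tT' : 0 <= t <= T by rewrite t0.
apply/(gmeasE _ (filtration_sub brownian_filtrationP tT')) => A mA.
by apply: sub_sigma_algebra; left; exists t, i, A; split => //; rewrite t0 lexx.
Qed.

Let dB u v i w := B v w 0 i - B u w 0 i.

Lemma brownian_incr_gmeas u v i : 0 <= u -> u <= v -> v <= T -> gmeas (F v) (dB u v i).
Proof.
move=> u0 uv vT; apply: measurable_funB.
  by apply: brownian_adapted; rewrite vT (le_trans u0 uv).
apply: (gmeas_sub _ _ (filtration_mono brownian_filtrationP u0 uv vT)).
- by apply: (filtration_sub brownian_filtrationP); rewrite u0 (le_trans uv vT).
- by apply: (filtration_sub brownian_filtrationP); rewrite vT (le_trans u0 uv).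
- by apply: brownian_adapted; rewrite u0 (le_trans uv vT).
Qed.

Lemma brownian_incr_meas u v i : 0 <= u -> u <= v -> v <= T -> measurable_fun setT (dB u v i).
Proof.
move=> u0 uv vT; apply: (gmeas_meas _ (brownian_incr_gmeas i u0 uv vT)).
by apply: (filtration_sub brownian_filtrationP); rewrite vT (le_trans u0 uv).
Qed.

Lemma brownian_indep1 u v i E A : 0 <= u -> u < v -> v <= T -> F u E -> measurable A ->
  P (E `&` dB u v i @^-1` A) = (P E * normal_prob 0 (Num.sqrt (v - u)) A)%E.
Proof.
move=> u0 uv vT FE mA.
(* The whole space is imposed on the other coordinates, so that their factors are 1. *)
have := @increment_event_indep u v (fun k => if k == i then A else setT) E u0 uv vT _ FE.
rewrite (bigD1 i)//= eqxx big1 ?mule1; last first.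
  by move=> k /negbTE ->; rewrite probability_setT.
move=> <-; last by move=> k; case: ifP.
congr (P _); apply/seteqP; split => w [Ew h]; split => //.
  by move=> k /=; case: eqP => // ->.
by have := h i; rewrite eqxx.
Qed.

Lemma brownian_indep2 u v i j E A C : 0 <= u -> u < v -> v <= T -> F u E -> i != j ->
  measurable A -> measurable C ->
  P (E `&` dB u v i @^-1` A `&` dB u v j @^-1` C) =
  (P (E `&` dB u v i @^-1` A) * normal_prob 0 (Num.sqrt (v - u)) C)%E.
Proof.
move=> u0 uv vT FE ij mA mC; rewrite [in RHS](brownian_indep1 i u0 uv vT FE mA).
have := @increment_event_indep u v (fun k => if k == i then A else if k == j then C else setT)
  E u0 uv vT _ FE.
rewrite (bigD1 i)//= eqxx (bigD1 j)/=; last by rewrite eq_sym.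
rewrite eq_sym (negbTE ij) eqxx big1 ?mule1; last first.
  by move=> k /andP[/negbTE -> /negbTE ->]; rewrite probability_setT.
rewrite muleA => <-; last by move=> k; case: ifP => //; case: ifP.
congr (P _); apply/seteqP; split => w.
  move=> [[Ew hA] hC]; split => // k /=.
  by case: eqP => [->//|_]; case: eqP => [->|].
move=> [Ew h]; split; first split => //.
  by have := h i; rewrite eqxx.
by have := h j; rewrite eqxx eq_sym (negbTE ij).
Qed.

Lemma brownian_moment1 u v i zeta : 0 <= u -> u <= v -> v <= T ->
  gmeas (F u) zeta -> integ zeta ->
  integ (fun w => zeta w * dB u v i w) /\ \int[P]_w (zeta w * dB u v i w) = 0.
Proof.
move=> u0 + vT mz iz; rewrite le_eqVlt => /predU1P[->|uv].
  have -> : (fun w => zeta w * dB v v i w) = cst 0.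
    by apply/funext => w; rewrite /dB subrr mulr0.
  split; first exact: integrable0.
  by rewrite /Rintegral integral0.
have uT : 0 <= u <= T by rewrite u0 (le_trans (ltW uv)).
have s0 : 0 < Num.sqrt (v - u) by rewrite sqrtr_gt0 subr_gt0.
have sF := subsigma_sigma (filtration_sub brownian_filtrationP uT).
have [|||||||h1 h2] := @indep_integral R disp Omega P (F u) _ (dB u v i)
  (normal_prob 0 (Num.sqrt (v - u))) _ _ zeta idfun.
- by rewrite sigma_algebra_id// => A; exact: (subsigma_meas (filtration_sub brownian_filtrationP uT)).
- exact: brownian_incr_meas (ltW uv) vT.
- by move=> E A; rewrite sigma_algebra_id//; exact: brownian_indep1.
- exact: mz.
- exact: measurable_id.
- exact: iz.
- exact: normal_integrable1.
by split => //; rewrite /Rintegral h2 normal_moment1// mule0.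
Qed.

(** On the diagonal the squared increment is independent of [F u]. Off the diagonal [zeta] times the
    increment of coordinate [i] is no longer [F u]-measurable, so the argument is repeated with the
    sigma-algebra generated by [F u] and that increment; the one of coordinate [j] is independent of
    it and centred. *)
Lemma brownian_moment2 u v i j zeta : 0 <= u -> u <= v -> v <= T ->
  gmeas (F u) zeta -> integ zeta ->
  integ (fun w => zeta w * dB u v i w * dB u v j w) /\
  \int[P]_w (zeta w * dB u v i w * dB u v j w) = (i == j)%:R * (v - u) * \int[P]_w zeta w.
Proof.
move=> u0 + vT mz iz; rewrite le_eqVlt => /predU1P[->|uv].
  have -> : (fun w => zeta w * dB v v i w * dB v v j w) = cst 0.
    by apply/funext => w; rewrite /dB !subrr !mulr0.
  split; first exact: integrable0.
  by rewrite /Rintegral integral0 subrr mulr0 mul0r.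
have uT : 0 <= u <= T by rewrite u0 (le_trans (ltW uv)).
have vT' : 0 <= v <= T by rewrite vT (le_trans u0 (ltW uv)).
have s0 : 0 < Num.sqrt (v - u) by rewrite sqrtr_gt0 subr_gt0.
have hu := filtration_sub brownian_filtrationP uT.
have sF := subsigma_sigma hu.
have vu0 : 0 <= v - u by rewrite subr_ge0 ltW.
case: (eqVneq i j) => [<-|ij].
  have [|||||||h1 h2] := @indep_integral R disp Omega P (F u) _ (dB u v i)
    (normal_prob 0 (Num.sqrt (v - u))) _ _ zeta (fun x => x ^+ 2).
  - by rewrite sigma_algebra_id// => A; exact: (subsigma_meas hu).
  - exact: brownian_incr_meas (ltW uv) vT.
  - by move=> E A; rewrite sigma_algebra_id//; exact: brownian_indep1.
  - exact: mz.
  - exact: measurable_funX.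
  - exact: iz.
  - exact: normal_integrable2.
  have e : (fun w => zeta w * dB u v i w * dB u v i w) = (fun w => zeta w * dB u v i w ^+ 2).
    by apply/funext => w; rewrite expr2 mulrA.
  rewrite e; split => //.
  rewrite /Rintegral h2 normal_moment2// sqr_sqrtr// fineM//; last exact: (integrable_fin_num _ iz).
  by rewrite mul1r mulrC.
(* A pi-system generating that larger sigma-algebra: independence is known on it by
   [brownian_indep2] and extends because two finite measures that agree on a pi-system containing
   the whole space are equal on what it generates. *)
pose Pi := [set C | exists E A, [/\ F u E, measurable A & C = E `&` dB u v i @^-1` A]].
have mdB k : measurable_fun setT (dB u v k) by exact: brownian_incr_meas (ltW uv) vT.
have mpre k A : measurable A -> measurable (dB u v k @^-1` A).
  by move=> mA; rewrite -[X in measurable X]setTI; exact: mdB.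
have mPi : Pi `<=` measurable.
  by move=> C [E [A [/(subsigma_meas hu) mE mA ->]]]; apply: measurableI => //; exact: mpre.
have msPi : forall A, <<s Pi >> A -> measurable A.
  by apply: smallest_sub => //; exact: sigma_algebra_measurable.
have IPi : setI_closed Pi.
  move=> C1 C2 [E1 [A1 [F1 m1 ->]]] [E2 [A2 [F2 m2 ->]]].
  exists (E1 `&` E2), (A1 `&` A2); split; [exact: (subsigmaI hu)|exact: measurableI|].
  by rewrite preimage_setI setIACA.
have PiT : Pi setT.
  by exists setT, setT; split => //; [exact: (subsigmaT hu)|rewrite preimage_setT setIT].
have ind E A : <<s Pi >> E -> measurable A ->
    P (E `&` dB u v j @^-1` A) = (P E * normal_prob 0 (Num.sqrt (v - u)) A)%E.
  move=> sE mA.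
  (* The probability of [A] is made a nonnegative scalar, so that the right-hand side becomes a
     multiple of [P], hence a measure in [E]. *)
  pose nA : {nonneg R} := NngNum (fine_ge0 (measure_ge0 (normal_prob 0 (Num.sqrt (v - u))) A)).
  have nAE : (nA%:num%:E = normal_prob 0 (Num.sqrt (v - u)) A)%E.
    by rewrite /= fineK// fin_num_measure.
  have -> : P (E `&` dB u v j @^-1` A) = mrestr P (mpre j A mA) E by [].
  have -> : (P E * normal_prob 0 (Num.sqrt (v - u)) A)%E = mscale nA P E.
    by rewrite /mscale/= -nAE muleC.
  apply: (@g_sigma_algebra_measure_unique _ _ _ Pi mPi (fun=> setT)) => //.
  - by rewrite bigcup_const.
  - move=> C [E' [A' [FE' mA' ->]]].
    rewrite /mrestr /mscale /=.
    have := brownian_indep2 u0 uv vT FE' ij mA' mA.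
    by move=> h; rewrite -[LHS]/(P _) h -nAE muleC.
  - move=> _; change (P (setT `&` dB u v j @^-1` A) < +oo)%E.
    by rewrite setTI ltey_eq fin_num_measure//; exact: mpre.
have [iz' _] := brownian_moment1 i u0 (ltW uv) vT mz iz.
have [|||||h1 h2] := @indep_integral R disp Omega P Pi msPi (dB u v j)
  (normal_prob 0 (Num.sqrt (v - u))) _ ind (fun w => zeta w * dB u v i w) idfun.
- exact: mdB.
- apply: measurable_funM.
    move=> _ A mA; rewrite setTI; apply: sub_sigma_algebra.
    exists (zeta @^-1` A), setT; split => //.
      by move/(gmeasE _ hu) : mz; exact.
    by rewrite preimage_setT setIT.
  move=> _ A mA; rewrite setTI; apply: sub_sigma_algebra.
  by exists setT, A; split => //; [exact: (subsigmaT hu)|rewrite setTI].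
- exact: measurable_id.
- exact: iz'.
- exact: normal_integrable1.
split => //.
by rewrite /Rintegral h2 normal_moment1// mule0 !mul0r.
Qed.

End BrownianMoments.

(** * Calculus of expectations of real random variables *)

Section Expectation.
Context {R : realType} {disp : measure_display} {Omega : measurableType disp}.
Variables (P : probability Omega R).
Local Notation integ := (integ P).
Implicit Types (X Y : Omega -> R) (A : set Omega).

Lemma integ_meas X : integ X -> measurable_fun setT X.
Proof. by move=> /integrableP[/measurable_EFinP]. Qed.

Lemma integD X Y : integ X -> integ Y -> integ (fun w => X w + Y w).
Proof. by move=> iX iY; exact: (integrableD measurableT iX iY). Qed.

Lemma integB X Y : integ X -> integ Y -> integ (fun w => X w - Y w).
Proof. by move=> iX iY; exact: (integrableB measurableT iX iY). Qed.

Lemma integZ c X : integ X -> integ (fun w => c * X w).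
Proof. by move=> iX; exact: (integrableZl measurableT _ iX). Qed.

Lemma integ_le X Y : measurable_fun setT X -> (forall w, `|X w| <= Y w) -> integ Y -> integ X.
Proof.
move=> mX XY iY; apply: (le_integrable measurableT _ _ iY).
- exact/measurable_EFinP.
- by move=> w _ /=; rewrite lee_fin (le_trans (XY w))// ler_norm.
Qed.

Lemma integ_norm X : integ X -> integ (fun w => `|X w|).
Proof. by move=> iX; exact: (integrable_norm iX). Qed.

Lemma integ_cst c : integ (fun=> c).
Proof. exact: finite_measure_integrable_cst. Qed.

Lemma integ_bnd c X : measurable_fun setT X -> (forall w, `|X w| <= c) -> integ X.
Proof. by move=> mX hX; apply: (integ_le mX hX); exact: integ_cst. Qed.

Lemma integ_sum (I : Type) (r : seq I) (p : pred I) (X : I -> Omega -> R) :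
  (forall i, integ (X i)) -> integ (fun w => \sum_(i <- r | p i) X i w).
Proof.
move=> hX; elim: r => [|i r IHr].
  by under eq_fun do rewrite big_nil; exact: integ_cst.
case pi: (p i); under eq_fun do rewrite big_cons pi; last exact: IHr.
exact: integD.
Qed.

Lemma ED X Y : integ X -> integ Y ->
  \int[P]_w (X w + Y w) = \int[P]_w X w + \int[P]_w Y w.
Proof. by move=> iX iY; rewrite RintegralD. Qed.

Lemma EB X Y : integ X -> integ Y ->
  \int[P]_w (X w - Y w) = \int[P]_w X w - \int[P]_w Y w.
Proof. by move=> iX iY; rewrite RintegralB. Qed.

Lemma EZ c X : integ X -> \int[P]_w (c * X w) = c * \int[P]_w X w.
Proof. by move=> iX; rewrite RintegralZl. Qed.

Lemma E0 : \int[P]_w (0 : R) = 0.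
Proof. by rewrite /Rintegral integral0. Qed.

Lemma Esum (I : Type) (r : seq I) (p : pred I) (X : I -> Omega -> R) :
  (forall i, integ (X i)) ->
  \int[P]_w (\sum_(i <- r | p i) X i w) = \sum_(i <- r | p i) \int[P]_w X i w.
Proof.
move=> hX; elim: r => [|i r IHr].
  by under eq_Rintegral do rewrite big_nil; rewrite big_nil E0.
under eq_Rintegral do rewrite big_cons.
rewrite big_cons; case: ifP => _ //.
by rewrite ED ?IHr//; exact: integ_sum.
Qed.

Lemma eq_E X Y : (forall w, X w = Y w) -> \int[P]_w X w = \int[P]_w Y w.
Proof. by move=> /funext ->. Qed.

Lemma Ele X Y : integ X -> integ Y -> (forall w, X w <= Y w) ->
  \int[P]_w X w <= \int[P]_w Y w.
Proof. by move=> iX iY h; apply: le_Rintegral => //. Qed.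

Lemma EFin_E X : integ X -> (\int[P]_w (X w)%:E = (\int[P]_w X w)%:E)%E.
Proof. by move=> iX; rewrite /Rintegral fineK//; exact: integrable_fin_num. Qed.

(* An integrable square is all that the martingale estimates use; the product of
   two such variables is integrable. *)
Definition L2 X := measurable_fun setT X /\ integ (fun w => X w ^+ 2).

Lemma L2_mul X Y : L2 X -> L2 Y -> integ (fun w => X w * Y w).
Proof.
move=> [mX iX] [mY iY].
apply: (integ_le (Y := fun w => X w ^+ 2 + Y w ^+ 2)); last exact: integD.
  exact: measurable_funM.
move=> w; rewrite normrM -[X w ^+ 2]real_normK ?num_real// -[Y w ^+ 2]real_normK ?num_real//.
have := sqr_ge0 (`|X w| - `|Y w|); have := normr_ge0 (X w); have := normr_ge0 (Y w).
set a := `|X w|; set b := `|Y w| => b0 a0 h; nra.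
Qed.

Lemma L2_bnd c X : measurable_fun setT X -> (forall w, `|X w| <= c) -> L2 X.
Proof.
move=> mX hX; split => //; apply: (@integ_bnd (c ^+ 2)).
  exact: measurable_funX.
by move=> w; rewrite normrX lerXn2r// nnegrE// (le_trans _ (hX w)).
Qed.

Lemma L2_bndM c X Y : measurable_fun setT X -> (forall w, `|X w| <= c) -> L2 Y ->
  L2 (fun w => X w * Y w).
Proof.
move=> mX hX [mY iY]; split; first exact: measurable_funM.
apply: (integ_le (Y := fun w => c ^+ 2 * Y w ^+ 2)); last exact: integZ.
  by apply: measurable_funX; exact: measurable_funM.
move=> w; rewrite exprMn normrM !normrX ler_pM// ?exprn_ge0//.
  by rewrite lerXn2r// nnegrE// (le_trans _ (hX w)).
by rewrite real_normK ?num_real.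
Qed.

Lemma L2D X Y : L2 X -> L2 Y -> L2 (fun w => X w + Y w).
Proof.
move=> hX hY; have [mX iX] := hX; have [mY iY] := hY; split; first exact: measurable_funD.
rewrite (_ : (fun _ => _) = fun w => X w ^+ 2 + (2 * (X w * Y w) + Y w ^+ 2)); last first.
  by apply/funext => w; ring.
by apply: integD => //; apply: integD => //; apply: integZ; exact: L2_mul.
Qed.

Lemma L2_integ X : L2 X -> integ X.
Proof.
move=> hX; rewrite (_ : X = fun w => X w * 1); last by apply/funext => w; rewrite mulr1.
by apply: L2_mul => //; apply: (@L2_bnd 1) => // w; rewrite normr1.
Qed.

Lemma L2_sum (I : Type) (r : seq I) (p : pred I) (X : I -> Omega -> R) :
  (forall i, L2 (X i)) -> L2 (fun w => \sum_(i <- r | p i) X i w).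
Proof.
move=> hX; elim: r => [|i r IHr].
  by under eq_fun do rewrite big_nil; apply: (@L2_bnd 0) => // w; rewrite normr0.
case pi: (p i); under eq_fun do rewrite big_cons pi; last exact: IHr.
exact: L2D.
Qed.

Lemma norm_indic_le1 A w : `|\1_A w : R| <= 1.
Proof. by rewrite indicE ger0_norm// lern1 leq_b1. Qed.

Lemma L2_indicM A X : measurable A -> L2 X -> L2 (fun w => \1_A w * X w).
Proof.
by move=> mA hX; apply: (@L2_bndM 1) => //; exact: norm_indic_le1.
Qed.

Lemma integ_indicM A X : measurable A -> integ X -> integ (fun w => \1_A w * X w).
Proof.
move=> mA iX; apply: (integ_le (Y := fun w => `|X w|)).
- by apply: measurable_funM => //; exact: integ_meas.
- by move=> w; rewrite normrM ler_piMl// norm_indic_le1.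
- by apply: integrable_norm.
Qed.

Lemma E_dct (Xn : nat -> Omega -> R) X Y :
  (forall n, measurable_fun setT (Xn n)) -> measurable_fun setT X ->
  {ae P, forall w, Xn ^~ w @ \oo --> X w} ->
  {ae P, forall w, forall n, `|Xn n w| <= Y w} -> integ Y ->
  \int[P]_w Xn n w @[n --> \oo] --> \int[P]_w X w.
Proof.
move=> mXn mX cX hY iY.
have [|||||iX _ h] := @dominated_convergence _ _ _ P setT measurableT
  (fun n => EFin \o Xn n) (EFin \o X) (EFin \o Y).
- by move=> n; exact/measurable_EFinP.
- exact/measurable_EFinP.
- apply: filterS cX => w h _ /=; apply: cvg_EFin; [exact: nearW|exact: h].
- exact: iY.
- by apply: filterS hY => w h n _ /=; rewrite lee_fin.
apply: fine_cvg.
by rewrite -(EFin_E iX); exact: h.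
Qed.

Lemma E_dct0 (Xn : nat -> Omega -> R) c :
  (forall n, measurable_fun setT (Xn n)) ->
  {ae P, forall w, Xn ^~ w @ \oo --> (0 : R)} ->
  {ae P, forall w, forall n, `|Xn n w| <= c} ->
  \int[P]_w Xn n w @[n --> \oo] --> (0 : R).
Proof.
by move=> mXn cX hY; rewrite -E0; apply: (@E_dct _ _ (cst c)) => //; exact: integ_cst.
Qed.

End Expectation.

(** * Adapted continuous processes and stopping *)

Section PathContinuity.
Context {R : realType}.
Variable (T : R).
Implicit Types (x y : R -> R).

(** Continuity on [[0, T]] with its modulus written out, which is what partitions and uniform limits
    consume; it agrees with topological continuity by [within_ucont] and [ucont_within]. *)
Definition ucont x : Prop := forall e, 0 < e -> exists2 h, 0 < h &
  forall s t, 0 <= s <= T -> 0 <= t <= T -> `|s - t| <= h -> `|x s - x t| <= e.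

(** Heine's theorem: on a compact set, a property that holds near each point for all small steps
    holds everywhere for one step. *)
Lemma within_ucont x : {within `[0, T], continuous x} -> ucont x.
Proof.
move=> /subspace_continuousP cx e e0.
have /compact_near_coveringP/near_covering_withinP K : compact [set` `[0, T]] by exact: segment_compact.
have e20 : 0 < e / 2 by rewrite divr_gt0.
pose Q (h s : R) := forall t, 0 <= t <= T -> `|s - t| <= h -> `|x s - x t| <= e.
have := K R (0 : R)^'+ Q _ _; case.
  move=> s sT; have sT' : 0 <= s <= T by move: sT; rewrite /= in_itv.
  have /cvgrPdist_le /(_ _ e20) := cx s sT.
  rewrite near_withinE => -[/= d d0 hd].
  exists (ball s (d / 2), [set h | h < d / 2]).
    split => /=; first by exists (d / 2) => //=; rewrite divr_gt0.
    by apply: nbhs_right_lt; rewrite divr_gt0.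
  move=> [r h] /= [sr hd2] rT t tT rt.
  have rT' : 0 <= r <= T by move: rT; rewrite in_itv.
  have h1 : `|x s - x r| <= e / 2.
    apply: hd => /=; rewrite ?in_itv//=; apply: (lt_trans sr).
    by rewrite ltr_pdivrMr// ltr_pMr// ltr1n.
  have h2 : `|x s - x t| <= e / 2.
    apply: hd; rewrite /= ?in_itv//=.
    have := ler_distD r s t; move: sr; rewrite /ball /=; lra.
  apply: le_trans (ler_distD (x s) _ _) _.
  by rewrite (splitr e) lerD// distrC.
move=> d /= d0 hd.
exists (d / 2); first by rewrite divr_gt0.
move=> s t sT tT st.
have := hd (d / 2); apply => //=.
- by rewrite sub0r normrN gtr0_norm ?divr_gt0// ltr_pdivrMr// ltr_pMr// ltr1n.
- by rewrite divr_gt0.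
Qed.

Lemma ucont_within x : ucont x -> {within `[0, T], continuous x}.
Proof.
move=> ux; apply/subspace_continuousP => s; rewrite /= in_itv/= => sT.
apply/cvgrPdist_le => e e0; have [h h0 hx] := ux e e0.
rewrite near_withinE; exists h => //= t /= st; rewrite in_itv/= => tT.
exact: hx (ltW st).
Qed.

Lemma ucontD x y : ucont x -> ucont y -> ucont (fun t => x t + y t).
Proof.
move=> ux uy e e0; have e20 : 0 < e / 2 by rewrite divr_gt0.
have [h h0 hx] := ux _ e20; have [k k0 ky] := uy _ e20.
exists (Num.min h k); first by rewrite lt_min h0.
move=> s t sT tT; rewrite le_min => /andP[/(hx _ _ sT tT) a /(ky _ _ sT tT) b].
have := ler_normD (x s - x t) (y s - y t).
rewrite (_ : x s - x t + (y s - y t) = x s + y s - (x t + y t)); [lra|ring].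
Qed.

Lemma ucontN x : ucont x -> ucont (fun t => - x t).
Proof.
move=> ux e e0; have [h h0 hx] := ux e e0; exists h => // s t sT tT st.
by rewrite -opprD normrN; exact: hx.
Qed.

Lemma ucontB x y : ucont x -> ucont y -> ucont (fun t => x t - y t).
Proof. by move=> ux uy; apply: ucontD => //; exact: ucontN. Qed.

Lemma ucont_norm x : ucont x -> ucont (fun t => `|x t|).
Proof.
move=> ux e e0; have [h h0 hx] := ux e e0; exists h => // s t sT tT st.
by apply: le_trans (hx _ _ sT tT st); exact: ler_dist_dist.
Qed.

Lemma ucont_cst c : ucont (fun=> c).
Proof. by move=> e e0; exists 1 => // s t _ _ _; rewrite subrr normr0 ltW. Qed.

Lemma ucontZ c x : ucont x -> ucont (fun t => c * x t).
Proof.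
move=> ux e e0; have c0 : 0 < `|c| + 1 by rewrite ltr_wpDl.
have [h h0 hx] := ux (e / (`|c| + 1)) (divr_gt0 e0 c0).
exists h => // s t sT tT st; rewrite -mulrBr normrM.
apply: (@le_trans _ _ ((`|c| + 1) * (e / (`|c| + 1)))).
  by apply: ler_pM => //; [rewrite lerDl|exact: hx].
by rewrite mulrCA divff ?mulr1// gt_eqF.
Qed.

Lemma ucont_sum (I : Type) (r : seq I) (x : I -> R -> R) :
  (forall i, ucont (x i)) -> ucont (fun t => \sum_(i <- r) x i t).
Proof.
move=> ux; elim: r => [|i r IHr].
  by under eq_fun do rewrite big_nil; exact: ucont_cst.
under eq_fun do rewrite big_cons; exact: ucontD.
Qed.

Lemma ucont_eq x y : (forall t, 0 <= t <= T -> x t = y t) -> ucont x -> ucont y.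
Proof.
move=> xy ux e e0; have [h h0 hx] := ux e e0; exists h => // s t sT tT.
by rewrite -!xy//; exact: hx.
Qed.

Lemma ucont_minr x c : 0 <= c <= T -> ucont x -> ucont (fun t => x (Num.min t c)).
Proof.
move=> /andP[c0 cT] ux e e0; have [h h0 hx] := ux e e0; exists h => // s t /andP[s0 sT] /andP[t0 tT] st.
apply: hx; rewrite ?le_min ?ge_min ?s0 ?t0 ?c0 ?sT ?tT//.
apply: le_trans st; case: (leP s c) => sc; case: (leP t c) => tc; rewrite ?subrr ?normr0//.
- by rewrite ler0_norm ?ler0_norm; lra.
- by rewrite ger0_norm ?ger0_norm; lra.
Qed.

(** With a modulus [h] for oscillation 1, walking from 0 in steps of length [h] raises the bound by
    at most 1 per step. *)
Lemma ucont_bounded x : 0 <= T -> ucont x -> exists C, forall t, 0 <= t <= T -> `|x t| <= C.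
Proof.
move=> T0 ux; have [h h0 hx] := ux 1 ltr01.
have key n t : 0 <= t <= T -> t <= n%:R * h -> `|x t| <= `|x 0| + n%:R.
  elim: n t => [|n IHn] t /andP[t0 tT] tn.
    rewrite mul0r in tn; have -> : t = 0 by apply/eqP; rewrite eq_le tn.
    by rewrite addr0.
  case: (leP t (n%:R * h)) => [tn'|nt].
    by apply: (le_trans (IHn t _ tn')); rewrite ?t0// lerD2l ler_nat.
  have nh0 : 0 <= n%:R * h by rewrite mulr_ge0// ltW.
  have h1 : `|x (n%:R * h)| <= `|x 0| + n%:R.
    by apply: IHn => //; rewrite nh0 (le_trans (ltW nt)).
  have h2 : `|x t - x (n%:R * h)| <= 1.
    apply: hx; rewrite ?t0 ?tT ?nh0 ?(le_trans (ltW nt) tT)//.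
    rewrite ger0_norm ?subr_ge0 ?(ltW nt)//; rewrite -natr1 in tn; lra.
  have := ler_distD 0 (x t) (x (n%:R * h)).
  have := ler_normD (x t - x (n%:R * h)) (x (n%:R * h)).
  rewrite subrK -natr1; lra.
exists (`|x 0| + (Num.truncn (T / h)).+1%:R) => t tT; apply: key => //.
case/andP: tT => _ tT; apply: (le_trans tT).
by rewrite -ler_pdivrMr// ltW// truncnS_gt.
Qed.

Lemma ucont_cvg x (s : nat -> R) t : ucont x -> 0 <= t <= T ->
  (forall n, 0 <= s n <= T) -> s @ \oo --> t -> x (s n) @[n --> \oo] --> x t.
Proof.
move=> ux tT sT st; apply/cvgrPdist_le => e e0; have [h h0 hx] := ux e e0.
by move/cvgrPdist_le : st => /(_ h h0); apply: filterS => n hn; exact: hx.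
Qed.

End PathContinuity.

Section Stopping.
Context {R : realType} {disp : measure_display} {Omega : measurableType disp}.
Variables (P : probability Omega R) (T : R) (F : R -> set (set Omega)).
Hypotheses (hP : measure_is_complete P) (T0 : 0 <= T) (hF : filtration P T F).
Implicit Types (X : R -> Omega -> R) (rho tau : Omega -> R).

Definition adapted X : Prop := forall t, 0 <= t <= T -> gmeas (F t) (X t).

(** The class of processes that get stopped: the value at a random time is recovered from continuity
    by [acproc_at]. *)
Definition acproc X : Prop := adapted X /\ {ae P, forall w, ucont T (X ^~ w)}.

Lemma gmeas_filt disp' (Y : measurableType disp') s t (X : Omega -> Y) :
  0 <= s -> s <= t -> t <= T -> gmeas (F s) X -> gmeas (F t) X.
Proof.
move=> s0 st tT; apply: gmeas_sub.
- by apply: (filtration_sub hF); rewrite s0 (le_trans st).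
- by apply: (filtration_sub hF); rewrite tT (le_trans s0).
- exact: (filtration_mono hF).
Qed.

(** A random time with countably many values raises no measurability problem; [s] is approached by
    such times [sn], and continuity of the paths passes to the limit outside a null set. *)
Lemma acproc_at X t (s : Omega -> R) : 0 <= t <= T -> acproc X ->
  gmeas (F t) s -> (forall w, 0 <= s w <= t) -> gmeas (F t) (fun w => X (s w) w).
Proof.
move=> tT [aX cX] ms st.
have hFt := filtration_sub hF tT.
(* Rounding down, not up, keeps [sn] at most [t], so that only values of [X] known at time [t] are
   used. *)
pose sn n w : R := (Num.truncn (s w * n.+1%:R))%:R / n.+1%:R.
have sn_le n w : 0 <= sn n w <= s w.
  have /andP[s0 _] := st w.
  rewrite divr_ge0//= ler_pdivrMr// truncn_le//.
  by rewrite mulr_ge0.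
have sn_gt n w : s w - n.+1%:R^-1 <= sn n w.
  rewrite /sn lerBlDr -[X in _ + X]mul1r -mulrDl ler_pdivlMr//.
  by rewrite natr1 ltW// truncnS_gt.
apply: (@gmeas_cvg R disp Omega P hP (F t) (fun n w => X (sn n w) w)) => //.
- move=> n; apply/(gmeasE _ hFt) => A mA.
  have -> : (fun w => X (sn n w) w) @^-1` A = \bigcup_k
      ([set w | k%:R <= s w * n.+1%:R < k.+1%:R] `&`
       [set w | k%:R / n.+1%:R <= t /\ A (X (k%:R / n.+1%:R) w)]).
    apply/seteqP; split => w /=.
      move=> Aw; exists (Num.truncn (s w * n.+1%:R)) => //; split => /=.
        by apply: truncn_itv; rewrite mulr_ge0//; case/andP: (st w).
      split => //; have /andP[_ h] := sn_le n w; apply: (le_trans h).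
      by case/andP: (st w).
    by move=> [k _ [/= /truncn_def kE [_ Aw]]]; rewrite /sn kE.
  apply: (subsigma_bigcup hFt) => k; apply: (subsigmaI hFt).
    have := (gmeasE _ hFt).1 ms [set` `[k%:R / n.+1%:R, k.+1%:R / n.+1%:R[%R] (measurable_itv _).
    congr (F t _); apply/seteqP; split => w /=; rewrite in_itv/= ler_pdivrMr// ltr_pdivlMr//.
  case: (leP (k%:R / n.+1%:R) t) => kt; last first.
    rewrite (_ : [set w | _] = set0); first by case: (subsigma_sigma hFt).
    by apply/seteqP; split => w //= -[].
  have k0 : 0 <= k%:R / n.+1%:R :> R by rewrite divr_ge0.
  have mX : gmeas (F t) (X (k%:R / n.+1%:R)).
    case/andP: (tT) => _ tT'.
    by apply: (gmeas_filt k0 kt tT'); apply: aX; rewrite k0 (le_trans kt).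
  have := (gmeasE _ hFt).1 mX A mA.
  by congr (F t _); apply/seteqP; split => w /=; [|case].
- apply: filterS cX => w cX.
  have sT : 0 <= s w <= T.
    by case/andP: (st w) => -> /= h; rewrite (le_trans h)//; case/andP: tT.
  apply: (ucont_cvg cX sT).
    move=> n; case/andP: (sn_le n w) => -> /= h; apply: (le_trans h).
    by case/andP: sT.
  apply: (@squeeze_cvgr _ _ _ _ (fun n => s w - n.+1%:R^-1) (fun=> s w)).
  - by apply: nearW => n; rewrite sn_gt; case/andP: (sn_le n w).
  - rewrite -[X in _ --> X]subr0; apply: cvgB; first exact: cvg_cst.
    exact: cvg_harmonic.
  - exact: cvg_cst.
Qed.

(** The strict inequality gives the weaker notion of stopping time: first entrance times of open
    sets satisfy it without right continuity of the filtration, and [Num.min t (rho w)] is still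
    [F t]-measurable. *)
Definition optional rho : Prop :=
  (forall w, 0 <= rho w <= T) /\
  (forall t, 0 <= t <= T -> F t [set w | rho w < t]).

(** For [x <= t] the event that the minimum is below [x] is [rho < x], known at [x], hence at [t];
    for [x > t] it is the whole space. *)
Lemma optional_min_gmeas rho t : optional rho -> 0 <= t <= T ->
  gmeas (F t) (fun w => Num.min t (rho w)).
Proof.
move=> [r0 hr] /andP[t0 tT].
have hFt : subsigma P (F t) by apply: (filtration_sub hF); rewrite t0.
apply: (measurability _ (@RGenInftyO.measurableE R)) => _ [_ [x ->] <-].
rewrite setTI; apply: sub_sigma_algebra.
case: (ltP t x) => tx.
  rewrite (_ : _ @^-1` _ = setT); first exact: (subsigmaT hFt).
  by apply/seteqP; split => w //= _; rewrite in_itv/= gt_min tx.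
have -> : (fun w => Num.min t (rho w)) @^-1` [set` `]-oo, x[%R] = [set w | rho w < x].
  by apply/seteqP; split => w /=; rewrite in_itv/= gt_min ltNge tx.
case: (leP 0 x) => x0.
  by apply: (filtration_mono hF x0 tx tT); apply: hr; rewrite x0 (le_trans tx).
rewrite (_ : [set w | _] = set0); first by case: (subsigma_sigma hFt).
apply/seteqP; split => w //= wx; have /andP[h _] := r0 w.
by have := lt_trans (le_lt_trans h wx) x0; rewrite ltxx.
Qed.

Lemma optional_min rho tau : optional rho -> optional tau ->
  optional (fun w => Num.min (rho w) (tau w)).
Proof.
move=> [r0 hr] [s0 hs]; split => [w|t tT].
  by rewrite le_min ge_min; case/andP: (r0 w) => -> ->; case/andP: (s0 w) => ->.
rewrite (_ : [set w | _] = [set w | rho w < t] `|` [set w | tau w < t]).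
  by apply: (subsigmaU (filtration_sub hF tT)); [exact: hr|exact: hs].
by apply/seteqP; split => w /=; rewrite gt_min; [case/orP; [left|right]|case => ->; rewrite ?orbT].
Qed.

Lemma optional_ge rho t : optional rho -> 0 <= t <= T -> F t [set w | t <= rho w].
Proof.
move=> [_ hr] tT; rewrite (_ : [set w | _] = ~` [set w | rho w < t]).
  by apply: (subsigmaC (filtration_sub hF tT)); exact: hr.
by apply/seteqP; split => w /=; rewrite ltNge; [move=> ->|move/negP; rewrite negbK].
Qed.

Definition stopped X rho t w : R := X (Num.min t (rho w)) w.

Lemma acproc_stopped X rho : optional rho -> acproc X -> acproc (stopped X rho).
Proof.
move=> hr hX; split.
  move=> t tT; apply: acproc_at => //; first exact: optional_min_gmeas.
  move=> w; rewrite le_min ge_min lexx /= andbT.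
  by case/andP: tT => -> _; case: hr => /(_ w)/andP[].
case: hX => _; apply: filterS => w ux.
by apply: (ucont_minr _ ux); case: hr => h _; exact: h.
Qed.

(* First time at which some U i is positive, read off rational times so that it
   is optional without any regularity of the paths. *)
Definition hitset (U : nat -> R -> Omega -> R) (w : Omega) : set R :=
  [set q | 0 <= q <= T /\ (q = T \/ exists r : rat, q = ratr r /\ exists i, 0 < U i q w)].

Definition hitting U w : R := inf (hitset U w).

Lemma hitset_has_inf U w : has_inf (hitset U w).
Proof.
split; first by exists T; split; [rewrite T0 lexx|left].
by exists 0 => q [/andP[]].
Qed.

Lemma hitting_le U w q : hitset U w q -> hitting U w <= q.
Proof. by move=> h; apply: ge_inf => //; case: (hitset_has_inf U w). Qed.

Lemma hitting_bnd U w : 0 <= hitting U w <= T.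
Proof.
apply/andP; split.
  by apply: lb_le_inf; [case: (hitset_has_inf U w)|move=> q [/andP[]]].
by apply: hitting_le; split; [rewrite T0 lexx|left].
Qed.

(** The infimum is below [t] exactly when some rational below [t] and some index make [U i]
    positive, a countable union of events of [F t]. The extra point [T] of [hitset] never lies below
    [t]. *)
Lemma hitting_optional U : (forall i, adapted (U i)) -> optional (hitting U).
Proof.
move=> aU; split => [w|t tT]; first exact: hitting_bnd.
have hFt := filtration_sub hF tT.
have -> : [set w | hitting U w < t] =
    (\bigcup_n \bigcup_i [set w | exists r : rat, [/\ pickle r = n, (0 : R) <= ratr r < t & 0 < U i (ratr r) w]]).
  apply/seteqP; split => w /=.
    move=> ht; have t0 : 0 < t - hitting U w by rewrite subr_gt0.
    have [q [/andP[q0 qT] hq] qt] := inf_adherent t0 (hitset_has_inf U w).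
    rewrite -/(hitting U w) addrC subrK in qt.
    case: hq => [qE|[r [qr [i Ui]]]].
      by move: qt; rewrite qE ltNge; case/andP: tT => _ ->.
    exists (pickle r) => //; exists i => //; exists r.
    by split => //; rewrite -qr ?q0.
  move=> [n _ [i _ [r [_ /andP[r0 rt] Ui]]]].
  have rT : (0 : R) <= ratr r <= T by rewrite r0 (le_trans (ltW rt))//; case/andP: tT.
  apply: le_lt_trans rt; apply: hitting_le; split => //.
  by right; exists r; split => //; exists i.
apply: (subsigma_bigcup hFt) => n; apply: (subsigma_bigcup hFt) => i.
(* Rationals are enumerated by their codes; an index that codes none contributes the empty set. *)
case hn : (@unpickle rat n) => [r|]; last first.
  rewrite (_ : [set w | _] = set0); first by case: (subsigma_sigma hFt).
  by apply/seteqP; split => w //= -[r [rn _ _]]; move: hn; rewrite -rn pickleK.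
case: (boolP ((pickle r == n) && ((0 : R) <= ratr r < t))) => [/andP[/eqP rn /andP[r0 rt]]|hr]; last first.
  rewrite (_ : [set w | _] = set0); first by case: (subsigma_sigma hFt).
  apply/seteqP; split => w //= -[r' [rn h1 _]]; move: hn hr.
  by rewrite -rn pickleK => -[<-]; rewrite eqxx h1.
have -> : [set w | exists r : rat, [/\ pickle r = n, (0 : R) <= ratr r < t & 0 < U i (ratr r) w]] =
    U i (ratr r) @^-1` [set` `]0, +oo[%R].
  apply/seteqP; split => w /=; rewrite in_itv/= andbT.
    by move=> [r' [rn' _ h]]; move: hn; rewrite -rn' pickleK => -[<-].
  by move=> h; exists r; rewrite r0.
apply: ((gmeasE _ hFt).1 _ _ (measurable_itv _)).
have rT : (0 : R) <= ratr r <= T by rewrite r0 (le_trans (ltW rt))//; case/andP: tT.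
by apply: (gmeas_filt r0 (ltW rt)); [case/andP: tT|exact: aU].
Qed.

(** If [U i] were positive at [s], it would be so on a left neighbourhood of [s], which contains a
    rational time before [hitting]. At [s = 0] there is no such neighbourhood, hence the last
    hypothesis. *)
Lemma hitting_before U w i s : ucont T (U i ^~ w) -> 0 <= s -> s <= hitting U w ->
  U i 0 w <= 0 -> U i s w <= 0.
Proof.
move=> uU s0 sh U0; have /andP[h0 hT] := hitting_bnd U w.
move: s0; rewrite le_eqVlt => /predU1P[<-//|s0].
rewrite leNgt; apply/negP => Us.
have [h hp hU] := uU (U i s w / 2) (divr_gt0 Us (ltr0Sn _ 1)).
have ms : Num.max 0 (s - h) < s by rewrite gt_max s0 ltrBlDr ltrDl.
have [r] := rat_in_itvoo ms.
rewrite in_itv/= gt_max => /andP[/andP[r0 r1] r2].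
have rT : (0 : R) <= ratr r <= T by apply/andP; split; [exact: ltW|exact: le_trans (ltW r2) (le_trans sh hT)].
have sT : 0 <= s <= T by apply/andP; split; [exact: ltW|exact: le_trans sh hT].
have := hU s (ratr r) sT rT.
rewrite ger0_norm ?subr_ge0 ?(ltW r2)// => /(_ _).
have rs : s - ratr r <= h by lra.
move=> /(_ rs); rewrite ler_norml => /andP[_ hr].
have Ur : 0 < U i (ratr r) w by lra.
have : hitting U w <= ratr r.
  by apply: hitting_le; split => //; right; exists r; split => //; exists i.
by move=> /(le_trans sh); rewrite leNgt r2.
Qed.

Lemma hitting_after U w : hitting U w < T -> forall h, 0 < h ->
  exists i q, [/\ hitting U w <= q, q < hitting U w + h, q <= T & 0 < U i q w].
Proof.
(* Capping by the distance to [T] rules out the point [T], which belongs to [hitset] whatever [U]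
   is. *)
move=> hT h h0; pose h' := Num.min h (T - hitting U w).
have h'0 : 0 < h' by rewrite lt_min h0 subr_gt0.
have [q [/andP[q0 qT] hq] qt] := inf_adherent h'0 (hitset_has_inf U w).
rewrite -/(hitting U w) in qt.
case: hq => [qE|[r [qr [i Ui]]]].
  have : T < T.
    rewrite -{1}qE; apply: (lt_le_trans qt).
    by rewrite -[leRHS](subrK (hitting U w)) addrC lerD2r ge_min lexx orbT.
  by rewrite ltxx.
exists i, q; split => //.
  by apply: hitting_le; split; [rewrite q0|right; exists r; split => //; exists i].
by apply: (lt_le_trans qt); rewrite lerD2l ge_min lexx.
Qed.

End Stopping.

(** * Optional stopping of square integrable martingales *)

Section SquareMartingale.
Context {R : realType} {disp : measure_display} {Omega : measurableType disp}.
Variables (P : probability Omega R) (T : R) (F : R -> set (set Omega)).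
Hypotheses (hP : measure_is_complete P) (T0 : 0 <= T) (hF : filtration P T F).
Local Notation integ := (integ P).
Local Notation L2 := (L2 P).
Implicit Types (X q zeta : Omega -> R) (M Q : R -> Omega -> R) (A : set Omega).

(* X is an increment over [u, v] of a square integrable martingale, and q the
   increment of its bracket. *)
Definition sq_incr u v X q : Prop :=
  [/\ gmeas (F v) X, L2 X, gmeas (F v) q, integ q &
   (forall zeta, gmeas (F u) zeta -> L2 zeta -> \int[P]_w (zeta w * X w) = 0) /\
   (forall A, F u A -> \int[P]_w (\1_A w * X w ^+ 2) = \int[P]_w (\1_A w * q w))].

Definition sqmart M Q : Prop := forall u v, 0 <= u -> u <= v -> v <= T ->
  sq_incr u v (fun w => M v w - M u w) (fun w => Q v w - Q u w).

Lemma filt_meas t A : 0 <= t <= T -> F t A -> measurable A.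
Proof. by move=> tT; exact: (subsigma_meas (filtration_sub hF tT)). Qed.

Lemma gmeas_indic t A : 0 <= t <= T -> F t A -> gmeas (F t) (\1_A : Omega -> R).
Proof. by move=> tT FA; apply: measurable_indic; exact: sub_sigma_algebra. Qed.

Lemma gmeas_measT disp' (Y : measurableType disp') t (X : Omega -> Y) : 0 <= t <= T ->
  gmeas (F t) X -> measurable_fun setT X.
Proof. by move=> tT; apply: gmeas_meas; exact: (filtration_sub hF tT). Qed.

(** Only the cross term needs an argument: [\1_A w * X1 w] is [F e]-measurable and square
    integrable, hence orthogonal to [X2]. *)
Lemma sq_incr_glue u e v X1 q1 X2 q2 : 0 <= u -> u <= e -> e <= v -> v <= T ->
  sq_incr u e X1 q1 -> sq_incr e v X2 q2 ->
  sq_incr u v (fun w => X1 w + X2 w) (fun w => q1 w + q2 w).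
Proof.
move=> u0 ue ev vT [mX1 lX1 mq1 iq1 [h1 h1']] [mX2 lX2 mq2 iq2 [h2 h2']].
have e0 := le_trans u0 ue; have eT := le_trans ev vT; have uT := le_trans ue eT.
have uT' : 0 <= u <= T by rewrite u0.
have eT' : 0 <= e <= T by rewrite e0.
split.
- by apply: measurable_funD => //; exact: (gmeas_filt hF e0 ev vT).
- exact: L2D.
- by apply: measurable_funD => //; exact: (gmeas_filt hF e0 ev vT).
- exact: integD.
- split=> [zeta mz lz|A FA].
    have lz' : gmeas (F e) zeta by exact: (gmeas_filt hF u0 ue eT).
    under eq_Rintegral do rewrite mulrDr.
    by rewrite ED ?h1 ?h2 ?addr0//; exact: L2_mul.
  have FeA : F e A by exact: (filtration_mono hF u0 ue eT).
  have mA := filt_meas uT' FA.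
  have l1 := L2_indicM mA lX1; have l2 := L2_indicM mA lX2.
  rewrite (eq_E P (Y := fun w => \1_A w * X1 w ^+ 2 + (2 * ((\1_A w * X1 w) * X2 w) + \1_A w * X2 w ^+ 2))); last first.
    by move=> w; ring.
  rewrite ED; last 2 first.
  - by apply: integ_indicM => //; case: lX1.
  - apply: integD; first by apply: integZ; exact: L2_mul.
    by apply: integ_indicM => //; case: lX2.
  rewrite ED; last 2 first.
  - by apply: integZ; exact: L2_mul.
  - by apply: integ_indicM => //; case: lX2.
  rewrite EZ; last exact: L2_mul.
  rewrite h2//; last first.
    by apply: measurable_funM => //; exact: gmeas_indic.
  rewrite mulr0 add0r h1'// h2'// -ED; last 2 first.
  - exact: integ_indicM.
  - exact: integ_indicM.
  by apply: eq_E => w; rewrite mulrDr.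
Qed.

Section DiscreteStopping.
Variables (M Q : R -> Omega -> R) (rho : Omega -> R).
Hypotheses (hM : sqmart M Q) (hrho : optional T F rho).
Variables (r : nat -> R) (N : nat).
Hypotheses (r0 : 0 <= r 0%N) (rnd : {homo r : i j / (i <= j)%N >-> i <= j}) (rT : r N <= T).

(** The first grid time strictly after [rho], or the index [N] where [find] ends by default. As
    [rho] is optional, the event of index [i] is then known at [r i]; this would fail in general for
    the last grid time before [rho]. *)
Definition stop_index w : nat := find (fun i => rho w < r i) (iota 0 N).
Local Notation kappa := stop_index.

Lemma stop_index_le w : (kappa w <= N)%N.
Proof. by rewrite /stop_index -{2}(size_iota 0 N) find_size. Qed.

Lemma stop_index_before w i : (i < kappa w)%N -> r i <= rho w.
Proof.
move=> ik; have := before_find 0%N ik; rewrite nth_iota; last first.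
  by apply: leq_trans ik _; exact: stop_index_le.
by rewrite add0n => /negbT; rewrite -leNgt.
Qed.

Lemma stop_index_at w : (kappa w < N)%N -> rho w < r (kappa w).
Proof.
move=> kN; have : has (fun i => rho w < r i) (iota 0 N) by rewrite has_find size_iota.
by move/(nth_find 0%N); rewrite nth_iota.
Qed.

Let ri i : (i <= N)%N -> 0 <= r i <= T.
Proof. by move=> iN; rewrite (le_trans r0 (rnd (leq0n i))) (le_trans (rnd iN) rT). Qed.

Lemma stop_index_filt i : (i <= N)%N -> F (r i) [set w | kappa w = i].
Proof.
move=> iN; have hFt := filtration_sub hF (ri iN).
have lower j : (j <= i)%N -> F (r i) [set w | forall k, (k < j)%N -> r k <= rho w].
  elim: j => [_|j IHj ji].
    rewrite (_ : [set w | _] = setT); first exact: (subsigmaT hFt).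
    by apply/seteqP; split.
  rewrite (_ : [set w | _] = [set w | forall k, (k < j)%N -> r k <= rho w] `&` [set w | r j <= rho w]).
    apply: (subsigmaI hFt); first exact: IHj (ltnW ji).
    have jN := leq_trans (ltnW ji) iN.
    apply: (filtration_mono hF _ (rnd (ltnW ji))).
    - by case/andP: (ri jN).
    - by case/andP: (ri iN).
    - exact: (optional_ge hF hrho (ri jN)).
  apply/seteqP; split => w /=.
    by move=> h; split => [k kj|]; apply: h => //; exact: ltnW.
  by move=> [h h'] k; rewrite ltnS leq_eqVlt => /predU1P[->//|]; exact: h.
have [iN'|Ni] := ltnP i N; last first.
  rewrite (_ : [set w | _] = [set w | forall k, (k < i)%N -> r k <= rho w]); first exact: lower.
  apply/seteqP; split => w /=; first by move=> <- k; exact: stop_index_before.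
  move=> h; apply/eqP; rewrite eqn_leq (leq_trans (stop_index_le w) Ni)/= leqNgt.
  apply/negP => ki; have := stop_index_at (leq_trans ki iN).
  by rewrite ltNge h.
rewrite (_ : [set w | _] = [set w | forall k, (k < i)%N -> r k <= rho w] `&` [set w | rho w < r i]).
  apply: (subsigmaI hFt); first exact: lower.
  by case: hrho => _ h; exact: (h _ (ri iN)).
apply/seteqP; split => w /=.
  by move=> ki; split => [k|]; rewrite -ki; [exact: stop_index_before|apply: stop_index_at; rewrite ki].
move=> [h h']; apply/eqP; rewrite eqn_leq; apply/andP; split; rewrite leqNgt; apply/negP => ki.
  by have := stop_index_before ki; rewrite leNgt h'.
by have := stop_index_at (ltn_trans ki iN'); rewrite ltNge h.
Qed.

Local Notation K i := [set w | kappa w = i].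

Lemma stop_index_sum (f : nat -> Omega -> R) w :
  f (kappa w) w = \sum_(i < N.+1) \1_(K i) w * f i w.
Proof.
have kN : (kappa w < N.+1)%N by rewrite ltnS stop_index_le.
rewrite (bigD1 (Ordinal kN))//= indicE mem_set// mul1r big1 ?addr0// => i /eqP ik.
rewrite indicE memNset ?mul0r// => /= ki; apply: ik; exact: val_inj.
Qed.

Lemma E_stop_index (f : nat -> Omega -> R) : (forall i, (i <= N)%N -> integ (f i)) ->
  integ (fun w => f (kappa w) w) /\
  \int[P]_w f (kappa w) w = \sum_(i < N.+1) \int[P]_w (\1_(K i) w * f i w).
Proof.
move=> hf; have iK (i : 'I_N.+1) : integ (fun w => \1_(K i) w * f i w).
  have iN : (i <= N)%N by rewrite -ltnS.
  by apply: integ_indicM; [exact: filt_meas (ri iN) (stop_index_filt iN)|exact: hf].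
under eq_fun do rewrite stop_index_sum.
split; first exact: integ_sum.
by rewrite Esum.
Qed.

Let S i w := M (r i) w - M (r 0%N) w.
Let U i w := M (r N) w - M (r i) w.

Let S_incr i : (i <= N)%N -> sq_incr (r 0%N) (r i) (S i) (fun w => Q (r i) w - Q (r 0%N) w).
Proof. by move=> iN; apply: hM => //; [exact: rnd|case/andP: (ri iN)]. Qed.

Let U_incr i : (i <= N)%N -> sq_incr (r i) (r N) (U i) (fun w => Q (r N) w - Q (r i) w).
Proof. by move=> iN; apply: hM => //; [case/andP: (ri iN)|exact: rnd]. Qed.

(** Pythagoras: [U i] is orthogonal to what is known at [r i], and its square has the mean of the
    remaining bracket. *)
Let pyth i G : (i <= N)%N -> F (r i) G ->
  \int[P]_w (\1_G w * S N w ^+ 2) =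
  \int[P]_w (\1_G w * S i w ^+ 2) + \int[P]_w (\1_G w * (Q (r N) w - Q (r i) w)).
Proof.
move=> iN FG; have [mS lS _ _ _] := S_incr iN; have [mU lU mq iq [hU hU']] := U_incr iN.
have mG := filt_meas (ri iN) FG.
rewrite (eq_E P (Y := fun w => \1_G w * S i w ^+ 2 + (2 * ((\1_G w * S i w) * U i w) + \1_G w * U i w ^+ 2))); last first.
  by move=> w; rewrite /S /U; ring.
have l1 := L2_indicM mG lS.
rewrite ED; last 2 first.
- by apply: integ_indicM => //; case: lS.
- apply: integD; first by apply: integZ; exact: L2_mul.
  by apply: integ_indicM => //; case: lU.
rewrite ED; last 2 first.
- by apply: integZ; exact: L2_mul.
- by apply: integ_indicM => //; case: lU.
rewrite EZ; last exact: L2_mul.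
rewrite hU//; last by apply: measurable_funM => //; exact: (gmeas_indic (ri iN)).
by rewrite mulr0 add0r hU'.
Qed.

Let rN0 : r 0%N <= r N. Proof. exact: rnd. Qed.

(** The stopped increment is the full one minus the remainder [U (kappa w)]; cut along the values of
    the index, each piece of the remainder is orthogonal to an [F (r i)]-measurable factor. *)
Lemma discrete_stop_mean zeta k A : F (r 0%N) A -> gmeas (F (r 0%N)) zeta ->
  (forall w, `|zeta w| <= k) ->
  \int[P]_w (\1_A w * zeta w * (M (r (kappa w)) w - M (r 0%N) w)) = 0.
Proof.
move=> FA mz zk; have r00 := ri (leq0n N).
have mA := filt_meas r00 FA; have mz' := gmeas_measT r00 mz.
have mAz : gmeas (F (r 0%N)) (fun w => \1_A w * zeta w).
  by apply: measurable_funM => //; exact: (gmeas_indic r00).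
have lAz : L2 (fun w => \1_A w * zeta w).
  by apply: L2_indicM => //; exact: L2_bnd zk.
have [_ lN _ _ [hN _]] := S_incr (leqnn N).
have hU i : (i <= N)%N -> integ (fun w => \1_A w * zeta w * U i w).
  by move=> iN; have [_ lU _ _ _] := U_incr iN; exact: L2_mul.
have [i1 e1] := E_stop_index hU.
rewrite (eq_E P (Y := fun w => \1_A w * zeta w * S N w - \1_A w * zeta w * U (kappa w) w)); last first.
  by move=> w; rewrite /S /U; ring.
rewrite EB//; last exact: L2_mul.
rewrite hN// e1 big1 ?subr0// => i _.
have iN : (i <= N)%N by rewrite -ltnS.
have [_ lU _ _ [hU0 _]] := U_incr iN.
have mK := filt_meas (ri iN) (stop_index_filt iN).
rewrite (eq_E P (Y := fun w => \1_(K i) w * (\1_A w * zeta w) * U i w)); last by move=> w; ring.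
apply: hU0; last exact: L2_indicM.
apply: measurable_funM; first exact: (gmeas_indic (ri iN) (stop_index_filt iN)).
by apply: (gmeas_filt hF _ _ _ mAz) => //; [exact: rnd|case/andP: (ri iN)].
Qed.

(** Summing [pyth] over the values of the index gives the mean square of [S N] as that of the
    stopped increment plus the remaining bracket. It is also the mean of the full bracket, and the
    difference is the claim. *)
Lemma discrete_stop_iso A : F (r 0%N) A ->
  \int[P]_w (\1_A w * (M (r (kappa w)) w - M (r 0%N) w) ^+ 2) =
  \int[P]_w (\1_A w * (Q (r (kappa w)) w - Q (r 0%N) w)).
Proof.
move=> FA; have r00 := ri (leq0n N); have mA := filt_meas r00 FA.
have iS i : (i <= N)%N -> integ (fun w => \1_A w * S i w ^+ 2).
  by move=> iN; have [_ [_ lS] _ _ _] := S_incr iN; exact: integ_indicM.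
have iq i : (i <= N)%N -> integ (fun w => \1_A w * (Q (r N) w - Q (r i) w)).
  by move=> iN; have [_ _ _ iq _] := U_incr iN; exact: integ_indicM.
have [i1 e1] := E_stop_index iS; have [i2 e2] := E_stop_index iq.
have [_ _ _ iqN [_ hN]] := S_incr (leqnn N).
have e3 : \int[P]_w (\1_A w * S N w ^+ 2) =
    \int[P]_w (\1_A w * S (kappa w) w ^+ 2) +
    \int[P]_w (\1_A w * (Q (r N) w - Q (r (kappa w)) w)).
  have [_ e4] := @E_stop_index (fun _ w => \1_A w * S N w ^+ 2) (fun _ _ => iS _ (leqnn N)).
  rewrite e4 e1 e2 -big_split /=; apply: eq_bigr => i _.
  have iN : (i <= N)%N by rewrite -ltnS.
  have FKA : F (r i) (K i `&` A).
    apply: (subsigmaI (filtration_sub hF (ri iN))); first exact: stop_index_filt.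
    by apply: (filtration_mono hF _ (rnd (leq0n i))) => //; case/andP: (ri iN).
  have eI w : \1_(K i `&` A) w = \1_(K i) w * \1_A w :> R by rewrite indicI.
  rewrite (eq_E P (Y := fun w => \1_(K i `&` A) w * S N w ^+ 2)); last by move=> w; rewrite eI mulrA.
  rewrite (pyth iN FKA); congr (_ + _); apply: eq_E => w; rewrite eI mulrA//.
rewrite hN// in e3.
have e5 : \int[P]_w (\1_A w * (Q (r (kappa w)) w - Q (r 0%N) w)) =
  \int[P]_w (\1_A w * (Q (r N) w - Q (r 0%N) w)) -
  \int[P]_w (\1_A w * (Q (r N) w - Q (r (kappa w)) w)).
  rewrite -EB//; last exact: integ_indicM.
  by apply: eq_E => w; ring.
by rewrite e5 e3 addrK.
Qed.

(** Given the index, the mean square only grows up to the last grid time, and exceeding [c] is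
    already decided at the index. So the tails of the stopped squares, which vary with the grid, are
    controlled by the square of one fixed increment. *)
Lemma discrete_stop_tail c A : F (r 0%N) A ->
  integ (fun w => \1_A w * (M (r (kappa w)) w - M (r 0%N) w) ^+ 2) /\
  \int[P]_w (\1_[set w | c < `|M (r (kappa w)) w - M (r 0%N) w|] w *
     (\1_A w * (M (r (kappa w)) w - M (r 0%N) w) ^+ 2)) <=
  \int[P]_w (\1_[set w | c < `|M (r (kappa w)) w - M (r 0%N) w|] w *
     (\1_A w * (M (r N) w - M (r 0%N) w) ^+ 2)).
Proof.
move=> FA; have r00 := ri (leq0n N); have mA := filt_meas r00 FA.
pose D i := [set w | c < `|S i w|].
have FD i : (i <= N)%N -> F (r i) (D i).
  move=> iN; have [mS _ _ _ _] := S_incr iN.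
  have := (gmeasE _ (filtration_sub hF (ri iN))).1 (measurableT_comp (@normr_measurable R setT) mS).
  move=> /(_ [set` `]c, +oo[%R] (measurable_itv _)).
  by congr (F _ _); apply/seteqP; split => w /=; rewrite in_itv/= andbT.
have mD i : (i <= N)%N -> measurable (D i).
  by move=> iN; exact: filt_meas (ri iN) (FD _ iN).
have iS i : (i <= N)%N -> integ (fun w => \1_A w * S i w ^+ 2).
  by move=> iN; have [_ [_ lS] _ _ _] := S_incr iN; exact: integ_indicM.
split; first by have [] := E_stop_index iS.
have iDS i : (i <= N)%N -> integ (fun w => \1_(D i) w * (\1_A w * S i w ^+ 2)).
  by move=> iN; apply: integ_indicM; [exact: mD|exact: iS].
have iDN i : (i <= N)%N -> integ (fun w => \1_(D i) w * (\1_A w * S N w ^+ 2)).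
  by move=> iN; apply: integ_indicM; [exact: mD|exact: iS].
have [_ e1] := E_stop_index iDS; have [_ e2] := E_stop_index iDN.
have eD w : \1_[set w | c < `|M (r (kappa w)) w - M (r 0%N) w|] w = \1_(D (kappa w)) w :> R.
  by [].
rewrite (eq_E P (Y := fun w => \1_(D (kappa w)) w * (\1_A w * S (kappa w) w ^+ 2)))// e1.
rewrite (eq_E P (Y := fun w => \1_(D (kappa w)) w * (\1_A w * S N w ^+ 2)))// e2.
apply: ler_sum => i _; have iN : (i <= N)%N by rewrite -ltnS.
have FG : F (r i) (K i `&` (D i `&` A)).
  have hFt := filtration_sub hF (ri iN).
  apply: (subsigmaI hFt); first exact: stop_index_filt.
  apply: (subsigmaI hFt); first exact: FD.
  by apply: (filtration_mono hF _ (rnd (leq0n i))) => //; case/andP: (ri iN).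
have eI w : \1_(K i `&` (D i `&` A)) w = \1_(K i) w * (\1_(D i) w * \1_A w) :> R.
  by rewrite !indicI.
rewrite (eq_E P (Y := fun w => \1_(K i `&` (D i `&` A)) w * S i w ^+ 2)); last by move=> w; rewrite eI !mulrA.
rewrite [leRHS](eq_E P (Y := fun w => \1_(K i `&` (D i `&` A)) w * S N w ^+ 2)); last by move=> w; rewrite eI !mulrA.
have [_ lU _ _ [_ hU']] := U_incr iN.
rewrite (pyth iN FG) lerDl -hU'//.
by apply: Rintegral_ge0 => w _; rewrite mulr_ge0 ?sqr_ge0// indicE.
Qed.

Lemma discrete_stop_L2 : L2 (fun w => M (r (kappa w)) w - M (r 0%N) w) /\
  integ (fun w => Q (r (kappa w)) w - Q (r 0%N) w).
Proof.
have [|i1 _] := @E_stop_index S.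
  by move=> i iN; have [_ lS _ _ _] := S_incr iN; exact: L2_integ.
have [|i2 _] := @E_stop_index (fun i w => S i w ^+ 2).
  by move=> i iN; have [_ [_ lS] _ _ _] := S_incr iN.
have [|i3 _] := @E_stop_index (fun i w => Q (r i) w - Q (r 0%N) w).
  by move=> i iN; have [_ _ _ iq _] := S_incr iN.
by split => //; split => //; exact: integ_meas i1.
Qed.

End DiscreteStopping.

Section ContinuousStopping.
Variables (M Q : R -> Omega -> R) (rho : Omega -> R) (C : R).
Hypotheses (hM : sqmart M Q) (hrho : optional T F rho) (aM : acproc P T F M) (aQ : acproc P T F Q).
Hypothesis QC : forall w s t, 0 <= s -> s <= t -> t <= T -> 0 <= Q t w - Q s w <= C.
Variables (u v : R).
Hypotheses (u0 : 0 <= u) (uv : u <= v) (vT : v <= T).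

(** Uniform partition of [[u, v]] into [n.+1] intervals; [sg n] approximates from the right the time
    [rho] clipped to [[u, v]]. *)
Let r n i : R := u + (v - u) * (i%:R / n.+1%:R).
Let kap n := stop_index rho (r n) n.+1.
Let sg n w := r n (kap n w).

Let rnd n : {homo r n : i j / (i <= j)%N >-> i <= j}.
Proof.
move=> i j ij; rewrite lerD2l ler_wpM2l ?subr_ge0// ler_wpM2r ?invr_ge0//.
by rewrite ler_nat.
Qed.

Let r0E n : r n 0%N = u. Proof. by rewrite /r mul0r mulr0 addr0. Qed.

Let rNE n : r n n.+1 = v.
Proof. by rewrite /r divff ?pnatr_eq0// mulr1 addrC subrK. Qed.

Let r00 n : 0 <= r n 0%N. Proof. by rewrite r0E. Qed.
Let rNT n : r n n.+1 <= T. Proof. by rewrite rNE. Qed.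

Let sg_itv n w : u <= sg n w <= v.
Proof.
have := rnd n (leq0n (kap n w)); have := rnd n (stop_index_le rho (r n) n.+1 w).
by rewrite r0E rNE => -> ->.
Qed.

Let sg_dist n w : u <= rho w -> `|sg n w - Num.min v (rho w)| <= (v - u) * n.+1%:R^-1.
Proof.
move=> ur.
have step i : r n i.+1 = r n i + (v - u) * n.+1%:R^-1.
  by rewrite /r -natr1; ring.
have d0 : 0 <= (v - u) * n.+1%:R^-1 by rewrite mulr_ge0 ?subr_ge0// invr_ge0.
have := stop_index_le rho (r n) n.+1 w; rewrite leq_eqVlt => /predU1P[kE|kN].
  have rn : r n n <= rho w by apply: (stop_index_before (N := n.+1)); rewrite kE.
  have vE : v = r n n + (v - u) * n.+1%:R^-1 by rewrite -step rNE.
  have -> : sg n w = v by rewrite /sg /kap kE rNE.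
  move: d0 vE; set dd := (v - u) / _ => d0 vE.
  by case: (leP v (rho w)) => vr; rewrite ger0_norm ?subr_ge0 ?subrr//; lra.
have rk := stop_index_at kN.
have k0 : (0 < kap n w)%N.
  by rewrite lt0n; apply/eqP => k0; move: rk; rewrite -/(kap n w) k0 r0E ltNge ur.
have rk' : r n (kap n w).-1 <= rho w by apply: (stop_index_before (N := n.+1)); rewrite prednK.
have sE : sg n w = r n (kap n w).-1 + (v - u) * n.+1%:R^-1 by rewrite /sg -{1}(prednK k0) step.
have rv : rho w <= v.
  by apply: (le_trans (ltW rk)); have /andP[] := sg_itv n w.
rewrite min_r// ger0_norm ?subr_ge0 ?(ltW rk)// sE.
by move: rk'; set a := r n _; set dd := _ / _; lra.
Qed.

Let sgT n w : 0 <= sg n w <= T.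
Proof. by case/andP: (sg_itv n w) => h1 h2; rewrite (le_trans u0 h1) (le_trans h2 vT). Qed.

Let cvg_stop (X : R -> Omega -> R) w : ucont T (X ^~ w) ->
  X (sg n w) w - X u w @[n --> \oo] --> stopped X rho v w - stopped X rho u w.
Proof.
move=> uX; rewrite /stopped; have [ur|ru] := leP u (rho w); last first.
  (* If [rho < u] the index is 0, [sg n] is [u], and both increments vanish. *)
  rewrite min_r ?(le_trans (ltW ru) uv)// subrr.
  have -> : (fun n => X (sg n w) w - X u w) = cst 0.
    apply/funext => n; rewrite /sg.
    have -> : kap n w = 0%N; last by rewrite r0E subrr.
    apply/eqP; rewrite -leqn0 leqNgt; apply/negP => k0.
    by have := stop_index_before k0; rewrite r0E leNgt ru.
  exact: cvg_cst.
apply: cvgB; last exact: cvg_cst.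
apply: (ucont_cvg uX) => //.
  case: hrho => /(_ w) /andP[h1 h2] _.
  by rewrite le_min ge_min h1 (le_trans u0 uv) vT.
apply/cvgrPdist_le => e e0.
have h : (v - u) * n.+1%:R^-1 @[n --> \oo] --> (0 : R).
  rewrite -[X in _ --> X](mulr0 (v - u)); apply: cvgMr; exact: cvg_harmonic.
move/cvgrPdist_le : h => /(_ e e0); apply: filterS => n.
rewrite sub0r normrN; apply: le_trans; rewrite distrC; apply: (le_trans (sg_dist n ur)).
exact: ler_norm.
Qed.

(** The discrete identities pass to the limit along the partitions. Only the limit increment is
    bounded by [c]; the approximating ones are not, and their part above [c + 1] is removed by means
    of [discrete_stop_tail]. *)
Lemma continuous_stop (c : R) A : F u A -> 0 <= c ->
  {ae P, forall w, A w -> `|stopped M rho v w - stopped M rho u w| <= c} ->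
  (forall zeta k, gmeas (F u) zeta -> (forall w, `|zeta w| <= k) ->
    \int[P]_w (\1_A w * zeta w * (stopped M rho v w - stopped M rho u w)) = 0) /\
  \int[P]_w (\1_A w * (stopped M rho v w - stopped M rho u w) ^+ 2) =
  \int[P]_w (\1_A w * (stopped Q rho v w - stopped Q rho u w)).
Proof.
move=> FA c0 hb.
have uT' : 0 <= u <= T by rewrite u0 (le_trans uv).
have vT' : 0 <= v <= T by rewrite vT (le_trans u0 uv).
have mA := filt_meas uT' FA.
pose S n w := M (sg n w) w - M u w.
pose q n w := Q (sg n w) w - Q u w.
pose Soo w := stopped M rho v w - stopped M rho u w.
pose qoo w := stopped Q rho v w - stopped Q rho u w.
have FA' n : F (r n 0%N) A by rewrite r0E.
have lS n : L2 (S n) /\ integ (q n).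
  have := discrete_stop_L2 hM hrho (r00 n) (@rnd n) (rNT n).
  by rewrite r0E.
have mstop (X : R -> Omega -> R) : acproc P T F X -> measurable_fun setT (fun w => stopped X rho v w - stopped X rho u w).
  move=> aX; have [aS _] := acproc_stopped hP hF hrho aX.
  by apply: measurable_funB; [exact: gmeas_measT (aS _ vT')|exact: gmeas_measT (aS _ uT')].
have mI : measurable_fun setT (\1_A : Omega -> R) by exact: measurable_indic.
have mS n : measurable_fun setT (S n) by have [[mS _] _] := lS n.
have mq n : measurable_fun setT (q n) by have [_ /integ_meas] := lS n.
have cS : {ae P, forall w, S ^~ w @ \oo --> Soo w}.
  by case: aM => _; apply: filterS => w uM; exact: cvg_stop.
have cq : {ae P, forall w, q ^~ w @ \oo --> qoo w}.
  by case: aQ => _; apply: filterS => w uQ; exact: cvg_stop.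
(* As [S n] converges on [A] to a limit bounded by [c], almost every path of [A] eventually leaves
   [B n]; off [B n] everything is bounded. *)
pose B n : set Omega := [set w | c + 1 < `|S n w|].
have mB n : measurable (B n).
  have mnS : measurable_fun setT (fun w => `|S n w|) by exact: measurableT_comp.
  have := mnS measurableT _ (measurable_itv `]c + 1, +oo[%R).
  by rewrite setTI; congr (measurable _); apply/seteqP; split => w /=; rewrite in_itv/= andbT.
have mIB n : measurable_fun setT (\1_(B n) : Omega -> R) by exact: measurable_indic.
pose N w := M v w - M u w.
have [_ [mN lN] _ _ _] := hM u0 uv vT.
have iAS n : integ (fun w => \1_A w * S n w ^+ 2).
  by apply: integ_indicM => //; have [[_ ?] _] := lS n.
have evB : {ae P, forall w, A w -> \forall n \near \oo, \1_(B n) w = 0 :> R}.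
  apply: filterS2 cS hb => w cSw hw Aw.
  move/cvgrPdist_le : cSw => /(_ 1 ltr01); apply: filterS => n hn.
  rewrite indicE memNset// /B /=; apply/negP; rewrite -leNgt.
  have hS : `|S n w| <= `|Soo w| + `|Soo w - S n w|.
    rewrite -{1}[S n w](_ : Soo w - (Soo w - S n w) = _); last by ring.
    exact: ler_normB.
  have hS2 : `|Soo w| <= c by exact: hw.
  by apply: (le_trans hS); exact: lerD.
have ind0 D w : 0 <= \1_D w :> R by rewrite indicE.
have ind1 D w : \1_D w <= 1 :> R by rewrite indicE lern1 leq_b1.
have tail0 : \int[P]_w (\1_(B n) w * (\1_A w * N w ^+ 2)) @[n --> \oo] --> (0 : R).
  rewrite -(E0 P); apply: (@E_dct _ _ _ P _ _ (fun w => N w ^+ 2)) => //.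
  - move=> n; apply: measurable_funM => //; apply: measurable_funM => //.
    exact: measurable_funX.
  - apply: filterS evB => w hw; case: (pselect (A w)) => [Aw|nA].
      apply: cvg_near_cst; apply: filterS (hw Aw) => n ->; by rewrite mul0r.
    rewrite indicE memNset//; under eq_fun do rewrite mul0r mulr0; exact: cvg_cst.
  - apply: aeW => w n; have A0 : 0 <= \1_A w * N w ^+ 2 by rewrite mulr_ge0 ?sqr_ge0.
    rewrite ger0_norm; last by rewrite mulr_ge0.
    by apply: (@le_trans _ _ (\1_A w * N w ^+ 2)); rewrite ler_piMl ?sqr_ge0 ?ind1.
pose a n := \int[P]_w (\1_(B n) w * (\1_A w * S n w ^+ 2)).
have a_cvg : a @ \oo --> (0 : R).
  apply: (@squeeze_cvgr _ _ _ _ (fun=> 0) (fun n => \int[P]_w (\1_(B n) w * (\1_A w * N w ^+ 2)))) => //; last exact: cvg_cst.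
  apply: nearW => n; apply/andP; split.
    by apply: Rintegral_ge0 => w _; rewrite mulr_ge0 ?ind0// mulr_ge0 ?ind0 ?sqr_ge0.
  have [_] := discrete_stop_tail hM hrho (r00 n) (@rnd n) (rNT n) (c + 1) (FA' n).
  by rewrite r0E rNE.
split; last first.
  have e1 n : \int[P]_w (\1_A w * S n w ^+ 2) = \int[P]_w (\1_A w * q n w).
    by have := discrete_stop_iso hM hrho (r00 n) (@rnd n) (rNT n) (FA' n); rewrite r0E.
  have c1 : \int[P]_w (\1_A w * q n w) @[n --> \oo] --> \int[P]_w (\1_A w * qoo w).
    apply: (@E_dct _ _ _ P _ _ (fun=> C)) => //.
    - by move=> n; exact: measurable_funM.
    - by apply: measurable_funM => //; exact: mstop.
    - by apply: filterS cq => w h; apply: cvgMr.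
    - apply: aeW => w n; rewrite normrM -[leRHS]mul1r ler_pM ?norm_indic_le1//.
      have /andP[h1 h2] := sg_itv n w.
      have /andP[h3 h4] := QC w u0 h1 (le_trans h2 vT).
      by rewrite ger0_norm.
    - exact: integ_cst.
  have c2 : \int[P]_w ((1 - \1_(B n) w) * (\1_A w * S n w ^+ 2)) @[n --> \oo] -->
      \int[P]_w (\1_A w * Soo w ^+ 2).
    apply: (@E_dct _ _ _ P _ _ (fun=> (c + 1) ^+ 2)) => //.
    - move=> n; apply: measurable_funM; first exact: measurable_funB.
      by apply: measurable_funM => //; exact: measurable_funX.
    - by apply: measurable_funM => //; apply: measurable_funX; exact: mstop.
    - apply: filterS2 evB cS => w hw cSw; case: (pselect (A w)) => [Aw|nA].
        have h : \1_A w * S n w ^+ 2 @[n --> \oo] --> \1_A w * Soo w ^+ 2.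
          by apply: cvgMr; rewrite expr2; under eq_fun do rewrite expr2; exact: cvgM.
        apply: cvg_trans h; apply: near_eq_cvg.
        by apply: filterS (hw Aw) => n /= ->; rewrite subr0 mul1r.
      rewrite indicE memNset// mul0r; under eq_fun do rewrite mul0r mulr0; exact: cvg_cst.
    - apply: aeW => w n; case: (pselect (B n w)) => [Bw|nB].
        by rewrite [\1_(B n) w]indicE mem_set// subrr mul0r normr0 sqr_ge0.
      rewrite [\1_(B n) w]indicE memNset// subr0 mul1r normrM -[leRHS]mul1r.
      rewrite ler_pM ?norm_indic_le1// normrX lerXn2r ?nnegrE ?addr_ge0//.
      by rewrite leNgt; apply/negP.
    - exact: integ_cst.
  have c3 : \int[P]_w (\1_A w * q n w) @[n --> \oo] --> \int[P]_w (\1_A w * Soo w ^+ 2).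
    rewrite -[X in _ --> X]addr0.
    have -> : (fun n => \int[P]_w (\1_A w * q n w)) =
        (fun n => \int[P]_w ((1 - \1_(B n) w) * (\1_A w * S n w ^+ 2)) + a n).
      apply/funext => n; rewrite -e1 /a -ED.
      - by apply: eq_E => w; ring.
      - apply: integ_le (iAS n) => [|w].
          apply: measurable_funM; first exact: measurable_funB.
          by apply: measurable_funM => //; exact: measurable_funX.
        rewrite normrM (ger0_norm (_ : 0 <= \1_A w * S n w ^+ 2)); last by rewrite mulr_ge0 ?sqr_ge0.
        have A0 : 0 <= \1_A w * S n w ^+ 2 by rewrite mulr_ge0 ?sqr_ge0.
        rewrite ler_piMl// indicE.
        by case: (w \in B n); rewrite ?subrr ?subr0 ?normr0 ?normr1.
      - exact: integ_indicM.
    exact: cvgD.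
  exact: (cvg_unique _ c3 c1).
move=> zeta k mz zk; have k0 : 0 <= k by exact: (le_trans (normr_ge0 _) (zk point)).
have mz' := gmeas_measT uT' mz.
have e1 n : \int[P]_w (\1_A w * zeta w * S n w) = 0.
  have mzn : gmeas (F (r n 0%N)) zeta by rewrite r0E.
  by have := discrete_stop_mean hM hrho (r00 n) (@rnd n) (rNT n) (FA' n) mzn zk; rewrite r0E.
have mAz : measurable_fun setT (fun w => \1_A w * zeta w) by exact: measurable_funM.
have Azk w : `|\1_A w * zeta w| <= k.
  by rewrite normrM -[leRHS]mul1r ler_pM ?norm_indic_le1.
have iAzS n : integ (fun w => \1_A w * zeta w * S n w).
  by apply: L2_mul; [exact: L2_bnd Azk|have [] := lS n].
have c2 : \int[P]_w ((1 - \1_(B n) w) * (\1_A w * zeta w * S n w)) @[n --> \oo] -->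
    \int[P]_w (\1_A w * zeta w * Soo w).
  apply: (@E_dct _ _ _ P _ _ (fun=> k * (c + 1))) => //.
  - move=> n; apply: measurable_funM; first exact: measurable_funB.
    exact: measurable_funM.
  - by apply: measurable_funM => //; exact: mstop.
  - apply: filterS2 evB cS => w hw cSw; case: (pselect (A w)) => [Aw|nA].
      have h : \1_A w * zeta w * S n w @[n --> \oo] --> \1_A w * zeta w * Soo w.
        exact: cvgMr.
      apply: cvg_trans h; apply: near_eq_cvg.
      by apply: filterS (hw Aw) => n /= ->; rewrite subr0 mul1r.
    rewrite indicE memNset// !mul0r; under eq_fun do rewrite !mul0r mulr0; exact: cvg_cst.
  - apply: aeW => w n; case: (pselect (B n w)) => [Bw|nB].
      by rewrite [\1_(B n) w]indicE mem_set// subrr mul0r normr0 mulr_ge0// addr_ge0.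
    rewrite [\1_(B n) w]indicE memNset// subr0 mul1r normrM ler_pM//.
    by rewrite leNgt; apply/negP.
  - exact: integ_cst.
have iB n : integ (fun w => \1_(B n) w * (\1_A w * zeta w * S n w)) by exact: integ_indicM.
have b0 : \int[P]_w (\1_(B n) w * (\1_A w * zeta w * S n w)) @[n --> \oo] --> (0 : R).
  apply/norm_cvg0P.
  apply: (@squeeze_cvgr _ _ _ _ (fun=> 0) (fun n => k * a n)); last 2 first.
  - exact: cvg_cst.
  - by rewrite -[X in _ --> X](mulr0 k); apply: cvgMr.
  apply: nearW => n; rewrite normr_ge0 /=.
  apply: (le_trans (le_normr_Rintegral measurableT (iB n))).
  rewrite /a -EZ; last exact: integ_indicM.
  apply: Ele => [||w].
  - exact: (integrable_norm (iB n)).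
  - by apply: integZ; exact: integ_indicM.
  (* On [B n] the increment is at least 1 in absolute value, hence bounded by its square, whose mean
     on [A] and [B n] is [a n]. *)
  - case: (pselect (B n w)) => [Bw|nB]; last first.
      by rewrite [\1_(B n) w]indicE memNset// !mul0r normr0 mulr0.
    rewrite [\1_(B n) w]indicE mem_set// !mul1r.
    case: (pselect (A w)) => [Aw|nA]; last first.
      by rewrite indicE memNset// !mul0r normr0 mulr0.
    rewrite indicE mem_set// !mul1r normrM ler_pM//.
    have S1 : 1 <= `|S n w| by move: Bw; rewrite /B /=; lra.
    by rewrite -[S n w ^+ 2]real_normK ?num_real// expr2 ler_peMl.
have c3 : (0 : R) @[n --> \oo] --> \int[P]_w (\1_A w * zeta w * Soo w).
  rewrite -[X in _ --> X]addr0.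
  have -> : (fun n : nat => 0 : R) =
      (fun n => \int[P]_w ((1 - \1_(B n) w) * (\1_A w * zeta w * S n w)) +
         \int[P]_w (\1_(B n) w * (\1_A w * zeta w * S n w))).
    apply/funext => n; rewrite -(e1 n) -ED//.
    - by apply: eq_E => w; ring.
    - rewrite (_ : (fun _ => _) = fun w => \1_A w * zeta w * S n w - \1_(B n) w * (\1_A w * zeta w * S n w)).
        exact: integB.
      by apply/funext => w; ring.
  exact: cvgD.
exact/esym/(cvg_unique _ (cvg_cst _) c3).
Qed.

End ContinuousStopping.
End SquareMartingale.

(** * Pathwise time integrals *)

Section TimeIntegral.
Context {R : realType}.
Local Notation leb := (@completed_lebesgue_measure R).
Local Notation ctype := (caratheodory_type ((wlength (@idfun R))^*)%mu).
Implicit Types (x y : R -> R) (a b c t : R).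

(** Lebesgue rather than Borel measurability: [ctype] is the line with the Caratheodory
    sigma-algebra, on which the measure is complete. *)
Definition lmeas (D : set R) x : Prop := measurable_fun (D : set ctype) (x : ctype -> R).

Lemma cmeasurable (A : set R) : measurable (A : set (measurableTypeR R)) -> measurable (A : set ctype).
Proof. exact: sub_caratheodory. Qed.

Lemma cmeasurable_itv (i : interval R) : measurable ([set` i] : set ctype).
Proof. by apply: cmeasurable; exact: measurable_itv. Qed.

Lemma lebE (A : set R) : leb A = lebesgue_measure A.
Proof. by []. Qed.

Lemma borel_lmeas (D : set R) x : measurable (D : set (measurableTypeR R)) ->
  measurable_fun (D : set (measurableTypeR R)) x -> lmeas D x.
Proof. by move=> mD mx _ A mA; apply: cmeasurable; exact: mx. Qed.

(** The identity from the Lebesgue to the Borel line is measurable and carries the completed measure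
    to the usual one, so this is a change of variables. It opens Tonelli's theorem to progressive
    processes, which are Borel in time. *)
Lemma integral_cleb (D : set R) (x : R -> \bar R) : measurable (D : set (measurableTypeR R)) ->
  measurable_fun (D : set (measurableTypeR R)) x -> (forall s, D s -> (0 <= x s)%E) ->
  (\int[leb]_(s in D) x s = \int[@lebesgue_measure R]_(s in D) x s)%E.
Proof.
move=> mD mx x0.
have mid : measurable_fun (setT : set ctype) (idfun : ctype -> measurableTypeR R).
  by move=> _ A mA; rewrite setTI; exact: cmeasurable.
have := @ge0_integral_pushforward _ _ _ _ R _ mid leb D x mD mx.
rewrite preimage_id => <-//.
by move=> s; rewrite inE; exact: x0.
Qed.


Definition li a b x : Prop := leb.-integrable `[a, b] (EFin \o x).
Local Notation mI := (cmeasurable_itv (Interval (BLeft _) (BRight _))).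
Local Notation itv a b := ([set` Interval (BLeft a) (BRight b)]).

Lemma itvP a b t : itv a b t <-> a <= t <= b.
Proof. by rewrite /= in_itv. Qed.

Lemma li_lmeas a b x : li a b x -> lmeas (itv a b) x.
Proof. by move=> /integrableP[/measurable_EFinP]. Qed.

Lemma lmeasS a b c d x : a <= c -> d <= b -> lmeas (itv a b) x -> lmeas (itv c d) x.
Proof.
move=> ac db; apply: measurable_funS; first exact: mI.
by move=> t /itvP/andP[ct td]; apply/itvP; rewrite (le_trans ac ct) (le_trans td db).
Qed.

Lemma liS a b c d x : a <= c -> d <= b -> li a b x -> li c d x.
Proof.
move=> ac db; apply: integrableS; [exact: mI|exact: mI|].
by move=> t /itvP/andP[ct td]; apply/itvP; rewrite (le_trans ac ct) (le_trans td db).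
Qed.

Lemma liD a b x y : li a b x -> li a b y -> li a b (fun t => x t + y t).
Proof. by move=> ix iy; exact: (integrableD mI ix iy). Qed.

Lemma liB a b x y : li a b x -> li a b y -> li a b (fun t => x t - y t).
Proof. by move=> ix iy; exact: (integrableB mI ix iy). Qed.

Lemma liZ a b c x : li a b x -> li a b (fun t => c * x t).
Proof. by move=> ix; exact: (integrableZl mI _ ix). Qed.

Lemma li_norm a b x : li a b x -> li a b (fun t => `|x t|).
Proof. by move=> ix; exact: (integrable_norm ix). Qed.

Lemma leb_itv a b : a <= b -> (leb : {measure set ctype -> \bar R}) (itv a b) = (b - a)%:E.
Proof.
move=> ab; rewrite [LHS]lebE lebesgue_measure_itv/= lte_fin.
by move: ab; rewrite le_eqVlt => /predU1P[->|->]; rewrite ?EFinB// ltxx subee.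
Qed.

Lemma li_cst a b c : li a b (fun=> c).
Proof.
apply/integrableP; split; first by apply/measurable_EFinP; exact: measurable_cst.
rewrite /comp integral_cst; last exact: mI.
case: (leP a b) => ab; first by rewrite leb_itv// -EFinM ltry.
by rewrite set_itv_ge ?measure0 ?mule0// bnd_simp -ltNge.
Qed.

Lemma li_le a b x y : lmeas (itv a b) x -> (forall t, a <= t <= b -> `|x t| <= y t) ->
  li a b y -> li a b x.
Proof.
move=> mx xy; apply: le_integrable; first exact: mI.
- exact/measurable_EFinP.
- by move=> t /itvP tab /=; rewrite lee_fin (le_trans (xy _ tab))// ler_norm.
Qed.

Lemma li_fin a b x : lmeas (itv a b) x -> (forall t, a <= t <= b -> 0 <= x t) ->
  (\int[leb]_(s in itv a b) (x s)%:E < +oo)%E -> li a b x.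
Proof.
move=> mx x0 fx; apply/integrableP; split; first exact/measurable_EFinP.
suff -> : (\int[leb]_(s in itv a b) `|(EFin \o x) s| = \int[leb]_(s in itv a b) (x s)%:E)%E by [].
by apply: eq_integral => t; rewrite inE => /itvP tab /=; rewrite ger0_norm// x0.
Qed.

Lemma li_EFin a b x : li a b x ->
  (\int[leb]_(s in itv a b) (x s)%:E = (\int[leb]_(s in itv a b) x s)%:E)%E.
Proof. by move=> ix; rewrite /Rintegral fineK//; exact: (integrable_fin_num mI ix). Qed.

Lemma lint_lt a b c x : li a b x -> (\int[leb]_(s in itv a b) (x s)%:E < c%:E)%E ->
  \int[leb]_(s in itv a b) x s < c.
Proof. by move=> lx; rewrite li_EFin// lte_fin. Qed.

Lemma li_eq a b x y : (forall t, a <= t <= b -> x t = y t) -> li a b x -> li a b y.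
Proof.
move=> xy; apply: eq_integrable; first exact: mI.
by move=> t; rewrite inE => /itvP tab /=; rewrite xy.
Qed.

Lemma lint_eq a b x y : (forall t, a <= t <= b -> x t = y t) ->
  \int[leb]_(s in itv a b) x s = \int[leb]_(s in itv a b) y s.
Proof. by move=> xy; apply: eq_Rintegral => t; rewrite inE => /itvP tab; rewrite xy. Qed.

Lemma lint_le a b x y : li a b x -> li a b y -> (forall t, a <= t <= b -> x t <= y t) ->
  \int[leb]_(s in itv a b) x s <= \int[leb]_(s in itv a b) y s.
Proof.
by move=> ix iy xy; apply: (le_Rintegral mI ix iy) => t /itvP; exact: xy.
Qed.

Lemma lint_cst a b c : a <= b -> \int[leb]_(s in itv a b) c = c * (b - a).
Proof. by move=> ab; rewrite Rintegral_cst; [rewrite leb_itv|exact: mI]. Qed.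

Lemma lint_norm a b x : li a b x ->
  `|\int[leb]_(s in itv a b) x s| <= \int[leb]_(s in itv a b) `|x s|.
Proof. by move=> ix; exact: (le_normr_Rintegral mI ix). Qed.

Lemma lint_set1 a x : \int[leb]_(s in itv a a) x s = 0.
Proof.
have e : leb (itv a a) = 0%E by rewrite leb_itv// subrr.
rewrite /Rintegral null_set_integral; [by []|exact: mI| |exact: e].
rewrite set_itv1; move=> _ B mB; rewrite setIC; case: (pselect (B (x a)%:E)) => h.
  by rewrite setIidr; [rewrite -set_itv1; exact: mI|move=> t ->].
rewrite (_ : _ `&` _ = set0); first exact: measurable0.
by apply/seteqP; split => // t [/= Bt ta]; apply: h; rewrite -ta.
Qed.

Lemma lint_add a b c x : a <= b -> b <= c -> li a c x ->
  \int[leb]_(s in itv a c) x s =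
  \int[leb]_(s in itv a b) x s + \int[leb]_(s in itv b c) x s.
Proof.
move=> ab bc ix.
have e : itv a c = itv a b `|` [set` `]b, c]].
  apply/seteqP; split => t /=; rewrite !in_itv/=.
    by move=> /andP[at_ tc]; case: (leP t b) => tb; [left|right]; rewrite ?at_.
  by move=> [/andP[at_ tb]|/andP[bt tc]]; rewrite ?at_ ?(le_trans tb)// tc (le_trans ab) ?ltW.
have e2 : itv b c = itv b b `|` [set` `]b, c]].
  apply/seteqP; split => t /=; rewrite !in_itv/=.
    move=> /andP[bt tc]; case: (leP t b) => tb; [left|right]; rewrite ?bt//.
  by move=> [/andP[bt tb]|/andP[bt ->]]; rewrite ?bt ?(le_trans tb)// ltW.
have mo : measurable ([set` `]b, c]] : set ctype) by exact: cmeasurable_itv.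
rewrite [in LHS]e Rintegral_setU//; [|exact: mI|by rewrite -e|]; last first.
  apply/disj_set2P; apply/seteqP; split => // t /= []; rewrite !in_itv/= => /andP[_ tb] /andP[].
  by rewrite ltNge tb.
congr (_ + _); rewrite [in RHS]e2 Rintegral_setU//.
- by rewrite lint_set1 add0r.
- exact: mI.
- by rewrite -e2; exact: (liS ab (lexx _) ix).
- apply/disj_set2P; apply/seteqP; split => // t /= []; rewrite !in_itv/= => /andP[_ tb] /andP[].
  by rewrite ltNge tb.
Qed.

(** Absolute continuity of the integral, applied to the function extended by 0 outside [[0, T]]. *)
Lemma li_ucont T x : li 0 T x -> ucont T (fun t => \int[leb]_(s in itv 0 t) x s).
Proof.
move=> ix e e0.
have ix' : leb.-integrable setT (EFin \o (x \_ (itv 0 T))).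
  by rewrite -restrict_EFin; exact: (integrable_mkcond _ mI).1 ix.
have [h [h0 hh]] := integral_normr_continuous ix' e0.
(* Half of [h], because the bound holds for sets of measure strictly below [h]. *)
exists (h / 2); first by rewrite divr_gt0.
have main s t : 0 <= s -> s <= t -> t <= T -> t - s <= h / 2 ->
  `|\int[leb]_(s in itv 0 t) x s - \int[leb]_(u in itv 0 s) x u| <= e.
  move=> s0 st tT d; rewrite (lint_add s0 st); last exact: (liS (lexx _) tT ix).
  rewrite addrC addKr.
  have ist : li s t x by exact: (liS s0 tT ix).
  apply: (le_trans (lint_norm ist)).
  have := hh (itv s t) mI.
  rewrite leb_itv// lte_fin => /(_ (le_lt_trans d _)) => H; apply/ltW.
  have h2 : h / 2 < h by lra.
  have := H h2; congr (_ < _); apply: lint_eq => u /andP[su ut].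
  by rewrite patchE mem_set//= in_itv/= (le_trans s0 su) (le_trans ut tT).
move=> s t /andP[s0 sT] /andP[t0 tT]; case: (leP s t) => st.
  by rewrite ler0_norm ?subr_le0// opprB distrC; exact: main.
have -> : `|s - t| = s - t by rewrite ger0_norm// subr_ge0 ltW.
by move=> d; apply: main => //; exact: ltW.
Qed.

#[local] Instance leb_ae_filter : Filter (nbhs (almost_everywhere leb)).
Proof. exact: ae_filter_ringOfSetsType. Qed.

Lemma ae_lebP (Q : R -> Prop) : {ae @lebesgue_measure R, forall s, Q s} -> {ae leb, forall s, Q s}.
Proof. by move=> [N [mN N0 hN]]; exists N; split => //; exact: cmeasurable. Qed.

(** Completeness of the measure makes the part of the preimage inside the null set measurable,
    whatever it is. *)
Lemma lmeas_ae a b x y : lmeas (itv a b) x -> {ae leb, forall s, a <= s <= b -> x s = y s} ->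
  lmeas (itv a b) y.
Proof.
move=> mx xy _ A mA.
have [N [mN N0 hN]] := xy.
have cl : measure_is_complete leb by exact: completed_lebesgue_measure_is_complete.
have -> : itv a b `&` y @^-1` A = ((itv a b `&` x @^-1` A) `\` N) `|` ((itv a b `&` y @^-1` A) `&` N).
  apply/seteqP; split => s /=.
    move=> [sab As]; case: (pselect (N s)) => Ns; [by right|left; split=> //; split => //].
    suff -> : x s = y s by [].
    by apply: contrapT => h; apply: Ns; apply: hN => /(_ ((itvP _ _ _).1 sab)).
  move=> [[[sab As] Ns]|[]//]; split => //.
  suff <- : x s = y s by [].
  by apply: contrapT => h; apply: Ns; apply: hN => /(_ ((itvP _ _ _).1 sab)).
apply: measurableU.
  by apply: measurableD => //; apply: mx => //; exact: mI.
by apply: cl; exists N; split => // s [].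
Qed.

Lemma lmeas_cvg a b (xn : nat -> R -> R) x : (forall n, lmeas (itv a b) (xn n)) ->
  {ae leb, forall s, a <= s <= b -> xn ^~ s @ \oo --> x s} -> lmeas (itv a b) x.
Proof.
move=> mx cx; have [N [mN N0 hN]] := cx.
have mz : lmeas (itv a b) (x \_ (~` N)).
  apply: (@measurable_fun_cvg _ _ _ _ (fun n => (xn n) \_ (~` N))).
  - move=> n; apply/(measurable_restrict _ _ _).
    + exact: measurableC.
    + exact: mI.
    by apply: measurable_funS (mx n) => //; exact: mI.
  - move=> s sab; rewrite /patch; case: ifPn => [|_]; last exact: cvg_cst.
    rewrite inE => Ns; apply: contrapT => h; apply: Ns; apply: hN => /(_ ((itvP _ _ _).1 sab)).
    exact: h.
apply: (lmeas_ae mz); exists N; split => // s h; apply: contrapT => Ns; apply: h => _.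
by rewrite patchE mem_set.
Qed.

Lemma lint_dct a b (xn : nat -> R -> R) x y : (forall n, lmeas (itv a b) (xn n)) ->
  {ae leb, forall s, a <= s <= b -> xn ^~ s @ \oo --> x s} ->
  {ae leb, forall s, a <= s <= b -> forall n, `|xn n s| <= y s} -> li a b y ->
  li a b x /\ \int[leb]_(s in itv a b) `|xn n s - x s| @[n --> \oo] --> (0 : R).
Proof.
move=> mxn cx hy iy; have mx := lmeas_cvg mxn cx.
have [|||||ix h _] := @dominated_convergence _ _ _ leb (itv a b) mI (fun n => EFin \o xn n) (EFin \o x) (EFin \o y).
- by move=> n; apply/measurable_EFinP; exact: mxn.
- exact/measurable_EFinP.
- apply: filterS cx => s hs /itvP sab; apply: cvg_EFin; last exact: hs.
  by near=> n.
- exact: iy.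
- by apply: filterS hy => s hs n /itvP sab; rewrite lee_fin; exact: hs.
split => //.
have e n : \int[leb]_(s in itv a b) `|xn n s - x s| = fine (\int[leb]_(s in itv a b) `|(xn n s)%:E - (x s)%:E|)%E.
  by [].
under eq_fun do rewrite e.
by apply/fine_cvg; exact: h.
Unshelve. all: by end_near. Qed.

End TimeIntegral.

(** * Progressive processes and their time integrals *)

Section Progressive.
Context {R : realType} {disp : measure_display} {Omega : measurableType disp}.
Variables (P : probability Omega R) (T : R) (F : R -> set (set Omega)).
Hypotheses (hP : measure_is_complete P) (T0 : 0 <= T) (hF : filtration P T F).
Implicit Types (X Y : R -> Omega -> R).
Local Notation leb := (@completed_lebesgue_measure R).
Local Notation progressive := (progressive T F).
Local Notation D t := ([set` `[0, t]] `*` setT : set (measurableTypeR R * g_sigma_algebraType (F t))).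

Lemma measurable_progD t : measurable (D t).
Proof. by apply: measurableX => //; exact: (@measurable_itv R `[0, t]). Qed.

Lemma progressiveD X Y : progressive X -> progressive Y -> progressive (fun t w => X t w + Y t w).
Proof. by move=> pX pY t tT; apply: measurable_funD; [exact: pX|exact: pY]. Qed.

Lemma progressiveM X Y : progressive X -> progressive Y -> progressive (fun t w => X t w * Y t w).
Proof. by move=> pX pY t tT; apply: measurable_funM; [exact: pX|exact: pY]. Qed.

Lemma progressive_comp X (u : R -> R) : measurable_fun setT u -> progressive X ->
  progressive (fun t w => u (X t w)).
Proof. by move=> mu pX t tT; apply: measurableT_comp => //; exact: pX. Qed.

Lemma progressive_cst c : progressive (fun _ _ => c).
Proof. by move=> t tT; exact: measurable_cst. Qed.

Lemma progressiveB X Y : progressive X -> progressive Y -> progressive (fun t w => X t w - Y t w).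
Proof. by move=> pX pY t tT; apply: measurable_funB; [exact: pX|exact: pY]. Qed.

Lemma progressive_sum (I : Type) (r : seq I) (X : I -> R -> Omega -> R) :
  (forall i, progressive (X i)) -> progressive (fun t w => \sum_(i <- r) X i t w).
Proof.
move=> pX; elim: r => [|i r IHr].
  by under eq_fun do under eq_fun do rewrite big_nil; exact: progressive_cst.
rewrite (_ : (fun t w => _) = fun t w => X i t w + \sum_(j <- r) X j t w); first exact: progressiveD.
by apply/funext => t; apply/funext => w; rewrite big_cons.
Qed.

Lemma progressive_norm X : progressive X -> progressive (fun t w => `|X t w|).
Proof. by move=> pX t tT; apply: measurableT_comp => //; exact: pX. Qed.

(* The limit of X n t w wherever it exists; chosen jointly measurable. *)
Definition plim (X : nat -> R -> Omega -> R) t w : R := fine (limn_esup (fun n => (X n t w)%:E)).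

Lemma plimE (X : nat -> R -> Omega -> R) t w l : X ^~ t ^~ w @ \oo --> l -> plim X t w = l.
Proof.
move=> Xl; have h : (fun n => (X n t w)%:E) @ \oo --> l%:E by apply: cvg_EFin => //; near=> n.
rewrite /plim is_cvg_limn_esupE; last by apply/cvg_ex; exists l%:E.
by rewrite (cvg_lim _ h).
Unshelve. all: by end_near. Qed.

Lemma progressive_plim (X : nat -> R -> Omega -> R) : (forall n, progressive (X n)) -> progressive (plim X).
Proof.
move=> pX t tT; rewrite /plim.
apply: (measurableT_comp (f := fine)); first exact: fine_measurable.
pose f n (sw : measurableTypeR R * g_sigma_algebraType (F t)) := (X n sw.1 sw.2)%:E.
by apply: (@measurable_fun_limn_esup _ _ _ _ f) => n; apply/measurable_EFinP; exact: pX.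
Qed.

Lemma progressive_adapted X : progressive X -> adapted T F X.
Proof.
move=> pX t tT; have t0 : 0 <= t by case/andP: tT.
have := pX t tT; rewrite /gmeas => mX.
have -> : X t = (fun sw => X sw.1 sw.2) \o (fun w : g_sigma_algebraType (F t) => (t : measurableTypeR R, w)) by [].
apply: (measurable_comp (F := D t)) => //.
- exact: measurable_progD.
- by move=> _ [w _ <-]; split => //=; rewrite in_itv/= t0 lexx.
- exact: pair1_measurable.
Qed.

Lemma progressive_borel X w : progressive X ->
  measurable_fun ([set` `[0, T]] : set (measurableTypeR R)) (X ^~ w).
Proof.
move=> pX; have TT : 0 <= T <= T by rewrite T0 lexx.
have mX := pX T TT.
have -> : X ^~ w = (fun sw => X sw.1 sw.2) \o (fun s : measurableTypeR R => (s, w : g_sigma_algebraType (F T))) by [].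
apply: (measurable_comp (F := D T)) => //.
- exact: measurable_progD.
- by move=> _ [s sT <-].
- by apply: measurable_funTS; exact: pair2_measurable.
Qed.

Lemma progressive_lmeas X w : progressive X -> lmeas [set` `[0, T]] (X ^~ w).
Proof.
move=> pX; apply: borel_lmeas; first exact: (@measurable_itv R `[0, T]).
exact: progressive_borel.
Qed.

Definition itproc X t w : R := \int[leb]_(s in `[0, t]) X s w.

(** Tonelli's theorem on [[0, t]] times [Omega] with the sigma-algebra [F t], which is what
    progressive measurability provides for; [h] is the integrand extended by 0, so that the theorem
    applies on the whole line. *)
Lemma gmeas_int X t : progressive X -> 0 <= t <= T -> (forall s w, 0 <= s <= T -> 0 <= X s w) ->
  gmeas (F t) (fun w => (\int[leb]_(s in `[0%R, t]) (X s w)%:E)%E).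
Proof.
move=> pX tT X0.
pose h : measurableTypeR R * g_sigma_algebraType (F t) -> \bar R := (fun sw => (X sw.1 sw.2)%:E) \_ (D t).
have mh : measurable_fun setT h.
  apply/(measurable_restrict _ _ _) => //; first exact: measurable_progD.
  by rewrite setTI; apply/measurable_EFinP; exact: pX.
have h0 sw : (0 <= h sw)%E.
  rewrite /h patchE; case: ifPn => // /set_mem[/= ]; rewrite in_itv/= => /andP[s0 st] _.
  by rewrite lee_fin X0// s0 (le_trans st)//; case/andP: tT.
have := measurable_fun_fubini_tonelli_G (m1 := @lebesgue_measure R) h mh h0.
rewrite /gmeas; apply: eq_measurable_fun => w _.
rewrite /fubini_G [RHS]integral_cleb.
- rewrite [RHS]integral_mkcond; apply: eq_integral => s _.
  by rewrite /h !patchE /=; congr (if _ then _ else _); apply/idP/idP; rewrite !inE; [case|split].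
- exact: (@measurable_itv R `[0, t]).
- apply/measurable_EFinP; apply: measurable_funS (progressive_borel w pX).
    exact: (@measurable_itv R `[0, T]).
  by move=> s /=; rewrite !in_itv/= => /andP[-> st]; rewrite (le_trans st)//; case/andP: tT.
- move=> s /=; rewrite in_itv/= => /andP[s0 st]; rewrite lee_fin X0// s0 (le_trans st)//.
  by case/andP: tT.
Qed.

Lemma itproc_acproc X : progressive X -> (forall s w, 0 <= s <= T -> 0 <= X s w) ->
  {ae P, forall w, li 0 T (X ^~ w)} -> acproc P T F (itproc X).
Proof.
move=> pX X0 iX; split.
  move=> t tT; rewrite /itproc /Rintegral.
  by apply: (measurableT_comp (f := fine)); [exact: fine_measurable|exact: gmeas_int].
by apply: filterS iX => w; exact: li_ucont.
Qed.

(** By Tonelli almost every slice of a null set of the product is Lebesgue null, so statements valid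
    [dP x dt]-a.e. become statements about almost all times of almost every path. *)
Lemma ae_PT_slice (Q : Omega -> R -> Prop) : ae_PT P T Q ->
  {ae P, forall w, {ae leb, forall s, 0 <= s <= T -> Q w s}}.
Proof.
move=> [N [mN N0 hN]].
have h0 : {ae P, forall w, (@lebesgue_measure R (xsection N w) = 0)%E}.
  have := N0; rewrite /product_measure1 /=.
  have mx : measurable_fun setT (fun w => @lebesgue_measure R (xsection N w)).
    exact: measurable_fun_xsection.
  have e : (\int[P]_w `|lebesgue_measure (xsection N w)| = \int[P]_w (lebesgue_measure \o xsection N) w)%E.
    by apply: eq_integral => w _; rewrite /= gee0_abs.
  rewrite -e => /(ae_eq_integral_abs _ measurableT mx); apply: filterS => w /(_ I).
  by [].
apply: filterS h0 => w hw; apply: ae_lebP; exists (xsection N w); split => //.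
  exact: measurable_xsection.
by move=> s /= h; apply/xsectionP; apply: hN.
Qed.

End Progressive.

Section TimeIntegral2.
Context {R : realType}.
Local Notation leb := (@completed_lebesgue_measure R).
Local Notation ctype := (caratheodory_type ((wlength (@idfun R))^*)%mu).
Local Notation mI := (cmeasurable_itv (Interval (BLeft _) (BRight _))).
Local Notation itv a b := ([set` Interval (BLeft a) (BRight b)]).
Implicit Types (x y : R -> R) (a b c t : R).

Lemma lint_ae_eq a b x y : li a b x -> {ae leb, forall s, a <= s <= b -> x s = y s} ->
  li a b y /\ \int[leb]_(s in `[a, b]) x s = \int[leb]_(s in `[a, b]) y s.
Proof.
move=> ix xy.
have F : Filter (nbhs (almost_everywhere leb)) by exact: leb_ae_filter.
have [|||iy h] := @lint_dct _ a b (fun=> x) y (fun s => `|x s|) (fun=> li_lmeas ix).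
- by apply: filterS xy => s hs sab; rewrite (hs sab); exact: cvg_cst.
- by apply: aeW => s _ _.
- exact: li_norm.
split=> //; have e : \int[leb]_(s in `[a, b]) `|x s - y s| = 0.
  by apply: (cvg_unique _ _ h) => //; exact: cvg_cst.
have ixy : li a b (fun s => x s - y s) by exact: liB.
have := lint_norm ixy; rewrite e normr_le0 RintegralB//; [|exact: mI].
by rewrite subr_eq0 => /eqP.
Qed.

(** The left end point is left out because simple integrands live on intervals []t_k, t_(k.+1)]];
    one point does not affect the integral. *)
Lemma lint_step a b c x : a <= b -> (forall s, a < s <= b -> x s = c) ->
  li a b x /\ \int[leb]_(s in `[a, b]) x s = c * (b - a).
Proof.
move=> ab xc; rewrite -(lint_cst c ab); have [|ix e] := @lint_ae_eq a b (fun=> c) x (li_cst a b c).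
  exists (itv a a); split => //; first exact: mI.
    by have := leb_itv (lexx a); rewrite subrr.
  move=> s /= h; rewrite in_itv/=; apply: contrapT => sa; apply: h => /andP[as_ sb].
  rewrite xc// sb andbT lt_neqAle as_ andbT; apply/negP => /eqP e; apply: sa.
  by rewrite e lexx.
by split.
Qed.

Lemma li_split a b c x : a <= b -> b <= c -> li a b x -> li b c x -> li a c x.
Proof.
move=> ab bc ix iy.
have e : itv a c = itv a b `|` [set` `]b, c]].
  apply/seteqP; split => t /=; rewrite !in_itv/=.
    by move=> /andP[at_ tc]; case: (leP t b) => tb; [left|right]; rewrite ?at_.
  by move=> [/andP[at_ tb]|/andP[bt tc]]; rewrite ?at_ ?(le_trans tb)// tc (le_trans ab) ?ltW.
have mo : measurable ([set` `]b, c]] : set ctype) by exact: cmeasurable_itv.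
have iy' : leb.-integrable [set` `]b, c]] (EFin \o x).
  apply: integrableS iy => //; first exact: mI.
  by move=> t /=; rewrite !in_itv/= => /andP[/ltW -> ->].
have /integrableP[mx fx] := ix; have /integrableP[my fy] := iy'.
have mxy : measurable_fun (itv a c : set ctype) (EFin \o x).
  by rewrite e; apply/measurable_funU => //; exact: mI.
apply/integrableP; split => //.
rewrite e ge0_integral_setU; [exact: lte_add_pinfty|exact: mI|exact: mo| | |].
- by rewrite -e; apply: measurableT_comp.
- by move=> *; exact: abse_ge0.
- apply/disj_set2P; apply/seteqP; split => // t /= []; rewrite !in_itv/= => /andP[_ tb] /andP[].
  by rewrite ltNge tb.
Qed.

End TimeIntegral2.

(** * Simple integrands *)

Section Simple.
Context {R : realType} {disp : measure_display} {Omega : measurableType disp} {d : nat}.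
Variables (P : probability Omega R) (T : R) (B : R -> Omega -> 'rV[R]_d).
Hypotheses (hP : measure_is_complete P) (T0 : 0 <= T) (hB : brownian_motion P T B).
Local Notation leb := (@completed_lebesgue_measure R).
Let F := brownian_filtration P B.
Let hF : filtration P T F := brownian_filtrationP hB.
Local Notation integ := (integ P).
Local Notation L2 := (L2 P).
Implicit Types (H a : R -> Omega -> 'rV[R]_d) (M : R -> Omega -> R).
Let dB u v i w := B v w 0 i - B u w 0 i.

Lemma enorm_sqr (z : 'rV[R]_d) : enorm z ^+ 2 = \sum_(i < d) z 0 i ^+ 2.
Proof. by rewrite /enorm sqr_sqrtr// sumr_ge0// => i _; exact: sqr_ge0. Qed.

Lemma enorm_coord (z : 'rV[R]_d) i : `|z 0 i| <= enorm z.
Proof.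
rewrite -sqrtr_sqr /enorm ler_wsqrtr// (bigD1 i)//= lerDl sumr_ge0// => j _.
exact: sqr_ge0.
Qed.

(** The square expands into products of increments of two coordinates; [brownian_moment2] keeps the
    diagonal, with mean [v - u] each, and kills the rest. *)
Lemma sq_incr_step u v (a : Omega -> 'rV[R]_d) C : 0 <= u -> u <= v -> v <= T ->
  (forall i, gmeas (F u) (fun w => a w 0 i)) -> (forall i w, `|a w 0 i| <= C) ->
  sq_incr P F u v (fun w => \sum_(i < d) a w 0 i * dB u v i w) (fun w => enorm (a w) ^+ 2 * (v - u)).
Proof.
move=> u0 uv vT ma aC; have uT : 0 <= u <= T by rewrite u0 (le_trans uv).
have vT' : 0 <= v <= T by rewrite vT (le_trans u0).
have mav i : gmeas (F v) (fun w => a w 0 i) by exact: (gmeas_filt hF u0 uv vT).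
have mat i := gmeas_measT hF uT (ma i).
have one : gmeas (F u) (fun=> 1 : R) by exact: measurable_cst.
have iB i j : integ (fun w => dB u v i w * dB u v j w).
  have [h _] := brownian_moment2 hB i j u0 uv vT one (integ_cst P 1).
  by move: h; congr integrable; apply/funext => w; rewrite /= mul1r.
have lB i : L2 (dB u v i).
  split; first exact: (brownian_incr_meas hB i u0 uv vT).
  by have := iB i i; congr integrable; apply/funext => w; rewrite /= expr2.
have e w : enorm (a w) ^+ 2 * (v - u) = \sum_(i < d) (v - u) * a w 0 i ^+ 2.
  by rewrite enorm_sqr mulrC mulr_sumr.
have ia2 i : integ (fun w => (v - u) * a w 0 i ^+ 2).
  by apply: integZ; have [] := L2_bnd P (mat i) (aC i).
split.
- apply: measurable_sum => i; apply: measurable_funM => //.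
  + exact: mav.
  + exact: (brownian_incr_gmeas hB i u0 uv vT).
- by apply: L2_sum => i; apply: L2_bndM (aC i) (lB i).
- under eq_fun do rewrite e.
  apply: measurable_sum => i; apply: measurable_funM; first exact: measurable_cst.
  by apply: measurable_funX; exact: mav.
- by under eq_fun do rewrite e; apply: integ_sum.
split=> [zeta mz lz|A FA].
  rewrite (eq_E P (Y := fun w => \sum_(i < d) (zeta w * a w 0 i) * dB u v i w)); last first.
    by move=> w; rewrite mulr_sumr; apply: eq_bigr => i _; rewrite mulrA.
  have iz i : integ (fun w => zeta w * a w 0 i).
    by apply: L2_mul => //; exact: L2_bnd (aC i).
  have h i := brownian_moment1 hB i u0 uv vT (measurable_funM mz (ma i)) (iz i).
  rewrite Esum; last by move=> i; exact: (h i).1.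
  by rewrite big1// => i _; exact: (h i).2.
have mA := filt_meas hF uT FA.
rewrite (eq_E P (Y := fun w => \sum_(i < d) \sum_(j < d) ((\1_A w * (a w 0 i * a w 0 j)) * dB u v i w * dB u v j w))); last first.
  move=> w; rewrite expr2 mulr_suml mulr_sumr; apply: eq_bigr => i _.
  by rewrite mulr_sumr mulr_sumr; apply: eq_bigr => j _; ring.
have iz i j : integ (fun w => \1_A w * (a w 0 i * a w 0 j)).
  by apply: integ_indicM => //; apply: L2_mul; [exact: L2_bnd (aC i)|exact: L2_bnd (aC j)].
have mz i j : gmeas (F u) (fun w => \1_A w * (a w 0 i * a w 0 j)).
  apply: measurable_funM; first exact: (gmeas_indic uT FA).
  by apply: measurable_funM; exact: ma.
have h i j := brownian_moment2 hB i j u0 uv vT (mz i j) (iz i j).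
rewrite Esum; last by move=> i; apply: integ_sum => j; exact: (h i j).1.
rewrite (eq_E P (Y := fun w => \sum_(i < d) \1_A w * ((v - u) * a w 0 i ^+ 2))); last first.
  by move=> w; rewrite e mulr_sumr.
rewrite Esum; last by move=> i; exact: integ_indicM.
apply: eq_bigr => i _; rewrite Esum; last by move=> j; exact: (h i j).1.
rewrite (bigD1 i)//= big1 ?addr0; last first.
  by move=> j ji; rewrite (h i j).2 eq_sym (negbTE ji) !mul0r.
rewrite (h i i).2 eqxx mul1r -EZ//; apply: eq_E => w; ring.
Qed.

(* H is constant in time, with bounded nonanticipative value, on every interval
   that no point of E cuts, and M is its integral. *)
Definition simp H M : Prop := exists (E : seq R) (C : R),
  [/\ {ae P, forall w, ucont T (M ^~ w)}, (forall w, M 0 w = 0) &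
  forall u v, 0 <= u -> u < v -> v <= T -> (forall e, e \in E -> ~~ (u < e < v)) ->
  exists a : Omega -> 'rV[R]_d, [/\ forall i, gmeas (F u) (fun w => a w 0 i),
    forall i w, `|a w 0 i| <= C, forall s w, u < s <= v -> H s w = a w &
    forall w, M v w - M u w = \sum_(i < d) a w 0 i * dB u v i w]].

(** Cut points are an unordered list, so two integrands are brought to a common refinement by
    concatenating the lists. *)
Lemma simpB H1 M1 H2 M2 : simp H1 M1 -> simp H2 M2 ->
  simp (fun s w => H1 s w - H2 s w) (fun s w => M1 s w - M2 s w).
Proof.
move=> [E1 [C1 [c1 z1 h1]]] [E2 [C2 [c2 z2 h2]]]; exists (E1 ++ E2), (C1 + C2); split.
- by apply: filterS2 c1 c2 => w; exact: ucontB.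
- by move=> w; rewrite z1 z2 subrr.
move=> u v u0 uv vT hE.
have [|a1 [ma1 b1 e1 f1]] := h1 u v u0 uv vT.
  by move=> e eE; apply: hE; rewrite mem_cat eE.
have [|a2 [ma2 b2 e2 f2]] := h2 u v u0 uv vT.
  by move=> e eE; apply: hE; rewrite mem_cat eE orbT.
exists (fun w => a1 w - a2 w); split.
- move=> i; have -> : (fun w => (a1 w - a2 w) 0 i) = (fun w => a1 w 0 i - a2 w 0 i).
    by apply/funext => w; rewrite !mxE.
  by apply: measurable_funB; [exact: ma1|exact: ma2].
- by move=> i w; rewrite !mxE (le_trans (ler_normB _ _))// lerD.
- by move=> s w sv; rewrite e1// e2.
move=> w; rewrite (_ : _ - _ = (M1 v w - M1 u w) - (M2 v w - M2 u w)); last by ring.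
by rewrite f1 f2 -sumrB; apply: eq_bigr => i _; rewrite !mxE; ring.
Qed.

Definition qvar H t w : R := itproc (fun s w => enorm (H s w) ^+ 2) t w.

(** Induction on the number of cut points inside []u, v[]: without any, the integrand is constant in
    time and [sq_incr_step] applies; otherwise the interval is split at one of them and the two
    parts are joined by [sq_incr_glue]. *)
Lemma simp_cut H M : simp H M -> exists C, forall u v, 0 <= u -> u <= v -> v <= T ->
  [/\ forall w, li u v (fun s => enorm (H s w) ^+ 2),
      forall w, 0 <= \int[leb]_(s in `[u, v]) enorm (H s w) ^+ 2 <= C * (v - u) &
      sq_incr P F u v (fun w => M v w - M u w)
        (fun w => \int[leb]_(s in `[u, v]) enorm (H s w) ^+ 2)].
Proof.
move=> [E [C [cM z h]]]; exists (d%:R * C ^+ 2) => u v.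
(* Splitting at [e] strictly lowers the count on each side, since [e] itself is no longer inside. *)
have cnt (p q : pred R) e : e \in E -> q e -> ~~ p e -> (forall x, p x -> q x) ->
    (size [seq x <- E | p x] < size [seq x <- E | q x])%N.
  move=> eE qe pe pq; rewrite !size_filter.
  have := count_predUI p (pred1 e) E; rewrite (_ : count (predI _ _) E = 0%N); last first.
    by apply/eqP; rewrite -leqn0 leqNgt -has_count; apply/hasPn => x _ /=; apply/negP => /andP[px /eqP xe]; rewrite -xe px in pe.
  have : (0 < count (pred1 e) E)%N by rewrite -has_count has_pred1.
  have : (count (predU p (pred1 e)) E <= count q E)%N.
    by apply: sub_count => x /= /orP[/pq//|/eqP ->].
  by rewrite addn0 => h1 h2 h3; apply: leq_trans h1; rewrite h3 -addn1 leq_add2l.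
have [n] := ubnP (size [seq e <- E | u < e < v]); elim: n u v => // n IHn u v szn u0.
move=> /[dup] /(le_trans u0) v0; rewrite le_eqVlt => /predU1P[->|uv] vT.
  split => [w|w|].
  - by apply: (lint_step (c := 0) (lexx v) _).1 => s /andP[vs /(lt_le_trans vs)]; rewrite ltxx.
  - by rewrite lint_set1 subrr mulr0 lexx.
  (* On a degenerate interval the increment is that of the zero coefficient. *)
  rewrite (_ : (fun w => M v w - M v w) = fun w => \sum_(i < d) (0 : 'rV[R]_d) 0 i * dB v v i w); last first.
    by apply/funext => w; rewrite subrr big1// => i _; rewrite mxE mul0r.
  rewrite (_ : (fun w => \int[leb]_(s in `[v, v]) _) = fun w => enorm (0 : 'rV[R]_d) ^+ 2 * (v - v)); last first.
    by apply/funext => w; rewrite lint_set1 subrr mulr0.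
  apply: (@sq_incr_step v v (fun=> 0) 0) => //.
    by move=> i; exact: measurable_cst.
  by move=> i w; rewrite mxE normr0.
have [hE|] := boolP (has (fun e => u < e < v) E); last first.
  move=> /hasPn hE; have [a [ma aC ea fa]] := h u v u0 uv vT hE.
  have st w := @lint_step _ u v (enorm (a w) ^+ 2) (fun s => enorm (H s w) ^+ 2) (ltW uv) (fun s sv => congr1 (fun z => enorm z ^+ 2) (ea s w sv)).
  split => [w|w|]; first exact: (st w).1.
  - have vu : 0 <= v - u by rewrite subr_ge0 ltW.
    rewrite (st w).2 mulr_ge0 ?sqr_ge0//= ler_wpM2r//.
    rewrite enorm_sqr; apply: (@le_trans _ _ (\sum_(i < d) C ^+ 2)).
      apply: ler_sum => i _; rewrite -[_ ^+ 2]real_normK ?num_real// lerXn2r ?nnegrE//.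
      exact: le_trans (aC i w).
    by rewrite sumr_const card_ord mulr_natl.
  rewrite (_ : (fun w => M v w - M u w) = fun w => \sum_(i < d) a w 0 i * dB u v i w); last exact/funext.
  rewrite (_ : (fun w => \int[leb]_(s in `[u, v]) enorm (H s w) ^+ 2) = fun w => enorm (a w) ^+ 2 * (v - u)).
    exact: (sq_incr_step u0 (ltW uv) vT ma aC).
  by apply/funext => w; exact: (st w).2.
move: hE => /hasP[e eE /andP[ue ev]].
have szl : (size [seq x <- E | (u < x < e)%R] < n)%N.
  rewrite ltnS in szn; apply: leq_trans szn; apply: (cnt _ _ e) => //=; rewrite ?ue ?ltxx ?andbF//.
  by move=> x /andP[-> /lt_trans ->].
have szr : (size [seq x <- E | (e < x < v)%R] < n)%N.
  rewrite ltnS in szn; apply: leq_trans szn; apply: (cnt _ _ e) => //=; rewrite ?ue ?ltxx//.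
  by move=> x /andP[/(lt_trans ue) -> ->].
have [l1 b1 s1] := IHn u e szl u0 (ltW ue) (le_trans (ltW ev) vT).
have [l2 b2 s2] := IHn e v szr (le_trans u0 (ltW ue)) (ltW ev) vT.
have l w : li u v (fun s => enorm (H s w) ^+ 2) by apply: li_split (l1 w) (l2 w); exact: ltW.
have q w := lint_add (ltW ue) (ltW ev) (l w).
split; [exact: l|move=> w|].
  rewrite q; have /andP[x1 y1] := b1 w; have /andP[x2 y2] := b2 w; rewrite addr_ge0//=.
  by rewrite (le_trans (lerD y1 y2))// -mulrDr (_ : e - u + (v - e) = v - u)//; ring.
rewrite (_ : (fun w => M v w - M u w) = fun w => (M e w - M u w) + (M v w - M e w)); last first.
  by apply/funext => w; ring.
rewrite (_ : (fun w => \int[leb]_(s in `[u, v]) enorm (H s w) ^+ 2) = fun w =>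
  \int[leb]_(s in `[u, e]) enorm (H s w) ^+ 2 + \int[leb]_(s in `[e, v]) enorm (H s w) ^+ 2); last exact/funext.
by apply: (sq_incr_glue hF u0 (ltW ue) (ltW ev) vT).
Qed.


Lemma simp_sqmart H M : simp H M ->
  [/\ sqmart P T F M (qvar H), acproc P T F M, acproc P T F (qvar H) &
   exists C, forall w s t, 0 <= s -> s <= t -> t <= T -> 0 <= qvar H t w - qvar H s w <= C].
Proof.
move=> hHM; have [C hC] := simp_cut hHM; have [E [C' [cM z _]]] := hHM.
have add w u v : 0 <= u -> u <= v -> v <= T ->
    qvar H v w - qvar H u w = \int[leb]_(s in `[u, v]) enorm (H s w) ^+ 2.
  move=> u0 uv vT; rewrite /qvar /itproc (lint_add u0 uv); first by rewrite addrAC subrr add0r.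
  by have [h _ _] := hC 0 v (lexx 0) (le_trans u0 uv) vT.
have z' w : qvar H 0 w = 0 by rewrite /qvar /itproc lint_set1.
have sM : sqmart P T F M (qvar H).
  move=> u v u0 uv vT; have [_ _] := hC u v u0 uv vT.
  by congr sq_incr; apply/funext => w; rewrite add.
have C0 : 0 <= C * T.
  have [_ h _] := hC 0 T (lexx 0) T0 (lexx T); have /andP[h1 h2] := h point.
  by rewrite (le_trans h1)// -[X in _ <= _ * X]subr0.
split => //.
- split => // t /andP[t0 tT]; have [h _ _ _ _] := sM 0 t (lexx 0) t0 tT.
  by move: h; congr gmeas; apply/funext => w; rewrite z subr0.
- split.
    move=> t /andP[t0 tT]; have [_ _ h _ _] := sM 0 t (lexx 0) t0 tT.
    by move: h; congr gmeas; apply/funext => w; rewrite z' subr0.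
  by apply: aeW => w; apply: li_ucont; have [h _ _] := hC 0 T (lexx 0) T0 (lexx T).
- exists (C * T) => w s t s0 st tT; rewrite add//.
  have [_ h _] := hC s t s0 st tT; have /andP[-> h2] /= := h w.
  apply: (le_trans h2).
  (* The sign of [C] is known only through that of [C * T]; if [T = 0] then [t - s = T], and the
     bound is an equality. *)
  have [T1|T1] := ltP 0 T.
    have : 0 <= C by rewrite -(pmulr_lge0 _ T1).
    nra.
  by rewrite (_ : t - s = T)//; lra.
Qed.

(** The grid points are the cuts: an interval []u, v]] that none of them cuts is, for every [k],
    either inside []t k, t k.+1]] or disjoint from it. The bound [m * C] is the crude one for a sum
    of [m] coefficients. *)
Lemma simple_simp m (t : nat -> R) (a : nat -> Omega -> 'rV[R]_d) :
  simple_integrand T F m t a -> simp (simple_process m t a) (simple_integral B m t a).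
Proof.
move=> [t0 tm tT ha].
have mono i j : (i <= j)%N -> (j <= m)%N -> t i <= t j.
  move=> ij; rewrite -(subnK ij); elim: (j - i)%N => [|k IHk] //=.
  by rewrite addSn => km; apply: (le_trans (IHk (ltnW km))); exact: tm.
have tk k : (k <= m)%N -> 0 <= t k <= T.
  by move=> km; rewrite -t0 -tT !mono.
have [C hC] : exists C, forall k, (k < m)%N -> forall w i, `|a k w 0 i| <= C.
  have h n : exists C, forall k, (k < n)%N -> (k < m)%N -> forall w i, `|a k w 0 i| <= C.
    elim: n => [|n [C hC]]; first by exists 0.
    case: (ltnP n m) => nm; last first.
      exists C => k kn km; apply: hC => //; exact: leq_trans km nm.
    have [_ [C' hC']] := ha _ nm; exists (Num.max C C') => k; rewrite ltnS leq_eqVlt.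
    move=> /predU1P[-> _ w i|kn km w i]; rewrite le_max; last by rewrite hC.
    apply/orP; right; apply: le_trans (hC' w).
    exact: enorm_coord.
  by have [C hC] := h m; exists C => k km; exact: hC.
exists [seq t k | k <- iota 0 m.+1], (m%:R * C); split.
- have [_ _ cB _ _] := hB.
  apply: filterS cB => w cB; have uB i : ucont T (fun s => B s w 0 i).
    apply: within_ucont => s; apply: (@continuous_comp _ _ _ (B ^~ w : subspace [set` `[0, T]] -> _) (fun z : 'rV[R]_d => z 0 i)).
      exact: cB.
    exact: coord_continuous.
  rewrite /simple_integral; apply: (@ucont_eq _ T (fun s => \sum_(k < m) \sum_(i < d)
    a k w 0 i * (B (Num.min s (t k.+1)) w 0 i - B (Num.min s (t k)) w 0 i))).
    by move=> s sT; apply: eq_bigr => k _; apply: eq_bigr => i _; rewrite ![Num.min s _]minC.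
  apply: ucont_sum => k; apply: ucont_sum => i; apply: ucontZ; apply: ucontB.
    by apply: (@ucont_minr _ T (fun s => B s w 0 i)) => //; exact: tk.
  by apply: (@ucont_minr _ T (fun s => B s w 0 i)) => //; apply: tk; exact: ltnW.
- move=> w; rewrite /simple_integral big1// => k _; rewrite big1// => i _.
  have /andP[k0 _] := tk k (ltnW (ltn_ord k)); have /andP[k1 _] := tk k.+1 (ltn_ord k).
  by rewrite !min_r// subrr mulr0.
move=> u v u0 uv vT hE.
have nocut k : (k <= m)%N -> (t k <= u) || (v <= t k).
  move=> km; have := hE (t k); rewrite negb_and -!leNgt; apply.
  by apply/mapP; exists k => //; rewrite mem_iota add0n ltnS.
pose b (k : nat) w : 'rV[R]_d := if (t k <= u) && (v <= t k.+1) then a k w else 0.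
exists (fun w => \sum_(k < m) b k w); split.
- move=> i; rewrite (_ : (fun w => _) = fun w => \sum_(k < m) b k w 0 i); last first.
    by apply/funext => w; rewrite summxE.
  apply: measurable_sum => k; rewrite /b; case E : ((t k <= u) && (v <= t k.+1)); last first.
    by under eq_fun do rewrite mxE; exact: measurable_cst.
  have /andP[k0 _] := tk k (ltnW (ltn_ord k)); have /andP[ku vk] := E.
  apply: (gmeas_filt hF k0 ku); first exact: le_trans (ltW uv) vT.
  by have [h _] := ha k (ltn_ord k); exact: h.
- move=> i w; rewrite summxE; apply: (le_trans (ler_norm_sum _ _ _)).
  apply: (@le_trans _ _ (\sum_(k < m) C)); last by rewrite sumr_const card_ord mulr_natl.
  apply: ler_sum => k _; rewrite /b; case: ifP => _; first exact: hC.
  by rewrite mxE normr0 (le_trans (normr_ge0 _) (hC k (ltn_ord k) w i)).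
- move=> s w /andP[us sv]; apply: eq_bigr => k _; rewrite /b.
  have := nocut k (ltnW (ltn_ord k)); have := nocut k.+1 (ltn_ord k).
  move=> h1 h2; congr (if _ then _ else _); apply/andP/andP => -[h3 h4]; split.
  - by case/orP: h2 => //; lra.
  - by case/orP: h1 => //; lra.
  - lra.
  - lra.
move=> w; rewrite /simple_integral -sumrB.
under eq_bigr do rewrite -sumrB.
rewrite exchange_big /=; apply: eq_bigr => i _; rewrite summxE mulr_suml; apply: eq_bigr => k _.
rewrite /b /dB; have := nocut k (ltnW (ltn_ord k)); have := nocut k.+1 (ltn_ord k).
have := tm k (ltn_ord k).
move=> h0 h1 h2; case: (leP (t k) u) => h3; case: (leP v (t k.+1)) => h4 /=.
- have h5 : t k <= v by lra.
  have h6 : u <= t k.+1 by lra.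
  by rewrite ?(min_r h4) ?(min_r h6) ?(min_l h3) ?(min_l h5); ring.
- have h5 : t k.+1 <= u by case/orP: h1 => //; lra.
  have h6 : t k.+1 <= v by lra.
  have h7 : t k <= v by lra.
  by rewrite mxE ?(min_l h5) ?(min_l h6) ?(min_l h7) ?(min_l h3); ring.
- have h5 : v <= t k by case/orP: h2 => //; lra.
  have h6 : u <= t k.+1 by lra.
  by rewrite mxE ?(min_r h4) ?(min_r h5) ?(min_r h6) ?(min_r (ltW h3)); ring.
- have h5 : v <= t k by case/orP: h2 => //; lra.
  by exfalso; lra.
Qed.

End Simple.

(** * Energy inequality *)

Section ItoPair.
Context {R : realType} {disp : measure_display} {Omega : measurableType disp}.
Variables (P : probability Omega R) (T : R) (F : R -> set (set Omega)).
Hypotheses (hP : measure_is_complete P) (T0 : 0 <= T) (hF : filtration P T F).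
Local Notation integ := (integ P).
Local Notation L2 := (L2 P).
Implicit Types (I Q X : R -> Omega -> R) (rho tau : Omega -> R) (A : set Omega).

(** Fatou's lemma with the integrability of the limit as part of the conclusion; the limit is
    replaced almost everywhere by the lower limit. *)
Lemma E_fatou (f : nat -> Omega -> R) (g : Omega -> R) (b : nat -> R) (c : R) :
  (forall n, integ (f n)) -> measurable_fun setT g -> (forall n w, 0 <= f n w) ->
  (forall w, 0 <= g w) -> {ae P, forall w, f ^~ w @ \oo --> g w} ->
  (forall n, \int[P]_w f n w <= b n) -> b @ \oo --> c ->
  integ g /\ \int[P]_w g w <= c.
Proof.
move=> mf mg f0 g0 fg fb bc.
have h : (\int[P]_w (g w)%:E <= c%:E)%E.
  have e : (\int[P]_w (g w)%:E = \int[P]_w limn_einf (fun n => (f n w)%:E))%E.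
    apply: ae_eq_integral => //.
    - exact/measurable_EFinP.
    - have -> : (fun w => limn_einf (fun n => (f n w)%:E)) = (fun w => (- limn_esup (fun n => (- f n w)%:E))%E).
        by apply/funext => w; rewrite -limn_einfN; congr limn_einf; apply/funext => n /=; rewrite opprK.
      apply: measurableT_comp => //; apply: (@measurable_fun_limn_esup _ _ _ _ (fun n w => (- f n w)%:E)) => n.
      by apply/measurable_EFinP; apply: measurableT_comp => //; exact: integ_meas (mf n).
    - apply: filterS fg => w hw _.
      have h : (fun n => (f n w)%:E) @ \oo --> (g w)%:E by apply: cvg_EFin => //; near=> n.
      by rewrite is_cvg_limn_einfE; [rewrite (cvg_lim _ h)|apply/cvg_ex; exists (g w)%:E].
  rewrite e; apply: (le_trans (fatou _ measurableT _ _)).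
  - by move=> n; apply/measurable_EFinP; exact: integ_meas (mf n).
  - by move=> n w _; rewrite lee_fin.
  have hb : (fun n => (b n)%:E) @ \oo --> c%:E by apply: cvg_EFin => //; near=> n.
  rewrite limn_einf_lim -(cvg_lim _ hb)//; apply: lee_lim.
  - exact: is_cvg_einfs.
  - by apply/cvg_ex; exists c%:E.
  apply: nearW => n; apply: (@le_trans _ _ (\int[P]_w (f n w)%:E)%E).
    by apply: ereal_inf_lbound; exists n => //=.
  by rewrite EFin_E// lee_fin; exact: fb.
have ig : integ g.
  apply/integrableP; split; first exact/measurable_EFinP.
  rewrite (_ : (\int[P]_x `|(EFin \o g) x| = \int[P]_w (g w)%:E)%E); last first.
    by apply: eq_integral => w _; rewrite /= ger0_norm.
  exact: le_lt_trans h (ltry _).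
by split => //; rewrite -lee_fin -EFin_E.
Unshelve. all: by end_near. Qed.

Lemma hitting_eqT (U : nat -> R -> Omega -> R) w :
  (forall i q, 0 <= q <= T -> U i q w <= 0) -> hitting T U w = T.
Proof.
move=> h; apply/eqP; rewrite eq_le; have /andP[_ ->] := hitting_bnd T0 U w.
apply: lb_le_inf; first by case: (hitset_has_inf T0 U w).
move=> q [qT [->//|[r [qr [i]]]]]; by rewrite ltNge h.
Qed.

(* I is a local martingale with bracket Q, presented as a uniform limit of square
   integrable ones. *)
Definition itopair I Q : Prop := [/\ acproc P T F I, acproc P T F Q &
  exists M Qs : nat -> R -> Omega -> R,
  (forall j, [/\ sqmart P T F (M j) (Qs j), acproc P T F (M j), acproc P T F (Qs j),
      forall w, M j 0 w = 0 /\ Qs j 0 w = 0 &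
      exists C, forall w s t, 0 <= s -> s <= t -> t <= T -> 0 <= Qs j t w - Qs j s w <= C]) /\
  {ae P, forall w, forall e : R, 0 < e -> exists N : nat, forall j, (N <= j)%N ->
    forall t, 0 <= t <= T -> `|M j t w - I t w| <= e /\ `|Qs j t w - Q t w| <= e}].

Lemma itopair0 I Q : itopair I Q -> {ae P, forall w, I 0 w = 0 /\ Q 0 w = 0}.
Proof.
move=> [_ _ [M [Qs [hM]]]]; apply: filterS => w h.
have T00 : 0 <= (0 : R) <= T by rewrite lexx.
have key e : 0 < e -> `|I 0 w| <= e /\ `|Q 0 w| <= e.
  move=> /h[N /(_ N (leqnn N) 0 T00)]; have [_ _ _ /(_ w)[-> ->] _] := hM N.
  by rewrite !sub0r !normrN.
by split; apply/eqP; rewrite -normr_le0; apply/ler_addgt0Pl => e /key[]; rewrite addr0.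
Qed.

(** Positive as soon as an approximant is more than 1 away from [I] (index 0) or from [Q] (any other
    index). *)
Let dev (M I Q' Q : R -> Omega -> R) (i : nat) (t : R) (w : Omega) : R :=
  if i is 0%N then `|M t w - I t w| - 1 else `|Q' t w - Q t w| - 1.

(** Stopping also when the [j]-th approximant leaves the unit tube around the limits bounds its
    increments on [A] by [c + 2], so [continuous_stop] applies to it. On almost every path this
    extra stopping eventually never happens, and bounded convergence gives the identities for [I]
    and [Q]. *)
Lemma ito_stop I Q rho (u v c : R) A : itopair I Q -> optional T F rho ->
  0 <= u -> u <= v -> v <= T -> F u A -> 0 <= c ->
  (forall w, A w -> forall s, u <= s <= v ->
    `|stopped I rho s w - stopped I rho u w| <= c /\
    `|stopped Q rho s w - stopped Q rho u w| <= c) ->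
  (forall (zeta : Omega -> R) (k : R), gmeas (F u) zeta -> (forall w, `|zeta w| <= k) ->
    \int[P]_w (\1_A w * zeta w * (stopped I rho v w - stopped I rho u w)) = 0) /\
  \int[P]_w (\1_A w * (stopped I rho v w - stopped I rho u w) ^+ 2) =
  \int[P]_w (\1_A w * (stopped Q rho v w - stopped Q rho u w)).
Proof.
move=> hIQ hrho u0 uv vT FA c0 hb.
have [aI aQ [M [Qs [hM cM]]]] := hIQ.
have uT' : 0 <= u <= T by rewrite u0 (le_trans uv).
have vT' : 0 <= v <= T by rewrite vT (le_trans u0).
have mA := filt_meas hF uT' FA.
pose U j := dev (M j) I (Qs j) Q.
pose rj j w := Num.min (rho w) (hitting T (U j) w).
have aU j i : adapted T F (U j i).
  move=> t tT; have [_ [aM _] [aQj _] _ _] := hM j.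
  have nm (X Y : R -> Omega -> R) : adapted T F X -> adapted T F Y ->
      gmeas (F t) (fun w => `|X t w - Y t w| - 1).
    move=> aX aY; apply: measurable_funB => //; apply: measurableT_comp => //.
    by apply: measurable_funB; [exact: aX|exact: aY].
  by case: i => [|i]; apply: nm => //; [case: aI|case: aQ].
have hrj j : optional T F (rj j) by apply: (optional_min hF hrho); apply: (hitting_optional T0 hF) => i; exact: aU.
have aU0 : {ae P, forall w, forall j i, ucont T (U j i ^~ w) /\ U j i 0 w <= 0}.
  apply/ae_foralln => j.
  have [_ [_ cMj] [_ cQj] z _] := hM j; case: aI => _ cI; case: aQ => _ cQ.
  apply: filterS2 (filterI cMj cQj) (filterI (filterI cI cQ) (itopair0 hIQ)) => w [h1 h2] [[h3 h4] [h5 h6]] [|i] /=; have [z1 z2] := z w; split.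
  - by apply: ucontB; [apply: ucont_norm; exact: ucontB|exact: ucont_cst].
  - by rewrite /U /dev z1 h5 subrr normr0 sub0r oppr_le0.
  - by apply: ucontB; [apply: ucont_norm; exact: ucontB|exact: ucont_cst].
  - by rewrite /U /dev z2 h6 subrr normr0 sub0r oppr_le0.
have r0 w : 0 <= rho w <= T by case: hrho.
(* up to rj the approximants are within 1 of the limits *)
have bnd : {ae P, forall w, A w -> forall j,
    `|stopped (M j) (rj j) v w - stopped (M j) (rj j) u w| <= c + 2 /\
    `|stopped (Qs j) (rj j) v w - stopped (Qs j) (rj j) u w| <= c + 2}.
  apply: filterS aU0 => w hw Aw j.
  have /andP[r1 r2] := r0 w.
  have /andP[k1 k2] := hitting_bnd T0 (U j) w.
  have near_ s : 0 <= s -> s <= hitting T (U j) w ->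
      `|M j s w - I s w| <= 1 /\ `|Qs j s w - Q s w| <= 1.
    move=> s0 sh; have [c1 d1] := hw j 0%N; have [c2 d2] := hw j 1%N.
    have := hitting_before T0 c1 s0 sh d1; have := hitting_before T0 c2 s0 sh d2.
    by rewrite /U /dev !subr_le0.
  rewrite /stopped /rj; set h := hitting _ _ _.
  have ms : [/\ 0 <= Num.min v (Num.min (rho w) h) , Num.min v (Num.min (rho w) h) <= h,
             0 <= Num.min u (Num.min (rho w) h) & Num.min u (Num.min (rho w) h) <= h].
    by rewrite !le_min !ge_min !lexx ?orbT (le_trans u0 uv) r1 k1 u0.
  have [m1 m2 m3 m4] := ms; have [n1 n2] := near_ _ m1 m2; have [n3 n4] := near_ _ m3 m4.
  have [i1 i2] : `|I (Num.min v (Num.min (rho w) h)) w - I (Num.min u (Num.min (rho w) h)) w| <= c /\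
       `|Q (Num.min v (Num.min (rho w) h)) w - Q (Num.min u (Num.min (rho w) h)) w| <= c.
    case: (leP u h) => uh; last first.
      have e x : u <= x -> Num.min x (Num.min (rho w) h) = Num.min (rho w) h.
        by move=> ux; rewrite min_r// ge_min; apply/orP; right; lra.
      by rewrite !e// !subrr !normr0.
    have e1 : Num.min u (Num.min (rho w) h) = Num.min u (rho w).
      by rewrite minCA [Num.min u h]min_l// minC.
    have e2 : Num.min v (Num.min (rho w) h) = Num.min (Num.min v h) (rho w).
      by rewrite minCA minC.
    rewrite e1 e2; apply: (hb w Aw); by rewrite le_min uv uh ge_min lexx.
  have tri (a b a' b' : R) : `|a - a'| <= 1 -> `|b - b'| <= 1 -> `|a' - b'| <= c -> `|a - b| <= c + 2.
    by rewrite !ler_norml; lra.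
  by split; [exact: tri n1 n3 i1|exact: tri n2 n4 i2].
have cv : {ae P, forall w, \forall j \near \oo, rj j w = rho w}.
  apply: filterS cM => w /(_ 1 ltr01)[N hN]; exists N => // j /= Nj.
  rewrite /rj hitting_eqT; first by rewrite min_l//; case/andP: (r0 w).
  by move=> [|i] q qT; have [x1 x2] := hN j Nj q qT; rewrite /U /dev subr_le0.
have lim (X : R -> Omega -> R) (Xn : nat -> R -> Omega -> R) :
    {ae P, forall w, forall e : R, 0 < e -> exists N : nat, forall j, (N <= j)%N ->
      forall t, 0 <= t <= T -> `|Xn j t w - X t w| <= e} ->
    {ae P, forall w, (fun j => stopped (Xn j) (rj j) v w - stopped (Xn j) (rj j) u w) @ \oo -->
      (stopped X rho v w - stopped X rho u w)}.
  apply: filterS2 cv => w cv; move=> h.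
  have one s : 0 <= s <= T -> (fun j => stopped (Xn j) (rj j) s w) @ \oo --> stopped X rho s w.
    move=> /andP[s0 sT]; apply/cvgrPdist_le => e e0; have [N hN] := h e e0.
    near=> j; rewrite distrC /stopped (_ : rj j w = rho w); last by near: j.
    apply: hN; first by near: j; exists N.
    have /andP[r1 r2] := r0 w.
    by rewrite le_min s0 r1 ge_min sT.
  by apply: cvgB; exact: one.
have cI : {ae P, forall w, (fun j => stopped (M j) (rj j) v w - stopped (M j) (rj j) u w) @ \oo -->
    (stopped I rho v w - stopped I rho u w)}.
  apply: lim; apply: filterS cM => w h e /h[N hN]; exists N => j Nj t tT.
  by case: (hN j Nj t tT).
have cQ : {ae P, forall w, (fun j => stopped (Qs j) (rj j) v w - stopped (Qs j) (rj j) u w) @ \oo -->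
    (stopped Q rho v w - stopped Q rho u w)}.
  apply: lim; apply: filterS cM => w h e /h[N hN]; exists N => j Nj t tT.
  by case: (hN j Nj t tT).
have ms (X : R -> Omega -> R) r t : acproc P T F X -> optional T F r -> 0 <= t <= T ->
    measurable_fun setT (stopped X r t).
  by move=> aX hr tT; have [h _] := acproc_stopped hP hF hr aX; exact: (gmeas_measT hF tT (h t tT)).
have mdI : measurable_fun setT (fun w => stopped I rho v w - stopped I rho u w).
  by apply: measurable_funB; exact: ms.
have mdQ : measurable_fun setT (fun w => stopped Q rho v w - stopped Q rho u w).
  by apply: measurable_funB; exact: ms.
have mdM j : measurable_fun setT (fun w => stopped (M j) (rj j) v w - stopped (M j) (rj j) u w).
  by have [_ aM _ _ _] := hM j; apply: measurable_funB; exact: ms.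
have mdQs j : measurable_fun setT (fun w => stopped (Qs j) (rj j) v w - stopped (Qs j) (rj j) u w).
  by have [_ _ aM _ _] := hM j; apply: measurable_funB; exact: ms.
have c2 : 0 <= c + 2 by rewrite addr_ge0.
have step j : (forall (zeta : Omega -> R) (k : R), gmeas (F u) zeta -> (forall w, `|zeta w| <= k) ->
    \int[P]_w (\1_A w * zeta w * (stopped (M j) (rj j) v w - stopped (M j) (rj j) u w)) = 0) /\
  \int[P]_w (\1_A w * (stopped (M j) (rj j) v w - stopped (M j) (rj j) u w) ^+ 2) =
  \int[P]_w (\1_A w * (stopped (Qs j) (rj j) v w - stopped (Qs j) (rj j) u w)).
  have [sM aM aQs _ [C hC]] := hM j.
  apply: (continuous_stop hP hF sM (hrj j) aM aQs hC u0 uv vT FA c2).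
  by apply: filterS bnd => w h Aw; exact: (h Aw j).1.
have A01 w : `|\1_A w : R| <= 1 by exact: norm_indic_le1.
split.
  move=> zeta k mz zk; have mz' := gmeas_measT hF uT' mz.
  have k0 : 0 <= k by exact: (le_trans (normr_ge0 _) (zk point)).
  have : \int[P]_w (\1_A w * zeta w * (stopped (M j) (rj j) v w - stopped (M j) (rj j) u w)) @[j --> \oo]
     --> \int[P]_w (\1_A w * zeta w * (stopped I rho v w - stopped I rho u w)).
    apply: (@E_dct _ _ _ P _ _ (fun=> k * (c + 2))) => //.
    - by move=> j; apply: measurable_funM => //; exact: measurable_funM.
    - by apply: measurable_funM => //; exact: measurable_funM.
    - by apply: filterS cI => w h; exact: cvgMr.
    - apply: filterS bnd => w h j; case: (pselect (A w)) => [Aw|nA]; last first.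
        by rewrite indicE memNset// !mul0r normr0 mulr_ge0.
      rewrite indicE mem_set// mul1r normrM ler_pM//; exact: (h Aw j).1.
    - exact: integ_cst.
  have s1 j := (step j).1 zeta k mz zk.
  under eq_fun do rewrite s1.
  by move=> h; apply/esym; apply: (cvg_unique _ (cvg_cst _) h).
have l1 : \int[P]_w (\1_A w * (stopped (M j) (rj j) v w - stopped (M j) (rj j) u w) ^+ 2) @[j --> \oo]
   --> \int[P]_w (\1_A w * (stopped I rho v w - stopped I rho u w) ^+ 2).
  apply: (@E_dct _ _ _ P _ _ (fun=> (c + 2) ^+ 2)) => //.
  - by move=> j; apply: measurable_funM => //; exact: measurable_funX.
  - by apply: measurable_funM => //; exact: measurable_funX.
  - by apply: filterS cI => w h; apply: cvgMr; under eq_fun do rewrite expr2; rewrite expr2; exact: cvgM.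
  - apply: filterS bnd => w h j; case: (pselect (A w)) => [Aw|nA]; last first.
      by rewrite indicE memNset// !mul0r normr0 sqr_ge0.
    rewrite indicE mem_set// mul1r normrX lerXn2r ?nnegrE//; exact: (h Aw j).1.
  - exact: integ_cst.
have l2 : \int[P]_w (\1_A w * (stopped (Qs j) (rj j) v w - stopped (Qs j) (rj j) u w)) @[j --> \oo]
   --> \int[P]_w (\1_A w * (stopped Q rho v w - stopped Q rho u w)).
  apply: (@E_dct _ _ _ P _ _ (fun=> (c + 2))) => //.
  - by move=> j; apply: measurable_funM.
  - by apply: measurable_funM.
  - by apply: filterS cQ => w h; exact: cvgMr.
  - apply: filterS bnd => w h j; case: (pselect (A w)) => [Aw|nA]; last first.
      by rewrite indicE memNset// !mul0r normr0.
    rewrite indicE mem_set// mul1r; exact: (h Aw j).2.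
  - exact: integ_cst.
have s2 j := (step j).2.
move: l1; under eq_fun do rewrite s2.
by move=> l1; exact: (cvg_unique _ l1 l2).
Unshelve. all: by end_near. Qed.

End ItoPair.

(** * Squares along partitions; Lenglart's inequality *)

Section Energy.
Context {R : realType} {disp : measure_display} {Omega : measurableType disp}.
Variables (P : probability Omega R) (T : R) (F : R -> set (set Omega)).
Hypotheses (hP : measure_is_complete P) (T0 : 0 <= T) (hF : filtration P T F).
Local Notation integ := (integ P).
Local Notation L2 := (L2 P).
Implicit Types (I Q X : R -> Omega -> R) (rho tau : Omega -> R) (A : set Omega).

Section Bounded.
Variables (I Q X Lam J : R -> Omega -> R) (rho : Omega -> R) (t C N : R) (A : set Omega).
Hypotheses (hIQ : itopair P T F I Q) (hrho : optional T F rho) (tT : 0 <= t <= T) (FA : F t A)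
  (C0 : 0 <= C) (N0 : 0 <= N) (aX : acproc P T F X) (aJ : acproc P T F J).
Hypothesis XC : forall w, A w -> forall s, 0 <= s <= rho w -> `|X s w| <= C.
Hypothesis bN : forall w, A w -> forall s, 0 <= s <= rho w ->
  [/\ 0 <= Lam s w <= N, 0 <= Q s w <= N & 0 <= J s w <= N].
Hypothesis cLam : forall w, A w -> ucont T (Lam ^~ w).
Hypothesis hD : forall w, A w -> forall r s, 0 <= r -> r <= s -> s <= rho w ->
  `|X r w - X s w + (I s w - I r w)| <= Lam s w - Lam r w.
Hypothesis hJ : forall w, A w -> forall e : R, 0 < e -> exists2 h : R, 0 < h & forall r s,
  0 <= r -> r <= s -> s <= rho w -> s - r <= h ->
  X s w * (X r w - X s w + (I s w - I r w)) <= J s w - J r w + e * (Lam s w - Lam r w).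

Let r0 w : 0 <= rho w <= T. Proof. by case: hrho. Qed.
Let r n i : R := t + (T - t) * (i%:R / n.+1%:R).

Let rnd n i j : (i <= j)%N -> r n i <= r n j.
Proof.
move=> ij; have /andP[_ tT'] := tT.
by rewrite lerD2l ler_wpM2l ?subr_ge0// ler_wpM2r ?invr_ge0// ler_nat.
Qed.

Let rt n i : t <= r n i.
Proof. by rewrite (_ : t = r n 0%N); [exact: rnd|rewrite /r mul0r mulr0 addr0]. Qed.

Let rNE n : r n n.+1 = T.
Proof. by rewrite /r divff ?pnatr_eq0// mulr1 addrC subrK. Qed.

Let rT n i : (i <= n.+1)%N -> 0 <= r n i <= T.
Proof. by move=> ni; case/andP: tT => t0 _; rewrite (le_trans t0 (rt n i)) -(rNE n) rnd. Qed.

Let x n i w := stopped X rho (r n i) w.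
Let dI n i w := stopped I rho (r n i.+1) w - stopped I rho (r n i) w.
Let dQ n i w := stopped Q rho (r n i.+1) w - stopped Q rho (r n i) w.
(** The part of finite variation. From [x_i + dI = x_(i+1) + dD] follows [x_i^2 + 2 x_i dI + dI^2 =
    x_(i+1)^2 + 2 x_(i+1) dD + dD^2]. The last two terms, restricted to [A], form [e]; the right end
    point is the one at which [hJ] evaluates [X]. *)
Let dD n i w := x n i w - x n i.+1 w + dI n i w.
Let e n i w := \1_A w * (2 * x n i.+1 w * dD n i w + dD n i w ^+ 2).

Let sr n i w : (i <= n.+1)%N -> 0 <= Num.min (r n i) (rho w) <= rho w.
Proof. by move=> ni; have /andP[h _] := rT ni; have /andP[h' _] := r0 w; rewrite le_min h h' ge_min lexx orbT. Qed.

Let srm n i w : Num.min (r n i) (rho w) <= Num.min (r n i.+1) (rho w).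
Proof.
have h := rnd n (leqnSn i); rewrite le_min ge_min h /=; rewrite ge_min lexx orbT//.
Qed.

Let mA : measurable A. Proof. exact: (filt_meas hF tT FA). Qed.

Let ms Y s : acproc P T F Y -> 0 <= s <= T -> gmeas (F s) (stopped Y rho s).
Proof. by move=> aY sT; have [h _] := acproc_stopped hP hF hrho aY; exact: h. Qed.

Let msT Y s : acproc P T F Y -> 0 <= s <= T -> measurable_fun setT (stopped Y rho s).
Proof. by move=> aY sT; exact: (gmeas_measT hF sT (ms aY sT)). Qed.

Let xC n i w : (i <= n.+1)%N -> `|\1_A w * x n i w| <= C.
Proof.
move=> ni; case: (pselect (A w)) => [Aw|nA]; last by rewrite indicE memNset// mul0r normr0.
by rewrite indicE mem_set// mul1r; apply: XC => //; exact: sr.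
Qed.

Let dDle n i w : (i <= n)%N -> A w ->
  `|dD n i w| <= stopped Lam rho (r n i.+1) w - stopped Lam rho (r n i) w.
Proof.
move=> ni Aw; have /andP[h1 _] := sr w (leqW ni).
have /andP[_ h2] := @sr n i.+1 w ni.
exact: (hD Aw h1 (srm n i w) h2).
Qed.

Let dDN n i w : (i <= n)%N -> A w -> `|dD n i w| <= N.
Proof.
move=> ni Aw; apply: (le_trans (dDle ni Aw)).
have [/andP[h1 _] _ _] := bN Aw (sr w (leqW ni)).
have [/andP[_ h2] _ _] := bN Aw (@sr n i.+1 w ni).
by rewrite /stopped; lra.
Qed.

Let dIN n i w : (i <= n)%N -> A w -> forall s, r n i <= s <= r n i.+1 ->
  `|stopped I rho s w - stopped I rho (r n i) w| <= 2 * C + N /\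
  `|stopped Q rho s w - stopped Q rho (r n i) w| <= 2 * C + N.
Proof.
move=> ni Aw s /andP[s1 s2]; have i1 := sr w (leqW ni).
have /andP[q1 q2] := r0 w.
have i2 : 0 <= Num.min s (rho w) <= rho w.
  have /andP[p1 _] := rT (leqW ni).
  by rewrite le_min (le_trans p1 s1) q1 ge_min lexx orbT.
have i3 : Num.min (r n i) (rho w) <= Num.min s (rho w).
  by rewrite le_min ge_min s1 /= ge_min lexx orbT.
have h1 := XC Aw i1; have h2 := XC Aw i2.
have [l1 k1 _] := bN Aw i1; have [l2 k2 _] := bN Aw i2.
have /andP[i10 _] := i1; have /andP[_ i21] := i2.
have h3 := hD Aw i10 i3 i21.
rewrite /stopped; move: h1 h2 h3 l1 k1 l2 k2; set a := I _ w; set b := I _ w.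
set c := X _ w; set d := X _ w; set m := Q _ w; set q := Q _ w.
rewrite !ler_norml => /andP[? ?] /andP[? ?] /andP[? ?] /andP[? ?] /andP[? ?] /andP[? ?] /andP[? ?].
have := C0; have := N0; lra.
Qed.

Let mdI n i : (i <= n)%N -> measurable_fun setT (dI n i).
Proof.
case: hIQ => aI _ _ ni; apply: measurable_funB; apply: msT => //; first exact: rT.
exact: rT (leqW ni).
Qed.

Let mdD n i : (i <= n)%N -> measurable_fun setT (dD n i).
Proof.
move=> ni; apply: measurable_funD; last exact: mdI.
by apply: measurable_funB; apply: msT => //; [exact: rT (leqW ni)|exact: rT].
Qed.

Let quad (a b : R) : `|a| <= C -> `|b| <= N -> `|2 * a * b + b ^+ 2| <= (2 * C + N) * `|b|.
Proof.
move=> ha hb; rewrite expr2 -mulrDl normrM ler_wpM2r//.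
by move: ha hb; rewrite !ler_norml => /andP[? ?] /andP[? ?]; apply/andP; split; lra.
Qed.

Let eN n i w : (i <= n)%N -> `|e n i w| <= (2 * C + N) * N.
Proof.
move=> ni; rewrite /e; case: (pselect (A w)) => [Aw|nA]; last first.
  by rewrite indicE memNset// mul0r normr0 mulr_ge0// addr_ge0// mulr_ge0.
rewrite indicE mem_set// mul1r; have h1 := dDN ni Aw; have h2 := XC Aw (@sr n i.+1 w ni).
apply: (le_trans (quad h2 h1)); rewrite ler_wpM2l//.
by rewrite addr_ge0// mulr_ge0.
Qed.

Let ie n i : (i <= n)%N -> integ (e n i).
Proof.
move=> ni; apply: (@integ_bnd _ _ _ P ((2 * C + N) * N)); last by move=> w; exact: eN.
apply: measurable_funM => //; apply: measurable_funD; last by apply: measurable_funX; exact: mdD.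
apply: measurable_funM; last exact: mdD.
by apply: measurable_funM => //; apply: msT => //; exact: rT.
Qed.

Let ix n i : (i <= n.+1)%N -> integ (fun w => \1_A w * x n i w ^+ 2).
Proof.
move=> ni; apply: (@integ_bnd _ _ _ P (C ^+ 2)) => [|w].
  by apply: measurable_funM => //; apply: measurable_funX; apply: msT => //; exact: rT.
have := xC w ni; case: (pselect (A w)) => [Aw|nA]; last by rewrite !indicE memNset// !mul0r normr0 sqr_ge0.
by rewrite !indicE mem_set// !mul1r normrX => h; rewrite lerXn2r// nnegrE.
Qed.

Let iQ (s s' : R) : 0 <= s <= T -> 0 <= s' <= T -> integ (fun w => \1_A w * (stopped Q rho s w - stopped Q rho s' w)).
Proof.
case: hIQ => _ aQ _ sT s'T; apply: (@integ_bnd _ _ _ P N) => [|w].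
  by apply: measurable_funM => //; apply: measurable_funB; exact: msT.
case: (pselect (A w)) => [Aw|nA]; last by rewrite !indicE memNset// !mul0r normr0.
have h (u : R) : 0 <= u <= T -> 0 <= Q (Num.min u (rho w)) w <= N.
  move=> /andP[u0 _]; have [|_ + _] := bN Aw (s := Num.min u (rho w)); last by [].
  by have /andP[h _] := r0 w; rewrite le_min u0 h ge_min lexx orbT.
have /andP[? ?] := h _ sT; have /andP[? ?] := h _ s'T.
by rewrite indicE mem_set// mul1r ler_norml /stopped; apply/andP; split; lra.
Qed.

(** The cross term [x_i dI] has mean 0 and [dI^2] has the mean of [dQ], by [ito_stop] between two
    grid times. *)
Let step n i : (i <= n)%N ->
  \int[P]_w (\1_A w * x n i w ^+ 2) + \int[P]_w (\1_A w * dQ n i w) =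
  \int[P]_w (\1_A w * x n i.+1 w ^+ 2) + \int[P]_w e n i w.
Proof.
move=> ni; have iT := rT (leqW ni); have jT := @rT n i.+1 ni.
have /andP[i0 _] := iT; have /andP[_ j1] := jT.
have FiA : F (r n i) A.
  by case/andP: tT => t0 _; apply: (filtration_mono hF t0 (rt n i)) => //; case/andP: iT.
have c0 : 0 <= 2 * C + N by rewrite addr_ge0// mulr_ge0.
have [h1 h2] := ito_stop hP T0 hF hIQ hrho i0 (rnd n (leqnSn i)) j1 FiA c0 (fun w Aw => dIN ni Aw).
rewrite -h2.
have mz : gmeas (F (r n i)) (fun w => \1_A w * x n i w).
  by apply: measurable_funM; [exact: (gmeas_indic iT FiA)|exact: ms].
have z0 := h1 _ C mz (fun w => xC w (leqW ni)).
have bnd w : `|\1_A w * dI n i w| <= 2 * C + N.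
  case: (pselect (A w)) => [Aw|nA]; last by rewrite !indicE memNset// !mul0r normr0.
  rewrite indicE mem_set// mul1r; apply: (dIN ni Aw _).1.
  by rewrite lexx rnd.
have mAI : measurable_fun setT (fun w => \1_A w * dI n i w) by apply: measurable_funM => //; exact: mdI.
have lI : L2 (fun w => \1_A w * dI n i w) by exact: L2_bnd bnd.
have lx : L2 (fun w => \1_A w * x n i w).
  by apply: L2_bnd (fun w => xC w (leqW ni)); exact: (gmeas_measT hF iT mz).
have i1 : integ (fun w => \1_A w * (\1_A w * x n i w) * dI n i w).
  rewrite (_ : (fun w => _) = fun w => (\1_A w * x n i w) * (\1_A w * dI n i w)); first exact: L2_mul.
  by apply/funext => w; ring.
have i2 : integ (fun w => \1_A w * dI n i w ^+ 2).
  rewrite (_ : (fun w => _) = fun w => (\1_A w * dI n i w) ^+ 2); first by case: lI.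
  by apply/funext => w; rewrite exprMn [\1_A w ^+ 2](_ : _ = \1_A w)// indicE; case: (w \in A); rewrite ?expr1n// expr0n.
transitivity (\int[P]_w (\1_A w * x n i w ^+ 2 + (\1_A w * dI n i w ^+ 2 + 2 * (\1_A w * (\1_A w * x n i w) * dI n i w)))).
  rewrite ED; [|exact: ix (leqW ni)|by apply: integD => //; exact: integZ].
  rewrite ED//; last exact: integZ.
  by rewrite EZ// z0 mulr0 addr0.
rewrite -ED; last 2 first.
- exact: ix.
- exact: ie.
apply: eq_E => w; rewrite /e /dD.
have -> : \1_A w * (\1_A w * x n i w) = \1_A w * x n i w.
  by rewrite mulrA indicE; case: (w \in A); rewrite ?mul1r// !mul0r.
by rewrite /dI; ring.
Qed.

Let total n k : (k <= n.+1)%N ->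
  \int[P]_w (\1_A w * x n 0 w ^+ 2) + \int[P]_w (\1_A w * (stopped Q rho (r n k) w - stopped Q rho (r n 0) w)) =
  \int[P]_w (\1_A w * x n k w ^+ 2) + \int[P]_w (\sum_(i < k) e n i w).
Proof.
elim: k => [_|k IHk kn].
  rewrite [X in _ + X = _](eq_E P (Y := fun=> 0)); last by move=> w; rewrite subrr mulr0.
  by rewrite [X in _ = _ + X](eq_E P (Y := fun=> 0))// => w; rewrite big_ord0.
have kn' := leqW kn; have := IHk (ltnW kn); have := @step n k kn.
have q1 : \int[P]_w (\1_A w * (stopped Q rho (r n k.+1) w - stopped Q rho (r n 0) w)) =
  \int[P]_w (\1_A w * (stopped Q rho (r n k) w - stopped Q rho (r n 0) w)) + \int[P]_w (\1_A w * dQ n k w).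
  rewrite -ED; last 2 first.
  - by apply: iQ; exact: rT => //; exact: ltnW.
  - by apply: iQ; [exact: rT|apply: rT; exact: ltnW].
  by apply: eq_E => w; rewrite /dQ; ring.
have q2 : \int[P]_w (\sum_(i < k.+1) e n i w) = \int[P]_w (\sum_(i < k) e n i w) + \int[P]_w e n k w.
  rewrite -ED; last 2 first.
  - by apply: integ_sum => i; apply: ie; apply: leq_trans (ltnW (ltn_ord i)) _; exact: kn.
  - exact: ie.
  by apply: eq_E => w; rewrite big_ord_recr.
rewrite q1 q2; lra.
Qed.

(** The excess of the drift terms over [2 J]. Its positive part is bounded uniformly in the grid, so
    that the pointwise limit 0 passes to the mean. *)
Let rest n w : R := Num.max 0 (\sum_(i < n.+1) e n i w - \1_A w * (2 * stopped J rho T w)).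

Let sumle n w : A w -> \sum_(i < n.+1) (stopped Lam rho (r n i.+1) w - stopped Lam rho (r n i) w) =
  stopped Lam rho T w - stopped Lam rho t w.
Proof.
move=> Aw; rewrite -(big_mkord xpredT (fun i => stopped Lam rho (r n i.+1) w - stopped Lam rho (r n i) w)).
rewrite telescope_sumr// rNE; congr (_ - stopped Lam rho _ w).
by rewrite /r mul0r mulr0 addr0.
Qed.

Let sumJ n w : A w -> \sum_(i < n.+1) (stopped J rho (r n i.+1) w - stopped J rho (r n i) w) =
  stopped J rho T w - stopped J rho t w.
Proof.
move=> Aw; rewrite -(big_mkord xpredT (fun i => stopped J rho (r n i.+1) w - stopped J rho (r n i) w)).
rewrite telescope_sumr// rNE; congr (_ - stopped J rho _ w).
by rewrite /r mul0r mulr0 addr0.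
Qed.

Let TT : 0 <= T <= T. Proof. by rewrite T0 lexx. Qed.

Let bs s w : 0 <= s <= T -> A w ->
  [/\ 0 <= stopped Lam rho s w <= N, 0 <= stopped Q rho s w <= N & 0 <= stopped J rho s w <= N].
Proof.
move=> /andP[s0 _] Aw; apply: (bN Aw).
by have /andP[h _] := r0 w; rewrite le_min s0 h ge_min lexx orbT.
Qed.

Let dLam n w : A w -> \sum_(i < n.+1) `|dD n i w| <= N.
Proof.
move=> Aw; apply: (@le_trans _ _ (stopped Lam rho T w - stopped Lam rho t w)).
  by rewrite -(sumle n Aw); apply: ler_sum => i _; apply: dDle => //; rewrite -ltnS.
have [/andP[_ h] _ _] := bs TT Aw; have [/andP[h' _] _ _] := bs tT Aw; lra.
Qed.

Let rest_bnd n w : 0 <= rest n w <= (2 * C + N) * N.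
Proof.
have c0 : 0 <= (2 * C + N) * N by rewrite mulr_ge0// addr_ge0// mulr_ge0.
rewrite /rest le_max lexx /= ge_max c0 /=.
case: (pselect (A w)) => [Aw|nA]; last first.
  rewrite !indicE memNset// mul0r subr0 big1// => i _.
  by rewrite /e indicE memNset// mul0r.
rewrite indicE mem_set// mul1r; have [_ _ /andP[j0 _]] := bs TT Aw.
apply: (@le_trans _ _ (\sum_(i < n.+1) (2 * C + N) * `|dD n i w|)); last first.
  by rewrite -mulr_sumr ler_wpM2l ?addr_ge0 ?mulr_ge0//; exact: dLam.
apply: (@le_trans _ _ (\sum_(i < n.+1) e n i w)); first by rewrite gerBl mulr_ge0.
apply: ler_sum => i _; have ni : (i <= n)%N by rewrite -ltnS.
rewrite /e indicE mem_set// mul1r; have h1 := dDN ni Aw; have h2 := XC Aw (@sr n i.+1 w ni).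
exact: (le_trans (ler_norm _) (quad h2 h1)).
Qed.

(** On a fine mesh each cross term is at most an increment of [J] plus [eps] times one of [Lam], by
    [hJ], and each square is at most [eps] times an increment of [Lam], by uniform continuity of
    [Lam]. *)
Let rest_cvg w : rest ^~ w @ \oo --> (0 : R).
Proof.
apply/cvgrPdist_le => d d0.
case: (pselect (A w)) => [Aw|nA]; last first.
  near=> n; rewrite /rest !indicE memNset// mul0r subr0 big1 ?maxxx ?subrr ?normr0 ?ltW// => i _.
  by rewrite /e indicE memNset// mul0r.
have K0 : 0 < 3 * (N + 1) by rewrite mulr_gt0// ltr_wpDl.
(* The factor 3 counts the cross term twice and the square once; [Lam] increases by at most [N] in
   total. *)
pose eps := d / (3 * (N + 1)).
have e0 : 0 < eps by rewrite divr_gt0.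
have [h h0 hh] := hJ Aw e0; have [k k0 hk] := cLam Aw e0.
have mesh : \forall n \near \oo, (T - t) / n.+1%:R <= Num.min h k.
  have hk0 : 0 < Num.min h k by rewrite lt_min h0.
  have : (T - t) * n.+1%:R^-1 @[n --> \oo] --> (T - t) * 0.
    by apply: cvgMr; exact: cvg_harmonic.
  rewrite mulr0 => /cvgrPdist_le /(_ _ hk0); apply: filterS => n.
  by rewrite sub0r normrN; apply: le_trans; exact: ler_norm.
near=> n.
have hn : (T - t) / n.+1%:R <= Num.min h k by near: n.
rewrite sub0r normrN ger0_norm; last by case/andP: (rest_bnd n w).
rewrite /rest ge_max (ltW d0) /= indicE mem_set// mul1r.
apply: (@le_trans _ _ (\sum_(i < n.+1) (2 * (stopped J rho (r n i.+1) w - stopped J rho (r n i) w) +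
   3 * eps * (stopped Lam rho (r n i.+1) w - stopped Lam rho (r n i) w)) - 2 * stopped J rho T w)).
  rewrite lerD2r; apply: ler_sum => i _; have ni : (i <= n)%N by rewrite -ltnS.
  rewrite /e indicE mem_set// mul1r.
  have /andP[s1 s1'] := sr w (leqW ni); have /andP[s2 s2'] := @sr n i.+1 w ni.
  have sm : Num.min (r n i.+1) (rho w) - Num.min (r n i) (rho w) <= (T - t) / n.+1%:R.
    apply: (@le_trans _ _ (r n i.+1 - r n i)).
      have := rnd n (leqnSn i); case: (leP (r n i.+1) (rho w)); case: (leP (r n i) (rho w)); lra.
    have ii : (i.+1%:R : R) = i%:R + 1 by rewrite -natr1.
    by rewrite /r ii le_eqVlt; apply/orP; left; apply/eqP; ring.
  move: (le_trans sm hn); rewrite le_min => /andP[sh sk].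
  have H1 := hh _ _ s1 (srm n i w) s2' sh.
  have T1 : 0 <= Num.min (r n i) (rho w) <= T by rewrite s1 (le_trans s1')//; case/andP: (r0 w).
  have T2 : 0 <= Num.min (r n i.+1) (rho w) <= T by rewrite s2 (le_trans s2')//; case/andP: (r0 w).
  have H2 : Lam (Num.min (r n i.+1) (rho w)) w - Lam (Num.min (r n i) (rho w)) w <= eps.
    apply: (le_trans (ler_norm _)); apply: hk => //.
    by rewrite ger0_norm// subr_ge0 srm.
  have H3 := dDle ni Aw.
  rewrite -/(stopped Lam rho _ w) -/(stopped Lam rho (r n i) w) in H1 H2.
  have H1' : x n i.+1 w * dD n i w <= stopped J rho (r n i.+1) w - stopped J rho (r n i) w +
    eps * (stopped Lam rho (r n i.+1) w - stopped Lam rho (r n i) w) := H1.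
  have H2' : stopped Lam rho (r n i.+1) w - stopped Lam rho (r n i) w <= eps := H2.
  have H4 : dD n i w ^+ 2 <= eps * (stopped Lam rho (r n i.+1) w - stopped Lam rho (r n i) w).
    rewrite -[leLHS]real_normK ?num_real// expr2 ler_pM//.
    exact: le_trans H3 H2'.
  by move: H1' H4; lra.
rewrite big_split /= -!mulr_sumr sumJ// sumle//.
have [/andP[_ l1] _ /andP[j1 _]] := bs TT Aw; have [/andP[l2 _] _ /andP[j2 _]] := bs tT Aw.
apply: (@le_trans _ _ (3 * eps * (N + 1))).
  have : 3 * eps * (stopped Lam rho T w - stopped Lam rho t w) <= 3 * eps * (N + 1).
    have e3 : 0 <= 3 * eps by rewrite mulr_ge0// ltW.
    by rewrite ler_wpM2l//; lra.
  lra.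
rewrite /eps le_eqVlt; apply/orP; left; apply/eqP; field.
by rewrite gt_eqF// ltr_wpDl.
Unshelve. all: by end_near. Qed.

(** [step] telescopes over the partition into [total]; the drift terms are then at most [2 J] plus
    [rest], whose mean tends to 0. *)
Lemma energy_bounded :
  \int[P]_w (\1_A w * stopped X rho t w ^+ 2) +
    \int[P]_w (\1_A w * (stopped Q rho T w - stopped Q rho t w)) <=
  \int[P]_w (\1_A w * stopped X rho T w ^+ 2) + 2 * \int[P]_w (\1_A w * stopped J rho T w).
Proof.
have r00 n : r n 0 = t by rewrite /r mul0r mulr0 addr0.
have iJ : integ (fun w => \1_A w * stopped J rho T w).
  apply: (@integ_bnd _ _ _ P N) => [|w]; first by apply: measurable_funM => //; exact: msT.
  case: (pselect (A w)) => [Aw|nA]; last by rewrite indicE memNset// mul0r normr0.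
  have [_ _ /andP[j0 j1]] := bs TT Aw.
  by rewrite indicE mem_set// mul1r ger0_norm.
have iS n : integ (fun w => \sum_(i < n.+1) e n i w).
  by apply: integ_sum => i; apply: ie; rewrite -ltnS.
have mrest n : measurable_fun setT (rest n).
  apply: measurable_maxr => //; apply: measurable_funB; first exact: integ_meas (iS n).
  apply: measurable_funM => //; apply: measurable_funM => //; exact: msT.
have irest n : integ (rest n).
  apply: (@integ_bnd _ _ _ P ((2 * C + N) * N)) => // w.
  by have /andP[h1 h2] := rest_bnd n w; rewrite ger0_norm.
have c0 : \int[P]_w rest n w @[n --> \oo] --> (0 : R).
  apply: (@E_dct0 _ _ _ P _ ((2 * C + N) * N)) => //.
  - by apply: aeW => w; exact: rest_cvg.
  - by apply: aeW => w n; have /andP[h1 h2] := rest_bnd n w; rewrite ger0_norm.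
apply/ler_addgt0Pr => d d0.
have [n _ hn] : \forall n \near \oo, `|0 - \int[P]_w rest n w| <= d.
  by move/cvgrPdist_le : c0 => /(_ _ d0).
have {}hn := hn n (leqnn n); rewrite /= sub0r normrN in hn.
have := @total n n.+1 (leqnn _); rewrite r00 rNE /x r00 rNE => ->.
rewrite -addrA lerD2l.
apply: (@le_trans _ _ (2 * \int[P]_w (\1_A w * stopped J rho T w) + \int[P]_w rest n w)); last first.
  by rewrite lerD2l (le_trans (ler_norm _)).
rewrite -EZ// -ED//; last exact: integZ.
apply: Ele => //; first by apply: integD => //; exact: integZ.
move=> w; rewrite -lerBlDl /rest le_max; apply/orP; right.
by rewrite lerD2l lerN2; lra.
Qed.

End Bounded.

Lemma E_ae (X Y : Omega -> R) : measurable_fun setT X -> measurable_fun setT Y ->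
  {ae P, forall w, X w = Y w} -> (integ X <-> integ Y) /\ \int[P]_w X w = \int[P]_w Y w.
Proof.
move=> mX mY XY; split; last first.
  congr fine; apply: ae_eq_integral => //; [exact/measurable_EFinP|exact/measurable_EFinP|].
  by apply: filterS XY => w /= -> _.
suff h (X' Y' : Omega -> R) : measurable_fun setT X' -> measurable_fun setT Y' ->
    {ae P, forall w, X' w = Y' w} -> integ X' -> integ Y'.
  by split; apply: h => //; apply: filterS XY => w ->.
move=> mX' mY' XY' /integrableP[_ h]; apply/integrableP; split; first exact/measurable_EFinP.
rewrite (_ : (\int[P]_w `|(EFin \o Y') w| = \int[P]_w `|(EFin \o X') w|)%E)//.
apply: ae_eq_integral => //.
- by apply/measurable_EFinP; exact: measurableT_comp.
- by apply/measurable_EFinP; exact: measurableT_comp.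
- by apply: filterS XY' => w /= -> _.
Qed.

(** [X_r - X_s + I_s - I_r] is the drift over [[r, s]] of an equation solved backwards. [Lam]
    dominates its variation, and [J] dominates the integral of [X] against it, up to an error
    [e * Lam] that fine partitions make negligible. Only an upper bound is asked of [J], so parts of
    the drift on which the product has a favourable sign need not be counted in it. *)
Definition energy_bound I Q X (Lam J : R -> Omega -> R) (C : R) w (tau : R) : Prop :=
  [/\ Lam 0 w = 0, J 0 w = 0,
     forall s, 0 <= s <= tau -> `|X s w| <= C,
     forall r s, 0 <= r -> r <= s -> s <= tau ->
       [/\ Q r w <= Q s w, J r w <= J s w &
         `|X r w - X s w + (I s w - I r w)| <= Lam s w - Lam r w] &
     forall e : R, 0 < e -> exists2 h : R, 0 < h & forall r s,
       0 <= r -> r <= s -> s <= tau -> s - r <= h ->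
       X s w * (X r w - X s w + (I s w - I r w)) <= J s w - J r w + e * (Lam s w - Lam r w)].

(** Stopping when [Lam], [Q] or [J] exceeds [n] reduces to [energy_bounded]. The stopping eventually
    disappears on each path of [A']: the left side passes to the limit by Fatou's lemma, the
    terminal square by boundedness, and [J] is monotone. *)
Lemma energy I Q X Lam J tau (t C : R) A : itopair P T F I Q -> optional T F tau ->
  0 <= t <= T -> F t A -> 0 <= C -> acproc P T F X -> acproc P T F Lam -> acproc P T F J ->
  {ae P, forall w, A w -> energy_bound I Q X Lam J C w (tau w)} ->
  integ (fun w => \1_A w * stopped J tau T w) ->
  integ (fun w => \1_A w * (stopped X tau t w ^+ 2 + (stopped Q tau T w - stopped Q tau t w))) /\
  \int[P]_w (\1_A w * (stopped X tau t w ^+ 2 + (stopped Q tau T w - stopped Q tau t w))) <=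
  \int[P]_w (\1_A w * stopped X tau T w ^+ 2) + 2 * \int[P]_w (\1_A w * stopped J tau T w).
Proof.
move=> hIQ htau tT FA C0 aX aLam aJ hA iJ.
have [_ aQ _] := hIQ; have hFt := filtration_sub hF tT.
have mA := filt_meas hF tT FA.
pose cond w := A w -> energy_bound I Q X Lam J C w (tau w).
(* Exceptional paths are removed from [A]: their set is null, hence in [F t], and the hypotheses
   then hold on every path of [A']. *)
pose G := [set w | [/\ ucont T (Lam ^~ w), ucont T (Q ^~ w), ucont T (J ^~ w), Q 0 w = 0 & cond w]].
have hG : P.-negligible (~` G).
  have : {ae P, forall w, G w}; last by [].
  case: aLam aQ aJ => _ c1 [_ c2] [_ c3].
  apply: filterS2 (filterI (filterI c1 c2) c3) (filterI (itopair0 T0 hIQ) hA).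
  by move=> w [[? ?] ?] [[_ ?] ?].
pose A' := A `&` G.
have FA' : F t A'.
  apply: (subsigmaI hFt) => //; rewrite -[G]setCK; apply: (subsigmaC hFt).
  exact: (subsigma_negl hP hFt hG).
have mA' := filt_meas hF tT FA'.
have A'E w : G w -> \1_A' w = \1_A w :> R.
  by move=> Gw; rewrite !indicE /A' in_setI (mem_set Gw) andbT.
have ae' (f : Omega -> R) : {ae P, forall w, \1_A' w * f w = \1_A w * f w}.
  have : {ae P, forall w, G w} by [].
  by apply: filterS => w /A'E ->.
have r0 w : 0 <= tau w <= T by case: htau.
have TT : 0 <= T <= T by rewrite T0 lexx.
have t0 w : 0 <= tau w by case/andP: (r0 w).
have ms Y r s : acproc P T F Y -> optional T F r -> 0 <= s <= T -> measurable_fun setT (stopped Y r s).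
  by move=> aY hr sT; have [h _] := acproc_stopped hP hF hr aY; exact: (gmeas_measT hF sT (h s sT)).
pose U (n : nat) (i : nat) (s : R) (w : Omega) : R :=
  (if i is 0%N then Lam s w else if i is 1%N then Q s w else J s w) - n%:R.
pose rho n w := Num.min (tau w) (hitting T (U n) w).
have hrho n : optional T F (rho n).
  apply: (optional_min hF htau); apply: (hitting_optional T0 hF) => i s sT.
  apply: measurable_funB; last exact: measurable_cst.
  by case: i => [|[|i]]; [case: aLam|case: aQ|case: aJ] => h _; exact: h.
have rt n w : rho n w <= tau w by rewrite ge_min lexx.
have r1 n w : 0 <= rho n w <= T by case: (hrho n).
have mono w r s : A' w -> 0 <= r -> r <= s -> s <= tau w ->
    [/\ Lam r w <= Lam s w, Q r w <= Q s w & J r w <= J s w].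
  move=> [Aw [_ _ _ _ /(_ Aw)[_ _ _ h _]]] r0' rs st; have [h1 h2 h3] := h r s r0' rs st.
  by split => //; rewrite -subr_ge0 (le_trans _ h3).
have bN n w : A' w -> forall s, 0 <= s <= rho n w ->
    [/\ 0 <= Lam s w <= n%:R, 0 <= Q s w <= n%:R & 0 <= J s w <= n%:R].
  move=> A'w s /andP[s0 sr]; have st := le_trans sr (rt n w).
  have [m1 m2 m3] := mono w 0 s A'w (lexx 0) s0 st.
  have [Aw [u1 u2 u3 q0 /(_ Aw)[l0 j0 _ _ _]]] := A'w.
  have sh : s <= hitting T (U n) w by rewrite (le_trans sr)// ge_min lexx orbT.
  have hb i : ucont T (U n i ^~ w) -> U n i 0 w <= 0 -> U n i s w <= 0.
    by move=> u u0; exact: (hitting_before T0 u s0 sh u0).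
  have uU i : ucont T (U n i ^~ w).
    by case: i => [|[|i]]; apply: ucontB => //; exact: ucont_cst.
  have U0 i : U n i 0 w <= 0.
    by case: i => [|[|i]]; rewrite /U ?l0 ?q0 ?j0 sub0r oppr_le0.
  have h0 := hb 0%N (uU _) (U0 _); have h1 := hb 1%N (uU _) (U0 _); have h2 := hb 2%N (uU _) (U0 _).
  rewrite /U !subr_le0 in h0 h1 h2.
  by rewrite l0 in m1; rewrite q0 in m2; rewrite j0 in m3; rewrite m1 m2 m3.
have XC w : A' w -> forall s, 0 <= s <= tau w -> `|X s w| <= C.
  by move=> [Aw [_ _ _ _ /(_ Aw)[_ _ h _ _]]].
pose f n w := \1_A' w * (stopped X (rho n) t w ^+ 2 + (stopped Q (rho n) T w - stopped Q (rho n) t w)).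
pose g w := \1_A' w * (stopped X tau t w ^+ 2 + (stopped Q tau T w - stopped Q tau t w)).
have iJ' : integ (fun w => \1_A' w * stopped J tau T w).
  have mJ := ms _ _ _ aJ htau TT.
  have [[_ h] _] := E_ae (measurable_funM (measurable_indic mA') mJ) (measurable_funM (measurable_indic mA) mJ) (ae' _).
  exact: h.
have mm x y : x <= T -> 0 <= y -> 0 <= x -> 0 <= Num.min x y <= y.
  by move=> _ y0 x0; rewrite le_min y0 x0 ge_min lexx orbT.
have stb w x n : A' w -> 0 <= x <= T -> [/\ `|stopped X (rho n) x w| <= C,
   0 <= stopped Q (rho n) x w <= n%:R & 0 <= stopped J (rho n) x w <= n%:R].
  move=> A'w /andP[x0 xT]; have /andP[h1 h2] := r1 n w.
  have /andP[h3 h4] := mm x (rho n w) xT h1 x0.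
  have [_ q j] := bN n w A'w _ (mm x (rho n w) xT h1 x0); split => //.
  by apply: (XC w A'w); rewrite h3 (le_trans h4).
have stbt w x : A' w -> 0 <= x <= T -> `|stopped X tau x w| <= C.
  move=> A'w /andP[x0 xT]; apply: (XC w A'w); exact: mm.
have Qm w y : A' w -> 0 <= y <= tau w -> Q (Num.min t y) w <= Q (Num.min T y) w.
  move=> A'w /andP[y0 yt]; have /andP[t00 tT'] := tT.
  have h : Num.min t y <= Num.min T y.
    by rewrite le_min ge_min tT' /= ge_min lexx orbT.
  have [] := mono w (Num.min t y) (Num.min T y) A'w _ h _ => //.
    by rewrite le_min t00.
  by rewrite ge_min yt orbT.
have f0 n w : 0 <= f n w.
  rewrite /f; case: (pselect (A' w)) => [A'w|nA]; last by rewrite indicE memNset// mul0r.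
  rewrite indicE mem_set// mul1r addr_ge0 ?sqr_ge0// subr_ge0; apply: Qm => //.
  by rewrite rt; case/andP: (r1 n w) => ->.
have g0 w : 0 <= g w.
  rewrite /g; case: (pselect (A' w)) => [A'w|nA]; last by rewrite indicE memNset// mul0r.
  rewrite indicE mem_set// mul1r addr_ge0 ?sqr_ge0// subr_ge0; apply: Qm => //.
  by rewrite lexx t0.
have iX n x : 0 <= x <= T -> integ (fun w => \1_A' w * stopped X (rho n) x w ^+ 2).
  move=> xT; apply: (@integ_bnd _ _ _ P (C ^+ 2)) => [|w].
    by apply: measurable_funM => //; apply: measurable_funX; exact: ms.
  case: (pselect (A' w)) => [A'w|nA]; last by rewrite !indicE memNset// !mul0r normr0 sqr_ge0.
  have [h _ _] := stb w x n A'w xT.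
  by rewrite !indicE mem_set// !mul1r normrX lerXn2r// nnegrE.
have iQn n : integ (fun w => \1_A' w * (stopped Q (rho n) T w - stopped Q (rho n) t w)).
  apply: (@integ_bnd _ _ _ P n%:R) => [|w].
    by apply: measurable_funM => //; apply: measurable_funB; exact: ms.
  case: (pselect (A' w)) => [A'w|nA]; last by rewrite !indicE memNset// !mul0r normr0.
  have [_ /andP[? ?] _] := stb w T n A'w TT; have [_ /andP[? ?] _] := stb w t n A'w tT.
  by rewrite !indicE mem_set// !mul1r ler_norml; apply/andP; split; lra.
have iJn n : integ (fun w => \1_A' w * stopped J (rho n) T w).
  apply: (@integ_bnd _ _ _ P n%:R) => [|w].
    by apply: measurable_funM => //; exact: ms.
  case: (pselect (A' w)) => [A'w|nA]; last by rewrite !indicE memNset// !mul0r normr0.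
  have [_ _ /andP[? ?]] := stb w T n A'w TT.
  by rewrite !indicE mem_set// !mul1r ger0_norm.
have fE n : integ (f n) /\ \int[P]_w f n w = \int[P]_w (\1_A' w * stopped X (rho n) t w ^+ 2) +
    \int[P]_w (\1_A' w * (stopped Q (rho n) T w - stopped Q (rho n) t w)).
  have fe : f n = fun w => \1_A' w * stopped X (rho n) t w ^+ 2 + \1_A' w * (stopped Q (rho n) T w - stopped Q (rho n) t w).
    by apply/funext => w; rewrite /f mulrDr.
  by split; [rewrite fe; apply: integD => //; exact: iX|rewrite fe ED//; exact: iX].
pose b n := \int[P]_w (\1_A' w * stopped X (rho n) T w ^+ 2) + 2 * \int[P]_w (\1_A' w * stopped J tau T w).
have fb n : \int[P]_w f n w <= b n.
  rewrite (fE n).2; apply: (@le_trans _ _ (\int[P]_w (\1_A' w * stopped X (rho n) T w ^+ 2) + 2 * \int[P]_w (\1_A' w * stopped J (rho n) T w))).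
    apply: (@energy_bounded I Q X Lam J (rho n) t C n%:R A' hIQ (hrho n) tT FA' C0 _ aX aJ) => //.
    - by move=> w A'w s /andP[s0 sr]; apply: (XC w A'w); rewrite s0 (le_trans sr).
    - exact: bN.
    - by move=> w [_ []].
    - move=> w [Aw [_ _ _ _ /(_ Aw)[_ _ _ h _]]] r s r0' rs sr.
      by have [] := h r s r0' rs (le_trans sr (rt n w)).
    - move=> w [Aw [_ _ _ _ /(_ Aw)[_ _ _ _ h]]] e /h[k k0 hk]; exists k => // r s r0' rs sr.
      exact: (hk r s r0' rs (le_trans sr (rt n w))).
  rewrite /b lerD2l ler_wpM2l//; apply: Ele => // w.
  case: (pselect (A' w)) => [A'w|nA]; last by rewrite !indicE memNset// !mul0r.
  rewrite indicE mem_set// !mul1r /stopped.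
  have /andP[r10 r1T] := r1 n w; have /andP[_ tT'] := r0 w.
  by rewrite !min_r//; have [] := mono w (rho n w) (tau w) A'w r10 (rt n w) (lexx _).
have ev w : A' w -> \forall n \near \oo, rho n w = tau w.
  move=> [_ [u1 u2 u3 _ _]].
  have [C1 h1] := ucont_bounded T0 u1; have [C2 h2] := ucont_bounded T0 u2.
  have [C3 h3] := ucont_bounded T0 u3.
  near=> n; rewrite /rho hitting_eqT//; first by rewrite min_l//; case/andP: (r0 w).
  have n1 : C1 <= n%:R by near: n; exact: nbhs_infty_ger.
  have n2 : C2 <= n%:R by near: n; exact: nbhs_infty_ger.
  have n3 : C3 <= n%:R by near: n; exact: nbhs_infty_ger.
  move=> [|[|i]] q qT; rewrite /U subr_le0 (le_trans (ler_norm _))//.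
  - exact: le_trans (h1 q qT) n1.
  - exact: le_trans (h2 q qT) n2.
  - exact: le_trans (h3 q qT) n3.
have fg : {ae P, forall w, f ^~ w @ \oo --> g w}.
  apply: aeW => w; rewrite /f /g; case: (pselect (A' w)) => [A'w|nA]; last first.
    by rewrite indicE memNset// mul0r; under eq_fun do rewrite mul0r; exact: cvg_cst.
  apply: cvg_near_cst; have := ev w A'w; apply: filterS => n e.
  by rewrite /stopped e.
have mg : measurable_fun setT g.
  apply: measurable_funM => //; apply: measurable_funD; first by apply: measurable_funX; exact: ms.
  by apply: measurable_funB; exact: ms.
have bc : b @ \oo --> \int[P]_w (\1_A' w * stopped X tau T w ^+ 2) + 2 * \int[P]_w (\1_A' w * stopped J tau T w).
  apply: cvgD; last exact: cvg_cst.
  apply: (@E_dct _ _ _ P _ _ (fun=> C ^+ 2)) => //.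
  - by move=> n; apply: measurable_funM => //; apply: measurable_funX; exact: ms.
  - by apply: measurable_funM => //; apply: measurable_funX; exact: ms.
  - apply: aeW => w; case: (pselect (A' w)) => [A'w|nA]; last first.
      by rewrite indicE memNset// mul0r; under eq_fun do rewrite mul0r; exact: cvg_cst.
    by apply: cvg_near_cst; have := ev w A'w; apply: filterS => n e; rewrite /stopped e.
  - apply: aeW => w n; case: (pselect (A' w)) => [A'w|nA]; last by rewrite !indicE memNset// !mul0r normr0 sqr_ge0.
    have [h _ _] := stb w T n A'w TT.
    by rewrite !indicE mem_set// !mul1r normrX lerXn2r// nnegrE.
  - exact: integ_cst.
have [ig hg] := E_fatou (fun n => (fE n).1) mg f0 g0 fg fb bc.
have mI (D : set Omega) (h : Omega -> R) : measurable D -> measurable_fun setT h -> measurable_fun setT (fun w => \1_D w * h w).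
  by move=> mD mh; apply: measurable_funM => //; exact: measurable_indic.
have mg' : measurable_fun setT (fun w => stopped X tau t w ^+ 2 + (stopped Q tau T w - stopped Q tau t w)).
  apply: measurable_funD; first by apply: measurable_funX; exact: ms.
  by apply: measurable_funB; exact: ms.
have mX2 : measurable_fun setT (fun w => stopped X tau T w ^+ 2) by apply: measurable_funX; exact: ms.
have [[h1 _] h2] := E_ae (mI _ _ mA' mg') (mI _ _ mA mg') (ae' _).
have [_ h3] := E_ae (mI _ _ mA' mX2) (mI _ _ mA mX2) (ae' _).
have [_ h4] := E_ae (mI _ _ mA' (ms _ _ _ aJ htau TT)) (mI _ _ mA (ms _ _ _ aJ htau TT)) (ae' _).
by split; [exact: h1|rewrite -h2 -h3 -h4].
Unshelve. all: by end_near. Qed.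

(** Stop when [|I|] exceeds [e] or [|Q|] exceeds [dl]. The stopped [I] has mean square equal to the
    mean of the stopped [Q], at most [dl]; on [E] the bracket never exceeds [dl], so the stopping is
    due to [I], which has then reached [e]. *)
Lemma lenglart I Q (e dl : R) (E : set Omega) : itopair P T F I Q -> 0 < e -> 0 <= dl -> measurable E ->
  {ae P, forall w, E w -> (forall s, 0 <= s <= T -> 0 <= Q s w <= dl) /\
     exists2 s, 0 <= s <= T & e < `|I s w|} ->
  e ^+ 2 * fine (P E) <= dl.
Proof.
move=> hIQ e0 dl0 mE hE.
have [aI aQ _] := hIQ.
have TT : 0 <= T <= T by rewrite T0 lexx.
have T00 : 0 <= (0 : R) <= T by rewrite lexx.
pose U (i : nat) s w : R := if i is 0%N then `|I s w| - e else `|Q s w| - dl.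
have aU i : adapted T F (U i).
  move=> s sT; case: i => [|i]; apply: measurable_funB; try exact: measurable_cst.
    by apply: measurableT_comp => //; case: aI => h _; exact: h.
  by apply: measurableT_comp => //; case: aQ => h _; exact: h.
pose rho := hitting T U.
have hrho : optional T F rho by exact: (hitting_optional T0 hF).
have ms Y s : acproc P T F Y -> 0 <= s <= T -> measurable_fun setT (stopped Y rho s).
  by move=> aY sT; have [h _] := acproc_stopped hP hF hrho aY; exact: (gmeas_measT hF sT (h s sT)).
pose G := [set w | [/\ ucont T (I ^~ w), ucont T (Q ^~ w), I 0 w = 0, Q 0 w = 0 &
   E w -> (forall s, 0 <= s <= T -> 0 <= Q s w <= dl) /\ exists2 s, 0 <= s <= T & e < `|I s w|]].
have aG : {ae P, forall w, G w}.
  case: (aI) (aQ) => _ c1 [_ c2].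
  apply: filterS2 (filterI c1 c2) (filterI (itopair0 T0 hIQ) hE).
  by move=> w [? ?] [[? ?] ?].
have hF0 := filtration_sub hF T00.
have FG : F 0 G.
  rewrite -[G]setCK; apply: (subsigmaC hF0); exact: (subsigma_negl hP hF0 aG).
have bG w : G w -> forall s, 0 <= s -> s <= rho w -> `|I s w| <= e /\ `|Q s w| <= dl.
  move=> [u1 u2 z1 z2 _] s s0 sr.
  have h1 : U 0%N s w <= 0.
    apply: (hitting_before T0 _ s0 sr); rewrite /U; last by rewrite z1 normr0 sub0r oppr_le0 ltW.
    by apply: ucontB; [exact: ucont_norm|exact: ucont_cst].
  have h2 : U 1%N s w <= 0.
    apply: (hitting_before T0 _ s0 sr); rewrite /U; last by rewrite z2 normr0 sub0r oppr_le0.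
    by apply: ucontB; [exact: ucont_norm|exact: ucont_cst].
  by move: h1 h2; rewrite /U !subr_le0.
have rb w : 0 <= rho w <= T by case: hrho.
have c0 : 0 <= 2 * e + 2 * dl by rewrite addr_ge0// mulr_ge0// ltW.
have st w s : G w -> 0 <= s -> `|stopped I rho s w| <= e /\ `|stopped Q rho s w| <= dl.
  move=> Gw s0; apply: (bG w Gw); last by rewrite ge_min lexx orbT.
  by rewrite le_min s0; case/andP: (rb w).
have bd w : G w -> forall s, 0 <= s <= T ->
    `|stopped I rho s w - stopped I rho 0 w| <= 2 * e + 2 * dl /\
    `|stopped Q rho s w - stopped Q rho 0 w| <= 2 * e + 2 * dl.
  move=> Gw s /andP[s0 _]; have [a1 a2] := st w s Gw s0; have [a3 a4] := st w 0 Gw (lexx 0).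
  split; [apply: (le_trans (ler_normB _ _))|apply: (le_trans (ler_normB _ _))]; lra.
have [_ iso] := ito_stop hP T0 hF hIQ hrho (lexx 0) T0 (lexx T) FG c0 bd.
have z w : G w -> stopped I rho 0 w = 0 /\ stopped Q rho 0 w = 0.
  by move=> [_ _ z1 z2 _]; rewrite /stopped min_l//; case/andP: (rb w).
have mG := filt_meas hF T00 FG.
(* If [rho < T], some [U i] is positive arbitrarily soon after [rho]; on [E] this cannot come from
   [Q], so continuity gives [|I| >= e] at [rho]. If [rho = T], [|I|] would never exceed [e], against
   the choice of [E]. *)
have low w : G w -> E w -> e <= `|stopped I rho T w|.
  move=> Gw Ew; have [u1 u2 z1 z2 /(_ Ew)[hQ [s sT es]]] := Gw.
  rewrite /stopped min_r; last by case/andP: (rb w).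
  case: (ltP (rho w) T) => rT; last first.
    have rE : rho w = T by apply/eqP; rewrite eq_le rT; case/andP: (rb w) => _ ->.
    have [] := bG w Gw s; [by case/andP: sT|by rewrite rE; case/andP: sT|].
    by move=> h _; move: es; rewrite ltNge h.
  apply/ler_addgt0Pr => d d0; have [h h0 hh] := u1 d d0.
  have [i [q [q1 q2 q3 q4]]] := hitting_after T0 rT h0.
  have qT : 0 <= q <= T by rewrite q3 (le_trans _ q1)//; case/andP: (rb w).
  have hr : `|I q w - I (rho w) w| <= d.
    apply: hh => //; rewrite ger0_norm; last by rewrite subr_ge0.
    by rewrite -/rho in q2; lra.
  case: i q4 => [|i]; rewrite /U subr_gt0 => q4.
    have := ler_distD (I q w) (I q w) (I (rho w) w).
    have := ler_normD (I q w - I (rho w) w) (I (rho w) w); rewrite subrK; lra.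
  by have /andP[k1 k2] := hQ q qT; move: q4; rewrite ger0_norm// ltNge k2.
have iI : integ (fun w => \1_G w * (stopped I rho T w - stopped I rho 0 w) ^+ 2).
  apply: (@integ_bnd _ _ _ P (e ^+ 2)) => [|w].
    by apply: measurable_funM => //; apply: measurable_funX; apply: measurable_funB; exact: ms.
  case: (pselect (G w)) => [Gw|nG]; last by rewrite indicE memNset// mul0r normr0 sqr_ge0.
  have [-> _] := z w Gw; rewrite subr0 indicE mem_set// mul1r normrX lerXn2r ?nnegrE ?(ltW e0)//.
  by have [] := st w T Gw T0.
have h1 : \int[P]_w (\1_G w * (stopped Q rho T w - stopped Q rho 0 w)) <= dl.
  apply: (@le_trans _ _ (\int[P]_w dl)); last first.
    have p1 : P setT = 1%E by exact: probability_setT.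
    by rewrite (Rintegral_cst P measurableT) [X in fine X]p1 mulr1.
  apply: Ele; last first.
  - move=> w; case: (pselect (G w)) => [Gw|nG]; last by rewrite indicE memNset// mul0r.
    have [_ ->] := z w Gw; rewrite subr0 indicE mem_set// mul1r (le_trans (ler_norm _))//.
    by have [] := st w T Gw T0.
  - exact: integ_cst.
  apply: (@integ_bnd _ _ _ P dl) => [|w].
    by apply: measurable_funM => //; apply: measurable_funB; exact: ms.
  case: (pselect (G w)) => [Gw|nG]; last by rewrite indicE memNset// mul0r normr0.
  have [_ ->] := z w Gw; rewrite subr0 indicE mem_set// mul1r.
  by have [] := st w T Gw T0.
apply: le_trans h1; rewrite -iso.
have -> : e ^+ 2 * fine (P E) = \int[P]_w (e ^+ 2 * \1_(E `&` G) w).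
  have e1 : P E = P (E `&` G).
    have nG : P.-negligible (~` G) by [].
    apply/eqP; rewrite eq_le; apply/andP; split; last by apply: le_measure; rewrite ?inE//; exact: measurableI.
    have mGC : measurable (~` G) by exact: measurableC.
    have z0 : P (~` G) = 0%E by apply/negligibleP.
    rewrite -[leRHS]adde0 -z0; apply: (le_trans _ (measureU2 _ _ _)) => //; last exact: measurableI.
    apply: le_measure; rewrite ?inE//; first by apply: measurableU => //; exact: measurableI.
    by move=> w Ew; case: (pselect (G w)) => Gw; [left|right].
  rewrite e1 EZ.
    by rewrite /Rintegral integral_indic ?setIT//; exact: measurableI.
  apply: (@integ_bnd _ _ _ P 1); first exact: measurable_indic (measurableI _ _ mE mG).
  by move=> w; exact: norm_indic_le1.
apply: Ele => //.
  apply: integZ; apply: (@integ_bnd _ _ _ P 1); first exact: measurable_indic (measurableI _ _ mE mG).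
  by move=> w; exact: norm_indic_le1.
move=> w; rewrite indicI /=; case: (pselect (G w)) => [Gw|nG]; last first.
  by rewrite [\1_G w]indicE memNset// !mul0r !mulr0.
rewrite [\1_G w]indicE mem_set// !mul1r mulr1; case: (pselect (E w)) => [Ew|nE]; last first.
  by rewrite indicE memNset// mulr0 sqr_ge0.
have [-> _] := z w Gw; rewrite subr0 indicE mem_set// mulr1 -[leRHS]real_normK ?num_real//.
by rewrite lerXn2r ?nnegrE ?(ltW e0)//; exact: low.
Qed.
End Energy.

(** * Convergence in probability and measurability of suprema *)

Section Probability.
Context {R : realType} {disp : measure_display} {Omega : measurableType disp}.
Variables (P : probability Omega R).
Hypotheses (hP : measure_is_complete P).
Implicit Types (W : nat -> Omega -> \bar R).

Lemma borel_cantelli_pow (E : nat -> set Omega) : (forall j, measurable (E j)) ->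
  (forall j, (P (E j) <= ((2^-1) ^+ j)%:E)%E) ->
  {ae P, forall w, exists N : nat, forall j, (N <= j)%N -> ~ E j w}.
Proof.
move=> mE hE.
have h0 : P (lim_sup_set E) = 0%E.
  apply: lim_sup_set_cvg0 => //.
  apply: (@le_lt_trans _ _ (\sum_(0 <= j <oo) ((2^-1 : R) ^+ j)%:E)%E).
    by apply: lee_nneseries => // j _; exact: hE.
  have h : \sum_(0 <= j < n) ((2^-1 : R) ^+ j)%:E @[n --> \oo] --> (2 / (2 ^+ 0) : R)%:E.
    have := @cvg_geometric_eseries_half R 2 0; rewrite (_ : eseries _ = fun n => \sum_(0 <= j < n) ((2^-1 : R) ^+ j)%:E)%E//.
    apply/funext => n; rewrite /eseries /=; apply: eq_bigr => k _; congr EFin.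
    by rewrite addn1 natrX exprS invfM mulrA divff// mul1r exprVn.
  by rewrite (cvg_lim _ h)// ltry.
exists (lim_sup_set E); split => //.
  by apply: bigcap_measurable => // n _; exact: bigcup_measurable.
move=> w /= h n _; apply: contrapT => hn; apply: h; exists n => j nj Ej; apply: hn.
by exists j.
Qed.

Lemma meas_ae_eq (X Y : Omega -> \bar R) : measurable_fun setT X ->
  {ae P, forall w, X w = Y w} -> measurable_fun setT Y.
Proof.
move=> mX XY.
have hG : subsigma P (@measurable _ Omega).
  by split => //; exact: sigma_algebra_measurable.
have gX : gmeas (@measurable _ Omega) X by apply/(gmeasE _ hG) => A mA; rewrite -[_ @^-1` _]setTI; exact: mX.
by apply: (gmeas_meas hG); exact: (gmeas_ae_eq hP hG gX XY).
Qed.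

(** By continuity the supremum is approached along the countable set of rationals clipped to
    [[t, T]]; the two suprema agree almost surely, which is enough for a complete measure. *)
Lemma sup_from_meas T (F : R -> set (set Omega)) (X : R -> Omega -> R) t :
  filtration P T F -> 0 <= t <= T -> acproc P T F X ->
  measurable_fun setT (fun w => sup_from T t (X ^~ w)).
Proof.
move=> hF /andP[t0 tT] [aX cX].
pose q (n : nat) : R := Num.max t (Num.min T (if unpickle n is Some r then ratr r else t)).
have qT n : t <= q n <= T by rewrite /q le_max lexx /= ge_max tT ge_min lexx.
have m1 : measurable_fun setT (fun w => esups (fun n => (X (q n) w)%:E) 0%N).
  apply: measurable_fun_esups => n; apply/measurable_EFinP.
  have qT' : 0 <= q n <= T by case/andP: (qT n) => h ->; rewrite (le_trans t0).
  exact: (gmeas_measT hF qT' (aX _ qT')).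
apply: (meas_ae_eq m1); apply: filterS cX => w ux.
apply/eqP; rewrite eq_le; apply/andP; split.
  apply: ge_ereal_sup => _ [n _ <-]; apply: ereal_sup_ubound.
  by exists (q n) => //=; rewrite in_itv/=.
apply: ge_ereal_sup => _ [s /= + <-]; rewrite in_itv/= => /andP[ts sT].
apply/lee_addgt0Pr => e e0; have [h h0 hh] := ux e e0.
have sh : s < s + h by rewrite ltrDl.
have [r] := rat_in_itvoo sh; rewrite in_itv/= => /andP[r1 r2].
pose n := pickle r.
have qE : q n = Num.min T (ratr r).
  rewrite /q /n pickleK max_r// le_min tT ltW//; exact: le_lt_trans ts r1.
have d : `|s - q n| <= h.
  rewrite distrC qE; case: (leP T (ratr r)) => hT; rewrite ger0_norm; lra.
have := hh s (q n) _ _ d; rewrite (le_trans t0 ts) sT.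
have /andP[q1 q2] := qT n; rewrite (le_trans t0 q1) q2 => /(_ isT isT) H.
apply: (@le_trans _ _ ((X (q n) w)%:E + e%:E)%E).
  by rewrite -EFinD lee_fin; move: H; rewrite ler_norml; lra.
by apply: leeD => //; apply: ereal_sup_ubound; exists n.
Qed.

Lemma meas_ge (X : Omega -> \bar R) (e : \bar R) : measurable_fun setT X -> measurable [set w | (e <= X w)%E].
Proof.
move=> mX; have := mX measurableT [set` `[e, +oo[] (emeasurable_itv _).
by congr measurable; apply/seteqP; split => w /=; rewrite in_itv/= andbT => // -[].
Qed.

Lemma ae_cvg_probability W : (forall n, measurable_fun setT (W n)) ->
  {ae P, forall w, forall e : R, 0 < e -> exists N : nat, forall n, (N <= n)%N -> (W n w < e%:E)%E} ->
  cvg_to0_in_probability P W.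
Proof.
move=> mW cW e e0.
have mE n : measurable [set w | (e%:E <= W n w)%E].
  exact: meas_ge.
have e1 n : \int[P]_w \1_[set w | (e%:E <= W n w)%E] w = fine (P [set w | (e%:E <= W n w)%E]).
  by rewrite /Rintegral integral_indic ?setIT.
have h : (fun n => fine (P [set w | (e%:E <= W n w)%E])) @ \oo --> (0 : R).
  under eq_fun do rewrite -e1.
  apply: (@E_dct0 _ _ _ P (fun n => \1_[set w | (e%:E <= W n w)%E]) 1).
  - by move=> n; exact: measurable_indic.
  - apply: filterS cW => w /(_ e e0)[N hN]; apply: cvg_near_cst; exists N => // n /= Nn.
    by rewrite indicE memNset// /=; apply/negP; rewrite -ltNge hN.
  - by apply: aeW => w n; exact: norm_indic_le1.
apply/fine_cvgP; split => //.
by apply: nearW => n; apply: fin_num_measure; exact: mE.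
Qed.

Lemma probability_small W e : cvg_to0_in_probability P W -> (forall n, measurable_fun setT (W n)) -> 0 < e ->
  exists N : nat, forall n, (N <= n)%N -> (P [set w | (e%:E <= W n w)%E] <= e%:E)%E.
Proof.
move=> /(_ e) + mW e0 => /(_ e0) /fine_cvgP[_ /cvgrPdist_le /(_ _ e0)[N _ hN]].
exists N => n Nn; have := hN n Nn; rewrite /= sub0r normrN ger0_norm; last by rewrite fine_ge0.
rewrite -lee_fin fineK// fin_num_measure//.
exact: meas_ge.
Qed.

End Probability.

Section Acproc.
Context {R : realType} {disp : measure_display} {Omega : measurableType disp}.
Variables (P : probability Omega R) (T : R) (F : R -> set (set Omega)).
Implicit Types (X Y : R -> Omega -> R).

Lemma acprocB X Y : acproc P T F X -> acproc P T F Y -> acproc P T F (fun t w => X t w - Y t w).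
Proof.
move=> [aX cX] [aY cY]; split.
  by move=> t tT; apply: measurable_funB; [exact: aX|exact: aY].
by apply: filterS2 cX cY => w; exact: ucontB.
Qed.

Lemma acprocD X Y : acproc P T F X -> acproc P T F Y -> acproc P T F (fun t w => X t w + Y t w).
Proof.
move=> [aX cX] [aY cY]; split.
  by move=> t tT; apply: measurable_funD; [exact: aX|exact: aY].
by apply: filterS2 cX cY => w; exact: ucontD.
Qed.

Lemma acproc_norm X : acproc P T F X -> acproc P T F (fun t w => `|X t w|).
Proof.
move=> [aX cX]; split; last by apply: filterS cX => w; exact: ucont_norm.
by move=> t tT; apply: measurableT_comp => //; exact: aX.
Qed.

End Acproc.

(** * The stochastic integral *)

Section ItoIntegral.
Context {R : realType} {disp : measure_display} {Omega : measurableType disp} {d : nat}.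
Variables (P : probability Omega R) (T : R) (B : R -> Omega -> 'rV[R]_d).
Hypotheses (hP : measure_is_complete P) (T0 : 0 <= T) (hB : brownian_motion P T B).
Local Notation leb := (@completed_lebesgue_measure R).
Let F := brownian_filtration P B.
Let hF : filtration P T F := brownian_filtrationP hB.
Implicit Types (Z : R -> Omega -> 'rV[R]_d) (I : R -> Omega -> R).
Let TT : 0 <= T <= T. Proof. by rewrite T0 lexx. Qed.

Lemma Sspace_acproc X : Sspace P T F X -> acproc P T F X.
Proof.
move=> [pX cX]; split; first exact: (progressive_adapted pX).
by apply: filterS cX => w; exact: within_ucont.
Qed.

Lemma progressive_vecB Z1 Z2 : progressive_vec T F Z1 -> progressive_vec T F Z2 ->
  progressive_vec T F (fun t w => Z1 t w - Z2 t w).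
Proof.
move=> p1 p2 i t tT.
have := progressiveB (p1 i) (p2 i) tT; congr measurable_fun.
by apply/funext => sw /=; rewrite !mxE.
Qed.

Lemma progressive_enorm2 Z : progressive_vec T F Z -> progressive T F (fun t w => enorm (Z t w) ^+ 2).
Proof.
move=> pZ; rewrite (_ : (fun t w => _) = fun t w => \sum_(i < d) Z t w 0 i * Z t w 0 i); last first.
  by apply/funext => t; apply/funext => w; rewrite enorm_sqr; apply: eq_bigr => i _; rewrite expr2.
by apply: progressive_sum => i; apply: progressiveM; exact: pZ.
Qed.

(** On [[0, r]] the [k]-th term vanishes if [r <= t k]; otherwise its coefficient is
    [F (t k)]-measurable, hence [F r]-measurable. *)
Lemma simple_process_progressive m (t : nat -> R) (a : nat -> Omega -> 'rV[R]_d) : simple_integrand T F m t a ->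
  progressive_vec T F (simple_process m t a).
Proof.
move=> [t0 tm tT ha] i.
have t00 k : (k <= m)%N -> 0 <= t k.
  elim: k => [_|k IHk km]; first by rewrite t0.
  exact: le_trans (IHk (ltnW km)) (tm _ km).
rewrite (_ : (fun s w => _) = fun s w => \sum_(k < m) (if t k < s <= t k.+1 then a k w 0 i else 0)); last first.
  apply/funext => s; apply/funext => w; rewrite /simple_process summxE; apply: eq_bigr => k _.
  by case: ifP => // _; rewrite mxE.
apply: progressive_sum => k r rT.
have [ma _] := ha k (ltn_ord k).
have [rt|tr] := leP r (t k).
  apply: (@eq_measurable_fun _ _ _ _ _ (fun=> 0 : R)); last exact: measurable_cst.
  move=> [s w]; rewrite inE /= in_itv/= => -[/andP[_ sr] _].
  by rewrite ltNge (le_trans sr rt).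
have mar : gmeas (F r) (fun w => a k w 0 i).
  have k0 := t00 k (ltnW (ltn_ord k)).
  by apply: (gmeas_filt hF k0 (ltW tr)); [case/andP: rT|exact: ma].
pose h (sw : measurableTypeR R * g_sigma_algebraType (F r)) : R := \1_[set` `]t k, t k.+1]] sw.1 * a k sw.2 0 i.
have mr : measurable_fun setT h.
  apply: measurable_funM; last exact: (measurableT_comp mar measurable_snd).
  exact: (measurableT_comp (f := \1_[set` `]t k, t k.+1]] : measurableTypeR R -> R)).
apply: (@eq_measurable_fun _ _ _ _ _ h); last exact: measurable_funTS.
move=> [s w] _; rewrite /h /= indicE; case: ifP => hs.
  by rewrite mem_set ?mul1r//= in_itv.
by rewrite memNset ?mul0r//= in_itv/= hs.
Qed.

Lemma enorm_int_meas Z : progressive_vec T F Z ->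
  measurable_fun setT (fun w => int_from T 0 (fun s => enorm (Z s w) ^+ 2)).
Proof.
move=> pZ; apply: (gmeas_measT hF TT); apply: (gmeas_int T0 _ TT).
  exact: progressive_enorm2.
by move=> s w _; exact: sqr_ge0.
Qed.

Lemma ito_simple_approx Z I (e : R) : progressive_vec T F Z -> ito_integral P T F B Z I -> 0 < e ->
  exists (x : nat * (nat -> R) * (nat -> Omega -> 'rV[R]_d)),
  [/\ simple_integrand T F x.1.1 x.1.2 x.2,
   (P [set w | e%:E <= int_from T 0 (fun s => enorm (simple_process x.1.1 x.1.2 x.2 s w - Z s w) ^+ 2)%R] <= e%:E)%E &
   (P [set w | e%:E <= sup_from T 0 (fun s => `|simple_integral B x.1.1 x.1.2 x.2 s w - I s w|)%R] <= e%:E)%E].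
Proof.
move=> pZ [hI [m [t [a [ha h1 h2]]]]] e0.
have m1 n : measurable_fun setT (fun w => int_from T 0 (fun s => enorm (simple_process (m n) (t n) (a n) s w - Z s w) ^+ 2)%R).
  by apply: enorm_int_meas; apply: progressive_vecB => //; exact: simple_process_progressive.
have m2 n : measurable_fun setT (fun w => sup_from T 0 (fun s => `|simple_integral B (m n) (t n) (a n) s w - I s w|)%R).
  apply: (sup_from_meas hP hF); first by rewrite lexx.
  apply: acproc_norm; apply: acprocB; last exact: Sspace_acproc.
  by have [] := simp_sqmart T0 hB (simple_simp hB (ha n)).
have [N1 hN1] := probability_small h1 m1 e0; have [N2 hN2] := probability_small h2 m2 e0.
exists (m (maxn N1 N2), t (maxn N1 N2), a (maxn N1 N2)); split => //=.
  by apply: hN1; exact: leq_maxl.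
by apply: hN2; exact: leq_maxr.
Qed.

(** Approximants whose errors exceed [2^-j] with probability at most [2^-j] converge almost surely
    by Borel-Cantelli, which turns a definition in probability into pathwise estimates. *)
Lemma ito_approx Z I : progressive_vec T F Z -> ito_integral P T F B Z I ->
  exists (H : nat -> R -> Omega -> 'rV[R]_d) (M : nat -> R -> Omega -> R),
  (forall j, simp P T B (H j) (M j) /\ progressive_vec T F (H j)) /\
  {ae P, forall w, exists N : nat, forall j, (N <= j)%N ->
    (int_from T 0 (fun s => enorm (H j s w - Z s w) ^+ 2)%R < (2^-1 ^+ j)%:E)%E /\
    (forall s, 0 <= s <= T -> `|M j s w - I s w| <= 2^-1 ^+ j)}.
Proof.
move=> pZ hI; have e0 j : (0 : R) < 2^-1 ^+ j by rewrite exprn_gt0.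
have /choice[x hx] := fun j => ito_simple_approx pZ hI (e0 j).
exists (fun j => simple_process (x j).1.1 (x j).1.2 (x j).2), (fun j => simple_integral B (x j).1.1 (x j).1.2 (x j).2).
split.
  move=> j; have [h _ _] := hx j; split; [exact: simple_simp|exact: simple_process_progressive].
have [hIS _] := hI.
have m1 n : measurable_fun setT (fun w => int_from T 0 (fun s => enorm (simple_process (x n).1.1 (x n).1.2 (x n).2 s w - Z s w) ^+ 2)%R).
  have [h _ _] := hx n.
  by apply: enorm_int_meas; apply: progressive_vecB => //; exact: simple_process_progressive.
have m2 n : measurable_fun setT (fun w => sup_from T 0 (fun s => `|simple_integral B (x n).1.1 (x n).1.2 (x n).2 s w - I s w|)%R).
  have [h _ _] := hx n.
  apply: (sup_from_meas hP hF); first by rewrite lexx.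
  apply: acproc_norm; apply: acprocB; last exact: Sspace_acproc.
  by have [] := simp_sqmart T0 hB (simple_simp hB h).
have := @borel_cantelli_pow _ _ _ P _ (fun j => meas_ge _ (m1 j)) (fun j => let: And3 _ h _ := hx j in h).
have := @borel_cantelli_pow _ _ _ P _ (fun j => meas_ge _ (m2 j)) (fun j => let: And3 _ _ h := hx j in h).
apply: filterS2 => w [N2 hN2] [N1 hN1]; exists (maxn N1 N2) => j; rewrite geq_max => /andP[j1 j2].
split; first by rewrite ltNge; apply/negP; exact: hN1.
move=> s sT; have : (sup_from T 0 (fun s => `|simple_integral B (x j).1.1 (x j).1.2 (x j).2 s w - I s w|)%R < (2^-1 ^+ j)%:E)%E.
  by rewrite ltNge; apply/negP; exact: hN2.
move=> /ltW h; rewrite -lee_fin; apply: le_trans h; apply: ereal_sup_ubound.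
by exists s => //=; rewrite in_itv/=.
Qed.

(** From [x^2 - y^2 = (x - y)^2 + 2 (x - y) y] and Young's inequality with weight [a]: a small [a]
    absorbs the term in [z], whose integral will be merely finite. *)
Lemma enorm_sqr_diff (h z : 'rV[R]_d) (a : R) : 0 < a ->
  `|enorm h ^+ 2 - enorm z ^+ 2| <= (1 + a^-1) * enorm (h - z) ^+ 2 + a * enorm z ^+ 2.
Proof.
move=> a0; rewrite !enorm_sqr -sumrB !mulr_sumr -big_split /=.
apply: (le_trans (ler_norm_sum _ _ _)); apply: ler_sum => i _; rewrite !mxE.
set x := h 0 i; set y := z 0 i.
have e : x ^+ 2 - y ^+ 2 = (x - y) ^+ 2 + 2 * (x - y) * y by ring.
have k : `|2 * (x - y) * y| <= a^-1 * (x - y) ^+ 2 + a * y ^+ 2.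
  have aa : a * a^-1 = 1 by rewrite divff// gt_eqF.
  have ai : 0 < a^-1 by rewrite invr_gt0.
  have p1 : 0 <= a^-1 * ((x - y) - a * y) ^+ 2 by rewrite mulr_ge0 ?sqr_ge0// ltW.
  have p2 : 0 <= a^-1 * ((x - y) + a * y) ^+ 2 by rewrite mulr_ge0 ?sqr_ge0// ltW.
  have q1 : a^-1 * ((x - y) - a * y) ^+ 2 = a^-1 * (x - y) ^+ 2 + (a * a^-1) * (a * y ^+ 2) - (a * a^-1) * (2 * (x - y) * y) by ring.
  have q2 : a^-1 * ((x - y) + a * y) ^+ 2 = a^-1 * (x - y) ^+ 2 + (a * a^-1) * (a * y ^+ 2) + (a * a^-1) * (2 * (x - y) * y) by ring.
  by rewrite q1 aa in p1; rewrite q2 aa in p2; rewrite ler_norml; apply/andP; split; lra.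
rewrite e; apply: (le_trans (ler_normD _ _)); rewrite ger0_norm ?sqr_ge0//.
by move: k; lra.
Qed.

Lemma enorm_sqr_add (h z : 'rV[R]_d) : enorm (h + z) ^+ 2 <= 2 * enorm h ^+ 2 + 2 * enorm z ^+ 2.
Proof.
rewrite !enorm_sqr !mulr_sumr -big_split /=; apply: ler_sum => i _; rewrite !mxE.
have := sqr_ge0 (h 0 i - z 0 i); nra.
Qed.

Lemma enormN (z : 'rV[R]_d) : enorm (- z) = enorm z.
Proof. by rewrite /enorm; congr Num.sqrt; apply: eq_bigr => i _; rewrite !mxE sqrrN. Qed.

Lemma int_from_li Z w : progressive_vec T F Z -> (int_from T 0 (fun s => enorm (Z s w) ^+ 2)%R < +oo)%E ->
  li 0 T (fun s => enorm (Z s w) ^+ 2).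
Proof.
move=> pZ h; apply: li_fin => //; first exact: (progressive_lmeas T0 w (progressive_enorm2 pZ)).
by move=> s _; exact: sqr_ge0.
Qed.

(** The approximants are the differences of those of the two integrals. Their brackets converge
    uniformly in time because [enorm_sqr_diff] leads to a bound by an integral over all of
    [[0, T]]. *)
Lemma itopair_diff Z1 Z2 I1 I2 : progressive_vec T F Z1 -> progressive_vec T F Z2 ->
  ito_integral P T F B Z1 I1 -> ito_integral P T F B Z2 I2 ->
  {ae P, forall w, li 0 T (fun s => enorm (Z1 s w) ^+ 2)} ->
  {ae P, forall w, li 0 T (fun s => enorm (Z2 s w) ^+ 2)} ->
  itopair P T F (fun t w => I1 t w - I2 t w) (itproc (fun s w => enorm (Z1 s w - Z2 s w) ^+ 2)).
Proof.
move=> p1 p2 h1 h2 l1 l2.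
have pZ := progressive_vecB p1 p2; have pE := progressive_enorm2 pZ.
have lZ : {ae P, forall w, li 0 T (fun s => enorm (Z1 s w - Z2 s w) ^+ 2)}.
  apply: filterS2 l1 l2 => w l1 l2.
  apply: (@li_le _ _ _ _ (fun s => 2 * enorm (Z1 s w) ^+ 2 + 2 * enorm (Z2 s w) ^+ 2)).
  - exact: (progressive_lmeas T0 w pE).
  - by move=> s _; rewrite ger0_norm ?sqr_ge0// -[enorm (Z2 s w)]enormN; exact: enorm_sqr_add.
  - by apply: liD; exact: liZ.
split.
- by apply: acprocB; apply: Sspace_acproc; [case: h1|case: h2].
- by apply: (itproc_acproc T0) => // s w _; exact: sqr_ge0.
have [H1 [M1 [s1 c1]]] := ito_approx p1 h1; have [H2 [M2 [s2 c2]]] := ito_approx p2 h2.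
have sd j : simp P T B (fun s w => H1 j s w - H2 j s w) (fun s w => M1 j s w - M2 j s w).
  by apply: simpB; [exact: (s1 j).1|exact: (s2 j).1].
exists (fun j s w => M1 j s w - M2 j s w), (fun j => qvar (fun s w => H1 j s w - H2 j s w)).
split.
  move=> j; have [a1 a2 a3 a4] := simp_sqmart T0 hB (sd j); split => //.
  move=> w; split; last by rewrite /qvar /itproc lint_set1.
  by have [E [C [_ z _]]] := sd j; exact: z.
apply: filterS2 (filterI c1 c2) lZ => w [[N1 hN1] [N2 hN2]] lz e e0.
pose z s := enorm (Z1 s w - Z2 s w) ^+ 2.
pose S := \int[leb]_(s in `[0, T]) z s.
have S0 : 0 <= S by apply: Rintegral_ge0 => s _; exact: sqr_ge0.
(* [a] makes the term [a * S] at most [e / 2]; [dl] below does the same for [1 + a^-1] times the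
   integral of [v], which is at most [4 * r]. *)
pose a := e / (2 * (S + 1)).
have a0 : 0 < a by rewrite divr_gt0// mulr_gt0// ltr_wpDl.
have ai : 0 < 1 + a^-1 by rewrite addr_gt0// invr_gt0.
have cv : (2^-1 : R) ^+ n @[n --> \oo] --> (0 : R) by apply: cvg_expr; rewrite ger0_norm// invf_lt1// ltr1n.
pose dl := Num.min (e / 2) (e / (2 * (1 + a^-1) * 4)).
have dl0 : 0 < dl by rewrite lt_min !divr_gt0// !mulr_gt0.
move/cvgrPdist_le : cv => /(_ _ dl0)[N3 _ hN3].
exists (maxn (maxn N1 N2) N3) => j; rewrite !geq_max => /andP[/andP[j1 j2] j3] t tT.
have := hN3 j j3; rewrite /= sub0r normrN ger0_norm ?exprn_ge0//.
set r := 2^-1 ^+ j; rewrite le_min => /andP[r1 r2].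
have [q1 m1] := hN1 j j1; have [q2 m2] := hN2 j j2.
split.
  rewrite (_ : _ - _ = (M1 j t w - I1 t w) - (M2 j t w - I2 t w)); last by ring.
  apply: (le_trans (ler_normB _ _)); have := m1 t tT; have := m2 t tT; rewrite -/r; lra.
have ld1 : li 0 T (fun s => enorm (H1 j s w - Z1 s w) ^+ 2).
  exact: (int_from_li (progressive_vecB (proj2 (s1 j)) p1) (lt_trans q1 (ltry _))).
have ld2 : li 0 T (fun s => enorm (H2 j s w - Z2 s w) ^+ 2).
  exact: (int_from_li (progressive_vecB (proj2 (s2 j)) p2) (lt_trans q2 (ltry _))).
pose u s := enorm (H1 j s w - H2 j s w) ^+ 2.
pose v s := enorm ((H1 j s w - H2 j s w) - (Z1 s w - Z2 s w)) ^+ 2.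
have vle s : v s <= 2 * enorm (H1 j s w - Z1 s w) ^+ 2 + 2 * enorm (H2 j s w - Z2 s w) ^+ 2.
  rewrite /v (_ : _ - _ = (H1 j s w - Z1 s w) + - (H2 j s w - Z2 s w)); last first.
    by rewrite !opprB addrACA [RHS]addrACA; congr (_ + _); rewrite addrC.
  by apply: (le_trans (enorm_sqr_add _ _)); rewrite enormN.
have lv : li 0 T v.
  apply: (@li_le _ _ _ _ (fun s => 2 * enorm (H1 j s w - Z1 s w) ^+ 2 + 2 * enorm (H2 j s w - Z2 s w) ^+ 2)).
  - exact: (progressive_lmeas T0 w (progressive_enorm2 (progressive_vecB (progressive_vecB (proj2 (s1 j)) (proj2 (s2 j))) pZ))).
  - by move=> s _; rewrite ger0_norm ?sqr_ge0.
  - by apply: liD; exact: liZ.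
have lu : li 0 T u.
  apply: (@li_le _ _ _ _ (fun s => 2 * v s + 2 * z s)).
  - exact: (progressive_lmeas T0 w (progressive_enorm2 (progressive_vecB (proj2 (s1 j)) (proj2 (s2 j))))).
  - move=> s _; rewrite ger0_norm ?sqr_ge0// /u /v /z.
    rewrite -{1}(subrK (Z1 s w - Z2 s w) (H1 j s w - H2 j s w)); exact: enorm_sqr_add.
  - by apply: liD; exact: liZ.
have /andP[t0 tT'] := tT.
have lt x : li 0 T x -> li 0 t x by exact: liS (lexx _) tT'.
rewrite /qvar /itproc -/u -/z -RintegralB//; [|exact: cmeasurable_itv|exact: lt|exact: lt].
apply: (le_trans (lint_norm (liB (lt _ lu) (lt _ lz)))).
apply: (@le_trans _ _ (\int[leb]_(s in `[0, T]) ((1 + a^-1) * v s + a * z s))).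
  have l3 : li 0 T (fun s => `|u s - z s|) by apply: li_norm; exact: liB.
  have l4 : li 0 T (fun s => (1 + a^-1) * v s + a * z s) by apply: liD; exact: liZ.
  rewrite [leRHS](lint_add t0 tT' l4) -[leLHS]addr0 lerD//.
    by apply: lint_le; [exact: lt|exact: lt|move=> s _; exact: enorm_sqr_diff].
  apply: Rintegral_ge0 => s _; rewrite addr_ge0// mulr_ge0 ?sqr_ge0// ltW//.
have mI := @cmeasurable_itv R `[0, T].
rewrite RintegralD//; [|exact: liZ|exact: liZ].
rewrite RintegralZl// RintegralZl//.
have b1 : \int[leb]_(s in `[0, T]) v s <= 4 * r.
  apply: (@le_trans _ _ (\int[leb]_(s in `[0, T]) (2 * enorm (H1 j s w - Z1 s w) ^+ 2 + 2 * enorm (H2 j s w - Z2 s w) ^+ 2))).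
    by apply: lint_le => //; apply: liD; exact: liZ.
  rewrite RintegralD//; [|exact: liZ|exact: liZ]; rewrite RintegralZl// RintegralZl//.
  have q1' := ltW (lint_lt ld1 q1); have q2' := ltW (lint_lt ld2 q2).
  exact: le_two_two q1' q2'.
have b2 : (1 + a^-1) * \int[leb]_(s in `[0, T]) v s <= e / 2.
  apply: (@le_trans _ _ ((1 + a^-1) * (4 * (e / (2 * (1 + a^-1) * 4))))).
    rewrite ler_wpM2l ?(ltW ai)//; apply: (le_trans b1); rewrite ler_wpM2l//.
  rewrite le_eqVlt; apply/orP; left; apply/eqP; field.
  by rewrite gt_eqF//= gt_eqF// addr_gt0.
have b3 : a * S <= e / 2.
  rewrite /a mulrAC ler_pdivrMr; last by rewrite mulr_gt0// ltr_wpDl.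
  rewrite (_ : e / 2 * (2 * (S + 1)) = e * (S + 1)); last by field.
  by rewrite (ler_wpM2l (ltW e0))// lerDl.
by rewrite -/S [leRHS](splitr e); apply: lerD; [exact: b2|exact: b3].
Qed.

(** Diagonal choice: the [j]-th simple integrand approximates [Zn j] up to [2^-j], outside an event
    of probability at most [2^-j]; Borel-Cantelli and the triangle inequality compare it with
    [Z]. *)
Lemma ito_integral_lim (Zn : nat -> R -> Omega -> 'rV[R]_d) (In : nat -> R -> Omega -> R) Z I :
  (forall j, progressive_vec T F (Zn j)) -> progressive_vec T F Z -> Sspace P T F I ->
  (forall j, ito_integral P T F B (Zn j) (In j)) ->
  {ae P, forall w, forall e : R, 0 < e -> exists N : nat, forall j, (N <= j)%N ->
    (int_from T 0 (fun s => enorm (Zn j s w - Z s w) ^+ 2)%R < e%:E)%E /\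
    (sup_from T 0 (fun s => `|In j s w - I s w|)%R < e%:E)%E} ->
  ito_integral P T F B Z I.
Proof.
move=> pn pZ sI hI cv; split => //.
have e0 j : (0 : R) < 2^-1 ^+ j by rewrite exprn_gt0.
have /choice[x hx] := fun j => ito_simple_approx (pn j) (hI j) (e0 j).
exists (fun j => (x j).1.1), (fun j => (x j).1.2), (fun j => (x j).2).
pose H j := simple_process (x j).1.1 (x j).1.2 (x j).2.
pose M j := simple_integral B (x j).1.1 (x j).1.2 (x j).2.
have pH j : progressive_vec T F (H j) by have [h _ _] := hx j; exact: simple_process_progressive.
have aM j : acproc P T F (M j).
  by have [h _ _] := hx j; have [] := simp_sqmart T0 hB (simple_simp hB h).
have m1 j : measurable_fun setT (fun w => int_from T 0 (fun s => enorm (H j s w - Zn j s w) ^+ 2)%R).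
  by apply: enorm_int_meas; exact: progressive_vecB.
have m2 j : measurable_fun setT (fun w => sup_from T 0 (fun s => `|M j s w - In j s w|)%R).
  apply: (sup_from_meas hP hF); first by rewrite lexx.
  by apply: acproc_norm; apply: acprocB => //; apply: Sspace_acproc; case: (hI j).
have bc1 := @borel_cantelli_pow _ _ _ P _ (fun j => meas_ge _ (m1 j)) (fun j => let: And3 _ h _ := hx j in h).
have bc2 := @borel_cantelli_pow _ _ _ P _ (fun j => meas_ge _ (m2 j)) (fun j => let: And3 _ _ h := hx j in h).
have small (e : R) : 0 < e -> exists N : nat, forall j, (N <= j)%N -> (2^-1 : R) ^+ j <= e.
  move=> e1; have : (2^-1 : R) ^+ n @[n --> \oo] --> (0 : R) by apply: cvg_expr; rewrite ger0_norm// invf_lt1// ltr1n.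
  move/cvgrPdist_le => /(_ _ e1)[N _ hN]; exists N => j Nj.
  by have := hN j Nj; rewrite /= sub0r normrN ger0_norm// exprn_ge0.
split; first by move=> n; have [] := hx n.
  apply: ae_cvg_probability.
    by move=> n; apply: enorm_int_meas; exact: progressive_vecB (pH n) pZ.
  apply: filterS2 bc1 cv => w [N1 hN1] cw e e1.
  have e4 : 0 < e / 4 by rewrite divr_gt0.
  have [N2 hN2] := cw _ e4; have [N3 hN3] := small _ e4.
  exists (maxn N1 (maxn N2 N3)) => j; rewrite !geq_max => /and3P[j1 j2 j3].
  have k1 : (int_from T 0 (fun s => enorm (H j s w - Zn j s w) ^+ 2)%R < (2^-1 ^+ j)%:E)%E.
    by rewrite ltNge; apply/negP; exact: hN1.
  have [k2 _] := hN2 j j2; have k3 := hN3 j j3.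
  have l1 := int_from_li (progressive_vecB (pH j) (pn j)) (lt_trans k1 (ltry _)).
  have l2 := int_from_li (progressive_vecB (pn j) pZ) (lt_trans k2 (ltry _)).
  have l3 : li 0 T (fun s => 2 * enorm (H j s w - Zn j s w) ^+ 2 + 2 * enorm (Zn j s w - Z s w) ^+ 2).
    by apply: liD; exact: liZ.
  have le3 s : enorm (H j s w - Z s w) ^+ 2 <= 2 * enorm (H j s w - Zn j s w) ^+ 2 + 2 * enorm (Zn j s w - Z s w) ^+ 2.
    rewrite (_ : H j s w - Z s w = (H j s w - Zn j s w) + (Zn j s w - Z s w)); first exact: enorm_sqr_add.
    by rewrite addrA subrK.
  have l4 : li 0 T (fun s => enorm (H j s w - Z s w) ^+ 2)%R.
    apply: li_le l3; last by move=> s _; rewrite ger0_norm ?sqr_ge0.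
    exact: (progressive_lmeas T0 w (progressive_enorm2 (progressive_vecB (pH j) pZ))).
  rewrite /int_from -/(H j) li_EFin// lte_fin.
  have mI := @cmeasurable_itv R `[0, T].
  apply: (le_lt_trans (lint_le l4 l3 (fun s _ => le3 s))).
  rewrite RintegralD//; [|exact: liZ|exact: liZ]; rewrite RintegralZl// RintegralZl//.
  exact: lt_quarters (lint_lt l1 k1) (lint_lt l2 k2) k3.
apply: ae_cvg_probability.
  move=> n; apply: (sup_from_meas hP hF); first by rewrite lexx.
  by apply: acproc_norm; apply: acprocB (aM n) _; exact: Sspace_acproc.
apply: filterS2 bc2 cv => w [N1 hN1] cw e e1.
have e4 : 0 < e / 4 by rewrite divr_gt0.
have [N2 hN2] := cw _ e4; have [N3 hN3] := small _ e4.
exists (maxn N1 (maxn N2 N3)) => j; rewrite !geq_max => /and3P[j1 j2 j3].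
have k1 : (sup_from T 0 (fun s => `|M j s w - In j s w|)%R < (2^-1 ^+ j)%:E)%E.
  by rewrite ltNge; apply/negP; exact: hN1.
have [_ k2] := hN2 j j2; have k3 := hN3 j j3.
apply: (@le_lt_trans _ _ ((e / 2)%:E)%E); last by rewrite lte_fin; lra.
apply: ge_ereal_sup => _ [s sT <-]; rewrite lee_fin -/(M j).
have b1 : `|M j s w - In j s w| <= 2^-1 ^+ j.
  by rewrite -lee_fin; apply: le_trans (ltW k1); apply: ereal_sup_ubound; exists s.
have b2 : `|In j s w - I s w| <= e / 4.
  by rewrite -lee_fin; apply: le_trans (ltW k2); apply: ereal_sup_ubound; exists s.
have := ler_distD (In j s w) (M j s w) (I s w); lra.
Qed.

End ItoIntegral.

(** * Real powers *)

Section Powers.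
Context {R : realType}.
Implicit Types (a b x p : R).

Lemma powR_le a b p : 0 <= p -> 0 <= a -> a <= b -> a `^ p <= b `^ p.
Proof. by move=> p0 a0 ab; apply: ge0_ler_powR => //; rewrite nnegrE// (le_trans a0). Qed.

Lemma powR_add_le a b p : 0 <= p -> 0 <= a -> 0 <= b -> (a + b) `^ p <= 2 `^ p * (a `^ p + b `^ p).
Proof.
move=> p0 a0 b0; case: (leP a b) => ab.
  apply: (@le_trans _ _ ((2 * b) `^ p)); first by apply: powR_le; rewrite ?addr_ge0//; lra.
  by rewrite powRM// ler_wpM2l ?powR_ge0// lerDr powR_ge0.
apply: (@le_trans _ _ ((2 * a) `^ p)); first by apply: powR_le; rewrite ?addr_ge0//; lra.
by rewrite powRM// ler_wpM2l ?powR_ge0// lerDl powR_ge0.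
Qed.

Lemma powRK a p : 0 < p -> 0 <= a -> (a `^ p) `^ p^-1 = a.
Proof. by move=> p0 a0; rewrite -powRrM divff ?gt_eqF// powRr1. Qed.

Lemma powRVK a p : 0 < p -> 0 <= a -> (a `^ p^-1) `^ p = a.
Proof. by move=> p0 a0; rewrite -powRrM mulVf ?gt_eqF// powRr1. Qed.

(** Away from 0 the power is differentiable; at 0 the level [e] is written as the power of its own
    root. *)
Lemma powR_cvg (x : nat -> R) l p : 0 < p -> (forall n, 0 <= x n) ->
  x @ \oo --> l -> (fun n => x n `^ p) @ \oo --> l `^ p.
Proof.
move=> p0 x0 xl.
have l0 : 0 <= l.
  rewrite -(cvg_lim _ xl)//; apply: limr_ge; first by apply/cvg_ex; exists l.
  exact: nearW.
move: l0; rewrite le_eqVlt => /predU1P[l0|l0]; last first.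
  have [dp _] := is_derive1_powR p l0.
  have c : {for l, continuous (fun a : R => a `^ p)}.
    by apply/differentiable_continuous; apply/derivable1_diffP.
  exact: (cvg_comp _ _ xl c).
rewrite -l0 powR0 ?gt_eqF//; apply/cvgrPdist_le => e e0.
have e1 : 0 < e `^ p^-1 by exact: powR_gt0.
rewrite -l0 in xl; move/cvgrPdist_le : xl => /(_ _ e1); apply: filterS => n.
rewrite !sub0r !normrN => h; rewrite ger0_norm ?powR_ge0//.
rewrite -[leRHS](powRVK p0 (ltW e0)); apply: powR_le => //; first exact: ltW.
exact: le_trans (ler_norm _) h.
Qed.

End Powers.

(** * Suprema of paths as real numbers *)

Section PathSup.
Context {R : realType}.
Variable T : R.
Hypothesis T0 : 0 <= T.
Implicit Types (x : R -> R) (C p : R).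

(* 0 for an unbounded path. *)
Definition psup x : R := fine (sup_from T 0 (fun s => `|x s|)).

Lemma sup_from_le (y : R -> R) (C : \bar R) : (forall s, 0 <= s <= T -> ((y s)%:E <= C)%E) ->
  (sup_from T 0 y <= C)%E.
Proof. by move=> h; apply: ge_ereal_sup => _ [s /= + <-]; rewrite in_itv/=; exact: h. Qed.

Lemma sup_from_ge (y : R -> R) s : 0 <= s <= T -> ((y s)%:E <= sup_from T 0 y)%E.
Proof. by move=> sT; apply: ereal_sup_ubound; exists s => //=; rewrite in_itv. Qed.

Lemma psup_fin x C : (forall s, 0 <= s <= T -> `|x s| <= C) ->
  sup_from T 0 (fun s => `|x s|) = (psup x)%:E.
Proof.
move=> h; rewrite /psup fineK// ge0_fin_numE.
  by apply: (@le_lt_trans _ _ C%:E); rewrite ?ltry//; apply: sup_from_le => s sT; rewrite lee_fin h.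
apply: le_trans (sup_from_ge (fun s => `|x s|) (s := 0) _); last by rewrite lexx.
by rewrite lee_fin.
Qed.

Lemma psup_le x C : (forall s, 0 <= s <= T -> `|x s| <= C) -> psup x <= C.
Proof.
move=> h; rewrite -lee_fin -(psup_fin h).
by apply: sup_from_le => s sT; rewrite lee_fin h.
Qed.

Lemma psup_ge x C s : (forall s, 0 <= s <= T -> `|x s| <= C) -> 0 <= s <= T -> `|x s| <= psup x.
Proof. by move=> h sT; rewrite -lee_fin -(psup_fin h); exact: (sup_from_ge (fun s => `|x s|)). Qed.

Lemma psup_ge0 x : 0 <= psup x.
Proof.
rewrite /psup fine_ge0//; apply: le_trans (sup_from_ge (fun s => `|x s|) (s := 0) _); last by rewrite lexx.
by rewrite lee_fin.
Qed.

(** The powers with exponents [p] and [1 / p] are both increasing, which gives one inequality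
    each. *)
Lemma psup_pow x C p : 0 < p -> (forall s, 0 <= s <= T -> `|x s| <= C) ->
  sup_from T 0 (fun s => `|x s| `^ p) = (psup x `^ p)%:E.
Proof.
move=> p0 h; apply/eqP; rewrite eq_le; apply/andP; split.
  by apply: sup_from_le => s sT; rewrite lee_fin powR_le ?(ltW p0)//; exact: (psup_ge h).
set S := sup_from _ _ _.
have S0 : (0 <= S)%E.
  apply: le_trans (sup_from_ge (fun s => `|x s| `^ p) (s := 0) _); last by rewrite lexx.
  by rewrite lee_fin powR_ge0.
have Sf : S \is a fin_num.
  rewrite ge0_fin_numE//; apply: (@le_lt_trans _ _ (C `^ p)%:E); rewrite ?ltry//.
  by apply: sup_from_le => s sT; rewrite lee_fin powR_le ?(ltW p0)// h.
rewrite -(fineK Sf) lee_fin -[leRHS](powRVK p0 (fine_ge0 S0)) powR_le ?(ltW p0) ?psup_ge0//.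
apply: psup_le => s sT; rewrite -[leLHS](powRK p0)// powR_le ?invr_ge0 ?(ltW p0) ?powR_ge0//.
by rewrite -lee_fin fineK//; exact: (sup_from_ge (fun s => `|x s| `^ p)).
Qed.

End PathSup.

(** * Monotone majorants and first passage on a grid *)

Section Passage.
Context {R : realType} {disp : measure_display} {Omega : measurableType disp}.
Variables (P : probability Omega R) (T : R) (F : R -> set (set Omega)).
Hypotheses (hP : measure_is_complete P) (T0 : 0 <= T) (hF : filtration P T F).
Local Notation integ := (integ P).
Implicit Types (X U : R -> Omega -> R) (A : set Omega).

Lemma psup_meas X : acproc P T F X -> measurable_fun setT (fun w => psup T (X ^~ w)).
Proof.
move=> aX; have TT : 0 <= (0 : R) <= T by rewrite lexx.
apply: (measurableT_comp (f := fine)); first exact: fine_measurable.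
by apply: (@sup_from_meas _ _ _ _ hP T F (fun s w => `|X s w|)) => //; exact: acproc_norm.
Qed.

(** Monotone convergence as a source of one integrable majorant for a whole increasing sequence. The
    limit is taken as an upper limit, which is measurable on all of [Omega], and made real-valued,
    being finite almost surely. *)
Lemma mono_E (f : nat -> Omega -> R) (c : R) : (forall n, integ (f n)) -> (forall n w, 0 <= f n w) ->
  {ae P, forall w, forall n, f n w <= f n.+1 w} -> (forall n, \int[P]_w f n w <= c) ->
  exists g : Omega -> R, [/\ integ g, \int[P]_w g w <= c, forall w, 0 <= g w &
    {ae P, forall w, forall n, f n w <= g w}].
Proof.
move=> iF f0 fm fc.
pose G w := limn_esup (fun n => (f n w)%:E).
have mG : measurable_fun setT G.
  apply: (@measurable_fun_limn_esup _ _ _ _ (fun n w => (f n w)%:E)) => n.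
  by apply/measurable_EFinP; exact: integ_meas (iF n).
have cG : {ae P, forall w, (fun n => (f n w)%:E) @ \oo --> G w}.
  apply: filterS fm => w h; rewrite /G.
  have nd : nondecreasing_seq (fun n => (f n w)%:E).
    by apply/nondecreasing_seqP => n; rewrite lee_fin.
  have c1 := ereal_nondecreasing_cvgn nd.
  rewrite is_cvg_limn_esupE; first by rewrite (cvg_lim _ c1).
  by apply/cvg_ex; eexists; exact: c1.
have G0 w : (0 <= G w)%E.
  apply: le_trans (limn_einf_sup _).
  rewrite limn_einf_lim; apply: lime_ge; first exact: is_cvg_einfs.
  apply: nearW => n; apply: le_ereal_inf_tmp => _ [m _ <-]; by rewrite lee_fin.
have Gc : (\int[P]_w G w <= c%:E)%E.
  have e : (\int[P]_w G w = \int[P]_w limn_einf (fun n => (f n w)%:E))%E.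
    apply: ae_eq_integral => //.
    - have -> : (fun w => limn_einf (fun n => (f n w)%:E)) = (fun w => (- limn_esup (fun n => (- f n w)%:E))%E).
        by apply/funext => w; rewrite -limn_einfN; congr limn_einf; apply/funext => n /=; rewrite opprK.
      apply: measurableT_comp => //; apply: (@measurable_fun_limn_esup _ _ _ _ (fun n w => (- f n w)%:E)) => n.
      by apply/measurable_EFinP; apply: measurableT_comp => //; exact: integ_meas (iF n).
    - apply: filterS cG => w h _; rewrite is_cvg_limn_einfE; first by rewrite (cvg_lim _ h).
      by apply/cvg_ex; exists (G w).
  rewrite e; apply: (le_trans (fatou _ measurableT _ _)).
  - by move=> n; apply/measurable_EFinP; exact: integ_meas (iF n).
  - by move=> n w _; rewrite lee_fin.
  rewrite limn_einf_lim; apply: lime_le; first exact: is_cvg_einfs.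
  apply: nearW => n; apply: (@le_trans _ _ (\int[P]_w (f n w)%:E)%E).
    by apply: ereal_inf_lbound; exists n => //=.
  by rewrite EFin_E// lee_fin; exact: fc.
have iG : P.-integrable setT G.
  apply/integrableP; split => //; rewrite (_ : (\int[P]_w `|G w| = \int[P]_w G w)%E).
    exact: le_lt_trans Gc (ltry _).
  by apply: eq_integral => w _; rewrite gee0_abs.
have fG := integrable_ae measurableT iG.
have mg : measurable_fun setT (fun w => fine (G w)).
  by apply: (measurableT_comp (f := fine)); [exact: fine_measurable|].
have e2 : (\int[P]_w (fine (G w))%:E = \int[P]_w G w)%E.
  apply: ae_eq_integral => //; first exact/measurable_EFinP.
  by apply: filterS fG => w /(_ I) h _; rewrite fineK.
have ig : integ (fun w => fine (G w)).
  apply/integrableP; split; first exact/measurable_EFinP.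
  rewrite (_ : (\int[P]_w `|(EFin \o (fun w => fine (G w))) w| = \int[P]_w G w)%E).
    exact: le_lt_trans Gc (ltry _).
  rewrite -e2; apply: eq_integral => w _; rewrite /= ger0_norm//.
  exact: fine_ge0.
exists (fun w => fine (G w)); split => //.
- by rewrite -lee_fin -EFin_E// e2.
- by move=> w; exact: fine_ge0.
apply: filterS2 (filterI fm cG) fG => w [h1 h2] /(_ I) h3 n.
rewrite -lee_fin fineK// -(cvg_lim _ h2)//; apply: lime_ge; first by apply/cvg_ex; exists (G w).
exists n => // m /= nm; rewrite lee_fin; elim: m nm => [|m IHm]; first by rewrite leqn0 => /eqP ->.
by rewrite leq_eqVlt => /predU1P[->//|nm]; exact: le_trans (IHm nm) (h1 m).
Qed.

(** [D i] is the event of [A] that [i] is the first index with [U (r i)] positive. It is known at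
    [r i], so the hypothesis on [G] applies to it; the [D i] are disjoint, and their union is the
    event on the right-hand side. *)
Lemma grid_passage (U G : R -> Omega -> R) (Gam : Omega -> R) A (r : nat -> R) N :
  0 <= r 0%N -> {homo r : i j / (i <= j)%N >-> i <= j} -> r N <= T -> F (r 0%N) A ->
  adapted T F U -> integ Gam -> (forall t, 0 <= t <= T -> measurable_fun setT (G t)) ->
  (forall t w, 0 <= G t w) ->
  (forall t D, 0 <= t <= T -> F t D -> D `<=` A -> integ (fun w => \1_D w * G t w) /\
     \int[P]_w (\1_D w * G t w) <= \int[P]_w (\1_D w * Gam w)) ->
  exists (D : 'I_N.+1 -> set Omega),
  [/\ forall i, measurable (D i), forall w, (exists i, D i w) <-> A w /\ exists2 i : nat, (i <= N)%N & 0 < U (r i) w,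
   forall i w, D i w -> [/\ A w, 0 < U (r i) w & forall j, (j < i)%N -> U (r j) w <= 0] &
   integ (fun w => \sum_(i < N.+1) \1_(D i) w * G (r i) w) /\
   \int[P]_w (\sum_(i < N.+1) \1_(D i) w * G (r i) w) <=
   \int[P]_w (\1_[set w | A w /\ exists2 i : nat, (i <= N)%N & 0 < U (r i) w] w * Gam w)].
Proof.
move=> r0 rnd rT FA aU iGam mG G0 hG.
have ri i : (i <= N)%N -> 0 <= r i <= T.
  by move=> iN; rewrite (le_trans r0 (rnd _ _ (leq0n i))) (le_trans (rnd _ _ iN) rT).
pose B i := [set w | A w /\ forall j, (j < i)%N -> U (r j) w <= 0].
have mono i j D : (i <= j)%N -> (j <= N)%N -> F (r i) D -> F (r j) D.
  move=> ij jN; apply: (filtration_mono hF _ (rnd _ _ ij)); first by case/andP: (ri i (leq_trans ij jN)).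
  by case/andP: (ri j jN).
have lev i c : (i <= N)%N -> F (r i) [set w | c < U (r i) w].
  move=> iN; have := (gmeasE _ (filtration_sub hF (ri _ iN))).1 (aU _ (ri _ iN)) [set` `]c, +oo[] (measurable_itv _).
  by congr (F _ _); apply/seteqP; split => w /=; rewrite in_itv/= andbT.
have FB i k : (i <= k.+1)%N -> (k <= N)%N -> F (r k) (B i).
  elim: i k => [|i IHi] k ik kN.
    rewrite (_ : B 0%N = A); first exact: mono FA.
    by apply/seteqP; split => w => [[]|Aw]//; split.
  rewrite (_ : B i.+1 = B i `&` ~` [set w | 0 < U (r i) w]).
    have hk := filtration_sub hF (ri _ kN).
    apply: (subsigmaI hk); first by apply: IHi => //; exact: ltnW.
    apply: (subsigmaC hk); apply: (mono i) => //; apply: lev; exact: (@leq_trans k).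
  apply/seteqP; split => w /=.
    move=> [Aw h]; split; first by split => // j ji; apply: h; exact: ltnW.
    by apply/negP; rewrite -leNgt h.
  move=> [[Aw h] /negP]; rewrite -leNgt => hi; split => // j.
  by rewrite ltnS leq_eqVlt => /predU1P[->//|]; exact: h.
pose D (i : 'I_N.+1) := B i `&` [set w | 0 < U (r i) w].
have iN (i : 'I_N.+1) : (i <= N)%N by rewrite -ltnS.
have FD (i : 'I_N.+1) : F (r i) (D i).
  by apply: (subsigmaI (filtration_sub hF (ri _ (iN i)))); [exact: FB|exact: lev].
have mD (i : 'I_N.+1) : measurable (D i) by exact: (filt_meas hF (ri _ (iN i)) (FD i)).
have DA (i : 'I_N.+1) : D i `<=` A by move=> w [[]].
have first w : A w -> (exists2 i : nat, (i <= N)%N & 0 < U (r i) w) -> exists i, D i w.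
  move=> Aw [i0 i0N hi0].
  have ex : exists i, (i <= N)%N && (0 < U (r i) w) by exists i0; rewrite i0N.
  case: (ex_minnP ex) => i /andP[iN' hi] hmin.
  have iN'' : (i < N.+1)%N by [].
  exists (Ordinal iN''); split => //; split => // j ji; rewrite leNgt; apply/negP => hj.
  by have := hmin j; rewrite hj (leq_trans (ltnW ji) iN') => /(_ isT); rewrite leqNgt ji.
have Diff w : (exists i, D i w) <-> A w /\ exists2 i : nat, (i <= N)%N & 0 < U (r i) w.
  split; last by move=> [Aw]; exact: first.
  by move=> [i [[Aw _] hi]]; split => //; exists i.
have disj w (i j : 'I_N.+1) : D i w -> D j w -> i = j.
  move=> [[_ h1] h2] [[_ h3] h4]; apply: val_inj; apply/eqP; rewrite eqn_leq; apply/andP; split.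
    by rewrite leqNgt; apply/negP => /h1; rewrite leNgt => /negP; apply.
  by rewrite leqNgt; apply/negP => /h3; rewrite leNgt => /negP; apply.
have h (i : 'I_N.+1) := hG _ _ (ri _ (iN i)) (FD i) (DA i).
exists D; split => //.
  by move=> i w [[Aw h1] h2]; split.
have ii (i : 'I_N.+1) : integ (fun w => \1_(D i) w * G (r i) w) by exact: (h i).1.
split; first exact: integ_sum.
rewrite Esum//; apply: (@le_trans _ _ (\sum_(i < N.+1) \int[P]_w (\1_(D i) w * Gam w))).
  by apply: ler_sum => i _; exact: (h i).2.
rewrite -Esum; last by move=> i; exact: integ_indicM.
set E0 := [set w | A w /\ _].
rewrite le_eqVlt; apply/orP; left; apply/eqP; apply: eq_E => w.
case: (pselect (exists i, D i w)) => [[i Diw]|nD]; last first.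
  rewrite [\1_E0 w]indicE memNset ?mul0r; last by move=> /= /Diff.
  by rewrite big1// => i _; rewrite indicE memNset ?mul0r// => Di; apply: nD; exists i.
rewrite [\1_E0 w]indicE mem_set; last by apply/Diff; exists i.
rewrite (bigD1 i)//= indicE mem_set// mul1r big1 ?addr0// => j ji.
by rewrite indicE memNset ?mul0r// => Dj; rewrite (disj _ _ _ Diw Dj) eqxx in ji.
Qed.

End Passage.

(** * Skorokhod condition *)

Section Skorokhod.
Context {R : realType}.
Variable T : R.
Hypothesis T0 : 0 <= T.
Implicit Types (k h : R -> R).

Lemma stieltjes_itv (k0 : cumulative R R) (r s : R) : r <= s ->
  lebesgue_stieltjes_measure k0 `]r, s]%classic = (k0 s - k0 r)%:E.
Proof.
move=> rs; rewrite /lebesgue_stieltjes_measure /measure_extension/= measurable_mu_extE/=; last exact: is_ocitv.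
move: rs; rewrite le_eqVlt => /predU1P[->|rs]; last by rewrite wlength_itv_bnd// ltW.
by rewrite subrr set_itvoc0 wlength0.
Qed.

(** A nonnegative function with zero integral vanishes [dk]-almost everywhere, so []r, s]], where
    [h] is positive, has [dk]-measure 0. *)
Lemma flat_of_stieltjes k h (r s : R) : is_stieltjes_integral T k h 0%E ->
  measurable_fun ([set` `[0, T]] : set (measurableTypeR R)) h ->
  (forall u, 0 <= u <= T -> 0 <= h u) ->
  0 <= r -> r <= s -> s <= T -> (forall u, r < u <= s -> 0 < h u) -> k r = k s.
Proof.
move=> [k0 [kE]] + mh h0 r0 rs sT hu.
have sub : (`]0%R, T] `<=` `[0%R, T])%classic by move=> u /=; rewrite !in_itv/= => /andP[/ltW -> ->].
have mh' : measurable_fun ([set` `]0, T]] : set (measurableTypeR R)) (EFin \o h).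
  apply/measurable_EFinP; apply: measurable_funS mh => //; exact: (@measurable_itv R `[0, T]).
have m0 : measurable ([set` `]0, T]] : set (measurableTypeR R)) by exact: measurable_itv.
have e : (\int[lebesgue_stieltjes_measure k0]_(u in `]0%R, T]) (h u)%:E =
   \int[lebesgue_stieltjes_measure k0]_(u in `]0%R, T]) `|(h u)%:E|)%E.
  apply: eq_integral => u; rewrite inE /= in_itv/= => /andP[u0 uT].
  by rewrite ger0_norm// h0// uT ltW.
rewrite e => /(ae_eq_integral_abs _ m0 mh') [N [mN N0 hN]].
have le0 : (lebesgue_stieltjes_measure k0 `]r, s]%classic <= lebesgue_stieltjes_measure k0 N)%E.
  apply: le_measure; rewrite ?inE//.
  move=> u /= rus; apply: hN => /= H; move: rus; rewrite in_itv/= => rus.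
  have /andP[ru us] := rus.
  have := H _; rewrite in_itv/= (le_lt_trans r0 ru) (le_trans us sT) => /(_ isT) [].
  by move=> hu0; have := hu u rus; rewrite hu0 ltxx.
have ge0 : (0 <= lebesgue_stieltjes_measure k0 `]r, s]%classic)%E by [].
move: le0 ge0; rewrite N0 (stieltjes_itv k0 rs) !lee_fin !kE ?r0 ?sT ?(le_trans r0 rs) ?(le_trans rs sT)//.
by lra.
Qed.

(** By continuity every point of []0, T]] where [h] is positive lies in an interval with rational
    ends, clipped to [[0, T]], on which [h] stays positive. [k] is flat there, so [dk] does not
    charge it, and these intervals are countably many. *)
Lemma stieltjes_of_flat k h : ucont T k -> ucont T h ->
  measurable_fun ([set` `[0, T]] : set (measurableTypeR R)) h ->
  (forall s t, 0 <= s -> s <= t -> t <= T -> k s <= k t) ->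
  (forall u, 0 <= u <= T -> 0 <= h u) ->
  (forall r s, 0 <= r -> r <= s -> s <= T -> (forall u, r <= u <= s -> 0 < h u) -> k r = k s) ->
  is_stieltjes_integral T k h 0%E.
Proof.
move=> uk uh mh knd h0 flat.
(* Composition with the clipping to [[0, T]] extends [k] to a nondecreasing right-continuous
   function on the line, as a Stieltjes measure requires. *)
pose c t : R := Num.max 0 (Num.min t T).
have cT t : 0 <= c t <= T by rewrite /c le_max lexx /= ge_max T0 ge_min lexx orbT.
have cE t : 0 <= t <= T -> c t = t by move=> /andP[t0 tT]; rewrite /c min_l// max_r.
have cnd s t : s <= t -> c s <= c t.
  move=> st; rewrite /c ge_max le_max lexx /= le_max.
  by apply/orP; right; rewrite le_min !ge_min st lexx !orbT.
have lip s t : s <= t -> c t - c s <= t - s.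
  rewrite /c; case: (leP s T) => a1; case: (leP t T) => a2; rewrite ?(max_r T0) => st.
  - by case: (leP 0 s) => a3; case: (leP 0 t) => a4; lra.
  - by case: (leP 0 s) => a3; lra.
  - lra.
  - lra.
have clip s t : `|c s - c t| <= `|s - t|.
  case: (leP s t) => st.
    have e1 : `|c s - c t| = c t - c s by rewrite distrC ger0_norm// subr_ge0 cnd.
    have e2 : `|s - t| = t - s by rewrite distrC ger0_norm// subr_ge0.
    by rewrite e1 e2 lip.
  have e1 : `|c s - c t| = c s - c t by rewrite ger0_norm// subr_ge0 cnd// ltW.
  have e2 : `|s - t| = s - t by rewrite ger0_norm// subr_ge0 ltW.
  by rewrite e1 e2 lip// ltW.
pose k0 t := k (c t).
have nd : {homo k0 : x y / x <= y}.
  move=> x y xy; have /andP[x0 _] := cT x; have /andP[_ yT] := cT y.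
  by apply: knd => //; exact: cnd.
have rc : right_continuous k0.
  move=> x; apply: cvg_at_right_filter; apply/cvgrPdist_le => e e0.
  have [d d0 hd] := uk e e0; exists d => //= y /= xy; apply: hd => //.
  exact: le_trans (clip _ _) (ltW xy).
pose K0 : cumulative R R := HB.pack k0 (isCumulative.Build R _ R k0 nd rc).
exists K0; split; first by move=> t tT; rewrite /= /k0 cE.
have m0 : measurable ([set` `]0, T]] : set (measurableTypeR R)) by exact: measurable_itv.
have mh' : measurable_fun ([set` `]0, T]] : set (measurableTypeR R)) (EFin \o h).
  apply/measurable_EFinP; apply: measurable_funS mh => //.
  by move=> u /=; rewrite !in_itv/= => /andP[/ltW -> ->].
rewrite -[RHS](integral0 (lebesgue_stieltjes_measure K0) [set` `]0, T]]).
apply: ae_eq_integral => //.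
pose q (o : option (rat * rat)) : R * R := if o is Some (a, b) then (Num.max 0 (ratr a), Num.min T (ratr b)) else (0, 0).
pose ok (n : nat) : Prop := let: (r, s) := q (unpickle n) in
  [/\ 0 <= r, r <= s, s <= T & forall u, r <= u <= s -> 0 < h u].
pose N (n : nat) : set (measurableTypeR R) := if pselect (ok n) then [set` `](q (unpickle n)).1, (q (unpickle n)).2]] else set0.
have N0 n : (lebesgue_stieltjes_measure K0).-negligible (N n).
  rewrite /N; case: pselect => okn; last exact: negligible_set0.
  exists [set` `](q (unpickle n)).1, (q (unpickle n)).2]]; split => //.
  move: okn; rewrite /ok; case: (q _) => r s [r0 rs sT hu] /=.
  rewrite (stieltjes_itv K0 rs) /= /k0 !cE ?r0 ?sT ?(le_trans r0 rs) ?(le_trans rs sT)//.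
  by rewrite (flat r s)// subrr.
apply: negligibleS (negligible_bigcup N0) => u /= /not_implyP[]; rewrite in_itv/= => /andP[u0 uT] hu.
have uT' : 0 <= u <= T by rewrite uT ltW.
have hpos : 0 < h u by rewrite lt_neqAle h0// andbT; apply/eqP => e; apply: hu; rewrite -e.
have [d d0 hd] := uh (h u / 2) (divr_gt0 hpos (ltr0Sn _ 1)).
have l1 : u - d < u by lra.
have l2 : u < u + d by lra.
have [a] := rat_in_itvoo l1; rewrite in_itv/= => /andP[a1 a2].
have [b] := rat_in_itvoo l2; rewrite in_itv/= => /andP[b1 b2].
have [n nE] : exists n, unpickle n = Some (a, b) by exists (pickle (a, b)); rewrite pickleK.
exists n => //.
have okn : ok n.
  rewrite /ok nE /=; split.
  - by rewrite le_max lexx.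
  - rewrite le_min !ge_max T0 /= (le_trans (ltW a2) uT) (le_trans (ltW u0) (ltW b1)) /=.
    by apply: ltW; exact: lt_trans a2 b1.
  - by rewrite ge_min lexx.
  - move=> v; rewrite ge_max le_min => /andP[/andP[v0 v1] /andP[v2 v3]].
    have dv : `|u - v| <= d by rewrite ler_norml; apply/andP; split; lra.
    have := hd u v uT' _ dv; rewrite v0 v2 => /(_ isT); rewrite ler_norml; lra.
rewrite /N; case: pselect => [okn'|nok]; last by case: (nok okn).
rewrite nE /= in_itv/= gt_max u0 a2 /=.
by rewrite le_min uT ltW.
Qed.

End Skorokhod.

(** * Fast Cauchy sequences and majorants in time *)

Section GeometricCauchy.
Context {R : realType}.
Local Notation leb := (@completed_lebesgue_measure R).
Local Notation ctype := (caratheodory_type ((wlength (@idfun R))^*)%mu).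
Local Notation hf j := ((2^-1 : R) ^+ j).

Lemma half_pow_ge0 j : 0 <= hf j.
Proof. by rewrite exprn_ge0// invr_ge0. Qed.

Lemma half_pow_small (e : R) : 0 < e -> exists J : nat, forall j, (J <= j)%N -> hf j <= e.
Proof.
move=> e0; have : hf j @[j --> \oo] --> (0 : R) by apply: cvg_expr; rewrite ger0_norm ?invr_ge0// invf_lt1// ltr1n.
move=> /cvgrPdist_le /(_ _ e0) [J _ hJ]; exists J => j Jj.
by have := hJ j Jj; rewrite sub0r normrN ger0_norm// half_pow_ge0.
Qed.

(** From rank [J] on, [u j - 2 c 2^-j] is nondecreasing and bounded, so it converges, and the
    correction tends to 0; the factor 2 is the sum of the geometric series. *)
Lemma geometric_cauchy (u : nat -> R) (c : R) (J : nat) : 0 <= c ->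
  (forall j, (J <= j)%N -> `|u j - u j.+1| <= c * hf j) ->
  exists l, u @ \oo --> l /\ forall j, (J <= j)%N -> `|u j - l| <= 2 * c * hf j.
Proof.
move=> c0 h.
have tele i k : (J <= i)%N -> `|u i - u (i + k)%N| <= 2 * c * (hf i - hf (i + k)%N).
  move=> Ji; elim: k => [|k IH]; first by rewrite addn0 !subrr normr0 mulr0.
  rewrite addnS -(subrK (u (i + k)%N) (u i)) -addrA.
  apply: (le_trans (ler_normD _ _)); apply: (le_trans (lerD IH (h _ _))); first exact: leq_trans (leq_addr _ _).
  rewrite exprS le_eqVlt; apply/orP; left; apply/eqP; by field.
have bnd i j : (J <= i)%N -> (i <= j)%N -> `|u i - u j| <= 2 * c * hf i.
  move=> Ji ij; have := tele i (j - i)%N Ji; rewrite subnKC// => /le_trans; apply.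
  by rewrite ler_wpM2l ?mulr_ge0// lerBlDr lerDl half_pow_ge0.
pose v k := u (k + J)%N - 2 * c * hf (k + J)%N.
have nd : nondecreasing_seq v.
  apply/nondecreasing_seqP => k; rewrite /v addSn exprS -subr_ge0.
  have := h (k + J)%N (leq_addl _ _); rewrite ler_norml => /andP[_ h2]; rewrite -subr_ge0 in h2.
  rewrite (_ : _ - _ = c * hf (k + J)%N - (u (k + J)%N - u (k + J).+1))//; by field.
have ub : has_ubound (range v).
  exists (u J + 2 * c * hf J) => _ [k _ <-]; rewrite /v.
  have := bnd J (k + J)%N (leqnn _) (leq_addl _ _); rewrite ler_norml => /andP[h1 _].
  apply: (@le_trans _ _ (u (k + J)%N)); first by rewrite lerBlDr lerDl !mulr_ge0// half_pow_ge0.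
  by move: h1; rewrite lerNl opprB lerBlDl.
have cv := nondecreasing_is_cvgn nd ub.
have c2 : (fun k => 2 * c * hf (k + J)%N) @ \oo --> (0 : R).
  rewrite -[X in _ --> X](mulr0 (2 * c)); apply: cvgM; first exact: cvg_cst.
  by rewrite (cvg_shiftn J (fun k => hf k)); apply: cvg_expr; rewrite ger0_norm ?invr_ge0// invf_lt1// ltr1n.
have cu : u @ \oo --> limn v.
  rewrite -(cvg_shiftn J) /= -[limn v]addr0.
  rewrite (_ : (fun n => u (n + J)%N) = (fun k => v k + 2 * c * hf (k + J)%N)).
    by apply: cvgD => //; exact: cv.
  by apply/funext => k; rewrite /v subrK.
exists (limn v); split => // j Jj.
have hh : (fun i => `|u j - u i|) @ \oo --> `|u j - limn v|.
  by apply: cvg_norm; apply: cvgB => //; exact: cvg_cst.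
rewrite -(cvg_lim _ hh)//; apply: limr_le; first by apply/cvg_ex; eexists; exact: hh.
by exists j => // i /= ji; exact: bnd.
Qed.

Lemma lint_mono a b (x : nat -> R -> R) (c : R) : (forall n, li a b (x n)) -> (forall n s, 0 <= x n s) ->
  (forall n s, x n s <= x n.+1 s) -> (forall n, \int[leb]_(s in `[a, b]) x n s <= c) ->
  exists g : R -> R, [/\ li a b g, forall s, 0 <= g s & {ae leb, forall s, a <= s <= b -> forall n, x n s <= g s}].
Proof.
move=> lx x0 xm xc; have mI := @cmeasurable_itv R `[a, b].
pose X n (s : ctype) := (x n s)%:E.
have nd s : nondecreasing_seq (X ^~ s).
  by apply/nondecreasing_seqP => n; rewrite lee_fin.
have mX n : measurable_fun ([set` `[a, b]] : set ctype) (X n) by exact: (measurable_int leb (lx n)).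
pose G s := limn (X ^~ s).
have cG s : X ^~ s @ \oo --> G s by exact: ereal_nondecreasing_is_cvgn.
have G0 s : (0 <= G s)%E by apply: lime_ge; [exact: cG|apply: nearW => n; rewrite lee_fin].
have XG n s : (X n s <= G s)%E by apply: lime_ge; [exact: cG|exists n => // m /= nm; exact: (nd s)].
have mG : measurable_fun ([set` `[a, b]] : set ctype) G.
  by apply: (emeasurable_fun_cvg X) => // s _; exact: cG.
have Gc : (\int[leb]_(s in `[a, b]) G s <= c%:E)%E.
  have h := @cvg_monotone_convergence _ _ _ leb `[a, b] mI X mX (fun n s _ => x0 n s) (fun s _ => nd s).
  rewrite -(cvg_lim _ h)//; apply: lime_le; first by apply/cvg_ex; eexists; exact: h.
  by apply: nearW => n; rewrite li_EFin// lee_fin.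
have iG : leb.-integrable `[a, b] G.
  apply/integrableP; split => //; rewrite (_ : (\int[leb]_(s in `[a, b]) `|G s| = \int[leb]_(s in `[a, b]) G s)%E).
    exact: le_lt_trans Gc (ltry _).
  by apply: eq_integral => w _; rewrite gee0_abs.
have fG := integrable_ae mI iG.
have mf : lmeas `[a, b] (fun s => fine (G s)).
  by apply: (measurableT_comp (f := fine)); [exact: fine_measurable|].
exists (fun s => fine (G s)); split.
- apply: li_fin => //; first by move=> s _; exact: fine_ge0.
  apply: le_lt_trans (ltry c); apply: le_trans Gc; apply: ge0_le_integral.
  + exact: mI.
  + by move=> s _; rewrite lee_fin fine_ge0.
  + exact/measurable_EFinP.
  + exact: mG.
  + by move=> s _; move: (G0 s); case: (G s) => //= r _; rewrite leey.
- by move=> s; exact: fine_ge0.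
- have lF : Filter (nbhs (almost_everywhere leb)) by exact: leb_ae_filter.
  apply: filterS fG => s hs sab n; rewrite -lee_fin fineK; first exact: XG.
  by apply: hs; rewrite /= in_itv.
Qed.

End GeometricCauchy.

(** * Locally uniform limits *)

Section LocalUniform.
Context {R : realType} {d : nat}.
Local Notation leb := (@completed_lebesgue_measure R).
Local Notation E := (R * 'rV[R]_d)%type.

Lemma row_cvg (z : nat -> 'rV[R]_d) (l : 'rV[R]_d) :
  (fun n => enorm (z n - l)) @ \oo --> (0 : R) -> z @ \oo --> l.
Proof.
move=> /cvgrPdist_le h; apply/cvgrPdist_le => e e0; have [N _ hN] := h e e0.
exists N => // n /= Nn; have := hN n Nn; rewrite sub0r normrN ger0_norm ?sqrtr_ge0// => hn.
rewrite -[`|_|]/(mx_norm _) mx_normrE; apply/bigmax_leP; split; first exact: ltW.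
move=> [i j] _; rewrite (ord1 i) /=; have := enorm_coord (z n - l) j.
by rewrite !mxE distrC => h'; exact: le_trans h' hn.
Qed.

(** All points [(y n, z n)] stay in one compact box, on which [gs] converges uniformly; continuity
    of [g] at the limit point does the rest. *)
Lemma family_compact_cvg (gs : nat -> E -> R) (g : E -> R) (y : nat -> R) (z : nat -> 'rV[R]_d)
    (y0 : R) (z0 : 'rV[R]_d) (C : R) :
  {family compact, gs @ \oo --> g} -> {for (y0, z0), continuous g} ->
  y @ \oo --> y0 -> (fun n => enorm (z n - z0)) @ \oo --> (0 : R) ->
  (forall n, `|y n| <= C) -> (forall n, enorm (z n) <= C) ->
  (fun n => gs n (y n, z n)) @ \oo --> g (y0, z0).
Proof.
move=> /fam_cvgP hu cg cy cz yC zC.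
pose A : set E := `[- C, C]%classic `*` [set v : 'rV[R]_d | forall i, `[- C, C]%classic (v ord0 i)].
have cA : compact A.
  apply: compact_setX; first exact: segment_compact.
  by apply: (@rV_compact _ _ (fun=> `[- C, C]%classic)) => i; exact: segment_compact.
have Az n : A (y n, z n).
  split => /=; first by rewrite in_itv/= -ler_norml.
  by move=> i; rewrite in_itv/= -ler_norml; apply: le_trans (zC n); exact: enorm_coord.
have hA := hu A cA.
have unif e : 0 < e -> exists N : nat, forall n, (N <= n)%N -> forall x, A x -> `|g x - gs n x| < e.
  move=> e0; have : nbhs (g : {uniform` A -> R}) [set h | forall x, A x -> `|g x - h x| < e].
    apply/uniform_nbhs; exists [set xy | `|xy.1 - xy.2| < e]; split => //.
    exact: (@entourage_ball _ _ (PosNum e0)).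
  by move=> /hA [N _ hN]; exists N => n Nn x Ax; exact: hN.
have cyz : (fun n => g (y n, z n)) @ \oo --> g (y0, z0).
  apply: (@cvg_comp _ _ _ (fun n => (y n, z n)) g _ _ _ _ cg).
  have cz' := row_cvg cz.
  exact: (@cvg_pair _ _ _ \oo (nbhs y0) (nbhs z0) _ _ _ y z cy cz').
apply/cvgrPdist_le => e e0; have e2 : 0 < e / 2 by rewrite divr_gt0.
have [N hN] := unif _ e2; have /cvgrPdist_le /(_ _ e2) [M _ hM] := cyz.
exists (maxn N M) => // n /=; rewrite geq_max => /andP[Nn Mn].
rewrite -(subrK (g (y n, z n)) (g (y0, z0))) -addrA (splitr e).
by apply: (le_trans (ler_normD _ _)); apply: lerD; [exact: hM|exact: ltW (hN _ Nn _ (Az n))].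
Qed.

Lemma li_le_ae a b (x y : R -> R) : lmeas [set` `[a, b]] x ->
  {ae leb, forall s, a <= s <= b -> `|x s| <= y s} -> li a b y -> li a b x.
Proof.
move=> mx h ly; have lF : Filter (nbhs (almost_everywhere leb)) by exact: leb_ae_filter.
have [||||h1 _] := @lint_dct _ a b (fun=> x) x y => //.
- by apply: aeW => s _; exact: cvg_cst.
- by apply: filterS h => s h sab _; exact: h.
Qed.

Lemma ucont_uniform_lim T (x : nat -> R -> R) (l : R -> R) : (forall n, ucont T (x n)) ->
  (forall e : R, 0 < e -> exists n, forall t, 0 <= t <= T -> `|x n t - l t| <= e) -> ucont T l.
Proof.
move=> ux h e e0; have e3 : 0 < e / 3 by rewrite divr_gt0.
have [n hn] := h _ e3; have [r r0 hr] := ux n _ e3; exists r => // s t sT tT st.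
rewrite (_ : l s - l t = (x n s - x n t) + ((x n t - l t) - (x n s - l s))); last by ring.
apply: (le_trans (ler_normD _ _)); rewrite (_ : e = e / 3 + (e / 3 + e / 3)); last by field.
apply: lerD; first exact: hr.
by apply: (le_trans (ler_normB _ _)); apply: lerD; exact: hn.
Qed.

Lemma ucont_pos_bound T (x : R -> R) (r s : R) : ucont T x -> 0 <= r -> r <= s -> s <= T ->
  (forall u, r <= u <= s -> 0 < x u) -> exists2 dl : R, 0 < dl & forall u, r <= u <= s -> dl <= x u.
Proof.
move=> ux r0 rs sT hx.
have cx : {within `[r, s], continuous x}.
  apply: continuous_subspaceW (ucont_within ux) => u /=; rewrite !in_itv/= => /andP[h1 h2].
  by rewrite (le_trans r0)// (le_trans h2).
have [c cI hc] := EVT_min rs cx; exists (x c); first by apply: hx; move: cI; rewrite in_itv.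
by move=> u us; apply: hc; rewrite in_itv.
Qed.

End LocalUniform.

(** * Norms as real numbers *)

Section Norms.
Context {R : realType} {disp : measure_display} {Omega : measurableType disp}.
Variables (P : probability Omega R) (hP : measure_is_complete P).

Lemma ae_int_EFin (X : Omega -> \bar R) (x : Omega -> R) : integ P x ->
  {ae P, forall w, X w = (x w)%:E} -> (\int[P]_w X w = (\int[P]_w x w)%:E)%E.
Proof.
move=> ix h; have mx : measurable_fun setT (EFin \o x) by exact/measurable_EFinP/(integ_meas ix).
rewrite -EFin_E//; apply: ae_eq_integral => //.
  by apply: (meas_ae_eq hP mx); apply: filterS h => w ->.
by apply: filterS h => w h _.
Qed.

Lemma root_cvg0 (a : nat -> R) (p : R) : 0 < p -> (forall n, 0 <= a n) -> a @ \oo --> (0 : R) ->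
  (fun n => (a n `^ p^-1)%:E) @ \oo --> 0%E.
Proof.
move=> p0 a0 h; rewrite -[X in _ --> X]/(0%:E); apply: cvg_EFin; first exact: nearW.
have -> : (0 : R) = 0 `^ p^-1 by rewrite powR0// invr_eq0 gt_eqF.
by apply: powR_cvg => //; rewrite invr_gt0.
Qed.

End Norms.

(** * Young's inequality along a path, and arithmetic *)

Section PathInequalities.
Context {R : realType}.
Local Notation leb := (@completed_lebesgue_measure R).
Implicit Types (x z : R -> R).

Lemma young_sqr (c x z : R) : 0 < c -> x * z <= c / 2 * x ^+ 2 + (2 * c)^-1 * z ^+ 2.
Proof.
move=> c0; rewrite -subr_ge0.
rewrite (_ : _ - _ = (2 * c)^-1 * (c * x - z) ^+ 2); last by field; rewrite gt_eqF.
by rewrite mulr_ge0 ?sqr_ge0// invr_ge0 mulr_ge0// ltW.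
Qed.

(* Young's inequality with weight M when the integral of z^2 is at most N, and with
   weight sqrt S otherwise, where sqrt S <= N^(-(p-1)/2) S^(p/2). *)
Lemma young_path a b x z (p M N u S : R) : li a b (fun s => x s ^+ 2) -> li a b (fun s => z s ^+ 2) ->
  li a b (fun s => x s * z s) -> 1 < p -> 0 < M -> 0 < N ->
  \int[leb]_(s in `[a, b]) x s ^+ 2 <= u -> \int[leb]_(s in `[a, b]) z s ^+ 2 <= S ->
  \int[leb]_(s in `[a, b]) (x s * z s) <=
  M / 2 * \int[leb]_(s in `[a, b]) x s ^+ 2 + N / (2 * M) + (u + 1) * (N `^ ((p - 1) / 2))^-1 * S `^ (p / 2).
Proof.
move=> lx lz lxz p1 M0 N0 hu hS; have mI := @cmeasurable_itv R `[a, b].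
have u0 : 0 <= u by apply: le_trans hu; apply: Rintegral_ge0 => s _; exact: sqr_ge0.
have S0 : 0 <= S by apply: le_trans hS; apply: Rintegral_ge0 => s _; exact: sqr_ge0.
have base c : 0 < c -> \int[leb]_(s in `[a, b]) (x s * z s) <=
    c / 2 * \int[leb]_(s in `[a, b]) x s ^+ 2 + (2 * c)^-1 * S.
  move=> c0; apply: (@le_trans _ _ (c / 2 * \int[leb]_(s in `[a, b]) x s ^+ 2 + (2 * c)^-1 * \int[leb]_(s in `[a, b]) z s ^+ 2)).
    rewrite -!RintegralZl// -RintegralD//; [|exact: (liZ (c / 2) lx)|exact: (liZ (2 * c)^-1 lz)].
    apply: lint_le => //; first by apply: liD; exact: liZ.
    by move=> s _; exact: young_sqr.
  by rewrite lerD2l ler_wpM2l// invr_ge0 mulr_ge0// ltW.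
have k0 : 0 < N `^ ((p - 1) / 2) by exact: powR_gt0.
have [SN|NS] := leP S N.
  apply: (le_trans (base _ M0)); rewrite -addrA lerD2l ler_wpDr//.
    by rewrite !mulr_ge0 ?powR_ge0 ?invr_ge0 ?powR_ge0// addr_ge0.
  by rewrite mulrC ler_pM2r// invr_gt0 mulr_gt0.
have SS : 0 < S by exact: lt_trans NS.
have c0 : 0 < Num.sqrt S by rewrite sqrtr_gt0.
apply: (le_trans (base _ c0)).
have -> : (2 * Num.sqrt S)^-1 * S = Num.sqrt S / 2.
  by rewrite -{2}(sqr_sqrtr S0); field; rewrite gt_eqF.
(* As [p / 2 = 1 / 2 + (p - 1) / 2], this is [N <= S] raised to the exponent [(p - 1) / 2], positive
   because [p > 1]. *)
have h : Num.sqrt S <= (N `^ ((p - 1) / 2))^-1 * S `^ (p / 2).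
  rewrite ler_pdivlMl// mulrC -powR12_sqrt// (_ : p / 2 = 2^-1 + (p - 1) / 2); last by field.
  rewrite powRD; last by rewrite (gt_eqF SS) implybT.
  by rewrite ler_wpM2l ?powR_ge0//; apply: powR_le => //; [rewrite divr_ge0// subr_ge0 ltW|exact: ltW|exact: ltW].
have h2 : Num.sqrt S / 2 * \int[leb]_(s in `[a, b]) x s ^+ 2 <= Num.sqrt S * u.
  apply: (@le_trans _ _ (Num.sqrt S / 2 * u)); first by rewrite ler_wpM2l// divr_ge0// ltW.
  by rewrite ler_wpM2r// ler_pdivrMr// ler_peMr// ?ltW// ltr1n.
have h3 : Num.sqrt S * (u + 1) <= (u + 1) * (N `^ ((p - 1) / 2))^-1 * S `^ (p / 2).
  by rewrite mulrC -mulrA ler_wpM2l// addr_ge0.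
have M2 : 0 <= M / 2 * \int[leb]_(s in `[a, b]) x s ^+ 2 + N / (2 * M).
  apply: addr_ge0; last by rewrite divr_ge0// ?mulr_ge0// ltW.
  by rewrite mulr_ge0 ?divr_ge0 ?(ltW M0)//; apply: Rintegral_ge0 => s _; exact: sqr_ge0.
apply: (@le_trans _ _ (Num.sqrt S * (u + 1))).
  by rewrite mulrDr mulr1; apply: lerD => //; rewrite ler_pdivrMr// ler_peMr// ?sqrtr_ge0// ler1n.
by rewrite -[X in X <= _]add0r; exact: lerD.
Qed.

Lemma growth_diff (a b f q1 q2 q l z1 z2 : R) : a <= f + q1 + l * z1 -> b <= f + q2 + l * z2 ->
  q1 <= q -> q2 <= q -> a + b <= 2 * f + 2 * q + l * (z1 + z2).
Proof. lra. Qed.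

Lemma norm_le_double (a b c : R) : a <= c -> b <= c -> a + b <= 2 * c.
Proof. lra. Qed.

Lemma young_assemble (G l M k N c D z1 z2 : R) : M != 0 ->
  G + l * ((M * k * G + N / (2 * M) + c * D * z1) + (M * k * G + N / (2 * M) + c * D * z2)) =
  (1 + 2 * l * M * k) * G + (l * N / M + l * (c * D) * (z1 + z2)).
Proof. by move=> M0; field. Qed.

Lemma quarter_sum (x y z e : R) : 0 < e -> x <= e / 4 -> y <= e / 4 -> z <= e / 4 -> x + (y + z) <= e.
Proof. lra. Qed.

Lemma le_one_sqr (x : R) : x <= 1 + x ^+ 2.
Proof. by have := sqr_ge0 (x - 1); have := sqr_ge0 x; nra. Qed.

Lemma path_diff (a b c e f k v y0 yt it i0 gg : R) : a - b + (c - e) = f + v + k ->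
  k - (y0 - yt + (it - i0) - gg - v) = (a - y0) - (b - yt) + (c - it) - (e - i0) - (f - gg).
Proof. by move=> h; have -> : k = a - b + (c - e) - f - v by [rewrite h; ring]; ring. Qed.

Lemma norm_sum5 (a b c e f x : R) : `|a| <= x / 5 -> `|b| <= x / 5 -> `|c| <= x / 5 -> `|e| <= x / 5 ->
  `|f| <= x / 5 -> `|a - b + c - e - f| <= x.
Proof.
move=> h1 h2 h3 h4 h5; rewrite (_ : x = x / 5 + x / 5 + x / 5 + x / 5 + x / 5); last by field.
apply: (le_trans (ler_normB _ _)); apply: lerD => //; apply: (le_trans (ler_normB _ _)); apply: lerD => //.
apply: (le_trans (ler_normD _ _)); apply: lerD => //; apply: (le_trans (ler_normB _ _)); exact: lerD.
Qed.

Lemma gap_pos (dl yn y l : R) : 0 < dl -> - (dl / 2) <= yn - y -> dl <= y - l -> l < yn.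
Proof. lra. Qed.

Lemma half_budget (e c : R) : 0 < e -> 0 <= c -> 2 * (e / (2 * (c + 1)) * c) <= e.
Proof.
move=> e0 c0; have c1 : 0 < c + 1 by rewrite ltr_wpDl.
rewrite (_ : 2 * _ = e * (c / (c + 1))); last by field; rewrite gt_eqF.
by rewrite ler_piMr ?(ltW e0)// ler_pdivrMr// mul1r lerDl.
Qed.

End PathInequalities.

(** * Almost sure comparisons and first passage in continuous time *)

Section AlmostEverywhere.
Context {R : realType} {disp : measure_display} {Omega : measurableType disp}.
Variables (P : probability Omega R) (hP : measure_is_complete P).
Implicit Types (X Y : Omega -> R).

(** Truncating [X] at [|Y|] changes it on a null set only and makes the domination hold
    everywhere. *)
Lemma integ_le_ae X Y : measurable_fun setT X -> {ae P, forall w, `|X w| <= Y w} ->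
  integ P Y -> integ P X.
Proof.
move=> mX XY iY; have mY := integ_meas iY.
pose X' w := Num.max (- `|Y w|) (Num.min (X w) `|Y w|).
have mX' : measurable_fun setT X'.
  apply: measurable_maxr; first by apply: measurableT_comp => //; exact: measurableT_comp.
  by apply: measurable_minr => //; exact: measurableT_comp.
have XX' : {ae P, forall w, X w = X' w}.
  apply: filterS XY => w h.
  have : `|X w| <= `|Y w| by exact: le_trans h (ler_norm _).
  by rewrite ler_norml => /andP[h1 h2]; rewrite /X' min_l// max_r.
have [[_ h] _] := E_ae mX mX' XX'.
apply: h; apply: integ_le (integ_norm iY) => // w.
by rewrite ler_norml ge_max le_max lexx/= ge_min lexx orbT andbT -subr_ge0 opprK addr_ge0.
Qed.

Lemma Ele_ae X Y : integ P X -> integ P Y -> {ae P, forall w, X w <= Y w} ->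
  \int[P]_w X w <= \int[P]_w Y w.
Proof.
move=> iX iY XY.
have mm : measurable_fun setT (fun w => Num.min (X w) (Y w)).
  by apply: measurable_minr; [exact: integ_meas iX|exact: integ_meas iY].
have XY' : {ae P, forall w, X w = Num.min (X w) (Y w)} by apply: filterS XY => w h; rewrite min_l.
have [[hi _] ->] := E_ae (integ_meas iX) mm XY'.
by apply: Ele => //; [exact: hi|move=> w; rewrite ge_min lexx orbT].
Qed.

Variables (T : R) (F : R -> set (set Omega)).
Hypotheses (T0 : 0 <= T) (hF : filtration P T F).
Definition grid (N i : nat) : R := i%:R / N.+1%:R * T.

Lemma grid_near N s : 0 <= s <= T -> exists2 i, (i <= N.+1)%N & `|grid N i - s| <= T / N.+1%:R.
Proof.
move=> /andP[s0 sT]; have := T0; rewrite le_eqVlt => /orP[/eqP T00|Tp].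
  exists 0%N => //; have -> : s = 0 by apply/eqP; rewrite eq_le s0 andbT T00.
  by rewrite /grid mul0r mul0r subrr normr0 -T00 mul0r.
have x0 : 0 <= s / T * N.+1%:R by rewrite mulr_ge0// divr_ge0.
have /andP[h1 h2] := truncn_itv x0; set i := Num.truncn _ in h1 h2 *.
have n0 : 0 < N.+1%:R :> R by rewrite ltr0n.
set M : R := N.+1%:R in n0 h1 h2 *.
have es : s = s / T * M * (T / M) by field; rewrite !gt_eqF.
have eg : grid N i = i%:R * (T / M) by rewrite /grid -/M; field; rewrite gt_eqF.
have t0 : 0 <= T / M by rewrite divr_ge0// ltW.
have M1 : 0 <= M^-1 by rewrite invr_ge0 ltW.
exists i.
  rewrite -(ler_nat R); apply: (le_trans h1); rewrite -[X in _ <= X]mul1r ler_wpM2r//.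
  by rewrite ler_pdivrMr// mul1r.
rewrite distrC {1}es eg -mulrBl ger0_norm ?mulr_ge0 ?subr_ge0//.
by rewrite ler_piMl// lerBlDl natr1 ltW.
Qed.

Lemma E_indic W : measurable W -> \int[P]_w (\1_W w : R) = fine (P W).
Proof. by move=> mW; rewrite /Rintegral integral_indic// setIT. Qed.

Lemma integ_indic W : measurable W -> integ P (\1_W : Omega -> R).
Proof. by move=> mW; apply: (@integ_bnd _ _ _ P 1) => // w; exact: norm_indic_le1. Qed.

Lemma prob_sub (A1 A2 A3 : set Omega) : measurable A1 -> measurable A2 -> measurable A3 ->
  {ae P, forall w, A1 w -> A2 w \/ A3 w} -> fine (P A1) <= fine (P A2) + fine (P A3).
Proof.
move=> m1 m2 m3 h; rewrite -!E_indic// -ED; [|exact: integ_indic|exact: integ_indic].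
apply: Ele_ae; [exact: integ_indic|by apply: integD; exact: integ_indic|].
apply: filterS h => w h; have [a1|na] := pselect (A1 w); last first.
  by rewrite [\1_A1 w]indicE memNset// addr_ge0.
rewrite [\1_A1 w]indicE mem_set//; case: (h a1) => a.
  by rewrite [\1_A2 w]indicE mem_set// lerDl.
by rewrite [\1_A3 w]indicE mem_set// lerDr.
Qed.

Lemma prob_bounded (X : Omega -> R) dl : measurable_fun setT X -> 0 < dl ->
  exists k : nat, fine (P [set w | k%:R < X w]) <= dl.
Proof.
move=> mX dl0.
have mk (k : nat) : measurable [set w | k%:R < X w].
  have := mX measurableT _ (measurable_itv `]k%:R, +oo[).
  by rewrite setTI; congr measurable; apply/seteqP; split => w /=; rewrite in_itv/= andbT.
have : (fun k : nat => \int[P]_w (\1_[set w | k%:R < X w] w : R)) @ \oo --> (0 : R).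
  apply: (E_dct0 (c := 1)).
  - by move=> k; exact: measurable_indic.
  - apply: aeW => w; apply/cvgrPdist_le => e e0; exists (Num.truncn `|X w|).+1 => // k /= kX.
    rewrite indicE memNset ?subrr ?normr0 ?ltW// => /=; apply/negP; rewrite -leNgt.
    apply: (le_trans (ler_norm _)); apply: ltW; apply: (lt_le_trans (truncnS_gt _)).
    by rewrite ler_nat.
  - by apply: aeW => w k; exact: norm_indic_le1.
move=> /cvgrPdist_le /(_ _ dl0) [k _ hk]; exists k.
have := hk k (leqnn k); rewrite sub0r normrN E_indic//; apply: le_trans; exact: ler_norm.
Qed.

(* [grid_passage] on finer and finer grids: f is dominated, up to e, by G at the first
   grid time at which U is positive. *)
Lemma passage_limit (U G : R -> Omega -> R) (Gam f : Omega -> R) (A W : set Omega) :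
  F 0 A -> adapted T F U -> integ P Gam -> (forall w, 0 <= Gam w) ->
  (forall t, 0 <= t <= T -> measurable_fun setT (G t)) -> (forall t w, 0 <= G t w) ->
  (forall t D, 0 <= t <= T -> F t D -> D `<=` A -> integ P (fun w => \1_D w * G t w) /\
     \int[P]_w (\1_D w * G t w) <= \int[P]_w (\1_D w * Gam w)) ->
  measurable_fun setT f -> (forall w, 0 <= f w) -> measurable W ->
  {ae P, forall w, forall e : R, 0 < e -> exists N0, forall N, (N0 <= N)%N -> 0 < f w ->
     exists2 i, (i <= N.+1)%N & [/\ A w, 0 < U (grid N i) w,
       forall j, (j < i)%N -> U (grid N j) w <= 0 & f w - e <= G (grid N i) w]} ->
  {ae P, forall w, (A w /\ exists2 s, 0 <= s <= T & 0 < U s w) -> W w} ->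
  integ P f /\ \int[P]_w f w <= \int[P]_w (\1_W w * Gam w).
Proof.
move=> FA aU iGam Gam0 mG G0 hG mf f0 mW happ hW.
have gr0 N : 0 <= grid N 0 by rewrite /grid mul0r mul0r.
have grm N : {homo grid N : i j / (i <= j)%N >-> i <= j}.
  by move=> i j ij; rewrite /grid ler_wpM2r// ler_wpM2r// ler_nat.
have grT N : grid N N.+1 <= T by rewrite /grid divff ?mul1r.
have step N : exists S : Omega -> R, [/\ integ P S, forall w, 0 <= S w,
    \int[P]_w S w <= \int[P]_w (\1_W w * Gam w) &
    forall w i, (i <= N.+1)%N -> A w -> 0 < U (grid N i) w -> (forall j, (j < i)%N -> U (grid N j) w <= 0) ->
      G (grid N i) w <= S w].
  have FA' : F (grid N 0) A by rewrite /grid mul0r mul0r.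
  have [D [mD hD hD' [iS leS]]] := grid_passage hF (gr0 N) (grm N) (grT N) FA' aU iGam mG G0 hG.
  exists (fun w => \sum_(i < N.+2) \1_(D i) w * G (grid N i) w); split => //.
  - by move=> w; apply: sumr_ge0 => i _; rewrite mulr_ge0.
  - apply: (le_trans leS); set ev := [set w | _].
    have mev : measurable ev.
      rewrite (_ : ev = \bigcup_i (if insub i is Some j then D j else set0)).
        by apply: bigcupT_measurable => i; case: insub => // j; exact: mD.
      apply/seteqP; split => w.
        by move=> h; have [i Di] := (hD w).2 h; exists (val i) => //; rewrite valK.
      by case=> i _; case: insub => // j Dj; apply: (hD w).1; exists j.
    apply: Ele_ae; [exact: integ_indicM|exact: integ_indicM|].
    apply: filterS hW => w h; rewrite ler_wpM2r// !indicE ler_nat.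
    have [/set_mem[Aw [i iN Ui]]|] := boolP (w \in ev); last by [].
    rewrite (mem_set (h _))//; split => //; exists (grid N i) => //.
    by rewrite (le_trans (gr0 N))/= ?(le_trans _ (grT N)) ?grm.
  - move=> w i iN Aw Ui Uj.
    have [i' Di] : exists i, D i w by apply/hD; split => //; exists i.
    have [_ U' Uj'] := hD' i' w Di.
    have ii : i' = i :> nat.
      apply/eqP; rewrite eqn_leq; apply/andP; split; rewrite leqNgt; apply/negP => h.
        by have := Uj' _ h; rewrite leNgt Ui.
      by have := Uj _ h; rewrite leNgt U'.
    rewrite (bigD1 i')//= indicE mem_set// mul1r ii lerDl; apply: sumr_ge0 => l _.
    by rewrite mulr_ge0.
have [S hS] := choice step.
have iS N : integ P (S N) by case: (hS N).
have S0 N w : 0 <= S N w by case: (hS N).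
(* The minimum tends to [f], since [S N] is eventually at least [f - e] where [f] is positive, and
   its mean is at most that of [S N]. *)
apply: (E_fatou (f := fun N w => Num.min (f w) (S N w)) (b := fun=> \int[P]_w (\1_W w * Gam w))) => //.
- move=> N; apply: integ_le (iS N); first by apply: measurable_minr => //; exact: integ_meas (iS N).
  by move=> w; rewrite ger0_norm ?le_min ?f0 ?S0// ge_min lexx orbT.
- by move=> N w; rewrite le_min f0 S0.
- apply: filterS happ => w h; apply/cvgrPdist_le => e e0; have [N0 hN] := h e e0.
  exists N0 => // N /= NN; rewrite ger0_norm ?subr_ge0 ?ge_min ?lexx//.
  rewrite lerBlDl -lerBlDr le_min lerBlDr lerDl (ltW e0)/=.
  have := f0 w; rewrite le_eqVlt => /orP[/eqP <-|fpos].
    by rewrite sub0r (le_trans _ (S0 _ _))// oppr_le0 ltW.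
  have [i iN [Aw Ui Uj le]] := hN N NN fpos; apply: (le_trans le).
  by case: (hS N) => _ _ _; exact.
- move=> N; case: (hS N) => _ _ + _; apply: le_trans; apply: Ele => //.
    apply: integ_le (iS N); first by apply: measurable_minr => //; exact: integ_meas (iS N).
    by move=> w; rewrite ger0_norm ?le_min ?f0 ?S0// ge_min lexx orbT.
  by move=> w; rewrite ge_min lexx orbT.
- exact: cvg_cst.
Qed.

End AlmostEverywhere.

(** * Passage to the limit *)

Section Approximation.
Context {R : realType} {disp : measure_display} {Omega : measurableType disp} {d : nat}.
Variables (P : probability Omega R) (T : R) (B : R -> Omega -> 'rV[R]_d).
Hypotheses (hP : measure_is_complete P) (T0 : 0 <= T) (hB : brownian_motion P T B).
Local Notation leb := (@completed_lebesgue_measure R).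
Local Notation integ := (integ P).
Local Notation F := (brownian_filtration P B).
Let hF : filtration P T F := brownian_filtrationP hB.
Let TT : 0 <= T <= T. Proof. by rewrite T0 lexx. Qed.
Let T00 : 0 <= (0 : R) <= T. Proof. by rewrite lexx. Qed.
Variables (p : R) (gn : nat -> R -> Omega -> R -> 'rV[R]_d -> R) (lambda : R)
  (f : R -> Omega -> R) (psi : R -> Omega -> R -> R) (V : R -> Omega -> R) (xi : Omega -> R)
  (L : R -> Omega -> R) (Yn : nat -> R -> Omega -> R) (Zn : nat -> R -> Omega -> 'rV[R]_d)
  (Kn In : nat -> R -> Omega -> R) (eta : Omega -> R).
Hypotheses (hp : 1 < p) (hlambda : 0 <= lambda).
Hypothesis hf : Hpspace P T F p f.
Hypothesis hpsi : Psispace P T F psi.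
Hypothesis hbound : forall n, ae_PT P T (fun w t => forall y z,
       `|gn n t w y z| <= f t w + psi t w `|y| + lambda * enorm z).
Hypothesis hL : Sspace P T F L.
Hypothesis hYn : forall n, Sspace P T F (Yn n).
Hypothesis hZn : forall n, progressive_vec T F (Zn n).
Hypothesis hKn : forall n, Sspace P T F (Kn n).
Hypothesis hI : forall n, ito_integral P T F B (Zn n) (In n).
Hypothesis hsol : forall n, [/\ {ae P, forall w, li 0 T (fun t => gn n t w (Yn n t w) (Zn n t w))},
   {ae P, forall w, li 0 T (fun t => enorm (Zn n t w) ^+ 2)},
   {ae P, forall w, forall t, 0 <= t <= T ->
          Yn n t w = xi w + (\int[leb]_(s in `[t, T]) gn n s w (Yn n s w) (Zn n s w))
                  + (V T w - V t w) + (Kn n T w - Kn n t w) - (In n T w - In n t w)} &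
   {ae P, forall w, forall t, 0 <= t <= T -> L t w <= Yn n t w}].
Hypothesis hsolK : forall n, [/\ nondecreasing_paths P T (Kn n), {ae P, forall w, Kn n 0 w = 0} &
      {ae P, forall w, is_stieltjes_integral T (Kn n ^~ w) (fun t => Yn n t w - L t w) 0%E}].
Hypothesis hmono : increases P T Yn \/ decreases P T Yn.
Hypothesis heta : Lqspace P T F 1 eta.
Hypothesis hest : forall n t, 0 <= t <= T ->
       cond_exp_le P (F t)
         (fun w => sup_from T t (fun s => `|Yn n s w| `^ p)%R
                   + int_from T t (fun s => enorm (Zn n s w) ^+ 2)%R `^ (p / 2)
                   + (`|Kn n T w - Kn n t w| `^ p)%:E
                   + int_from T t (fun s => `|gn n s w (Yn n s w) (Zn n s w)|)%R `^ p)%E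
         (fun w => (eta w)%:E).

Let p0 : 0 < p. Proof. exact: lt_trans ltr01 hp. Qed.
Let aY n : acproc P T F (Yn n). Proof. exact: Sspace_acproc. Qed.
Let aK n : acproc P T F (Kn n). Proof. exact: Sspace_acproc. Qed.
Let aI n : acproc P T F (In n). Proof. by apply: Sspace_acproc; case: (hI n). Qed.
Let aL : acproc P T F L. Proof. exact: Sspace_acproc. Qed.

Lemma eta_integ : integ eta.
Proof.
case: heta => meta h; have mE := gmeas_measT hF TT meta.
apply/integrableP; split; first exact/measurable_EFinP.
by move: h; congr (_ < _)%E; apply: eq_integral => w _; rewrite /= powRr1.
Qed.

(** The four terms are nonnegative, so each inherits the bound; integrating over [A] in [F t]
    removes the conditional expectations. The event [A] is kept in the statement because random
    times are reached later through such events. *)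
Lemma est_term n t (Th : Omega -> \bar R) (th : Omega -> R) A : 0 <= t <= T -> F t A ->
  measurable_fun setT th -> (forall w, 0 <= th w) -> {ae P, forall w, Th w = (th w)%:E} ->
  (forall w, (Th w <= sup_from T t (fun s => `|Yn n s w| `^ p)%R
                   + int_from T t (fun s => enorm (Zn n s w) ^+ 2)%R `^ (p / 2)
                   + (`|Kn n T w - Kn n t w| `^ p)%:E
                   + int_from T t (fun s => `|gn n s w (Yn n s w) (Zn n s w)|)%R `^ p)%E) ->
  integ (fun w => \1_A w * th w) /\ \int[P]_w (\1_A w * th w) <= \int[P]_w (\1_A w * eta w).
Proof.
move=> tT FA mth th0 hTh le; have [U [U' [[iX iU mU eU] [iE iU' mU' eU'] UU']]] := hest n tT.
have mA := filt_meas hF tT FA.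
have sA : <<s F t >> A by exact: sub_sigma_algebra.
set X := (X in P.-integrable setT X) in iX.
have mAth : measurable_fun setT (fun w => \1_A w * th w) by apply: measurable_funM.
have conv (y : Omega -> R) : (\int[P]_w (\1_A w * y w)%:E = \int[P]_(w in A) (y w)%:E)%E.
  rewrite [RHS]integral_mkcond; apply: eq_integral => w _; rewrite patchE indicE.
  by case: (w \in A); rewrite ?mul1r ?mul0r.
have iXA : P.-integrable A X by exact: integrableS iX.
have mXT : measurable_fun setT X by exact: measurable_int iX.
have h1 : (\int[P]_w (\1_A w * th w)%:E <= \int[P]_(w in A) X w)%E.
  rewrite conv; apply: ae_ge0_le_integral => //.
  - by move=> w _; rewrite lee_fin.
  - by apply: measurable_funTS; exact/measurable_EFinP.
  - move=> w _; rewrite /X; apply: adde_ge0; last exact: poweR_ge0.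
    apply: adde_ge0; last by rewrite lee_fin powR_ge0.
    apply: adde_ge0; last exact: poweR_ge0.
    apply: le_trans (ereal_sup_ubound _); last first.
      by exists T => //=; rewrite in_itv/= lexx andbT; case/andP: tT.
    by rewrite lee_fin powR_ge0.
  - exact: measurable_funTS.
  - by apply: filterS hTh => w <- _; exact: le.
have h2 : (\int[P]_(w in A) U w <= \int[P]_(w in A) U' w)%E.
  have [N [mN N0 hN]] := UU'.
  have iUA : P.-integrable A U by exact: integrableS iU.
  have iU'A : P.-integrable A U' by exact: integrableS iU'.
  rewrite (negligible_integral mN mA iUA N0) (negligible_integral mN mA iU'A N0).
  apply: le_integral.
  - exact: measurableD.
  - by apply: integrableS iU => //; exact: measurableD.
  - by apply: integrableS iU' => //; exact: measurableD.
  - move=> w; rewrite inE => -[_ nN]; apply: contrapT => h; apply: nN; exact: hN.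
have h3 : (\int[P]_w (\1_A w * th w)%:E <= \int[P]_w (\1_A w * eta w)%:E)%E.
  by rewrite conv in h1 *; rewrite conv -(eU' _ sA) (le_trans h1)// -(eU _ sA).
have iAe : integ (fun w => \1_A w * eta w) by apply: integ_indicM => //; exact: eta_integ.
have iAt : integ (fun w => \1_A w * th w).
  apply/integrableP; split; first exact/measurable_EFinP.
  apply: le_lt_trans (ltry (\int[P]_w (\1_A w * eta w))); rewrite -EFin_E//.
  apply: le_trans h3; apply: ge0_le_integral => //.
  - by apply: measurableT_comp => //; exact/measurable_EFinP.
  - exact/measurable_EFinP.
  - by move=> w _ /=; rewrite lee_fin ger0_norm// mulr_ge0.
by split => //; rewrite -lee_fin -!EFin_E.
Qed.

Let e0 := \int[P]_w eta w.
Let ET (th : Omega -> R) : \int[P]_w (\1_setT w * th w) = \int[P]_w th w.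
Proof. by apply: eq_E => w; rewrite indicT mul1r. Qed.
Let F0T : F 0 setT. Proof. exact: (subsigmaT (filtration_sub hF T00)). Qed.

Let sum4 (a b c e : \bar R) : (0 <= a)%E -> (0 <= b)%E -> (0 <= c)%E -> (0 <= e)%E ->
  [/\ (a <= a + b + c + e)%E, (b <= a + b + c + e)%E & (c <= a + b + c + e)%E].
Proof.
move=> a0 b0 c0 e0'; split.
- by apply: le_trans (leeDl _ e0'); apply: le_trans (leeDl _ c0); exact: leeDl.
- by apply: le_trans (leeDl _ e0'); apply: le_trans (leeDl _ c0); exact: leeDr.
- by apply: le_trans (leeDl _ e0'); apply: leeDr; exact: adde_ge0.
Qed.

Let sup0 (y : R -> R) t : 0 <= t <= T -> (forall s, 0 <= y s) -> (0 <= sup_from T t y)%E.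
Proof.
move=> tT y0; apply: le_trans (ereal_sup_ubound _); last first.
  by exists T => //=; rewrite in_itv/= lexx andbT; case/andP: tT.
by rewrite lee_fin.
Qed.

Lemma Y_moment n : integ (fun w => psup T (Yn n ^~ w) `^ p) /\
  \int[P]_w (psup T (Yn n ^~ w) `^ p) <= e0.
Proof.
have [||||] := @est_term n 0 (fun w => sup_from T 0 (fun s => `|Yn n s w| `^ p)%R) (fun w => psup T (Yn n ^~ w) `^ p) setT T00 F0T.
- by apply: (measurableT_comp (measurable_powR p)); exact: (psup_meas hP T0 hF).
- by move=> w; exact: powR_ge0.
- case: (aY n) => _; apply: filterS => w u; have [C hC] := ucont_bounded T0 u.
  exact: (psup_pow T0 p0 hC).
- move=> w; set b := (_ `^ (p / 2))%E; set c := (`|Kn n T w - _| `^ p)%:E; set e := (_ `^ p)%E.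
  have [||||h _ _] := @sum4 (sup_from T 0 (fun s => `|Yn n s w| `^ p)%R) b c e; last exact: h.
  + by apply: sup0 => // s; exact: powR_ge0.
  + exact: poweR_ge0.
  + by rewrite lee_fin powR_ge0.
  + exact: poweR_ge0.
by rewrite !ET => h1 h2; split => //; move: h1; congr integrable; apply/funext => w /=; rewrite indicT mul1r.
Qed.

Let QZ n : R -> Omega -> R := itproc (fun s w => enorm (Zn n s w) ^+ 2).

Lemma QZ_acproc n : acproc P T F (QZ n).
Proof.
apply: (itproc_acproc T0); first exact: progressive_enorm2.
- by move=> s w _; exact: sqr_ge0.
- by case: (hsol n).
Qed.

Lemma Z_moment n t A : 0 <= t <= T -> F t A ->
  integ (fun w => \1_A w * `|QZ n T w - QZ n t w| `^ (p / 2)) /\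
  \int[P]_w (\1_A w * `|QZ n T w - QZ n t w| `^ (p / 2)) <= \int[P]_w (\1_A w * eta w).
Proof.
move=> tT FA; have [t0 tT'] := andP tT.
apply: (@est_term n t (fun w => (int_from T t (fun s => enorm (Zn n s w) ^+ 2)%R `^ (p / 2))%E)) => //.
- apply: (measurableT_comp (measurable_powR _)); apply: measurableT_comp => //.
  have [h _] := QZ_acproc n; apply: measurable_funB; exact: (gmeas_measT hF _ (h _ _)).
- have [_ hz _ _] := hsol n; apply: filterS hz => w lz.
  rewrite /int_from li_EFin; last exact: liS lz.
  rewrite poweR_EFin; congr ((_ `^ _)%:E).
  have h : 0 <= \int[leb]_(s in `[t, T]) enorm (Zn n s w) ^+ 2 by apply: Rintegral_ge0 => s _; exact: sqr_ge0.
  by rewrite /QZ /itproc (lint_add t0 tT' lz) addrAC subrr add0r ger0_norm.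
- move=> w; set b := (_ `^ (p / 2))%E; set c := (`|Kn n T w - _| `^ p)%:E; set e := (int_from _ _ _ `^ p)%E.
  have [||||_ h _] := @sum4 (sup_from T t (fun s => `|Yn n s w| `^ p)%R) b c e; last exact: h.
  + by apply: sup0 => // s; exact: powR_ge0.
  + exact: poweR_ge0.
  + by rewrite lee_fin powR_ge0.
  + exact: poweR_ge0.
Qed.

Lemma K_moment n : integ (fun w => `|Kn n T w - Kn n 0 w| `^ p) /\
  \int[P]_w (`|Kn n T w - Kn n 0 w| `^ p) <= e0.
Proof.
have [||||] := @est_term n 0 (fun w => (`|Kn n T w - Kn n 0 w| `^ p)%:E) (fun w => `|Kn n T w - Kn n 0 w| `^ p) setT T00 F0T.
- apply: (measurableT_comp (measurable_powR _)); apply: measurableT_comp => //.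
  by have [h _] := aK n; apply: measurable_funB; exact: (gmeas_measT hF _ (h _ _)).
- by move=> w; exact: powR_ge0.
- exact: aeW.
- move=> w; set b := (_ `^ (p / 2))%E; set c := (`|Kn n T w - _| `^ p)%:E; set e := (int_from _ _ _ `^ p)%E.
  have [||||_ _ h] := @sum4 (sup_from T 0 (fun s => `|Yn n s w| `^ p)%R) b c e; last exact: h.
  + by apply: sup0 => // s; exact: powR_ge0.
  + exact: poweR_ge0.
  + by rewrite lee_fin powR_ge0.
  + exact: poweR_ge0.
by rewrite !ET => h1 h2; split => //; move: h1; congr integrable; apply/funext => w /=; rewrite indicT mul1r.
Qed.

Let monoY : {ae P, forall w, (forall t, 0 <= t <= T -> forall n m, (n <= m)%N -> Yn n t w <= Yn m t w) \/
  (forall t, 0 <= t <= T -> forall n m, (n <= m)%N -> Yn m t w <= Yn n t w)}.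
Proof.
have ind (rr : R -> R -> Prop) (y : nat -> R) : (forall x, rr x x) -> (forall x y z, rr x y -> rr y z -> rr x z) ->
    (forall n, rr (y n) (y n.+1)) -> forall n m, (n <= m)%N -> rr (y n) (y m).
  move=> rxx tr h n m nm; rewrite -(subnK nm); elim: (m - n)%N => [|k IHk]; first exact: rxx.
  by rewrite addSn; exact: tr IHk (h _).
case: hmono => /ae_foralln; apply: filterS => w h.
  left=> t tT; apply: (ind (fun x y => x <= y)) => //; first by move=> x y z; exact: le_trans.
  by move=> n; exact: h.
right=> t tT; apply: (ind (fun x y => y <= x)) => //; first by move=> x y z h1 h2; exact: le_trans h2 h1.
by move=> n; exact: h.
Qed.

(** By monotonicity [|Yn n - Yn 0|] increases with [n], hence so does the [p]-th power of its
    supremum; the means stay below a multiple of [e0], and [mono_E] yields one majorant. *)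
Lemma Y_bound : exists Wp : Omega -> R, [/\ integ Wp, forall w, 0 <= Wp w &
  {ae P, forall w, forall n t, 0 <= t <= T -> `|Yn n t w| `^ p <= Wp w}].
Proof.
pose v n w := psup T (fun t => Yn n t w - Yn 0 t w).
have mv n : measurable_fun setT (v n).
  by apply: (psup_meas hP T0 hF (X := fun t w => Yn n t w - Yn 0 t w)); exact: acprocB.
have uY : {ae P, forall w, forall n, ucont T (Yn n ^~ w)}.
  by apply/ae_foralln => n; case: (aY n).
have v0 n w : 0 <= v n w by exact: psup_ge0.
have vle : {ae P, forall w, forall n, v n w `^ p <= 2 `^ p * (psup T (Yn n ^~ w) `^ p + psup T (Yn 0 ^~ w) `^ p)}.
  apply: filterS uY => w u n.
  apply: le_trans (powR_add_le _ (psup_ge0 T0 _) (psup_ge0 T0 _)); last exact: ltW.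
  apply: powR_le => //; first exact: ltW.
  have [C hC] := ucont_bounded T0 (u n); have [C0 hC0] := ucont_bounded T0 (u 0%N).
  apply: psup_le => // s sT; apply: (le_trans (ler_normB _ _)); apply: lerD.
    exact: (psup_ge T0 hC).
  exact: (psup_ge T0 hC0).
have im n : integ (fun w => 2 `^ p * (psup T (Yn n ^~ w) `^ p + psup T (Yn 0 ^~ w) `^ p)).
  by apply: integZ; apply: integD; [exact: (Y_moment n).1|exact: (Y_moment 0).1].
have mvp n : measurable_fun setT (fun w => v n w `^ p) by exact: (measurableT_comp (measurable_powR p)).
(* The power of [v n] is below its bound only almost surely; the minimum is below it on every
   path. *)
pose vv n w := Num.min (v n w `^ p) (2 `^ p * (psup T (Yn n ^~ w) `^ p + psup T (Yn 0 ^~ w) `^ p)).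
have vv0 n w : 0 <= vv n w.
  by rewrite le_min powR_ge0 mulr_ge0 ?powR_ge0// addr_ge0 ?powR_ge0.
have ivv n : integ (vv n).
  apply: integ_le (im n); first by apply: measurable_minr => //; exact: integ_meas (im n).
  by move=> w; rewrite ger0_norm// ge_min lexx orbT.
have [||g [ig _ g0 hg]] := @mono_E _ _ _ P vv (2 `^ p * (e0 + e0)) ivv vv0.
- apply: filterS2 (filterI vle uY) monoY => w [h u] mon n.
  rewrite /vv !min_l//; apply: powR_le => //; first exact: ltW.
  have [C hC] := ucont_bounded T0 (ucontB (u n.+1) (u 0%N)).
  apply: psup_le => // s sT; apply: le_trans (psup_ge T0 hC sT).
  case: mon => mon.
    by rewrite !ger0_norm ?subr_ge0 ?mon// lerD2r mon.
  by rewrite !ler0_norm ?subr_le0 ?mon// lerN2 lerD2r mon.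
- move=> n; apply: (@le_trans _ _ (\int[P]_w (2 `^ p * (psup T (Yn n ^~ w) `^ p + psup T (Yn 0 ^~ w) `^ p)))).
    by apply: Ele => // w; rewrite ge_min lexx orbT.
  rewrite EZ; last by apply: integD; [exact: (Y_moment n).1|exact: (Y_moment 0).1].
  rewrite ED; [|exact: (Y_moment n).1|exact: (Y_moment 0).1].
  by rewrite ler_wpM2l ?powR_ge0// lerD//; [exact: (Y_moment n).2|exact: (Y_moment 0).2].
exists (fun w => 2 `^ p * (g w + psup T (Yn 0 ^~ w) `^ p)); split.
- by apply: integZ; apply: integD => //; exact: (Y_moment 0).1.
- by move=> w; rewrite mulr_ge0 ?powR_ge0// addr_ge0// powR_ge0.
apply: filterS2 (filterI vle uY) hg => w [h u] hgw n t tT.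
have [C hC] := ucont_bounded T0 (ucontB (u n) (u 0%N)); have [C0 hC0] := ucont_bounded T0 (u 0%N).
apply: (@le_trans _ _ ((v n w + psup T (Yn 0 ^~ w)) `^ p)).
  apply: powR_le => //; first exact: ltW.
  rewrite -(subrK (Yn 0 t w) (Yn n t w)); apply: (le_trans (ler_normD _ _)); apply: lerD.
    exact: (psup_ge T0 hC).
  exact: (psup_ge T0 hC0).
apply: (le_trans (powR_add_le (ltW p0) (v0 n w) (psup_ge0 T0 _))).
rewrite ler_wpM2l ?powR_ge0// lerD2r; have := hgw n.
by rewrite /vv min_l.
Qed.


Let Y : R -> Omega -> R := plim Yn.

(* The full-measure set of paths on which every hypothesis and every equation holds
   for all n and all times simultaneously. *)
Record good w : Prop := Good {
  gY : forall n, ucont T (Yn n ^~ w);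
  gK : forall n, ucont T (Kn n ^~ w);
  gI : forall n, ucont T (In n ^~ w);
  gL : ucont T (L ^~ w);
  gZ : forall n, li 0 T (fun s => enorm (Zn n s w) ^+ 2);
  gG : forall n, li 0 T (fun s => gn n s w (Yn n s w) (Zn n s w));
  gf : li 0 T (fun s => `|f s w|);
  gpsi : forall k : nat, li 0 T (fun s => psi s w k%:R);
  gbd : {ae leb, forall s, 0 <= s <= T -> forall n y z,
     `|gn n s w y z| <= `|f s w| + psi s w `|y| + lambda * enorm z};
  gpm : {ae leb, forall s, 0 <= s <= T -> forall r1 r2, 0 <= r1 -> r1 <= r2 -> psi s w r1 <= psi s w r2};
  geq : forall n t, 0 <= t <= T ->
          Yn n t w = xi w + (\int[leb]_(s in `[t, T]) gn n s w (Yn n s w) (Zn n s w))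
                  + (V T w - V t w) + (Kn n T w - Kn n t w) - (In n T w - In n t w);
  gYL : forall n t, 0 <= t <= T -> L t w <= Yn n t w;
  gKm : forall n s t, 0 <= s -> s <= t -> t <= T -> Kn n s w <= Kn n t w;
  gK0 : forall n, Kn n 0 w = 0;
  gSk : forall n r s, 0 <= r -> r <= s -> s <= T -> (forall u, r < u <= s -> L u w < Yn n u w) ->
     Kn n r w = Kn n s w;
  gbnd : exists C, forall n t, 0 <= t <= T -> `|Yn n t w| <= C;
  gcv : forall t, 0 <= t <= T -> (fun n => Yn n t w) @ \oo --> Y t w;
  gmon : forall n m t, 0 <= t <= T -> (n <= m)%N ->
     `|Yn n t w - Yn m t w| <= `|Yn n t w - Y t w| /\ `|Yn m t w - Y t w| <= `|Yn n t w - Y t w| }.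

Lemma ae_good : {ae P, forall w, good w}.
Proof.
have h1 : {ae P, forall w, forall n, ucont T (Yn n ^~ w)} by apply/ae_foralln => n; case: (aY n).
have h2 : {ae P, forall w, forall n, ucont T (Kn n ^~ w)} by apply/ae_foralln => n; case: (aK n).
have h3 : {ae P, forall w, forall n, ucont T (In n ^~ w)} by apply/ae_foralln => n; case: (aI n).
have h4 : {ae P, forall w, ucont T (L ^~ w)} by case: aL.
have h5 : {ae P, forall w, forall n, li 0 T (fun s => enorm (Zn n s w) ^+ 2)} by apply/ae_foralln => n; case: (hsol n).
have h6 : {ae P, forall w, forall n, li 0 T (fun s => gn n s w (Yn n s w) (Zn n s w))} by apply/ae_foralln => n; case: (hsol n).
have lfin (x : R -> Omega -> R) : Hspace P T F x -> {ae P, forall w, li 0 T (fun s => `|x s w|)}.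
  move=> [px]; apply: filterS => w h; apply: li_fin => //.
  by have := progressive_lmeas T0 w (progressive_norm px).
have h7 : {ae P, forall w, li 0 T (fun s => `|f s w|)} by case: hf => h _; exact: lfin.
have h8 : {ae P, forall w, forall k : nat, li 0 T (fun s => psi s w k%:R)}.
  apply/ae_foralln => k; have [psi0 _ /(_ k%:R (ler0n _ _)) hp'] := hpsi.
  apply: filterS (lfin _ hp') => w; apply: li_eq => s sT.
  by rewrite ger0_norm// psi0.
have h9 : {ae P, forall w, forall n, {ae leb, forall s, 0 <= s <= T -> forall y z,
     `|gn n s w y z| <= `|f s w| + psi s w `|y| + lambda * enorm z}}.
  apply/ae_foralln => n; apply: filterS (ae_PT_slice (hbound n)) => w.
  have lF : Filter (nbhs (almost_everywhere leb)) by exact: leb_ae_filter.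
  apply: filterS => s h sT y z; apply: (le_trans (h sT y z)).
  by rewrite -!addrA lerD2r ler_norm.
have h10 : {ae P, forall w, {ae leb, forall s, 0 <= s <= T -> forall r1 r2, 0 <= r1 -> r1 <= r2 -> psi s w r1 <= psi s w r2}}.
  have [_ hm _] := hpsi; apply: filterS (ae_PT_slice hm) => w.
  have lF : Filter (nbhs (almost_everywhere leb)) by exact: leb_ae_filter.
  by apply: filterS => s h sT; have [] := h sT.
have h11 : {ae P, forall w, forall n t, 0 <= t <= T ->
          Yn n t w = xi w + (\int[leb]_(s in `[t, T]) gn n s w (Yn n s w) (Zn n s w))
                  + (V T w - V t w) + (Kn n T w - Kn n t w) - (In n T w - In n t w)}.
  by apply/ae_foralln => n; case: (hsol n).
have h12 : {ae P, forall w, forall n t, 0 <= t <= T -> L t w <= Yn n t w}.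
  by apply/ae_foralln => n; case: (hsol n).
have h13 : {ae P, forall w, forall n s t, 0 <= s -> s <= t -> t <= T -> Kn n s w <= Kn n t w}.
  by apply/ae_foralln => n; case: (hsolK n).
have h14 : {ae P, forall w, forall n, Kn n 0 w = 0} by apply/ae_foralln => n; case: (hsolK n).
have h15 : {ae P, forall w, forall n, is_stieltjes_integral T (Kn n ^~ w) (fun t => Yn n t w - L t w) 0%E}.
  by apply/ae_foralln => n; case: (hsolK n).
have [Wp [iW W0 hW]] := Y_bound.
apply: filterS2 (filterI (filterI (filterI h1 h2) (filterI h3 h4)) (filterI (filterI h5 h6) (filterI h7 h8)))
  (filterI (filterI (filterI h9 h10) (filterI h11 h12)) (filterI (filterI h13 h14) (filterI (filterI h15 hW) monoY))).
move=> w [[[k1 k2] [k3 k4]] [[k5 k6] [k7 k8]]] [[[k9 k10] [k11 k12]] [[k13 k14] [[k15 k16] k17]]].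
have bd : exists C, forall n t, 0 <= t <= T -> `|Yn n t w| <= C.
  exists (Wp w `^ p^-1) => n t tT.
  by rewrite -[leLHS](powRK p0)// powR_le ?invr_ge0 ?(ltW p0) ?powR_ge0//; exact: k16.
(* A monotone sequence stays on one side of its limit, so the distance between two terms is at most
   that of the earlier one to the limit, and the distance to the limit decreases: this is [gmon]. *)
have cvmon (y : nat -> R) C : (forall n, `|y n| <= C) ->
   (forall n m, (n <= m)%N -> y n <= y m) \/ (forall n m, (n <= m)%N -> y m <= y n) ->
   exists l, y @ \oo --> l /\ (forall n m, (n <= m)%N -> `|y n - y m| <= `|y n - l| /\ `|y m - l| <= `|y n - l|).
  have up (u : nat -> R) : (forall n, `|u n| <= C) -> (forall n m, (n <= m)%N -> u n <= u m) ->
     exists l, u @ \oo --> l /\ (forall n m, (n <= m)%N -> `|u n - u m| <= `|u n - l| /\ `|u m - l| <= `|u n - l|).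
    move=> uC um.
    have nd : nondecreasing_seq u by move=> n m; exact: um.
    have ub : has_ubound (range u) by exists C => _ [n _ <-]; exact: le_trans (ler_norm _) (uC n).
    have cu := nondecreasing_is_cvgn nd ub.
    exists (limn u); split; first exact: cu.
    move=> n m nm; have un := nondecreasing_cvgn_le nd cu n; have um' := nondecreasing_cvgn_le nd cu m.
    have unm := um n m nm.
    by split; rewrite !ler0_norm ?subr_le0// !opprB; [rewrite lerD2r|rewrite lerD2l lerN2].
  move=> yC [ym|ym]; first exact: up.
  have [|n m nm|l [h h']] := up (fun n => - y n).
  - by move=> n; rewrite normrN.
  - by rewrite lerN2; exact: ym.
  exists (- l); split.
    have e : (fun n => - - y n) = y by apply/funext => n; rewrite opprK.
    by rewrite -e; exact: cvgN.
  move=> n m nm; have [h1' h2'] := h' n m nm.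
  split.
    rewrite -normrN (_ : - (y n - y m) = - y n - - y m); last by ring.
    by rewrite (le_trans h1')// -normrN (_ : - (- y n - l) = y n - - l)//; ring.
  rewrite -normrN (_ : - (y m - - l) = - y m - l); last by ring.
  by rewrite (le_trans h2')// -normrN (_ : - (- y n - l) = y n - - l)//; ring.
have lims t : 0 <= t <= T -> (fun n => Yn n t w) @ \oo --> Y t w /\
   (forall n m, (n <= m)%N -> `|Yn n t w - Yn m t w| <= `|Yn n t w - Y t w| /\ `|Yn m t w - Y t w| <= `|Yn n t w - Y t w|).
  move=> tT; have [C hC] := bd.
  have [|l [h1' h2']] := @cvmon (fun n => Yn n t w) C (fun n => hC n t tT).
    by case: k17 => h; [left|right] => n m nm; exact: h.
  have -> : Y t w = l by exact: (@plimE _ _ _ Yn t w l).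
  by split.
have lF : Filter (nbhs (almost_everywhere leb)) by exact: leb_ae_filter.
split => //.
- have : {ae leb, forall s, forall n, 0 <= s <= T -> forall y z,
     `|gn n s w y z| <= `|f s w| + psi s w `|y| + lambda * enorm z}.
    exact/ae_foralln.
  by apply: filterS => s h sT n; exact: h.
- move=> n r s r0 rs sT hu.
  apply: (flat_of_stieltjes (T := T) (k15 n)) => //.
  + have pYL : progressive T F (fun t w => Yn n t w - L t w).
      by apply: progressiveB; [case: (hYn n)|case: hL].
    exact: (progressive_borel T0 w pYL).
  + by move=> u uT; rewrite subr_ge0 k12.
  + by move=> u us; rewrite subr_gt0; exact: hu.
- by move=> t tT; case: (lims t tT).
- by move=> n m t tT; case: (lims t tT) => _; exact.
Qed.


Lemma lint_le_ae a b (x y : R -> R) : li a b x -> li a b y ->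
  {ae leb, forall s, a <= s <= b -> x s <= y s} ->
  \int[leb]_(s in `[a, b]) x s <= \int[leb]_(s in `[a, b]) y s.
Proof.
move=> ix iy xy.
have lF : Filter (nbhs (almost_everywhere leb)) by exact: leb_ae_filter.
have [|im ->] := @lint_ae_eq _ a b x (fun s => Num.min (x s) (y s)) ix.
  by apply: filterS xy => s h /h xy; rewrite min_l.
by apply: lint_le => // s _; rewrite ge_min lexx orbT.
Qed.

Lemma progressive_enorm (Z : R -> Omega -> 'rV[R]_d) : progressive_vec T F Z -> progressive T F (fun t w => enorm (Z t w)).
Proof.
move=> pZ; rewrite (_ : (fun t w => _) = fun t w => Num.sqrt (enorm (Z t w) ^+ 2)); last first.
  by apply/funext => t; apply/funext => w; rewrite sqrtr_sqr ger0_norm// sqrtr_ge0.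
apply: progressive_comp; last exact: progressive_enorm2.
by apply: continuous_measurable_fun; exact: sqrt_continuous.
Qed.

Lemma enorm_ge0 (z : 'rV[R]_d) : 0 <= enorm z. Proof. exact: sqrtr_ge0. Qed.

Lemma li_enorm (Z : R -> Omega -> 'rV[R]_d) w : progressive_vec T F Z -> li 0 T (fun s => enorm (Z s w) ^+ 2) -> li 0 T (fun s => enorm (Z s w)).
Proof.
move=> pZ lz; apply: (@li_le _ _ _ _ (fun s => 1 + enorm (Z s w) ^+ 2)).
- exact: (progressive_lmeas T0 w (progressive_enorm pZ)).
- move=> s _; rewrite ger0_norm ?enorm_ge0//; have := sqr_ge0 (enorm (Z s w) - 1); have := enorm_ge0 (Z s w); nra.
- by apply: liD => //; exact: li_cst.
Qed.

Let psi0 s w (k : nat) : 0 <= s <= T -> 0 <= psi s w k%:R.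
Proof. by move=> sT; case: hpsi => h _ _; exact: h. Qed.
Let ppsi (k : nat) : progressive T F (fun s w => psi s w k%:R).
Proof. by case: hpsi => _ _ /(_ k%:R (ler0n _ _))[]. Qed.
Let pf : progressive T F f. Proof. by case: hf => [[]]. Qed.
Let pY n : progressive T F (Yn n). Proof. by case: (hYn n). Qed.
Let pYl : progressive T F Y. Proof. exact: progressive_plim. Qed.

(** * Energy estimate for differences up to a localizing time *)

Section Localized.
Variables (k : nat) (k' : R).
Hypothesis k'0 : 0 <= k'.

(** While all solutions stay below [k], this plus [lambda] times the norms of [Zn n] and [Zn m]
    bounds the difference of the generators. *)
Let gam0 s w : R := 2 * `|f s w| + 2 * psi s w k%:R.
Let Gam := itproc gam0.
Let pgam0 : progressive T F gam0.
Proof.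
apply: progressiveD; apply: progressiveM => //; try exact: progressive_cst.
exact: progressive_norm.
Qed.
Let gam00 s w : 0 <= s <= T -> 0 <= gam0 s w.
Proof. by move=> sT; rewrite addr_ge0// mulr_ge0// psi0. Qed.
Let lgam0 w : good w -> li 0 T (gam0 ^~ w).
Proof. by move=> gw; apply: liD; apply: liZ; [exact: gf|exact: gpsi]. Qed.
Let aGam : acproc P T F Gam.
Proof. by apply: (itproc_acproc T0) => //; apply: filterS ae_good => w; exact: lgam0. Qed.

Let U (i : nat) t w : R := if i is j.+1 then `|Yn j t w| - k%:R else Gam t w - k'.
(** One time for all [n]: index 0 of [U] watches the integral of [gam0], index [j.+1] watches
    [Yn j]. By [loc_exists] it equals [T] outside an event of small probability, for suitable [k]
    and [k']. *)
Definition loc_time : Omega -> R := hitting T U.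
(** No stopping prevents large values at time 0, so these are excluded by an event of [F 0]. *)
Definition loc_set : set Omega := [set w | forall n, `|Yn n 0 w| <= k%:R].
Local Notation tau := loc_time.
Local Notation A0 := loc_set.

Lemma loc_time_optional : optional T F tau.
Proof.
apply: (hitting_optional T0 hF) => -[|j] t tT.
  by apply: measurable_funB; [case: aGam => h _; exact: h|exact: measurable_cst].
apply: measurable_funB; last exact: measurable_cst.
by apply: measurableT_comp => //; case: (aY j) => h _; exact: h.
Qed.

Lemma loc_set_filt : F 0 A0.
Proof.
have hF0 := filtration_sub hF T00.
rewrite (_ : A0 = ~` \bigcup_n [set w | k%:R < `|Yn n 0 w|]).
  apply: (subsigmaC hF0); apply: (subsigma_bigcup hF0) => n.
  have [h _] := acproc_norm (aY n).
  have := (gmeasE _ hF0).1 (h 0 T00) [set` `]k%:R, +oo[] (measurable_itv _).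
  by congr (F _ _); apply/seteqP; split => w /=; rewrite in_itv/= andbT.
apply/seteqP; split => w /=; first by move=> h [n _ /=]; rewrite ltNge h.
by move=> h n; rewrite leNgt; apply/negP => hn; apply: h; exists n.
Qed.

Let tau0 w : 0 <= tau w <= T. Proof. by case: loc_time_optional. Qed.

Lemma loc_before w : good w -> A0 w -> forall s, 0 <= s <= tau w ->
  (forall n, `|Yn n s w| <= k%:R) /\ Gam s w <= k'.
Proof.
move=> gw Aw s /andP[s0 st]; split.
  move=> n; have h := hitting_before T0 (U := U) (i := n.+1) (s := s) (w := w).
  have := h _ s0 st; rewrite /U !subr_le0; apply; last exact: Aw.
  by apply: ucontB; [apply: ucont_norm; exact: gY|exact: ucont_cst].
have h := hitting_before T0 (U := U) (i := 0%N) (s := s) (w := w).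
have := h _ s0 st; rewrite /U !subr_le0; apply.
  by apply: ucontB; [apply: li_ucont; exact: lgam0|exact: ucont_cst].
by rewrite /Gam /itproc lint_set1.
Qed.

Let sT w s : 0 <= s <= tau w -> 0 <= s <= T.
Proof. by move=> /andP[-> h]; rewrite (le_trans h)//; case/andP: (tau0 w). Qed.

Lemma loc_Y w : good w -> A0 w -> forall s, 0 <= s <= tau w -> `|Y s w| <= k%:R.
Proof.
move=> gw Aw s st.
have h : (fun n => `|Yn n s w|) @ \oo --> `|Y s w| by apply: cvg_norm; exact: gcv (sT st).
rewrite -(cvg_lim _ h)//; apply: limr_le; first by apply/cvg_ex; eexists; exact: h.
by apply: nearW => n; have [hn _] := loc_before gw Aw st; exact: hn.
Qed.

Lemma good_incr w n r s : good w -> 0 <= r -> r <= s -> s <= T ->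
  Yn n r w - Yn n s w + (In n s w - In n r w) =
  \int[leb]_(u in `[r, s]) gn n u w (Yn n u w) (Zn n u w) + (V s w - V r w) + (Kn n s w - Kn n r w).
Proof.
move=> gw r0 rs sT'.
rewrite (geq gw n (t := r)) ?r0 ?(le_trans rs)// (geq gw n (t := s)) ?sT' ?(le_trans r0)//.
rewrite (lint_add rs sT'); last exact: (liS r0 (lexx _) (gG gw n)).
ring.
Qed.

(** The weight serves two terms at once: [gam0] gives the part of [J] without [Z], and the 1 makes
    [Gap] control the integral of [|Yn n - Y|^2], because [|Yn n - Y| <= 2 k] before the localizing
    time. *)
Let Gap n := itproc (fun s w => `|Yn n s w - Y s w| * (gam0 s w + 1)).

Let Yb w : good w -> exists2 C, 0 <= C & forall n s, 0 <= s <= T -> `|Yn n s w - Y s w| <= 2 * C.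
Proof.
move=> gw; have [C hC] := gbnd gw; exists C; first by exact: le_trans (hC 0%N 0 T00).
move=> n s s0T; apply: (le_trans (ler_normB _ _)); apply: norm_le_double; first exact: hC.
have h : (fun n => `|Yn n s w|) @ \oo --> `|Y s w| by apply: cvg_norm; exact: gcv s0T.
rewrite -(cvg_lim _ h)//; apply: limr_le; first by apply/cvg_ex; eexists; exact: h.
by apply: nearW => j; exact: hC.
Qed.

Let pGap n : progressive T F (fun s w => `|Yn n s w - Y s w| * (gam0 s w + 1)).
Proof.
apply: progressiveM; first by apply: progressive_norm; exact: progressiveB.
by apply: progressiveD => //; exact: progressive_cst.
Qed.

Let lGap n w : good w -> li 0 T (fun s => `|Yn n s w - Y s w| * (gam0 s w + 1)).
Proof.
move=> gw; have [C C0 hC] := Yb gw.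
apply: (@li_le _ _ _ _ (fun s => (2 * C) * (gam0 s w + 1))).
- exact: (progressive_lmeas T0 w (pGap n)).
- move=> s s0T; have g1 := addr_ge0 (gam00 w s0T) ler01.
  by rewrite normrM normr_id (ger0_norm g1) ler_wpM2r//; exact: hC.
- by apply: liZ; apply: liD; [exact: lgam0|exact: li_cst].
Qed.

Let aGap n : acproc P T F (Gap n).
Proof.
apply: (itproc_acproc T0); first exact: pGap.
- by move=> s w s0T; rewrite mulr_ge0// addr_ge0// gam00.
- by apply: filterS ae_good => w; exact: lGap.
Qed.

Section Pair.
Variables n m : nat.
Hypothesis nm : (n <= m)%N.
Let X t w := Yn n t w - Yn m t w.
Let II t w := In n t w - In m t w.
Let Q := itproc (fun s w => enorm (Zn n s w - Zn m s w) ^+ 2).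
Let gam s w := gam0 s w + lambda * (enorm (Zn n s w) + enorm (Zn m s w)).
(** The drift of [X] consists of the generators, bounded by [gam], and of [Kn n - Kn m], whose
    variation is at most [Kn n + Kn m]; [V] cancels. [pair_J] has no term in [K], whose contribution
    has a favourable sign. *)
Let Lam t w := itproc gam t w + (Kn n t w + Kn m t w).
Definition pair_J := itproc (fun s w => `|Yn n s w - Yn m s w| * gam s w).
Local Notation J := pair_J.

Let pgam : progressive T F gam.
Proof.
apply: progressiveD => //; apply: progressiveM; first exact: progressive_cst.
by apply: progressiveD; exact: progressive_enorm.
Qed.

Let gamge0 s w : 0 <= s <= T -> 0 <= gam s w.
Proof. by move=> h; rewrite addr_ge0 ?gam00// mulr_ge0// addr_ge0// enorm_ge0. Qed.

Let lgam w : good w -> li 0 T (gam ^~ w).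
Proof.
move=> gw; apply: liD; first exact: lgam0.
by apply: liZ; apply: liD; apply: li_enorm => //; exact: gZ.
Qed.

Let lJ w : good w -> li 0 T (fun s => `|X s w| * gam s w).
Proof.
move=> gw; have [C hC] := gbnd gw.
apply: (@li_le _ _ _ _ (fun s => (2 * C) * gam s w)).
- have h : progressive T F (fun s w => `|X s w| * gam s w).
    by apply: progressiveM; [apply: progressive_norm; exact: progressiveB|exact: pgam].
  exact: (progressive_lmeas T0 w h).
- move=> s s0T; rewrite normrM normr_id (ger0_norm (gamge0 _ s0T)) ler_wpM2r ?gamge0//.
  by apply: (le_trans (ler_normB _ _)); apply: norm_le_double; exact: hC.
- by apply: liZ; exact: lgam.
Qed.

Let aX : acproc P T F X. Proof. exact: acprocB. Qed.
Lemma pair_Lam_acproc : acproc P T F Lam.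
Proof.
apply: acprocD; last exact: acprocD.
apply: (itproc_acproc T0); [exact: pgam|exact: gamge0|].
by apply: filterS ae_good => w; exact: lgam.
Qed.
Lemma pair_J_acproc : acproc P T F J.
Proof.
apply: (itproc_acproc T0).
- by apply: progressiveM; [apply: progressive_norm; exact: progressiveB|exact: pgam].
- by move=> s w h; rewrite mulr_ge0// gamge0.
- by apply: filterS ae_good => w; exact: lJ.
Qed.

(* If K^n increases on [r, s], then Y^n meets L there, where Y^n <= Y^m. *)
Lemma pair_energy_bound w : good w -> A0 w -> energy_bound II Q X Lam J (2 * k%:R) w (tau w).
Proof.
move=> gw Aw; have lg := lgam gw; have lj := lJ gw.
have lq : li 0 T (fun s => enorm (Zn n s w - Zn m s w) ^+ 2).
  apply: (@li_le _ _ _ _ (fun s => 2 * enorm (Zn n s w) ^+ 2 + 2 * enorm (Zn m s w) ^+ 2)).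
  - exact: (progressive_lmeas T0 w (progressive_enorm2 (progressive_vecB (hZn n) (hZn m)))).
  - by move=> s _; rewrite ger0_norm ?sqr_ge0// -[enorm (Zn m s w)]enormN; exact: enorm_sqr_add.
  - by apply: liD; apply: liZ; exact: gZ.
have addI (x : R -> R) r s : li 0 T x -> 0 <= r -> r <= s -> s <= T ->
    \int[leb]_(u in `[0, s]) x u - \int[leb]_(u in `[0, r]) x u = \int[leb]_(u in `[r, s]) x u.
  by move=> lx r0 rs s'; rewrite (lint_add r0 rs (liS (lexx _) s' lx)); rewrite addrAC subrr add0r.
have tT : tau w <= T by case/andP: (tau0 w).
have Deq r s : 0 <= r -> r <= s -> s <= tau w ->
   X r w - X s w + (II s w - II r w) =
   \int[leb]_(u in `[r, s]) (gn n u w (Yn n u w) (Zn n u w) - gn m u w (Yn m u w) (Zn m u w)) +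
    ((Kn n s w - Kn n r w) - (Kn m s w - Kn m r w)).
  move=> r0 rs st; have s' := le_trans st tT.
  have e1 := good_incr n gw r0 rs s'; have e2 := good_incr m gw r0 rs s'.
  rewrite RintegralB; [|exact: cmeasurable_itv|exact: (liS r0 s' (gG gw n))|exact: (liS r0 s' (gG gw m))].
  exact: diff_of_sums e1 e2.
have gbnd' r s : 0 <= r -> r <= s -> s <= tau w ->
   `|\int[leb]_(u in `[r, s]) (gn n u w (Yn n u w) (Zn n u w) - gn m u w (Yn m u w) (Zn m u w))| <=
   \int[leb]_(u in `[r, s]) gam u w.
  move=> r0 rs st; have s' := le_trans st tT.
  have lgg : li r s (fun u => gn n u w (Yn n u w) (Zn n u w) - gn m u w (Yn m u w) (Zn m u w)).
    by apply: liB; apply: (liS r0 s'); exact: gG.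
  apply: (le_trans (lint_norm lgg)); apply: lint_le_ae.
  - exact: li_norm.
  - exact: (liS r0 s' lg).
  have lF : Filter (nbhs (almost_everywhere leb)) by exact: leb_ae_filter.
  apply: filterS2 (gbd gw) (gpm gw) => u hb hm /andP[ru us].
  have uT : 0 <= u <= T by rewrite (le_trans r0 ru) (le_trans us s').
  have ut : 0 <= u <= tau w by rewrite (le_trans r0 ru) (le_trans us st).
  have [hY _] := loc_before gw Aw ut.
  apply: (le_trans (ler_normB _ _)).
  have b1 := hb uT n (Yn n u w) (Zn n u w); have b2 := hb uT m (Yn m u w) (Zn m u w).
  have c1 := hm uT _ _ (normr_ge0 _) (hY n); have c2 := hm uT _ _ (normr_ge0 _) (hY m).
  exact: (growth_diff b1 b2 c1 c2).
split.
- by rewrite /Lam /itproc lint_set1 !(gK0 gw) !addr0.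
- by rewrite /pair_J /itproc lint_set1.
- move=> s st; apply: (le_trans (ler_normB _ _)).
  by have [hY _] := loc_before gw Aw st; apply: norm_le_double; exact: hY.
- move=> r s r0 rs st; have s' := le_trans st tT; split.
  + rewrite -subr_ge0 /Q /itproc addI//; apply: Rintegral_ge0 => u _; exact: sqr_ge0.
  + rewrite -subr_ge0 /pair_J /itproc addI//; apply: Rintegral_ge0 => u /=; rewrite in_itv/= => /andP[ru us].
    by rewrite mulr_ge0// gamge0// (le_trans r0 ru) (le_trans us s').
  + rewrite Deq//; have h1 := gbnd' r s r0 rs st; have k1 := gKm gw n r0 rs s'; have k2 := gKm gw m r0 rs s'.
    have e := addI _ r s lg r0 rs s'.
    rewrite (_ : Lam s w - Lam r w = \int[leb]_(u in `[r, s]) gam u w +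
      ((Kn n s w - Kn n r w) + (Kn m s w - Kn m r w))); last by rewrite -e /Lam /itproc; ring.
    apply: (le_trans (ler_normD _ _)); apply: lerD => //.
    by apply: (le_trans (ler_normB _ _)); rewrite !ger0_norm ?subr_ge0.
move=> e epos; have uX : ucont T (X ^~ w) by apply: ucontB; exact: gY.
have [h h0 hh] := uX e epos; exists h => // r s r0 rs st sr; have s' := le_trans st tT.
have osc u : r <= u -> u <= s -> `|X s w - X u w| <= e.
  move=> ru us; apply: hh; first by rewrite (le_trans r0 rs).
    by rewrite (le_trans r0 ru) (le_trans us).
  by rewrite ger0_norm ?subr_ge0//; apply: le_trans sr; rewrite lerD2l lerN2.
rewrite Deq// mulrDr.
have lgr := liS r0 s' lg; have ljr := liS r0 s' lj.
(* [X s] is replaced under the integral by [X u], at the cost of the oscillation [e]. *)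
have p1 : X s w * \int[leb]_(u in `[r, s]) (gn n u w (Yn n u w) (Zn n u w) - gn m u w (Yn m u w) (Zn m u w)) <=
   (\int[leb]_(u in `[r, s]) (`|X u w| * gam u w)) + e * \int[leb]_(u in `[r, s]) gam u w.
  apply: (le_trans (ler_norm _)); rewrite normrM.
  apply: (@le_trans _ _ (`|X s w| * \int[leb]_(u in `[r, s]) gam u w)).
    by rewrite ler_wpM2l//; exact: gbnd'.
  have mI := @cmeasurable_itv R `[r, s].
  rewrite -!RintegralZl// -RintegralD//; last exact: liZ.
  apply: lint_le; [exact: liZ|by apply: liD => //; exact: liZ|].
  move=> u /andP[ru us]; rewrite -mulrDl ler_wpM2r ?gamge0//.
    by rewrite (le_trans r0 ru) (le_trans us s').
  by rewrite -lerBlDl; apply: le_trans (osc u ru us); exact: lerB_dist.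
have flat j i : j <= e -> 0 <= i -> j * i <= e * i by move=> je i0; rewrite ler_wpM2r.
(* [Yn a - Yn b] is at most 0 at some [u] of the interval, hence at most its oscillation [e] at [s].
   It is used in both orders, since the term in [Kn m] is the one in [Kn n] with the roles
   exchanged. *)
have pos (a b : nat) : 0 <= Kn a s w - Kn a r w ->
   (forall u, r <= u -> u <= s -> Yn a s w - Yn b s w - (Yn a u w - Yn b u w) <= e) ->
   (Yn a s w - Yn b s w) * (Kn a s w - Kn a r w) <= e * (Kn a s w - Kn a r w).
  move=> K0 osc'; have [E|] := eqVneq (Kn a r w) (Kn a s w); first by rewrite E subrr !mulr0.
  move=> NE; rewrite ler_wpM2r//.
  have [u [ru us Lu]] : exists u, [/\ r < u, u <= s & Yn a u w <= L u w].
    apply: contrapT => no; case/eqP: NE; apply: (gSk gw r0 rs s') => u /andP[ru us].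
    by rewrite ltNge; apply/negP => le; apply: no; exists u.
  have uT : 0 <= u <= T by rewrite (le_trans r0 (ltW ru)) (le_trans us s').
  apply: le_trans (osc' u (ltW ru) us); rewrite -[X in X <= _]subr0 lerD2l lerN2 subr_le0.
  exact: le_trans Lu (gYL gw b uT).
have K1 : 0 <= Kn n s w - Kn n r w by rewrite subr_ge0; exact: gKm.
have K2 : 0 <= Kn m s w - Kn m r w by rewrite subr_ge0; exact: gKm.
have q1 := pos n m K1 (fun u ru us => le_trans (ler_norm _) (osc u ru us)).
have q2 : (Yn m s w - Yn n s w) * (Kn m s w - Kn m r w) <= e * (Kn m s w - Kn m r w).
  apply: (pos m n K2) => u ru us; apply: le_trans (osc u ru us).
  by rewrite -normrN (_ : - (X s w - X u w) = Yn m s w - Yn n s w - (Yn m u w - Yn n u w)) ?ler_norm// /X; ring.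
rewrite /Lam /pair_J /itproc (addI _ r s lj r0 rs s').
have -> : e * (\int[leb]_(u in `[0, s]) gam u w + (Kn n s w + Kn m s w) -
    (\int[leb]_(u in `[0, r]) gam u w + (Kn n r w + Kn m r w))) =
  e * \int[leb]_(u in `[r, s]) gam u w + (e * (Kn n s w - Kn n r w) + e * (Kn m s w - Kn m r w)).
  by rewrite -(addI _ r s lg r0 rs s'); ring.
rewrite addrA; apply: lerD; first exact: p1.
rewrite mulrBr; apply: lerD; first exact: q1.
by rewrite -mulNr opprB.
Qed.

(** As [n <= m], monotonicity gives [|X| <= |Yn n - Y|], so that [Gap n] does not involve [m]. The
    part with [gam0] is in [Gap n]; those with [Zn n] and [Zn m] come from [young_path], the
    integral of [x^2] being at most [2 k Gap n] and at most [4 k^2 T]. *)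
Lemma pair_J_bound w (M N : R) : good w -> A0 w -> 0 < M -> 0 < N ->
  J (tau w) w <= Gap n (tau w) w + lambda * (
    (M * k%:R * Gap n (tau w) w + N / (2 * M) + (4 * k%:R ^+ 2 * T + 1) * (N `^ ((p - 1) / 2))^-1 * QZ n T w `^ (p / 2)) +
    (M * k%:R * Gap n (tau w) w + N / (2 * M) + (4 * k%:R ^+ 2 * T + 1) * (N `^ ((p - 1) / 2))^-1 * QZ m T w `^ (p / 2))).
Proof.
move=> gw Aw M0 N0; have /andP[t0 tT] := tau0 w; have mI := @cmeasurable_itv R `[0, tau w].
pose x s := `|Yn n s w - Y s w|.
have xk s : 0 <= s <= tau w -> 0 <= x s <= 2 * k%:R.
  move=> st; rewrite /x normr_ge0/=; apply: (le_trans (ler_normB _ _)); apply: norm_le_double.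
    by have [h _] := loc_before gw Aw st.
  exact: loc_Y.
have mx : lmeas [set` `[0, tau w]] x.
  apply: (lmeasS (lexx 0) tT); apply: (progressive_lmeas T0 w (X := fun s w => `|Yn n s w - Y s w|)).
  by apply: progressive_norm; exact: progressiveB.
have lx : li 0 (tau w) x.
  apply: (@li_le _ _ _ _ (fun=> 2 * k%:R)) => //; last exact: li_cst.
  by move=> s /xk /andP[x0 x1]; rewrite ger0_norm.
have lxx : li 0 (tau w) (fun s => x s ^+ 2).
  apply: (@li_le _ _ _ _ (fun s => 2 * k%:R * x s)); last exact: liZ.
    exact: (measurable_funM mx mx).
  by move=> s /xk /andP[x0 x1]; rewrite ger0_norm ?sqr_ge0// expr2 ler_wpM2r.
have lxg : li 0 (tau w) (fun s => x s * (gam0 s w + 1)).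
  apply: (liS (lexx 0) tT); exact: lGap.
have pz j : 0 <= \int[leb]_(s in `[0, tau w]) (x s * enorm (Zn j s w)) /\
   li 0 (tau w) (fun s => x s * enorm (Zn j s w)).
  split; last first.
    apply: (@li_le _ _ _ _ (fun s => 2 * k%:R * enorm (Zn j s w))).
    - have mz := lmeasS (lexx 0) tT (progressive_lmeas T0 w (progressive_enorm (hZn j))).
      exact: (measurable_funM mx mz).
    - move=> s /xk /andP[x0 x1]; rewrite ger0_norm ?mulr_ge0 ?enorm_ge0//.
      by rewrite ler_wpM2r// enorm_ge0.
    - by apply: liZ; apply: (liS (lexx 0) tT); apply: (li_enorm (hZn j)); exact: gZ.
  by apply: Rintegral_ge0 => s _; rewrite mulr_ge0 ?enorm_ge0// /x.
have hU : \int[leb]_(s in `[0, tau w]) x s ^+ 2 <= 2 * k%:R * Gap n (tau w) w.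
  rewrite /Gap /itproc -RintegralZl//; apply: lint_le => //; first exact: liZ.
  move=> s st; have /andP[x0 x1] := xk s st; rewrite expr2.
  apply: ler_pM => //; rewrite ler_peMr// lerDr gam00//; exact: sT st.
have hu : \int[leb]_(s in `[0, tau w]) x s ^+ 2 <= 4 * k%:R ^+ 2 * T.
  apply: (@le_trans _ _ (\int[leb]_(s in `[0, tau w]) (4 * k%:R ^+ 2))).
    apply: lint_le => //; first exact: li_cst.
    move=> s /xk /andP[x0 x1]; rewrite (_ : 4 * _ = (2 * k%:R) ^+ 2); last by ring.
    by rewrite ler_sqr ?nnegrE// mulr_ge0.
  by rewrite lint_cst// subr0 ler_wpM2l// mulr_ge0// sqr_ge0.
have yz j : \int[leb]_(s in `[0, tau w]) (x s * enorm (Zn j s w)) <=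
    M * k%:R * Gap n (tau w) w + N / (2 * M) + (4 * k%:R ^+ 2 * T + 1) * (N `^ ((p - 1) / 2))^-1 * QZ j T w `^ (p / 2).
  have lz := gZ gw j.
  have hS : \int[leb]_(s in `[0, tau w]) enorm (Zn j s w) ^+ 2 <= QZ j T w.
    rewrite /QZ /itproc (lint_add t0 tT lz) lerDl; apply: Rintegral_ge0 => s _; exact: sqr_ge0.
  apply: (le_trans (young_path lxx (liS (lexx 0) tT lz) (pz j).2 hp M0 N0 hu hS)).
  rewrite !lerD2r (_ : M * k%:R * _ = M / 2 * (2 * k%:R * Gap n (tau w) w)); last by field.
  by rewrite ler_wpM2l// divr_ge0// ltW.
apply: (@le_trans _ _ (\int[leb]_(s in `[0, tau w]) (x s * (gam0 s w + 1) +
   lambda * (x s * enorm (Zn n s w) + x s * enorm (Zn m s w))))).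
  apply: lint_le.
  - exact: (liS (lexx 0) tT (lJ gw)).
  - by apply: liD => //; apply: liZ; apply: liD; exact: (pz _).2.
  move=> s st; have s0T := sT st; have [h1 _] := gmon gw s0T nm.
  have g0 := gam00 w s0T; have e1 := enorm_ge0 (Zn n s w); have e2 := enorm_ge0 (Zn m s w).
  apply: (@le_trans _ _ (x s * gam s w)); first by rewrite ler_wpM2r// gamge0.
  rewrite -!mulrDr mulrCA -mulrDr ler_wpM2l//; first by rewrite /x.
  by rewrite /gam; apply: lerD => //; rewrite lerDl.
rewrite RintegralD//; last by apply: liZ; apply: liD; exact: (pz _).2.
rewrite lerD2l RintegralZl//; last by apply: liD; exact: (pz _).2.
rewrite ler_wpM2l// RintegralD//; [|exact: (pz _).2|exact: (pz _).2].
by apply: lerD; exact: yz.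
Qed.

End Pair.
Let stT (x : R -> Omega -> R) w : stopped x tau T w = x (tau w) w.
Proof. by rewrite /stopped min_r//; case/andP: (tau0 w). Qed.

Let mA0 : measurable A0. Proof. exact: (filt_meas hF T00 loc_set_filt). Qed.

Let mstop x : acproc P T F x -> measurable_fun setT (stopped x tau T).
Proof.
move=> ax; have [h _] := acproc_stopped hP hF loc_time_optional ax.
exact: (gmeas_measT hF TT (h T TT)).
Qed.

(** Dominated convergence in time: before [tau] the factor [|Yn n - Y|] is at most [2 k], and the
    integral of [gam0 + 1] is at most [k' + T]. *)
Let gap_key w : good w -> A0 w -> (fun n => Gap n (tau w) w) @ \oo --> (0 : R) /\
    forall n, `|Gap n (tau w) w| <= 2 * k%:R * (k' + T).
Proof.
have lF : Filter (nbhs (almost_everywhere leb)) by exact: leb_ae_filter.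
move=> gw Aw; have /andP[t0 tT] := tau0 w; have mI := @cmeasurable_itv R `[0, tau w].
  have lg : li 0 (tau w) (fun s => gam0 s w + 1).
    by apply: liD; [exact: (liS (lexx 0) tT (lgam0 gw))|exact: li_cst].
  have xk n s : 0 <= s <= tau w -> 0 <= `|Yn n s w - Y s w| <= 2 * k%:R.
    move=> st; rewrite normr_ge0/=; apply: (le_trans (ler_normB _ _)); apply: norm_le_double.
      by have [h _] := loc_before gw Aw st.
    exact: loc_Y.
  have g1 s : 0 <= s <= tau w -> 0 <= gam0 s w + 1.
    by move=> st; apply: addr_ge0 => //; apply: gam00; exact: sT st.
  have dom n s : 0 <= s <= tau w -> `| `|Yn n s w - Y s w| * (gam0 s w + 1) | <= 2 * k%:R * (gam0 s w + 1).
    move=> st; have /andP[x0 x1] := xk n s st.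
    by rewrite ger0_norm ?mulr_ge0 ?g1// ler_wpM2r ?g1.
  have lgn n := liS (lexx 0) tT (lGap n gw).
  split.
    have [||||_ h] := @lint_dct _ 0 (tau w) (fun n s => `|Yn n s w - Y s w| * (gam0 s w + 1)) (fun=> 0)
      (fun s => 2 * k%:R * (gam0 s w + 1)).
    - by move=> n; exact: (li_lmeas (lgn n)).
    - apply: aeW => s st; rewrite -[X in _ --> X](mul0r (gam0 s w + 1)).
      apply: cvgM; last exact: cvg_cst.
      rewrite -(normr0 R) -(subrr (Y s w)); apply: cvg_norm; apply: cvgB; last exact: cvg_cst.
      by apply: (gcv gw); exact: sT st.
    - by apply: aeW => s st n; exact: dom.
    - exact: liZ.
    apply: cvg_trans h; apply: near_eq_cvg; apply: nearW => n.
    apply: lint_eq => s st; rewrite subr0 ger0_norm// mulr_ge0// g1//.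
  move=> n; apply: (le_trans (lint_norm (lgn n))).
  apply: (@le_trans _ _ (\int[leb]_(s in `[0, tau w]) (2 * k%:R * (gam0 s w + 1)))).
    by apply: lint_le; [exact: li_norm|exact: liZ|exact: dom].
  rewrite RintegralZl// ler_wpM2l ?mulr_ge0// RintegralD//; last first.
  - exact: li_cst.
  - exact: (liS (lexx 0) tT (lgam0 gw)).
  rewrite lint_cst// subr0 mul1r; apply: lerD => //.
  have tt : 0 <= tau w <= tau w by rewrite t0 lexx.
  by have [_] := loc_before gw Aw tt.
Qed.

Lemma gap_cvg : (fun n => \int[P]_w (\1_A0 w * stopped (Gap n) tau T w)) @ \oo --> (0 : R).
Proof.
apply: (E_dct0 (c := 2 * k%:R * (k' + T))).
- by move=> n; apply: measurable_funM => //; exact: mstop.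
- apply: filterS ae_good => w gw; have [Aw|nA] := pselect (A0 w).
    under eq_fun do rewrite stT indicE mem_set// mul1r.
    by have [] := gap_key gw Aw.
  by under eq_fun do rewrite indicE memNset// mul0r; exact: cvg_cst.
- apply: filterS ae_good => w gw n; have [Aw|nA] := pselect (A0 w).
    by rewrite stT indicE mem_set// mul1r; have [] := gap_key gw Aw.
  by rewrite indicE memNset// mul0r normr0 mulr_ge0 ?mulr_ge0// addr_ge0.
Qed.

Let mYt : measurable_fun setT (stopped Y tau T).
Proof.
rewrite (_ : stopped Y tau T = fine \o (fun w => limn_esup (fun n => (stopped (Yn n) tau T w)%:E))) //.
apply: measurableT_comp; first exact: fine_measurable.
pose x n w := (stopped (Yn n) tau T w)%:E.
by apply: (@measurable_fun_limn_esup _ _ _ _ x) => n; apply/measurable_EFinP; exact: mstop.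
Qed.

Lemma terminal_cvg : (fun n => \int[P]_w (\1_A0 w * (stopped (Yn n) tau T w - stopped Y tau T w) ^+ 2)) @ \oo --> (0 : R).
Proof.
have st w : 0 <= tau w <= tau w by rewrite lexx andbT; case/andP: (tau0 w).
apply: (E_dct0 (c := (2 * k%:R) ^+ 2)).
- move=> n; apply: measurable_funM => //; apply: measurable_funX.
  by apply: measurable_funB => //; exact: mstop.
- apply: filterS ae_good => w gw; have [Aw|nA] := pselect (A0 w).
    have h : (fun n => Yn n (tau w) w - Y (tau w) w) @ \oo --> Y (tau w) w - Y (tau w) w.
      by apply: cvgB; [apply: (gcv gw); exact: tau0|exact: cvg_cst].
    have hh := cvgM h h; rewrite subrr mulr0 in hh.
    suff -> : (fun n => \1_A0 w * (stopped (Yn n) tau T w - stopped Y tau T w) ^+ 2) =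
      (fun n => (Yn n (tau w) w - Y (tau w) w) * (Yn n (tau w) w - Y (tau w) w)) by exact: hh.
    by apply/funext => n; rewrite !stT indicE mem_set// mul1r expr2.
  by under eq_fun do rewrite indicE memNset// mul0r; exact: cvg_cst.
- apply: filterS ae_good => w gw n; have [Aw|nA] := pselect (A0 w).
    rewrite !stT indicE mem_set// mul1r normrX.
    rewrite ler_sqr ?nnegrE ?mulr_ge0//; apply: (le_trans (ler_normB _ _)); apply: norm_le_double.
      by have [h _] := loc_before gw Aw (st w).
    by apply: (loc_Y gw Aw).
  by rewrite indicE memNset// mul0r normr0 sqr_ge0.
Qed.

Let Zm j : integ (fun w => QZ j T w `^ (p / 2)) /\ \int[P]_w (QZ j T w `^ (p / 2)) <= e0.
Proof.
have [h1 h2] := @Z_moment j 0 setT T00 F0T.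
have e w : \1_setT w * `|QZ j T w - QZ j 0 w| `^ (p / 2) = QZ j T w `^ (p / 2).
  rewrite indicT mul1r {2}/QZ /itproc lint_set1 subr0 ger0_norm//.
  by apply: Rintegral_ge0 => s _; exact: sqr_ge0.
rewrite -(eq_E P e) -[e0]ET; split => //; move: h1; congr integrable; apply/funext => w /=.
by rewrite e.
Qed.

Lemma e0_ge0 : 0 <= e0.
Proof. by apply: le_trans (Zm 0).2; apply: Rintegral_ge0 => w _; exact: powR_ge0. Qed.

Let sX n m t w := Yn n t w - Yn m t w.
Let sJ n m := stopped (pair_J n m) tau T.

Lemma J_ge0 n m t w : good w -> 0 <= t <= T -> 0 <= pair_J n m t w.
Proof.
move=> gw /andP[t0 tT]; apply: Rintegral_ge0 => s /=; rewrite in_itv/= => /andP[s0 st].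
have s0T : 0 <= s <= T by rewrite s0 (le_trans st).
by rewrite mulr_ge0// addr_ge0 ?gam00// mulr_ge0// addr_ge0// enorm_ge0.
Qed.

(** The constants of [pair_J_bound] are chosen in order: [N] so large that the terms divided by its
    power are small, thanks to the moment of [Z]; then [M] so that [N / M] is small; then [n] so
    that [Gap n], multiplied by [M], is small. None depends on [m]. *)
Lemma J_small e : 0 < e -> exists N0 : nat, forall n m, (N0 <= n)%N -> (n <= m)%N ->
  integ (fun w => \1_A0 w * sJ n m w) /\ \int[P]_w (\1_A0 w * sJ n m w) <= e.
Proof.
move=> epos; have q0 : 0 < (p - 1) / 2 by rewrite divr_gt0// subr_gt0.
pose c := 4 * k%:R ^+ 2 * T + 1.
have c0 : 0 < c by rewrite ltr_wpDl// mulr_ge0// mulr_ge0// sqr_ge0.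
(* The value required of the power of [N] with exponent [(p - 1) / 2]. Adding 1 keeps [D], and [M]
   below, positive when [lambda = 0]. *)
pose D := 8 * lambda * c * (e0 + 1) / e + 1.
have e01 : 0 <= e0 + 1 by rewrite addr_ge0// e0_ge0.
have D0 : 0 < D by rewrite ltr_wpDl// divr_ge0 ?(ltW epos)// !mulr_ge0// ltW.
pose N := D `^ ((p - 1) / 2)^-1.
have N0 : 0 < N by exact: powR_gt0.
have ND : N `^ ((p - 1) / 2) = D by rewrite /N -powRrM mulVf ?gt_eqF// powRr1// ltW.
pose M := 4 * lambda * N / e + 1.
have M0 : 0 < M by rewrite ltr_wpDl// divr_ge0 ?(ltW epos)// !mulr_ge0// ltW.
(* Total coefficient of [Gap n]: 1 directly, and [lambda * M * k] from each of the two terms in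
   [Z]. *)
pose a := 1 + 2 * lambda * M * k%:R.
have a0 : 0 < a by rewrite ltr_pwDl// !mulr_ge0// ltW.
have := gap_cvg; move=> /cvgrPdist_le /(_ (e / (4 * a))) h.
have ea : 0 < e / (4 * a) by rewrite divr_gt0// mulr_gt0.
have [N1 _ hN1] := h ea; exists N1 => n m N1n nm.
have {}hN1 := hN1 n N1n; rewrite sub0r normrN in hN1.
pose bd w := a * (\1_A0 w * stopped (Gap n) tau T w) + (lambda * N / M + lambda * (c / D) * (QZ n T w `^ (p / 2) + QZ m T w `^ (p / 2))).
have iGap : integ (fun w => \1_A0 w * stopped (Gap n) tau T w).
  apply: (integ_le_ae (Y := fun=> 2 * k%:R * (k' + T))); last exact: integ_cst.
    by apply: measurable_funM => //; exact: mstop.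
  apply: filterS ae_good => w gw; have [Aw|nA] := pselect (A0 w).
    by rewrite stT indicE mem_set// mul1r; have [] := gap_key gw Aw.
  by rewrite indicE memNset// mul0r normr0 mulr_ge0 ?mulr_ge0// addr_ge0.
have ibd : integ bd.
  apply: integD; first exact: integZ.
  apply: integD; first exact: integ_cst.
  by apply: integZ; apply: integD; exact: (Zm _).1.
have le : {ae P, forall w, `|\1_A0 w * sJ n m w| <= bd w}.
  apply: filterS ae_good => w gw.
  have r0 : 0 <= lambda * N / M + lambda * (c / D) * (QZ n T w `^ (p / 2) + QZ m T w `^ (p / 2)).
    apply: addr_ge0; first by rewrite divr_ge0 ?mulr_ge0// ltW.
    by apply: mulr_ge0; [rewrite mulr_ge0// divr_ge0// ltW|rewrite addr_ge0// powR_ge0].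
  rewrite /bd indicE; have [Aw|nA] := pselect (A0 w); last first.
    by rewrite memNset// !mul0r mulr0 normr0 add0r.
  rewrite mem_set// !mul1r ger0_norm /sJ !stT; last exact: J_ge0.
  apply: (le_trans (pair_J_bound nm gw Aw M0 N0)).
  by rewrite ND -/c young_assemble// gt_eqF.
have iJ : integ (fun w => \1_A0 w * sJ n m w).
  apply: integ_le_ae le ibd; apply: measurable_funM => //; apply: mstop; exact: pair_J_acproc.
split => //; apply: (@le_trans _ _ (\int[P]_w bd w)).
  by apply: Ele_ae => //; apply: filterS le => w; apply: le_trans; exact: ler_norm.
rewrite ED//; [|exact: integZ|]; last first.
  apply: integD; first exact: integ_cst.
  by apply: integZ; apply: integD; exact: (Zm _).1.
rewrite EZ// ED; [|exact: integ_cst|by apply: integZ; apply: integD; exact: (Zm _).1].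
rewrite Rintegral_cst//= EZ; last by apply: integD; exact: (Zm _).1.
rewrite ED; [|exact: (Zm n).1|exact: (Zm m).1].
have b1 : a * \int[P]_w (\1_A0 w * stopped (Gap n) tau T w) <= e / 4.
  have := le_trans (ler_norm _) hN1; rewrite -(ler_pM2l a0) => /le_trans; apply.
  by rewrite le_eqVlt; apply/orP; left; apply/eqP; field; rewrite gt_eqF.
have b2 : lambda * N / M <= e / 4.
  rewrite ler_pdivrMr// -ler_pdivrMl ?divr_gt0// (_ : _^-1 * _ = 4 * lambda * N / e); last by field; rewrite gt_eqF.
  by rewrite lerDl.
have b3 : lambda * (c / D) * (\int[P]_w (QZ n T w `^ (p / 2)) + \int[P]_w (QZ m T w `^ (p / 2))) <= e / 4.
  apply: (@le_trans _ _ (lambda * (c / D) * (2 * (e0 + 1)))).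
    apply: ler_wpM2l; first by rewrite mulr_ge0// divr_ge0// ltW.
    by apply: norm_le_double; apply: (le_trans (Zm _).2); rewrite lerDl.
  rewrite (_ : _ * _ = (2 * lambda * c * (e0 + 1)) / D); last by field; rewrite gt_eqF.
  rewrite ler_pdivrMr// -ler_pdivrMl ?divr_gt0//.
  by rewrite (_ : _^-1 * _ = 8 * lambda * c * (e0 + 1) / e) ?lerDl//; field; rewrite gt_eqF.
by rewrite probability_setT mulr1; exact: quarter_sum.
Qed.

(** The terminal square is bounded, uniformly in [m], by that of [Yn n - Y], since
    [|X| <= |Yn n - Y|] at [tau]. *)
Lemma pair_small e : 0 < e -> exists N0 : nat, forall n m, (N0 <= n)%N -> (n <= m)%N ->
  [/\ integ (fun w => \1_A0 w * stopped (sX n m) tau T w ^+ 2), integ (fun w => \1_A0 w * sJ n m w) &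
   \int[P]_w (\1_A0 w * stopped (sX n m) tau T w ^+ 2) + 2 * \int[P]_w (\1_A0 w * sJ n m w) <= e].
Proof.
move=> epos; have e2 : 0 < e / 2 by rewrite divr_gt0.
have e4 : 0 < e / 4 by rewrite divr_gt0.
have [N1 hN1] := J_small e4.
have := terminal_cvg => /cvgrPdist_le /(_ _ e2) [N2 _ hN2].
exists (maxn N1 N2) => n m; rewrite geq_max => /andP[N1n N2n] nm.
have [iJ leJ] := hN1 n m N1n nm; have {}hN2 := hN2 n N2n.
have bnd j : {ae P, forall w, `|\1_A0 w * (stopped (Yn n) tau T w - stopped j tau T w) ^+ 2| <= (2 * k%:R) ^+ 2} ->
   measurable_fun setT (stopped j tau T) -> integ (fun w => \1_A0 w * (stopped (Yn n) tau T w - stopped j tau T w) ^+ 2).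
  move=> h mj; apply: (integ_le_ae (Y := fun=> (2 * k%:R) ^+ 2)) => //; last exact: integ_cst.
  apply: measurable_funM => //; apply: measurable_funX; apply: measurable_funB => //; exact: mstop.
have st w : 0 <= tau w <= tau w by rewrite lexx andbT; case/andP: (tau0 w).
have bb (j : R -> Omega -> R) : (forall w, good w -> A0 w -> `|j (tau w) w| <= k%:R) ->
    {ae P, forall w, `|\1_A0 w * (stopped (Yn n) tau T w - stopped j tau T w) ^+ 2| <= (2 * k%:R) ^+ 2}.
  move=> hj; apply: filterS ae_good => w gw; have [Aw|nA] := pselect (A0 w).
    rewrite !stT indicE mem_set// mul1r normrX.
    rewrite ler_sqr ?nnegrE ?mulr_ge0//; apply: (le_trans (ler_normB _ _)); apply: norm_le_double.
      by have [h _] := loc_before gw Aw (st w).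
    exact: hj.
  by rewrite indicE memNset// mul0r normr0 sqr_ge0.
have iY : integ (fun w => \1_A0 w * (stopped (Yn n) tau T w - stopped Y tau T w) ^+ 2).
  by apply: bnd mYt; apply: bb => w gw Aw; exact: loc_Y.
have iX : integ (fun w => \1_A0 w * stopped (sX n m) tau T w ^+ 2).
  apply: (bnd (Yn m)); last exact: mstop.
  by apply: bb => w gw Aw; have [h _] := loc_before gw Aw (st w).
split => //; rewrite (splitr e); apply: lerD; last first.
  by rewrite mulrC -ler_pdivlMr// (_ : e / 2 / 2 = e / 4) //; field.
apply: (@le_trans _ _ (\int[P]_w (\1_A0 w * (stopped (Yn n) tau T w - stopped Y tau T w) ^+ 2))).
  apply: Ele_ae => //; apply: filterS ae_good => w gw; rewrite ler_wpM2l// !stT.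
  have [h _] := gmon gw (tau0 w) nm.
  by rewrite -[X in X <= _]real_normK ?num_real// -[X in _ <= X]real_normK ?num_real// ler_sqr ?nnegrE.
by rewrite sub0r normrN in hN2; apply: le_trans (ler_norm _) hN2.
Qed.

Let sQ n m := itproc (fun s w => enorm (Zn n s w - Zn m s w) ^+ 2).

(** [itopair_diff] and [pair_energy_bound] supply the hypotheses of [energy]. Sub-events of [A0]
    known at [t] are allowed, so that the estimate can be started at a first passage. *)
Lemma loc_energy n m t D : (n <= m)%N -> 0 <= t <= T -> F t D -> D `<=` A0 ->
  integ (fun w => \1_A0 w * sJ n m w) ->
  integ (fun w => \1_D w * (stopped (sX n m) tau t w ^+ 2 + (stopped (sQ n m) tau T w - stopped (sQ n m) tau t w))) /\
  \int[P]_w (\1_D w * (stopped (sX n m) tau t w ^+ 2 + (stopped (sQ n m) tau T w - stopped (sQ n m) tau t w))) <=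
  \int[P]_w (\1_D w * stopped (sX n m) tau T w ^+ 2) + 2 * \int[P]_w (\1_D w * sJ n m w).
Proof.
move=> nm tT FD DA iJ; have mD := filt_meas hF tT FD.
have ip := itopair_diff hP T0 hB (hZn n) (hZn m) (hI n) (hI m) (let: And4 _ h _ _ := hsol n in h) (let: And4 _ h _ _ := hsol m in h).
apply: (energy hP T0 hF (Lam := _) (C := 2 * k%:R) ip loc_time_optional tT FD _ _ (pair_Lam_acproc n m) (pair_J_acproc n m)).
- by rewrite mulr_ge0.
- exact: acprocB.
- by apply: filterS ae_good => w gw Dw; exact: (pair_energy_bound n m gw (DA w Dw)).
- have -> : (fun w => \1_D w * stopped (pair_J n m) tau T w) = (fun w => \1_D w * (\1_A0 w * sJ n m w)).
    apply/funext => w; rewrite /sJ !indicE; have [/set_mem/DA Aw|_] := boolP (w \in D); last by rewrite !mul0r.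
    by rewrite mem_set// !mul1r.
  exact: integ_indicM.
Qed.

(** Chebyshev's inequality for the energy estimate started at time 0. *)
Lemma loc_Q_small c dl : 0 < c -> 0 < dl -> exists N0 : nat, forall n m, (N0 <= n)%N -> (n <= m)%N ->
  forall W, measurable W -> {ae P, forall w, W w -> [/\ A0 w, tau w = T & c <= sQ n m T w]} ->
  fine (P W) <= dl.
Proof.
move=> c0 dl0; have [N0 hN0] := pair_small (mulr_gt0 c0 dl0).
exists N0 => n m N0n nm W mW hW; have [iX iJ le] := hN0 n m N0n nm.
have [iE leE] := loc_energy nm T00 loc_set_filt (@subset_refl _ A0) iJ.
rewrite -(ler_pM2l c0) -E_indic// -EZ; last exact: integ_indic.
apply: le_trans (le_trans leE le); apply: Ele_ae => //; first by apply: integZ; exact: integ_indic.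
apply: filterS2 hW ae_good => w hw gw.
have Q0 : A0 w -> stopped (sQ n m) tau 0 w <= stopped (sQ n m) tau T w.
  move=> Aw; have [_ _ _ h _] := pair_energy_bound n m gw Aw.
  have /andP[t0 tT] := tau0 w.
  by have [] := h 0 (tau w) (lexx _) t0 (lexx _); rewrite /stopped (min_l t0) (min_r tT).
rewrite !indicE; have [/set_mem Ww|_] := boolP (w \in W).
  have [Aw eT hc] := hw Ww; rewrite mem_set// mulr1 mul1r.
  have e1 : stopped (sQ n m) tau T w = sQ n m T w by rewrite stT eT.
  have e2 : stopped (sQ n m) tau 0 w = 0 by rewrite /stopped eT min_l// /sQ /itproc lint_set1.
  by rewrite e1 e2 subr0 (le_trans hc)// lerDr sqr_ge0.
rewrite mulr0; have [/set_mem Aw|_] := boolP (w \in A0); last by rewrite mul0r.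
by rewrite mul1r addr_ge0 ?sqr_ge0// subr_ge0 Q0.
Qed.

(** A maximal inequality obtained by starting the energy estimate at the first grid time where [|X|]
    exceeds [c]: [passage_limit] with [X^2] for [G], and for [f] the value [c^2] on [W]. *)
Lemma loc_Y_small c dl : 0 < c -> 0 < dl -> exists N0 : nat, forall n m, (N0 <= n)%N -> (n <= m)%N ->
  forall W, measurable W -> {ae P, forall w, W w -> [/\ A0 w, tau w = T &
    exists2 s, 0 <= s <= T & c < `|Yn n s w - Yn m s w|]} ->
  fine (P W) <= dl.
Proof.
move=> c0 dl0; have c20 : 0 < c ^+ 2 by rewrite exprn_gt0.
have [N0 hN0] := pair_small (mulr_gt0 c20 dl0).
exists N0 => n m N0n nm W mW hW; have [iX iJ le] := hN0 n m N0n nm.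
have aX : acproc P T F (stopped (sX n m) tau).
  by apply: (acproc_stopped hP hF loc_time_optional); exact: acprocB.
have mX t : 0 <= t <= T -> measurable_fun setT (stopped (sX n m) tau t).
  by move=> tT; case: aX => h _; exact: (gmeas_measT hF tT (h t tT)).
(* Nonnegative almost surely; its absolute value serves as majorant, which has to be nonnegative on
   every path. *)
pose Gm w := \1_A0 w * stopped (sX n m) tau T w ^+ 2 + 2 * (\1_A0 w * sJ n m w).
have iG : integ Gm by apply: integD => //; exact: integZ.
have Gm0 : {ae P, forall w, `|Gm w| = Gm w}.
  apply: filterS ae_good => w gw; rewrite ger0_norm// /Gm !indicE.
  have j0 : 0 <= sJ n m w by rewrite /sJ stT; apply: J_ge0 => //; exact: tau0.
  by apply: addr_ge0; [rewrite mulr_ge0 ?sqr_ge0|rewrite !mulr_ge0].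
rewrite -(ler_pM2l c20) -E_indic// -EZ; last exact: integ_indic.
apply: le_trans le; rewrite -EZ// -ED//; last exact: integZ.
have -> : \int[P]_w (\1_A0 w * stopped (sX n m) tau T w ^+ 2 + 2 * (\1_A0 w * sJ n m w)) = \int[P]_w (\1_setT w * `|Gm w|).
  have mGm : measurable_fun setT (fun w => \1_setT w * `|Gm w|).
    by apply: measurable_funM => //; apply: measurableT_comp => //; exact: integ_meas iG.
  have eG : {ae P, forall w, Gm w = \1_setT w * `|Gm w|}.
    by apply: filterS Gm0 => w ->; rewrite indicT mul1r.
  by have [_] := E_ae (integ_meas iG) mGm eG.
have aU : adapted T F (fun t w => `|stopped (sX n m) tau t w| - c).
  move=> t tT; have [h _] := acproc_norm aX.
  by apply: measurable_funB; [exact: h|exact: measurable_cst].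
apply: (proj2 (@passage_limit _ _ _ P T F T0 hF (fun t w => `|stopped (sX n m) tau t w| - c)
  (fun t w => stopped (sX n m) tau t w ^+ 2) (fun w => `|Gm w|) (fun w => c ^+ 2 * \1_W w) A0 setT
  loc_set_filt aU (integ_norm iG) _ _ _ _ _ _ measurableT _ _)).
- by [].
- by move=> t tT; apply: measurable_funX; exact: mX.
- by move=> t w; exact: sqr_ge0.
- move=> t D tT FD DA; have mD := filt_meas hF tT FD.
  have [iD leD] := loc_energy nm tT FD DA iJ.
  have le1 : {ae P, forall w, `|\1_D w * stopped (sX n m) tau t w ^+ 2| <=
     \1_D w * (stopped (sX n m) tau t w ^+ 2 + (stopped (sQ n m) tau T w - stopped (sQ n m) tau t w))}.
    apply: filterS ae_good => w gw; rewrite indicE.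
    have [/set_mem/DA Aw|_] := boolP (w \in D); last by rewrite !mul0r normr0.
    rewrite !mul1r ger0_norm ?sqr_ge0// lerDl subr_ge0.
    have [_ _ _ h _] := pair_energy_bound n m gw Aw; have /andP[t0 t1] := tT.
    have /andP[s0 s1] := tau0 w.
    have [] := h (Num.min t (tau w)) (Num.min T (tau w)).
    + by rewrite le_min t0.
    + by rewrite le_min !ge_min t1 lexx orbT.
    + by rewrite ge_min lexx orbT.
    + by [].
  have i1 : integ (fun w => \1_D w * stopped (sX n m) tau t w ^+ 2).
    by apply: integ_le_ae le1 iD; apply: measurable_funM => //; apply: measurable_funX; exact: mX.
  split => //; apply: (@le_trans _ _ (\int[P]_w (\1_D w * (stopped (sX n m) tau t w ^+ 2 + (stopped (sQ n m) tau T w - stopped (sQ n m) tau t w))))).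
    by apply: Ele_ae => //; apply: filterS le1 => w; apply: le_trans; exact: ler_norm.
  apply: (le_trans leD).
  have eD (x : Omega -> R) w : \1_D w * x w = \1_D w * (\1_A0 w * x w).
    rewrite !indicE; have [/set_mem/DA Aw|_] := boolP (w \in D); last by rewrite !mul0r.
    by rewrite mem_set// !mul1r.
  have iDX : integ (fun w => \1_D w * stopped (sX n m) tau T w ^+ 2).
    by rewrite (_ : (fun w => _) = (fun w => \1_D w * (\1_A0 w * stopped (sX n m) tau T w ^+ 2)));
      [exact: integ_indicM|apply/funext => w; exact: (eD (fun w => stopped (sX n m) tau T w ^+ 2))].
  have iDJ : integ (fun w => \1_D w * sJ n m w).
    by rewrite (_ : (fun w => _) = (fun w => \1_D w * (\1_A0 w * sJ n m w)));
      [exact: integ_indicM|apply/funext => w; exact: (eD (sJ n m))].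
  rewrite -EZ// -ED//; last exact: integZ.
  apply: Ele_ae; [by apply: integD => //; exact: integZ|by apply: integ_indicM => //; exact: integ_norm|].
  apply: aeW => w; apply: (@le_trans _ _ (\1_D w * Gm w)); last by rewrite ler_wpM2l// ler_norm.
  by rewrite (eD (sJ n m)) (eD (fun w => stopped (sX n m) tau T w ^+ 2)) /Gm mulrDr [X in _ <= _ + X]mulrCA.
- by apply: measurable_funM => //; exact: measurable_indic.
- by move=> w; rewrite mulr_ge0// ltW.
- apply: filterS2 hW ae_good => w hw gw e epos.
  have [Ww|nW] := pselect (W w); last by exists 0%N => N _; rewrite indicE memNset// mulr0 ltxx.
  have [Aw eT [s sT' cs]] := hw Ww.
  have ee : 0 < `|sX n m s w| - c by rewrite subr_gt0.
  have uX : ucont T (sX n m ^~ w) by apply: ucontB; exact: gY.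
  (* Half of the excess over [c] remains at a grid point close enough to [s], so there is a passage
     on the grid. *)
  have ee2 : 0 < (`|sX n m s w| - c) / 2 by rewrite divr_gt0.
  have [h h0 hh] := uX _ ee2.
  have [N1 hN1] : exists N1 : nat, forall N, (N1 <= N)%N -> T / N.+1%:R <= h.
    exists (Num.truncn (T / h)) => N NN; rewrite ler_pdivrMr ?ltr0n// -ler_pdivrMl// mulrC.
    by apply: ltW; apply: (lt_le_trans (truncnS_gt _)); rewrite ler_nat ltnS.
  exists N1 => N NN _; have [i iN gi] := grid_near T0 N sT'.
  have giT : 0 <= grid T N i <= T.
    rewrite /grid mulr_ge0 ?divr_ge0//= ler_piMl// ler_pdivrMr ?ltr0n// mul1r ler_nat//.
  have iex : c < `|stopped (sX n m) tau (grid T N i) w|.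
    rewrite /stopped eT min_l; last by case/andP: giT.
    have := hh s (grid T N i) sT' giT; rewrite distrC => /(_ (le_trans gi (hN1 N NN))) => h1.
    have := lerB_dist (sX n m s w) (sX n m (grid T N i) w).
    move=> /le_trans /(_ h1); rewrite lerBlDr -lerBlDl; apply: lt_le_trans.
    rewrite -subr_gt0 (_ : _ - c = (`|sX n m s w| - c) / 2)//; first by field.
  have ex : exists i, c < `|stopped (sX n m) tau (grid T N i) w| by exists i.
  case: (ex_minnP ex) => l cl lmin; exists l; first by exact: leq_trans (lmin _ iex) iN.
  split => //.
  + by rewrite subr_gt0.
  + move=> j jl; rewrite subr_le0 leNgt; apply/negP => /lmin; by rewrite leqNgt jl.
  + rewrite indicE mem_set// mulr1 lerBlDr ler_wpDr ?(ltW epos)//.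
    by rewrite -[X in _ <= X]real_normK ?num_real// ler_sqr ?nnegrE ?(ltW c0)// ltW.
- by apply: aeW => w _.
Qed.

End Localized.
Let mgt (X : Omega -> R) (c : R) : measurable_fun setT X -> measurable [set w | c < X w].
Proof.
move=> mX; have := mX measurableT _ (measurable_itv `]c, +oo[).
by rewrite setTI; congr measurable; apply/seteqP; split => w /=; rewrite in_itv/= andbT.
Qed.

(** The majorant of all [|Yn n|^p] and the integral of [gam0] are finite real variables, hence
    bounded outside an event of small probability; there the localization never acts. *)
Lemma loc_exists dl : 0 < dl -> exists (k : nat) (k' : R) (bad : set Omega),
  [/\ 0 <= k', measurable bad, fine (P bad) <= dl &
   {ae P, forall w, ~ bad w -> loc_set k w /\ loc_time k k' w = T}].
Proof.
move=> dl0; have dl2 : 0 < dl / 2 by rewrite divr_gt0.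
have [Wp [iWp Wp0 hWp]] := Y_bound.
have [K hK] := prob_bounded P (integ_meas iWp) dl2.
(* An integer above the [p]-th root of [K]; it is fixed before [K'], since [Gam] depends on it. *)
pose k := (Num.truncn (K%:R `^ p^-1)).+1.
pose Gam := itproc (fun s w => 2 * `|f s w| + 2 * psi s w k%:R).
have aG : acproc P T F Gam.
  apply: (itproc_acproc T0).
  - by apply: progressiveD; apply: progressiveM => //; try exact: progressive_cst; exact: progressive_norm.
  - by move=> s w sT; rewrite addr_ge0// mulr_ge0// psi0.
  - by apply: filterS ae_good => w gw; apply: liD; apply: liZ; [exact: gf|exact: gpsi].
have mG : measurable_fun setT (Gam T) by case: aG => h _; exact: (gmeas_measT hF TT (h T TT)).
have [K' hK'] := prob_bounded P mG dl2.
have m1 := mgt K%:R (integ_meas iWp); have m2 := mgt K'%:R mG.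
exists k, K'%:R, ([set w | K%:R < Wp w] `|` [set w | K'%:R < Gam T w]); split => //.
- exact: measurableU.
- rewrite [X in _ <= X](splitr dl); apply: le_trans (lerD hK hK'); apply: prob_sub => //; first exact: measurableU.
  by apply: aeW => w.
apply: filterS2 hWp ae_good => w hw gw /= nb.
have Wk : Wp w <= K%:R by rewrite leNgt; apply/negP => h; apply: nb; left.
have Gk : Gam T w <= K'%:R by rewrite leNgt; apply/negP => h; apply: nb; right.
have Yk n t : 0 <= t <= T -> `|Yn n t w| <= k%:R.
  move=> tT; rewrite -(powRK p0 (normr_ge0 (Yn n t w))).
  apply: (@le_trans _ _ (K%:R `^ p^-1)).
    by apply: powR_le; [rewrite invr_ge0 ltW|exact: powR_ge0|exact: le_trans (hw n t tT) Wk].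
  by apply: ltW; exact: truncnS_gt.
split; first by move=> n; exact: Yk.
apply: (hitting_eqT T0) => -[|j] q qT; last by rewrite subr_le0; exact: Yk.
rewrite subr_le0; apply: le_trans Gk; have /andP[q0 q1] := qT.
rewrite [X in _ <= X](lint_add q0 q1); last by apply: liD; apply: liZ; [exact: gf|exact: gpsi].
rewrite lerDl; apply: Rintegral_ge0 => s /=; rewrite in_itv/= => /andP[qs sT].
by rewrite addr_ge0// mulr_ge0// psi0// (le_trans q0 qs).
Qed.

Let mge (X : Omega -> R) (c : R) : measurable_fun setT X -> measurable [set w | c <= X w].
Proof.
move=> mX; have := mX measurableT _ (measurable_itv `[c, +oo[).
by rewrite setTI; congr measurable; apply/seteqP; split => w /=; rewrite in_itv/= andbT.
Qed.

Let psup_gt x c : 0 <= c -> c < psup T x -> exists2 s, 0 <= s <= T & c < `|x s|.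
Proof.
move=> c0 h; apply: contrapT => no; move: h; apply/negP; rewrite -leNgt; apply: psup_le => // s sT.
by rewrite leNgt; apply/negP => h; apply: no; exists s.
Qed.

Let mY n m : measurable_fun setT (fun w => psup T (fun t => Yn n t w - Yn m t w)).
Proof. by apply: (psup_meas hP T0 hF (X := fun t w => Yn n t w - Yn m t w)); exact: acprocB. Qed.
Let mI n m : measurable_fun setT (fun w => psup T (fun t => In n t w - In m t w)).
Proof. by apply: (psup_meas hP T0 hF (X := fun t w => In n t w - In m t w)); exact: acprocB. Qed.

(** The localization is removed at the price of the event [bad], to which half of [e] is devoted. *)
Lemma Y_cauchy e : 0 < e -> exists N0 : nat, forall n m, (N0 <= n)%N -> (n <= m)%N ->
  fine (P [set w | e < psup T (fun t => Yn n t w - Yn m t w)]) <= e.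
Proof.
move=> epos; have e2 : 0 < e / 2 by rewrite divr_gt0.
have [k [k' [bad [k'0 mbad Pbad hbad]]]] := loc_exists e2.
have [N0 hN0] := loc_Y_small k k'0 epos e2; exists N0 => n m N0n nm.
pose W := [set w | e < psup T (fun t => Yn n t w - Yn m t w)] `&` ~` bad.
have mW : measurable W by apply: measurableI; [exact: mgt|exact: measurableC].
have h : fine (P W) <= e / 2.
  apply: (hN0 n m N0n nm W mW); apply: filterS hbad => w hw [/= h nb]; have [h1 h2] := hw nb.
  by split => //; apply: psup_gt => //; exact: ltW.
rewrite [X in _ <= X](splitr e); apply: le_trans (lerD h Pbad); apply: prob_sub => //; first exact: mgt.
by apply: aeW => w /= hw; have [b|nb] := pselect (bad w); [right|left].
Qed.

Lemma Q_acproc n m : acproc P T F (itproc (fun s w => enorm (Zn n s w - Zn m s w) ^+ 2)).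
Proof.
by case: (itopair_diff hP T0 hB (hZn n) (hZn m) (hI n) (hI m) (let: And4 _ h _ _ := hsol n in h) (let: And4 _ h _ _ := hsol m in h)).
Qed.

Let mQ n m : measurable_fun setT (itproc (fun s w => enorm (Zn n s w - Zn m s w) ^+ 2) T).
Proof. by have [h _] := Q_acproc n m; exact: (gmeas_measT hF TT (h T TT)). Qed.

Lemma Q_cauchy e : 0 < e -> exists N0 : nat, forall n m, (N0 <= n)%N -> (n <= m)%N ->
  fine (P [set w | e <= itproc (fun s w => enorm (Zn n s w - Zn m s w) ^+ 2) T w]) <= e.
Proof.
move=> epos; have e2 : 0 < e / 2 by rewrite divr_gt0.
have [k [k' [bad [k'0 mbad Pbad hbad]]]] := loc_exists e2.
have [N0 hN0] := loc_Q_small k k'0 epos e2; exists N0 => n m N0n nm.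
pose W := [set w | e <= itproc (fun s w => enorm (Zn n s w - Zn m s w) ^+ 2) T w] `&` ~` bad.
have mW : measurable W by apply: measurableI; [exact: mge|exact: measurableC].
have h : fine (P W) <= e / 2.
  apply: (hN0 n m N0n nm W mW); apply: filterS hbad => w hw [/= h nb]; have [h1 h2] := hw nb.
  by split.
rewrite [X in _ <= X](splitr e); apply: le_trans (lerD h Pbad); apply: prob_sub => //; first exact: mge.
by apply: aeW => w /= hw; have [b|nb] := pselect (bad w); [right|left].
Qed.

Lemma I_cauchy e : 0 < e -> exists N0 : nat, forall n m, (N0 <= n)%N -> (n <= m)%N ->
  fine (P [set w | e < psup T (fun t => In n t w - In m t w)]) <= e.
Proof.
(* The first entry bounds the probability that the bracket reaches [dl], the second turns Lenglart's
   [e^2 P(W) <= dl] into [P(W) <= e / 2]. *)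
move=> epos; pose dl := Num.min (e / 2) (e ^+ 2 * (e / 2)).
have e2 : 0 < e / 2 by rewrite divr_gt0.
have dl0 : 0 < dl by rewrite lt_min e2 mulr_gt0 ?exprn_gt0.
have [N0 hN0] := Q_cauchy dl0; exists N0 => n m N0n nm.
have {}hN0 := hN0 n m N0n nm.
pose Q := itproc (fun s w => enorm (Zn n s w - Zn m s w) ^+ 2).
pose W := [set w | e < psup T (fun t => In n t w - In m t w)] `&` ~` [set w | dl <= Q T w].
have mW : measurable W by apply: measurableI; [exact: mgt|apply: measurableC; exact: (mge dl (mQ n m))].
have ip := itopair_diff hP T0 hB (hZn n) (hZn m) (hI n) (hI m) (let: And4 _ h _ _ := hsol n in h) (let: And4 _ h _ _ := hsol m in h).
have h : e ^+ 2 * fine (P W) <= dl.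
  apply: (lenglart hP T0 hF ip epos (ltW dl0) mW); apply: filterS ae_good => w gw [/= h1 h2].
  have lq : li 0 T (fun s => enorm (Zn n s w - Zn m s w) ^+ 2).
    apply: (@li_le _ _ _ _ (fun s => 2 * enorm (Zn n s w) ^+ 2 + 2 * enorm (Zn m s w) ^+ 2)).
    - exact: (progressive_lmeas T0 w (progressive_enorm2 (progressive_vecB (hZn n) (hZn m)))).
    - by move=> s _; rewrite ger0_norm ?sqr_ge0// -[enorm (Zn m s w)]enormN; exact: enorm_sqr_add.
    - by apply: liD; apply: liZ; exact: gZ.
  split; last by apply: psup_gt => //; exact: ltW.
  move=> s /andP[s0 sT]; apply/andP; split; first by apply: Rintegral_ge0 => u _; exact: sqr_ge0.
  apply: (@le_trans _ _ (Q T w)); last by apply: ltW; rewrite ltNge; apply/negP.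
  by rewrite /Q /itproc (lint_add s0 sT lq) lerDl; apply: Rintegral_ge0 => u _; exact: sqr_ge0.
have h' : fine (P W) <= e / 2.
  by rewrite -(ler_pM2l (exprn_gt0 2 epos)) (le_trans h)// ge_min lexx orbT.
have hq : fine (P [set w | dl <= Q T w]) <= e / 2 by apply: (le_trans hN0); rewrite ge_min lexx.
rewrite [X in _ <= X](splitr e); apply: le_trans (lerD h' hq); apply: prob_sub => //; [exact: mgt|exact: (mge dl (mQ n m))|].
by apply: aeW => w /= hw; have [b|nb] := pselect (dl <= Q T w); [right|left].
Qed.

(** A single integrable variable is uniformly integrable: where [|eta| <= k] the integral over [W]
    is at most [k P(W)], and the part above [k] is small for large [k]. *)
Lemma eta_ui dl : 0 < dl -> exists2 rho : R, 0 < rho & forall W, measurable W ->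
  fine (P W) <= rho -> \int[P]_w (\1_W w * `|eta w|) <= dl.
Proof.
move=> dl0; have iE := integ_norm eta_integ; have mE := integ_meas iE.
have : (fun k : nat => \int[P]_w (\1_[set w | k%:R < `|eta w|] w * `|eta w|)) @ \oo --> \int[P]_w (0 : R).
  apply: (E_dct (Y := fun w => `|eta w|)) => //.
  - by move=> k; apply: measurable_funM => //; apply: measurable_indic; exact: mgt.
  - apply: aeW => w; apply/cvgrPdist_le => e epos; exists (Num.truncn `|eta w|).+1 => // k /= kX.
    rewrite indicE memNset ?mul0r ?subrr ?normr0 ?ltW// => /=; apply/negP; rewrite -leNgt.
    by apply: ltW; apply: (lt_le_trans (truncnS_gt _)); rewrite ler_nat.
  - by apply: aeW => w k; rewrite indicE; case: (w \in _); rewrite ?mul1r ?mul0r ?normr_id// normr0.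
have d2 : 0 < dl / 2 by rewrite divr_gt0.
rewrite E0 => /cvgrPdist_le /(_ _ d2) [k _ hk].
have k1 : 0 < k%:R + 1 :> R by rewrite ltr_wpDl.
exists (dl / 2 / (k%:R + 1)); first by rewrite divr_gt0.
move=> W mW hW; have mk : measurable [set w | k%:R < `|eta w|] by exact: mgt.
apply: (@le_trans _ _ (\int[P]_w (\1_[set w | k%:R < `|eta w|] w * `|eta w| + k%:R * \1_W w))).
  apply: Ele; [exact: integ_indicM|by apply: integD; [exact: integ_indicM|apply: integZ; exact: integ_indic]|].
  move=> w; rewrite !indicE; have [hw|hw] := boolP (w \in [set w | k%:R < `|eta w|]).
    by rewrite mul1r ler_wpDr// ?mulr_ge0//; case: (w \in W); rewrite ?mul1r ?mul0r.
  rewrite mul0r add0r; case: (w \in W); rewrite ?mul1r ?mulr1 ?mul0r ?mulr0//.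
  by rewrite leNgt; apply: contra hw => h; exact: mem_set.
rewrite ED; [|exact: integ_indicM|by apply: integZ; exact: integ_indic].
rewrite EZ; last exact: integ_indic.
rewrite E_indic// (splitr dl); apply: lerD.
  by have := hk k (leqnn k); rewrite sub0r normrN; apply: le_trans; exact: ler_norm.
apply: (@le_trans _ _ (k%:R * (dl / 2 / (k%:R + 1)))); first by rewrite ler_wpM2l.
by rewrite mulrCA ler_piMr ?(ltW d2)// ler_pdivrMr// mul1r lerDl.
Qed.

Let r := p / 2.
Let r0 : 0 < r. Proof. by rewrite divr_gt0. Qed.

(** A one-sided continuity at [x]: since the power increases, only values of [y] below [x]
    matter. *)
Let powR_near (x e : R) : 0 < x -> 0 < e -> exists2 dl, 0 < dl & forall y, x - dl <= y -> x `^ r - e <= `|y| `^ r.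
Proof.
move=> x0 epos.
have hc : (fun k : nat => x - x * (2^-1) ^+ k) @ \oo --> x.
  rewrite -[X in _ --> X]subr0; apply: cvgB; first exact: cvg_cst.
  rewrite -[X in _ --> X](mulr0 x); apply: cvgM; first exact: cvg_cst.
  by apply: cvg_expr; rewrite ger0_norm ?invr_ge0// invf_lt1// ltr1n.
have y0 (k : nat) : 0 <= x - x * (2^-1) ^+ k.
  by rewrite subr_ge0 ler_piMr ?(ltW x0)// exprn_ile1// ?invr_ge0// invf_le1// ler1n.
have /cvgrPdist_le /(_ _ epos) [k _ hk] := powR_cvg r0 y0 hc.
exists (x * (2^-1) ^+ k); first by rewrite mulr_gt0// exprn_gt0// invr_gt0.
move=> y hy; have := hk k (leqnn k) => /(le_trans (ler_norm _)); rewrite lerBlDr -lerBlDl => /le_trans; apply.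
by apply: powR_le; [exact: ltW|exact: y0|exact: le_trans hy (ler_norm _)].
Qed.

Let QZ0 n w : QZ n 0 w = 0. Proof. exact: lint_set1. Qed.
Let QZ_ge0 n t w : 0 <= QZ n t w.
Proof. by apply: Rintegral_ge0 => s _; exact: sqr_ge0. Qed.
Let mQZ n t : 0 <= t <= T -> measurable_fun setT (QZ n t).
Proof. by move=> tT; have [h _] := QZ_acproc n; exact: (gmeas_measT hF tT (h t tT)). Qed.
Let QZm n w t : good w -> 0 <= t <= T -> QZ n t w <= QZ n T w.
Proof.
move=> gw /andP[t0 tT]; rewrite /QZ /itproc (lint_add t0 tT (gZ gw n)) lerDl.
by apply: Rintegral_ge0 => s _; exact: sqr_ge0.
Qed.

(* E[(QZ_T - N)^+ ^ r] is estimated by conditioning at the first grid time at which QZ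
   exceeds N, where QZ is close to N. *)
Lemma Z_excess N n : 0 < N -> integ (fun w => Num.max (QZ n T w - N) 0 `^ r) /\
  \int[P]_w (Num.max (QZ n T w - N) 0 `^ r) <= \int[P]_w (\1_[set w | N <= QZ n T w] w * `|eta w|).
Proof.
move=> N0; have aQ := QZ_acproc n.
apply: (@passage_limit _ _ _ P T F T0 hF (fun t w => QZ n t w - N) (fun t w => `|QZ n T w - QZ n t w| `^ r)
  (fun w => `|eta w|) _ setT _ F0T _ (integ_norm eta_integ)).
- move=> t tT; have [h _] := aQ.
  by apply: measurable_funB; [exact: h|exact: measurable_cst].
- by [].
- move=> t tT; apply: (measurableT_comp (measurable_powR _)); apply: measurableT_comp => //.
  by apply: measurable_funB; exact: mQZ.
- by move=> t w; exact: powR_ge0.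
- move=> t D tT FD _; have mD := filt_meas hF tT FD; have [h1 h2] := Z_moment n tT FD; split => //.
  apply: (le_trans h2); apply: Ele; [by apply: integ_indicM => //; exact: eta_integ|by apply: integ_indicM => //; apply: integ_norm; exact: eta_integ|].
  by move=> w; rewrite ler_wpM2l// ler_norm.
- apply: (measurableT_comp (measurable_powR _)); apply: measurable_maxr => //.
  by apply: measurable_funB => //; exact: mQZ.
- by move=> w; exact: powR_ge0.
- by apply: mge; exact: mQZ.
- apply: filterS ae_good => w gw e epos.
  have uQ : ucont T (QZ n ^~ w) by apply: li_ucont; exact: gZ.
  have [QN|NQ] := leP (QZ n T w) N.
    by exists 0%N => M _; rewrite max_r ?subr_le0// powR0 ?gt_eqF// ltxx.
  have x0 : 0 < QZ n T w - N by rewrite subr_gt0.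
  have [dl dl0 hdl] := powR_near x0 epos; have [h h0 hh] := uQ _ dl0.
  exists (Num.truncn (T / h)) => M MM _.
  have Th : T / M.+1%:R <= h.
    rewrite ler_pdivrMr ?ltr0n// -ler_pdivrMl// mulrC.
    by apply: ltW; apply: (lt_le_trans (truncnS_gt _)); rewrite ler_nat ltnS.
  have eT : grid T M M.+1 = T by rewrite /grid divff ?mul1r.
  have ex : exists i, 0 < QZ n (grid T M i) w - N by exists M.+1; rewrite eT.
  case: (ex_minnP ex) => l cl lmin; have lM : (l <= M.+1)%N by apply: lmin; rewrite eT.
  exists l => //; split => //.
    by move=> j jl; rewrite leNgt; apply/negP => /lmin; rewrite leqNgt jl.
  (* Index 0 is impossible since [QZ] starts at 0, below [N]. At the preceding grid time [QZ] is
     still at most [N], so by continuity it has hardly passed [N] at the passage. *)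
  case: l cl lmin lM => [|l] cl lmin lM.
    by move: cl; rewrite /grid mul0r mul0r QZ0 sub0r oppr_gt0 => /ltW; rewrite leNgt N0.
  have gT i : (i <= M.+1)%N -> 0 <= grid T M i <= T.
    move=> iM; rewrite /grid mulr_ge0 ?divr_ge0//= ler_piMl// ler_pdivrMr ?ltr0n// mul1r ler_nat//.
  have gl : QZ n (grid T M l) w <= N.
    by rewrite -subr_le0 leNgt; apply/negP => /lmin; rewrite ltnn.
  have := hh _ _ (gT _ lM) (gT _ (ltnW lM)).
  rewrite (_ : grid T M l.+1 - grid T M l = T / M.+1%:R); last first.
    by rewrite /grid -mulrBl -mulrBl -natr1 addrC addKr mul1r mulrC.
  rewrite ger0_norm ?divr_ge0// => /(_ Th) /(le_trans (ler_norm _)) osc.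
  rewrite max_l; last by rewrite subr_ge0 ltW.
  apply: hdl; rewrite -addrA -opprD lerD2l lerN2.
  by rewrite -lerBlDl; apply: le_trans osc; rewrite lerD2l lerN2.
- apply: filterS ae_good => w gw [_ [s sT' hs]] /=.
  by apply: ltW; apply: (lt_le_trans _ (QZm n gw sT')); rewrite -subr_gt0.
Qed.

(** By Chebyshev's inequality [QZ n T >= N] has probability at most [rho] for all [n] at once,
    because the power [r] of [N] is [D], above [e0 / rho]; [Z_excess] and [eta_ui] then conclude. *)
Lemma Z_ui dl : 0 < dl -> exists2 N : R, 0 < N & forall n, \int[P]_w (Num.max (QZ n T w - N) 0 `^ r) <= dl.
Proof.
move=> dl0; have [rho rho0 hrho] := eta_ui dl0.
pose D := e0 / rho + 1; have D0 : 0 < D by rewrite ltr_wpDl// divr_ge0 ?e0_ge0// ltW.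
pose N := D `^ r^-1; have N0 : 0 < N by exact: powR_gt0.
have ND : N `^ r = D by rewrite /N -powRrM mulVf ?gt_eqF// powRr1// ltW.
exists N => // n; apply: (le_trans (Z_excess n N0).2); apply: hrho; first by apply: mge; exact: mQZ.
have mW : measurable [set w | N <= QZ n T w] by apply: mge; exact: mQZ.
rewrite -(ler_pM2l D0) -E_indic// -EZ; last exact: integ_indic.
have [iZ eZ] : integ (fun w => QZ n T w `^ r) /\ \int[P]_w (QZ n T w `^ r) <= e0.
  have [h1 h2] := @Z_moment n 0 setT T00 F0T.
  have e w : \1_setT w * `|QZ n T w - QZ n 0 w| `^ r = QZ n T w `^ r.
    by rewrite indicT mul1r QZ0 subr0 ger0_norm.
  rewrite -(eq_E P e) -[e0]ET; split => //; move: h1; congr integrable; apply/funext => w /=.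
  by rewrite -[p / 2]/r e.
apply: (@le_trans _ _ e0).
  apply: le_trans eZ; apply: Ele => //; first by apply: integZ; exact: integ_indic.
  move=> w; rewrite indicE; have [/set_mem/= h|_] := boolP (_ \in _); last by rewrite mulr0 powR_ge0.
  by rewrite mulr1 -ND; apply: powR_le => //; exact: ltW.
by rewrite /D mulrDl mul1r divfK ?gt_eqF// lerDl ltW.
Qed.

Let sQ n m := itproc (fun s w => enorm (Zn n s w - Zn m s w) ^+ 2).

(** Vitali's argument: off [W] the bracket is below [e']; on [W] it is at most
    [2 (a_n + a_m + 2 N)], where the excesses are small in mean by [Z_ui] and the constant is
    multiplied by the small probability of [W]. *)
Lemma pair_Lp e : 0 < e -> exists N0 : nat, forall n m, (N0 <= n)%N -> (n <= m)%N ->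
  integ (fun w => sQ n m T w `^ r) /\ \int[P]_w (sQ n m T w `^ r) <= e.
Proof.
move=> epos; have e4 : 0 < e / 4 by rewrite divr_gt0.
pose c := 2 `^ r; have c0 : 0 < c by exact: powR_gt0.
(* The cube of [c] collects one factor from the leading 2 and one from each of two uses of
   [powR_add_le]. *)
pose dl := e / 4 / (2 * c ^+ 3); have c3 : 0 < 2 * c ^+ 3 by rewrite mulr_gt0// exprn_gt0.
have dl0 : 0 < dl by rewrite divr_gt0.
have [N N0 hN] := Z_ui dl0.
pose C2 := c ^+ 2 * (2 * N) `^ r; have C20 : 0 <= C2 by rewrite mulr_ge0 ?sqr_ge0// powR_ge0.
pose e1 := (e / 4) `^ r^-1; have e10 : 0 < e1 by exact: powR_gt0.
have e1r : e1 `^ r = e / 4 by rewrite /e1 -powRrM mulVf ?gt_eqF// powRr1// ltW.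
pose e' := Num.min e1 (e / 4 / (C2 + 1)).
have C21 : 0 < C2 + 1 by rewrite ltr_wpDl.
have e'0 : 0 < e' by rewrite lt_min e10 divr_gt0.
have [N1 hN1] := Q_cauchy e'0; exists N1 => n m n1 nm; have {}hN1 := hN1 n m n1 nm.
pose W := [set w | e' <= sQ n m T w]; have mW : measurable W by exact: mge (mQ n m).
pose A j w := Num.max (QZ j T w - N) 0 `^ r.
have iA j : integ (A j) by exact: (Z_excess j N0).1.
pose bd w := e / 4 + (c ^+ 3 * (A n w + A m w) + C2 * \1_W w).
have ibd : integ bd.
  apply: integD; first exact: integ_cst.
  by apply: integD; apply: integZ; [exact: integD|exact: integ_indic].
have Qle : {ae P, forall w, `|sQ n m T w `^ r| <= bd w}.
  apply: filterS ae_good => w gw; rewrite ger0_norm ?powR_ge0//.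
  have r1 : 0 <= c ^+ 3 * (A n w + A m w).
    by rewrite mulr_ge0 ?addr_ge0 ?powR_ge0// exprn_ge0// ltW.
  have Q0 : 0 <= sQ n m T w by apply: Rintegral_ge0 => s _; exact: sqr_ge0.
  rewrite /bd indicE; have [/set_mem hw|hw] := boolP (w \in W); last first.
    rewrite mulr0 addr0 ler_wpDr// -e1r; apply: powR_le => //; first exact: ltW.
    rewrite leNgt; apply: contra hw => h; apply/mem_set; rewrite /W /=.
    by apply: ltW; apply: le_lt_trans h; rewrite ge_min lexx.
  rewrite mulr1 ler_wpDl ?(ltW e4)//.
  pose a j := Num.max (QZ j T w - N) 0.
  have a0 j : 0 <= a j by rewrite le_max lexx orbT.
  have Qa : sQ n m T w <= 2 * ((a n + a m) + 2 * N).
    have lz j := gZ gw j; have mIT := @cmeasurable_itv R `[0, T].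
    apply: (@le_trans _ _ (2 * QZ n T w + 2 * QZ m T w)).
      have -> : 2 * QZ n T w + 2 * QZ m T w = \int[leb]_(s in `[0, T]) (2 * enorm (Zn n s w) ^+ 2 + 2 * enorm (Zn m s w) ^+ 2).
        rewrite RintegralD//; [|exact: (liZ 2 (lz n))|exact: (liZ 2 (lz m))].
        by rewrite RintegralZl; [rewrite RintegralZl; [by []|exact: mIT|exact: lz]|exact: mIT|exact: lz].
      apply: lint_le.
      - apply: (@li_le _ _ _ _ (fun s => 2 * enorm (Zn n s w) ^+ 2 + 2 * enorm (Zn m s w) ^+ 2)).
        + exact: (progressive_lmeas T0 w (progressive_enorm2 (progressive_vecB (hZn n) (hZn m)))).
        + by move=> s _; rewrite ger0_norm ?sqr_ge0// -[enorm (Zn m s w)]enormN; exact: enorm_sqr_add.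
        + by apply: liD; apply: liZ.
      - by apply: liD; exact: liZ.
      - by move=> s _; rewrite -[enorm (Zn m s w)]enormN; exact: enorm_sqr_add.
    have ha j : QZ j T w <= a j + N by rewrite -lerBlDr le_max lexx.
    have h1 := ha n; have h2 := ha m.
    rewrite -mulrDr ler_wpM2l//; apply: (le_trans (lerD h1 h2)).
    by rewrite addrACA; have -> : 2 * N = N + N by ring.
  apply: (le_trans (powR_le (ltW r0) Q0 Qa)).
  have N20 : 0 <= 2 * N by rewrite mulr_ge0// ltW.
  have s1 := powR_add_le (ltW r0) (addr_ge0 (a0 n) (a0 m)) N20.
  have s2 := powR_add_le (ltW r0) (a0 n) (a0 m).
  rewrite powRM ?addr_ge0 ?a0// -/c; apply: (@le_trans _ _ (c * (c * (c * (a n `^ r + a m `^ r) + (2 * N) `^ r)))).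
    rewrite ler_wpM2l ?(ltW c0)//; apply: (le_trans s1); rewrite ler_wpM2l ?(ltW c0)//.
    by rewrite lerD2r.
  have E (x y : R) : c * (c * (c * x + y)) = c ^+ 3 * x + c ^+ 2 * y by ring.
  by rewrite E.
have iQ : integ (fun w => sQ n m T w `^ r).
  by apply: integ_le_ae Qle ibd; apply: (measurableT_comp (measurable_powR _)); exact: mQ.
split => //; apply: (@le_trans _ _ (\int[P]_w bd w)).
  by apply: Ele_ae => //; apply: filterS Qle => w; apply: le_trans; exact: ler_norm.
rewrite ED; [|exact: integ_cst|by apply: integD; apply: integZ; [exact: integD|exact: integ_indic]].
rewrite ED; [|by apply: integZ; exact: integD|by apply: integZ; exact: integ_indic].
rewrite EZ; last exact: integD.
rewrite ED// EZ; last exact: integ_indic.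
rewrite E_indic// Rintegral_cst//= probability_setT mulr1.
apply: (quarter_sum epos (lexx _)).
  apply: (@le_trans _ _ (c ^+ 3 * (dl + dl))); first by apply: ler_wpM2l; [rewrite exprn_ge0// ltW|apply: lerD; exact: hN].
  by rewrite le_eqVlt; apply/orP; left; apply/eqP; rewrite /dl; field; rewrite gt_eqF.
apply: (@le_trans _ _ (C2 * e')); first by rewrite ler_wpM2l.
apply: (@le_trans _ _ (C2 * (e / 4 / (C2 + 1)))); first by rewrite ler_wpM2l// ge_min lexx orbT.
by rewrite mulrCA ler_piMr ?(ltW e4)// ler_pdivrMr// mul1r lerDl.
Qed.

Local Notation hp2 j := ((2^-1 : R) ^+ j).
Let hf_gt0 j : 0 < hp2 j. Proof. by rewrite exprn_gt0// invr_gt0. Qed.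
Let hf_le1 j : hp2 j <= 1. Proof. by rewrite exprn_ile1// ?invr_ge0// invf_le1// ler1n. Qed.
Let hf3 j : 0 < hp2 j ^+ 3 /\ hp2 j ^+ 3 <= hp2 j.
Proof.
split; first by rewrite exprn_gt0.
by rewrite exprS ler_piMr ?(ltW (hf_gt0 j))// exprn_ile1// ltW.
Qed.

(** Errors below [8^-j] rather than [2^-j] leave room for the weights [4^j] by which the squared
    increments of [Z] will be multiplied: their integrals remain summable. *)
Lemma subsequence_exists : exists nj : nat -> nat, (forall i j, (i < j)%N -> (nj i < nj j)%N) /\
  {ae P, forall w, exists J, forall j, (J <= j)%N ->
    [/\ psup T (fun t => Yn (nj j) t w - Yn (nj j.+1) t w) <= hp2 j ^+ 3,
        itproc (fun s w => enorm (Zn (nj j) s w - Zn (nj j.+1) s w) ^+ 2) T w <= hp2 j ^+ 3 &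
        psup T (fun t => In (nj j) t w - In (nj j.+1) t w) <= hp2 j ^+ 3]}.
Proof.
have step j : exists N : nat, forall n m, (N <= n)%N -> (n <= m)%N ->
  [/\ fine (P [set w | hp2 j ^+ 3 < psup T (fun t => Yn n t w - Yn m t w)]) <= hp2 j ^+ 3,
      fine (P [set w | hp2 j ^+ 3 <= itproc (fun s w => enorm (Zn n s w - Zn m s w) ^+ 2) T w]) <= hp2 j ^+ 3 &
      fine (P [set w | hp2 j ^+ 3 < psup T (fun t => In n t w - In m t w)]) <= hp2 j ^+ 3].
  have [N1 h1] := Y_cauchy (hf3 j).1; have [N2 h2] := Q_cauchy (hf3 j).1.
  have [N3 h3] := I_cauchy (hf3 j).1.
  exists (maxn N1 (maxn N2 N3)) => n m; rewrite !geq_max => /and3P[n1 n2 n3] nm.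
  by split; [exact: h1|exact: h2|exact: h3].
have [N hN] := choice step.
(* Each index exceeds the previous one and the threshold of its own rank, so consecutive indices
   satisfy the estimates of [step]. *)
pose nj := nat_rect (fun=> nat) (N 0%N) (fun j x => maxn x.+1 (N j.+1)).
have njS j : (nj j < nj j.+1)%N by rewrite /= leq_max leqnn.
have njN j : (N j <= nj j)%N by case: j => // j; rewrite /= leq_max leqnn orbT.
have BC (E : nat -> set Omega) : (forall j, measurable (E j)) -> (forall j, fine (P (E j)) <= hp2 j ^+ 3) ->
    {ae P, forall w, exists J : nat, forall j, (J <= j)%N -> ~ E j w}.
  move=> mE hE; apply: borel_cantelli_pow => // j.
  rewrite -(@fineK _ (P (E j))) ?fin_num_measure// lee_fin; apply: le_trans (hE j) _.
  by case: (hf3 j).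
exists nj; split.
  move=> i j ij; rewrite -(subnKC ij); elim: (j - i.+1)%N => [|k IH]; first by rewrite addn0.
  by rewrite addnS; exact: ltn_trans IH (njS _).
have b1 := BC (fun j => [set w | hp2 j ^+ 3 < psup T (fun t => Yn (nj j) t w - Yn (nj j.+1) t w)])
  (fun j => mgt _ (mY _ _)) (fun j => let: And3 h _ _ := hN j (nj j) (nj j.+1) (njN j) (ltnW (njS j)) in h).
have b2 := BC (fun j => [set w | hp2 j ^+ 3 <= itproc (fun s w => enorm (Zn (nj j) s w - Zn (nj j.+1) s w) ^+ 2) T w])
  (fun j => mge _ (mQ _ _)) (fun j => let: And3 _ h _ := hN j (nj j) (nj j.+1) (njN j) (ltnW (njS j)) in h).
have b3 := BC (fun j => [set w | hp2 j ^+ 3 < psup T (fun t => In (nj j) t w - In (nj j.+1) t w)])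
  (fun j => mgt _ (mI _ _)) (fun j => let: And3 _ _ h := hN j (nj j) (nj j.+1) (njN j) (ltnW (njS j)) in h).
apply: filterS2 (filterI b1 b2) b3 => w [[J1 h1] [J2 h2]] [J3 h3].
exists (maxn J1 (maxn J2 J3)) => j; rewrite !geq_max => /and3P[j1 j2 j3]; split.
- by rewrite leNgt; apply/negP; exact: h1.
- by apply: ltW; rewrite ltNge; apply/negP; exact: h2.
- by rewrite leNgt; apply/negP; exact: h3.
Qed.

(** * The limit triple along a fast subsequence *)

Section Subsequence.
Variable nj : nat -> nat.
Hypothesis hnj : forall i j, (i < j)%N -> (nj i < nj j)%N.
Hypothesis hsub : {ae P, forall w, exists J, forall j, (J <= j)%N ->
    [/\ psup T (fun t => Yn (nj j) t w - Yn (nj j.+1) t w) <= hp2 j ^+ 3,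
        itproc (fun s w => enorm (Zn (nj j) s w - Zn (nj j.+1) s w) ^+ 2) T w <= hp2 j ^+ 3 &
        psup T (fun t => In (nj j) t w - In (nj j.+1) t w) <= hp2 j ^+ 3]}.

Let nj_ge j : (j <= nj j)%N.
Proof. by elim: j => // j IH; exact: leq_ltn_trans IH (hnj (ltnSn j)). Qed.

Let sub_cvg (u : nat -> R) (l : R) : u @ \oo --> l -> (fun j => u (nj j)) @ \oo --> l.
Proof.
move=> /cvgrPdist_le h; apply/cvgrPdist_le => e epos; have [N _ hN] := h e epos.
by exists N => // j /= Nj; apply: hN => /=; exact: leq_trans Nj (nj_ge j).
Qed.

(** Upper limits along the subsequence, coordinate by coordinate: defined for every path and time,
    progressive by construction, and equal to the limit wherever there is one. *)
Let Z : R -> Omega -> 'rV[R]_d := fun t w => \row_i plim (fun j t w => Zn (nj j) t w 0 i) t w.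
Let I : R -> Omega -> R := plim (fun j => In (nj j)).
Let K : R -> Omega -> R := plim (fun j => Kn (nj j)).

(** For [Z] the convergence is kept pointwise in time, with a rate and an integrable factor [G]:
    this serves both for convergence of the integrals of squares and for the domination of the
    generators. For [Y] the whole sequence converges. *)
Record converges w : Prop := Converges {
  cgood : good w;
  cY : forall e : R, 0 < e -> exists N : nat, forall n, (N <= n)%N -> forall t, 0 <= t <= T -> `|Yn n t w - Y t w| <= e;
  cI : forall e : R, 0 < e -> exists J : nat, forall j, (J <= j)%N -> forall t, 0 <= t <= T -> `|In (nj j) t w - I t w| <= e;
  cZ : exists G : R -> R, [/\ li 0 T G, forall s, 0 <= G s &
    {ae leb, forall s, 0 <= s <= T -> forall j, enorm (Zn (nj j) s w - Z s w) ^+ 2 <= hp2 j * G s}] }.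

Let pdZ n m : progressive T F (fun s w => enorm (Zn n s w - Zn m s w) ^+ 2).
Proof. exact: (progressive_enorm2 (progressive_vecB (hZn n) (hZn m))). Qed.

Let ldZ n m w : good w -> li 0 T (fun s => enorm (Zn n s w - Zn m s w) ^+ 2).
Proof.
move=> gw; apply: (@li_le _ _ _ _ (fun s => 2 * enorm (Zn n s w) ^+ 2 + 2 * enorm (Zn m s w) ^+ 2)).
- exact: (progressive_lmeas T0 w (pdZ n m)).
- by move=> s _; rewrite ger0_norm ?sqr_ge0// -[enorm (Zn m s w)]enormN; exact: enorm_sqr_add.
- by apply: liD; apply: liZ; exact: gZ.
Qed.

Let sub_bound (x : nat -> R -> Omega -> R) w j : (forall n, ucont T (x n ^~ w)) ->
  psup T (fun t => x (nj j) t w - x (nj j.+1) t w) <= hp2 j ^+ 3 ->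
  forall t, 0 <= t <= T -> `|x (nj j) t w - x (nj j.+1) t w| <= 1 * hp2 j.
Proof.
move=> u h t tT; have [C hC] := ucont_bounded T0 (ucontB (u (nj j)) (u (nj j.+1))).
rewrite mul1r; apply: le_trans (hf3 j).2; apply: le_trans h.
exact: (psup_ge T0 hC).
Qed.

Lemma ae_converges : {ae P, forall w, converges w}.
Proof.
have lF : Filter (nbhs (almost_everywhere leb)) by exact: leb_ae_filter.
apply: filterS2 hsub ae_good => w [J hJ] gw; split => //.
- move=> e epos; have e2 : 0 < e / 2 by rewrite divr_gt0.
  have [J' hJ'] := half_pow_small e2; pose j := maxn J J'; exists (nj j) => n jn t tT.
  (* [|Yn n - Y|] decreases in [n], so the rate of the subsequence serves the whole sequence. *)
  have [_ h] := gmon gw tT jn; apply: (le_trans h).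
  have [|l [cl hl]] := @geometric_cauchy _ (fun j => Yn (nj j) t w) 1 J ler01.
    by move=> i Ji; have [h1 _ _] := hJ i Ji; exact: (sub_bound (gY gw) h1).
  have -> : Y t w = l.
    by apply: (@cvg_unique _ (@norm_hausdorff _ R) _ _ _ _ (sub_cvg (gcv gw tT)) cl).
  apply: (le_trans (hl j (leq_maxl _ _))); rewrite mulr1 mulrC -ler_pdivlMr//.
  by apply: hJ'; exact: leq_maxr.
- move=> e epos; have e2 : 0 < e / 2 by rewrite divr_gt0.
  have [J' hJ'] := half_pow_small e2; exists (maxn J J') => j; rewrite geq_max => /andP[Jj J'j] t tT.
  have [|l [cl hl]] := @geometric_cauchy _ (fun j => In (nj j) t w) 1 J ler01.
    by move=> i Ji; have [_ _ h1] := hJ i Ji; exact: (sub_bound (gI gw) h1).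
  have -> : I t w = l by exact: plimE.
  apply: (le_trans (hl j Jj)); rewrite mulr1 mulrC -ler_pdivlMr//; exact: hJ'.
pose D j s := enorm (Zn (nj j) s w - Zn (nj j.+1) s w) ^+ 2.
(* With weights [4^j] the partial sums have bounded integrals, since that of [D j] is at most [8^-j]
   from [J] on. Under their common majorant [G] the increments of [Z] are at most [sqrt G] times
   [2^-j] at almost every time, a geometric Cauchy sequence. *)
pose x N s := \sum_(j < N) (2 ^+ j) ^+ 2 * D j s.
have D0 j s : 0 <= (2 ^+ j) ^+ 2 * D j s by rewrite mulr_ge0// sqr_ge0.
have x0 N s : 0 <= x N s by apply: sumr_ge0 => j _; exact: D0.
have xS N s : x N.+1 s = x N s + (2 ^+ N) ^+ 2 * D N s by rewrite /x big_ord_recr.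
have lD j : li 0 T (D j) by exact: ldZ.
have lx N : li 0 T (x N).
  elim: N => [|N IH]; first by apply: li_eq (li_cst 0 T 0) => s _; rewrite /x big_ord0.
  by apply: (li_eq (x := fun s => x N s + (2 ^+ N) ^+ 2 * D N s)); [move=> s _; rewrite xS|apply: liD => //; exact: liZ].
have mIT := @cmeasurable_itv R `[0, T].
pose y N := \int[leb]_(s in `[0, T]) x N s.
have yS N : y N.+1 = y N + (2 ^+ N) ^+ 2 * \int[leb]_(s in `[0, T]) D N s.
  rewrite /y (lint_eq (y := fun s => x N s + (2 ^+ N) ^+ 2 * D N s)); last by move=> s _; exact: xS.
  have h1 := lx N; have h2 := liZ ((2 ^+ N) ^+ 2) (lD N).
  rewrite RintegralD; [|exact: mIT|exact: h1|exact: h2].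
  by rewrite RintegralZl; [by []|exact: mIT|exact: lD].
have DI j : 0 <= \int[leb]_(s in `[0, T]) D j s by apply: Rintegral_ge0 => s _; exact: sqr_ge0.
have yJ k : y (J + k)%N <= y J + (2 * hp2 J - 2 * hp2 (J + k)%N).
  elim: k => [|k IH]; first by rewrite addn0 subrr addr0.
  rewrite addnS yS; have [_ h _] := hJ (J + k)%N (leq_addr _ _).
  have h2 : (2 ^+ (J + k)) ^+ 2 * \int[leb]_(s in `[0, T]) D (J + k)%N s <= hp2 (J + k)%N.
    apply: (@le_trans _ _ ((2 ^+ (J + k)) ^+ 2 * hp2 (J + k)%N ^+ 3)); first by rewrite ler_wpM2l ?sqr_ge0.
    have a0 : (2 : R) ^+ (J + k) != 0 by rewrite expf_neq0.
    by rewrite !exprVn exprS invfM mulrCA mulfV ?mulr1// expf_neq0.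
  apply: (le_trans (lerD IH h2)); rewrite exprS -addrA lerD2l le_eqVlt; apply/orP; left; apply/eqP.
  by field.
have ym N : y N <= y N.+1 by rewrite yS lerDl mulr_ge0 ?sqr_ge0.
have yC N : y N <= y J + 2.
  apply: (@le_trans _ _ (y (J + N)%N)).
    by elim: J {hJ yJ} => // J0; rewrite addSn => /le_trans; apply; exact: ym.
  apply: (le_trans (yJ N)); rewrite lerD2l; apply: (@le_trans _ _ (2 * hp2 J)).
    by rewrite lerBlDr lerDl mulr_ge0// ltW.
  by rewrite -[X in _ <= X]mulr1 ler_wpM2l.
have xm N s : x N s <= x N.+1 s by rewrite xS lerDl.
have [G [lG G0 hG]] := lint_mono lx x0 xm yC.
(* Each coordinate is within [2 sqrt G 2^-j] of its limit; the squares are summed over [d]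
   coordinates, and one of the two factors [2^-j] is dropped. *)
exists (fun s => 4 * d%:R * G s); split.
- exact: liZ.
- by move=> s; rewrite !mulr_ge0.
apply: filterS hG => s hs sT j; have {}hs := hs sT.
have dZ i : enorm (Zn (nj i) s w - Zn (nj i.+1) s w) <= Num.sqrt (G s) * hp2 i.
  have h1 : (2 ^+ i * enorm (Zn (nj i) s w - Zn (nj i.+1) s w)) ^+ 2 <= G s.
    by rewrite exprMn; apply: le_trans (hs i.+1); rewrite xS lerDr.
  have h2 : 2 ^+ i * enorm (Zn (nj i) s w - Zn (nj i.+1) s w) <= Num.sqrt (G s).
    rewrite -[X in X <= _]ger0_norm ?mulr_ge0 ?enorm_ge0 ?exprn_ge0// -sqrtr_sqr.
    by rewrite ler_wsqrtr.
  by rewrite exprVn ler_pdivlMr ?exprn_gt0// mulrC.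
have cz i : `|Zn (nj j) s w 0 i - Z s w 0 i| <= 2 * Num.sqrt (G s) * hp2 j.
  have [|l [cl hl]] := @geometric_cauchy _ (fun j => Zn (nj j) s w 0 i) (Num.sqrt (G s)) 0 (sqrtr_ge0 _).
    move=> l _; apply: le_trans (dZ l).
    by have := enorm_coord (Zn (nj l) s w - Zn (nj l.+1) s w) i; rewrite !mxE.
  have -> : Z s w 0 i = l by rewrite mxE; exact: plimE.
  exact: hl.
rewrite enorm_sqr; apply: (@le_trans _ _ (\sum_(i < d) (2 * Num.sqrt (G s) * hp2 j) ^+ 2)).
  have R0 : 0 <= 2 * Num.sqrt (G s) * hp2 j.
    by apply: mulr_ge0; [rewrite mulr_ge0 ?sqrtr_ge0|exact: ltW].
  apply: ler_sum => i _; rewrite -[X in X <= _]real_normK ?num_real// ler_sqr ?nnegrE//.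
  by have := cz i; rewrite !mxE.
rewrite sumr_const card_ord -[X in X <= _]mulr_natr.
have -> : (2 * Num.sqrt (G s) * hp2 j) ^+ 2 * d%:R = (hp2 j * (4 * d%:R * Num.sqrt (G s) ^+ 2)) * hp2 j by ring.
rewrite sqr_sqrtr//.
by rewrite ler_piMr// mulr_ge0 ?(ltW (hf_gt0 j))// !mulr_ge0.
Qed.

Variable g : R -> Omega -> R -> 'rV[R]_d -> R.
Hypotheses (g_cont : continuous_generator P T g) (hlim : tends_locally_uniformly P T gn g).
Let Gs s w := g s w (Y s w) (Z s w).
Let Gn n s w := gn n s w (Yn n s w) (Zn n s w).

Let pZ : progressive_vec T F Z.
Proof.
move=> i; rewrite (_ : (fun t w => Z t w 0 i) = plim (fun j t w => Zn (nj j) t w 0 i)).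
  by apply: progressive_plim => j; exact: (hZn (nj j) i).
by apply/funext => t; apply/funext => w; rewrite mxE.
Qed.

Record limit_path w : Prop := LimitPath {
  lconv : converges w;
  lZ : li 0 T (fun s => enorm (Z s w) ^+ 2);
  lG : li 0 T (Gs ^~ w);
  lY : ucont T (Y ^~ w);
  lI : ucont T (I ^~ w);
  lK : ucont T (K ^~ w);
  lKc : forall e : R, 0 < e -> exists J : nat, forall j, (J <= j)%N -> forall t, 0 <= t <= T -> `|Kn (nj j) t w - K t w| <= e;
  leq : forall t, 0 <= t <= T -> Y t w = xi w + \int[leb]_(s in `[t, T]) Gs s w + (V T w - V t w) + (K T w - K t w) - (I T w - I t w) }.

(** At almost every time the pairs [(Y^n, Z^n)] converge along the subsequence and stay bounded, so
    [family_compact_cvg] gives convergence of the integrands. The growth bound dominates them, with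
    [psi] at an integer above all [|Yn n|] and the norm of [Z] replaced by 1 plus its square. *)
Lemma generator_cvg w : converges w ->
  {ae leb, forall s, 0 <= s <= T -> continuous (fun yz : R * 'rV[R]_d => g s w yz.1 yz.2)} ->
  {ae leb, forall s, 0 <= s <= T -> {family compact, (fun n (yz : R * 'rV[R]_d) => gn n s w yz.1 yz.2) @ \oo -->
                     (fun yz : R * 'rV[R]_d => g s w yz.1 yz.2)}} ->
  [/\ li 0 T (fun s => enorm (Z s w) ^+ 2), li 0 T (Gs ^~ w) &
     \int[leb]_(s in `[0, T]) `|Gn (nj j) s w - Gs s w| @[j --> \oo] --> (0 : R)].
Proof.
move=> cw hc hu; have gw := cgood cw; have [G [lG G0 hG]] := cZ cw; have [C hC] := gbnd gw.
have lF : Filter (nbhs (almost_everywhere leb)) by exact: leb_ae_filter.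
have lZ2 : li 0 T (fun s => enorm (Z s w) ^+ 2).
  apply: (li_le_ae (y := fun s => 2 * enorm (Zn (nj 0) s w) ^+ 2 + 2 * G s)).
  - exact: (progressive_lmeas T0 w (progressive_enorm2 pZ)).
  - apply: filterS hG => s h sT; rewrite ger0_norm ?sqr_ge0//.
    rewrite (_ : Z s w = Zn (nj 0) s w + - (Zn (nj 0) s w - Z s w)); last by rewrite opprB addrC subrK.
    apply: (le_trans (enorm_sqr_add _ _)); rewrite enormN lerD2l ler_wpM2l//.
    by apply: le_trans (h sT 0%N) _; rewrite expr0 mul1r.
  - by apply: liD; apply: liZ; [exact: gZ|exact: lG].
have zle j s : enorm (Zn (nj j) s w - Z s w) ^+ 2 <= G s -> enorm (Zn (nj j) s w) <= 1 + (2 * G s + 2 * enorm (Z s w) ^+ 2).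
  move=> h; have h2 : enorm (Zn (nj j) s w) ^+ 2 <= 2 * G s + 2 * enorm (Z s w) ^+ 2.
    rewrite -{1}(subrK (Z s w) (Zn (nj j) s w)); apply: (le_trans (enorm_sqr_add _ _)).
    by rewrite lerD2r ler_wpM2l.
  apply: (@le_trans _ _ (1 + enorm (Zn (nj j) s w) ^+ 2)); last by rewrite lerD2l.
  exact: le_one_sqr.
have hGle j s : hp2 j * G s <= G s by rewrite ler_piMl.
pose k := (Num.truncn C).+1.
have Ck : C <= k%:R by apply: ltW; exact: truncnS_gt.
pose dom s := `|f s w| + psi s w k%:R + lambda * (1 + (2 * G s + 2 * enorm (Z s w) ^+ 2)).
have [||||h1 h2] := @lint_dct _ 0 T (fun j => Gn (nj j) ^~ w) (Gs ^~ w) dom.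
- by move=> j; exact: (li_lmeas (gG gw (nj j))).
- apply: filterS2 (filterI hc hu) hG => s [h1 h2] h3 sT.
  have c1 := h1 sT; have c2 := h2 sT; have c3 := h3 sT.
  (* A bound for [|Y^n|] and [|Z^n|] along the subsequence at this one time; it may depend on
     [s]. *)
  pose M := Num.max C (1 + (2 * G s + 2 * enorm (Z s w) ^+ 2)).
  have cz : (fun j => enorm (Zn (nj j) s w - Z s w)) @ \oo --> (0 : R).
    apply/cvgrPdist_le => e epos.
    have ee : 0 < e ^+ 2 / (G s + 1) by rewrite divr_gt0 ?exprn_gt0// ltr_wpDl.
    have [J hJ] := half_pow_small ee; exists J => // j /= Jj.
    rewrite sub0r normrN ger0_norm ?enorm_ge0// -ler_sqr ?nnegrE ?enorm_ge0 ?(ltW epos)//.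
    apply: (le_trans (c3 j)); apply: (@le_trans _ _ (e ^+ 2 / (G s + 1) * G s)).
      by rewrite ler_wpM2r// hJ.
    by rewrite mulrAC ler_pdivrMr ?ltr_wpDl// ler_wpM2l ?sqr_ge0// lerDl.
  have nc : nj @ \oo --> \oo.
    by move=> D [N _ hD]; exists N => // l Nl; apply: hD => /=; exact: leq_trans Nl (nj_ge l).
  pose gs n (yz : R * 'rV[R]_d) := gn n s w yz.1 yz.2.
  pose g0 (yz : R * 'rV[R]_d) := g s w yz.1 yz.2.
  have hs : {family compact, (gs \o nj) @ \oo --> g0} by exact: cvg_trans (cvg_app gs nc) c2.
  apply: (@family_compact_cvg _ _ (gs \o nj) g0 (fun j => Yn (nj j) s w) (fun j => Zn (nj j) s w) (Y s w) (Z s w) M hs (c1 _)) => //.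
  - exact: (sub_cvg (gcv gw sT)).
  - by move=> n; rewrite le_max hC.
  - by move=> n; rewrite le_max (zle n) ?orbT// (le_trans (c3 n)).
- apply: filterS2 (filterI (gbd gw) (gpm gw)) hG => s [h1 h2] h3 sT j.
  have sb := h1 sT (nj j) (Yn (nj j) s w) (Zn (nj j) s w); apply: (le_trans sb).
  rewrite /dom -!addrA lerD2l; apply: lerD.
    by apply: (h2 sT) => //; exact: le_trans (hC _ _ sT) Ck.
  by rewrite ler_wpM2l// zle// (le_trans (h3 sT j)).
- apply: liD; first by apply: liD; [exact: gf|exact: gpsi].
  by apply: liZ; apply: liD; [exact: li_cst|apply: liD; exact: liZ].
by split.
Qed.

(** The equation at time 0 minus the equation at time [t], solved for [K]. *)
Let Kt w t := Y 0 w - Y t w + (I t w - I 0 w) - \int[leb]_(s in `[0, t]) Gs s w - (V t w - V 0 w).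

Lemma ae_limit_path : {ae P, forall w, limit_path w}.
Proof.
have lF : Filter (nbhs (almost_everywhere leb)) by exact: leb_ae_filter.
apply: filterS2 ae_converges (filterI (ae_PT_slice g_cont) (ae_PT_slice hlim)) => w cw [hc hu].
have [lZ2 lGs cG] := generator_cvg cw hc hu; have gw := cgood cw.
have Kc (e : R) : 0 < e -> exists J : nat, forall j, (J <= j)%N -> forall t, 0 <= t <= T -> `|Kn (nj j) t w - Kt w t| <= e.
  move=> epos; have e5 : 0 < e / 5 by rewrite divr_gt0.
  have [J1 h1] := cY cw e5; have [J2 h2] := cI cw e5.
  have /cvgrPdist_le /(_ _ e5) [J3 _ h3] := cG.
  exists (maxn J1 (maxn J2 J3)) => j; rewrite !geq_max => /and3P[j1 j2 j3] t tT; have /andP[t0 t1] := tT.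
  have jn : (J1 <= nj j)%N by exact: leq_trans j1 (nj_ge j).
  have inc := good_incr (nj j) gw (lexx 0) t0 t1; rewrite (gK0 gw) subr0 in inc.
  have y0 := h1 _ jn 0 T00; have yt := h1 _ jn t tT; have i0 := h2 _ j2 0 T00; have it := h2 _ j2 t tT.
  have lg1 := liS (lexx 0) t1 (gG gw (nj j)); have lg2 := liS (lexx 0) t1 lGs.
  have gt : `|\int[leb]_(s in `[0, t]) Gn (nj j) s w - \int[leb]_(s in `[0, t]) Gs s w| <= e / 5.
    have lgB : li 0 T (fun s => Gn (nj j) s w - Gs s w) by apply: liB => //; exact: gG.
    rewrite -RintegralB; [|exact: cmeasurable_itv|exact: lg1|exact: lg2].
    apply: (le_trans (lint_norm (liS (lexx 0) t1 lgB))).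
    apply: le_trans (_ : \int[leb]_(s in `[0, T]) `|Gn (nj j) s w - Gs s w| <= _).
      rewrite (lint_add t0 t1 (li_norm lgB)) lerDl; apply: Rintegral_ge0 => s _; exact: normr_ge0.
    have := h3 j j3; rewrite sub0r normrN; apply: le_trans; exact: ler_norm.
  (* The increment of [V] is common to both sides and cancels, which leaves five errors of size
     [e / 5]. *)
  have -> : Kn (nj j) t w - Kt w t = (Yn (nj j) 0 w - Y 0 w) - (Yn (nj j) t w - Y t w) +
     (In (nj j) t w - I t w) - (In (nj j) 0 w - I 0 w) -
     (\int[leb]_(s in `[0, t]) Gn (nj j) s w - \int[leb]_(s in `[0, t]) Gs s w).
    rewrite /Kt; apply: (@path_diff _ _ _ _ _ _ _ _ _ _ _ _ _ inc).
  exact: norm_sum5.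
have KE t : 0 <= t <= T -> K t w = Kt w t.
  move=> tT; apply: plimE; apply/cvgrPdist_le => e epos; have [J hJ] := Kc e epos.
  by exists J => // j /= Jj; rewrite distrC; exact: hJ.
have lY' : ucont T (Y ^~ w).
  apply: (ucont_uniform_lim (x := fun n t => Yn n t w) (gY gw)) => e epos.
  by have [N hN] := cY cw epos; exists N; exact: hN.
have lI' : ucont T (I ^~ w).
  apply: (ucont_uniform_lim (x := fun j t => In (nj j) t w) (fun j => gI gw (nj j))) => e epos.
  by have [N hN] := cI cw epos; exists N; exact: hN.
have Kc' (e : R) : 0 < e -> exists J : nat, forall j, (J <= j)%N -> forall t, 0 <= t <= T -> `|Kn (nj j) t w - K t w| <= e.
  by move=> epos; have [J hJ] := Kc e epos; exists J => j Jj t tT; rewrite KE//; exact: hJ.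
have lK' : ucont T (K ^~ w).
  apply: (ucont_uniform_lim (x := fun j t => Kn (nj j) t w) (fun j => gK gw (nj j))) => e epos.
  by have [N hN] := Kc' _ epos; exists N; exact: hN.
split => // t tT; have /andP[t0 t1] := tT.
(* At [T] every increment in the equation vanishes, so [Yn n T w] is [xi w] for all [n]. *)
have YT : Y T w = xi w.
  apply: plimE; apply/cvgrPdist_le => e epos; exists 0%N => // n _.
  by rewrite (geq gw n TT) lint_set1 !subrr !addr0 subr0 subrr normr0 ltW.
rewrite !KE// /Kt (lint_add t0 t1 lGs) YT; ring.
Qed.

Let limK w : limit_path w -> forall t, 0 <= t <= T -> (fun j => Kn (nj j) t w) @ \oo --> K t w.
Proof.
move=> lw t tT; apply/cvgrPdist_le => e epos; have [J hJ] := lKc lw epos.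
by exists J => // j /= Jj; rewrite distrC; exact: hJ.
Qed.

(** On the compact [[q, s]] the gap [Y - L] has a positive minimum; by uniform convergence
    [Yn n > L] there for large [n], so [Kn n] is flat along the subsequence, and so is its limit. *)
Lemma limit_flat w q s : limit_path w -> 0 <= q -> q <= s -> s <= T -> (forall u, q <= u <= s -> 0 < Y u w - L u w) ->
  K q w = K s w.
Proof.
move=> lw q0 qs sT h; have cw := lconv lw; have gw := cgood cw.
have uT u : q <= u <= s -> 0 <= u <= T by move=> /andP[h1 h2]; rewrite (le_trans q0)// (le_trans h2).
have [dl dl0 hdl] := ucont_pos_bound (ucontB (lY lw) (gL gw)) q0 qs sT h.
have dl2 : 0 < dl / 2 by rewrite divr_gt0.
have [N hN] := cY cw dl2.
have eK j : (N <= j)%N -> Kn (nj j) q w = Kn (nj j) s w.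
  move=> Nj; apply: (gSk gw q0 qs sT) => u /andP[qu us].
  have us' : q <= u <= s by rewrite (ltW qu).
  have := hN (nj j) (leq_trans Nj (nj_ge j)) u (uT u us'); rewrite ler_norml => /andP[h1 _].
  have h2 := hdl u us'; exact: (gap_pos dl0 h1 h2).
have qT : 0 <= q <= T by rewrite q0 (le_trans qs).
have sT' : 0 <= s <= T by rewrite sT (le_trans q0).
have c0 : (fun j => Kn (nj j) q w - Kn (nj j) s w) @ \oo --> K q w - K s w by apply: cvgB; exact: limK.
apply/eqP; rewrite -subr_eq0; apply/eqP; apply: (@cvg_unique _ (@norm_hausdorff _ R) _ _ _ _ c0).
by apply/cvgrPdist_le => e epos; exists N => // j /= Nj; rewrite eK// subrr subr0 normr0 ltW.
Qed.

Let pI : progressive T F I.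
Proof. by apply: progressive_plim => j; case: (hI (nj j)) => -[]. Qed.
Let pK : progressive T F K.
Proof. by apply: progressive_plim => j; case: (hKn (nj j)). Qed.

Let SY : Sspace P T F Y.
Proof. by split => //; apply: filterS ae_limit_path => w lw; apply: ucont_within; exact: lY. Qed.
Let SI : Sspace P T F I.
Proof. by split => //; apply: filterS ae_limit_path => w lw; apply: ucont_within; exact: lI. Qed.
Let SK : Sspace P T F K.
Proof. by split => //; apply: filterS ae_limit_path => w lw; apply: ucont_within; exact: lK. Qed.

Let cZ0 w : converges w -> exists2 c : R, 0 <= c & forall j, li 0 T (fun s => enorm (Zn (nj j) s w - Z s w) ^+ 2) /\
  \int[leb]_(s in `[0, T]) enorm (Zn (nj j) s w - Z s w) ^+ 2 <= hp2 j * c.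
Proof.
move=> cw; have [G [lG G0 hG]] := cZ cw; exists (\int[leb]_(s in `[0, T]) G s).
  by apply: Rintegral_ge0 => s _; exact: G0.
move=> j; have lF : Filter (nbhs (almost_everywhere leb)) by exact: leb_ae_filter.
have lz : li 0 T (fun s => enorm (Zn (nj j) s w - Z s w) ^+ 2).
  apply: (li_le_ae (y := fun s => hp2 j * G s)); last exact: liZ.
    exact: (progressive_lmeas T0 w (progressive_enorm2 (progressive_vecB (hZn (nj j)) pZ))).
  by apply: filterS hG => s h sT; rewrite ger0_norm ?sqr_ge0// h.
split => //; have mIT := @cmeasurable_itv R `[0, T].
rewrite -RintegralZl//; apply: lint_le_ae => //; first exact: liZ.
by apply: filterS hG => s h sT; exact: h.
Qed.

Lemma limit_ito : ito_integral P T F B Z I.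
Proof.
apply: (ito_integral_lim hP T0 hB (Zn := fun j => Zn (nj j)) (In := fun j => In (nj j))) => //.
apply: filterS ae_limit_path => w lw e epos; have cw := lconv lw; have [c c0 hc] := cZ0 cw.
have e2 : 0 < e / 2 by rewrite divr_gt0.
have ec : 0 < e / 2 / (c + 1) by rewrite divr_gt0// ltr_wpDl.
have [J1 h1] := half_pow_small ec; have [J2 h2] := cI cw e2.
exists (maxn J1 J2) => j; rewrite geq_max => /andP[j1 j2].
have ee : e / 2 < e by rewrite ltr_pdivrMr// ltr_pMr// ltr1n.
split.
  have [lz hz] := hc j; rewrite /int_from li_EFin// lte_fin; apply: le_lt_trans ee.
  apply: (le_trans hz); apply: (@le_trans _ _ (e / 2 / (c + 1) * c)); first by rewrite ler_wpM2r// h1.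
  by rewrite mulrAC ler_pdivrMr ?ltr_wpDl// ler_wpM2l ?(ltW e2)// lerDl.
apply: (@le_lt_trans _ _ ((e / 2)%:E)); last by rewrite lte_fin.
by apply: sup_from_le => s sT; rewrite lee_fin h2.
Qed.

Lemma limit_solution : rbsde_solution P T F B xi g V L Y Z K.
Proof.
split; first by split.
split.
  split.
  - by apply: filterS ae_limit_path => w lw; exact: lG lw.
  - by apply: filterS ae_limit_path => w lw; exact: lZ lw.
  - exists I; first exact: limit_ito.
    by apply: filterS ae_limit_path => w lw; exact: leq lw.
  - apply: filterS ae_good => w gw t tT; rewrite -(cvg_lim _ (gcv gw tT))//.
    apply: limr_ge; first by apply/cvg_ex; eexists; exact: (gcv gw tT).
    by apply: nearW => n; exact: gYL.
have Kmono w : limit_path w -> forall s t, 0 <= s -> s <= t -> t <= T -> K s w <= K t w.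
  move=> lw s t s0 st tT; have sT : 0 <= s <= T by rewrite s0 (le_trans st).
  have tT' : 0 <= t <= T by rewrite tT (le_trans s0).
  rewrite -subr_ge0.
  have c0 : (fun j => Kn (nj j) t w - Kn (nj j) s w) @ \oo --> K t w - K s w by apply: cvgB; exact: limK.
  rewrite -(cvg_lim _ c0)//; apply: limr_ge; first by apply/cvg_ex; eexists; exact: c0.
  by apply: nearW => j; rewrite subr_ge0; exact: (gKm (cgood (lconv lw))).
split.
- by apply: filterS ae_limit_path => w lw; exact: Kmono.
- by case: SK.
- apply: filterS ae_limit_path => w lw; apply: plimE; apply/cvgrPdist_le => e epos.
  by exists 0%N => // j _; rewrite (gK0 (cgood (lconv lw))) subrr normr0 ltW.
- apply: filterS ae_limit_path => w lw; have gw := cgood (lconv lw).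
  have YL u : 0 <= u <= T -> 0 <= Y u w - L u w.
    move=> uT; rewrite subr_ge0 -(cvg_lim _ (gcv gw uT))//.
    apply: limr_ge; first by apply/cvg_ex; eexists; exact: (gcv gw uT).
    by apply: nearW => n; exact: gYL.
  apply: (stieltjes_of_flat T0 (lK lw) (ucontB (lY lw) (gL gw))) => //.
  + by apply: (progressive_borel T0 w (X := fun t w => Y t w - L t w)); apply: progressiveB; [exact: SY.1|case: hL].
  + exact: Kmono.
  + by move=> q s q0 qs sT h; exact: (limit_flat lw q0 qs sT h).
Qed.

Lemma Snorm_EFin X : acproc P T F X -> integ (fun w => psup T (X ^~ w) `^ p) ->
  Snorm P T p X = ((\int[P]_w (psup T (X ^~ w) `^ p)) `^ p^-1)%:E.
Proof.
move=> [_ aX] iX; rewrite /Snorm (ae_int_EFin hP iX) ?poweR_EFin//.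
apply: filterS aX => w u; have [C hC] := ucont_bounded T0 u; exact: (psup_pow T0 p0 hC).
Qed.

Lemma Mnorm_EFin (X : R -> Omega -> 'rV[R]_d) : progressive_vec T F X -> {ae P, forall w, li 0 T (fun s => enorm (X s w) ^+ 2)} ->
  integ (fun w => itproc (fun s w => enorm (X s w) ^+ 2) T w `^ r) ->
  Mnorm P T p X = ((\int[P]_w (itproc (fun s w => enorm (X s w) ^+ 2) T w `^ r)) `^ p^-1)%:E.
Proof.
move=> pX lX iX; rewrite /Mnorm (ae_int_EFin hP iX) ?poweR_EFin//.
by apply: filterS lX => w lx; rewrite /int_from li_EFin// poweR_EFin.
Qed.

Let aYl : acproc P T F Y. Proof. exact: Sspace_acproc. Qed.
Let aKl : acproc P T F K. Proof. exact: Sspace_acproc. Qed.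

Let rootW (Wp x : R) : 0 <= Wp -> `|x| `^ p <= Wp -> `|x| <= Wp `^ p^-1.
Proof. by move=> W0 h; rewrite -(powRK p0 (normr_ge0 x)); apply: powR_le => //; rewrite ?invr_ge0 ?powR_ge0 ?(ltW p0). Qed.

(** All [|Yn n|^p] and their limit are below [Wp], so a multiple of [Wp] dominates and almost sure
    uniform convergence passes to the mean. *)
Lemma Y_limit : [/\ integ (fun w => psup T (Y ^~ w) `^ p),
  forall n, integ (fun w => psup T (fun t => Yn n t w - Y t w) `^ p) &
  (fun n => \int[P]_w (psup T (fun t => Yn n t w - Y t w) `^ p)) @ \oo --> (0 : R)].
Proof.
have [Wp [iW W0 hW]] := Y_bound.
have Yb' w : good w -> (forall n t, 0 <= t <= T -> `|Yn n t w| `^ p <= Wp w) -> forall t, 0 <= t <= T -> `|Y t w| <= Wp w `^ p^-1.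
  move=> gw h t tT; have hc : (fun n => `|Yn n t w|) @ \oo --> `|Y t w| by apply: cvg_norm; exact: gcv tT.
  rewrite -(cvg_lim _ hc)//; apply: limr_le; first by apply/cvg_ex; eexists; exact: hc.
  by apply: nearW => n; apply: rootW => //; exact: h.
have pw (x c : R) w : 0 <= x -> 0 <= c -> x <= c * Wp w `^ p^-1 -> x `^ p <= c `^ p * Wp w.
  move=> x0 c0 h; apply: (le_trans (powR_le (ltW p0) x0 h)).
  by rewrite powRM ?powR_ge0// powRVK.
have mYn n : measurable_fun setT (fun w => psup T (fun t => Yn n t w - Y t w) `^ p).
  apply: (measurableT_comp (measurable_powR p)).
  by apply: (psup_meas hP T0 hF (X := fun t w => Yn n t w - Y t w)); exact: acprocB.
have i2 : integ (fun w => 2 `^ p * Wp w) by exact: integZ.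
have bn : {ae P, forall w, forall n, `|psup T (fun t => Yn n t w - Y t w) `^ p| <= 2 `^ p * Wp w}.
  apply: filterS2 ae_good hW => w gw h n; rewrite ger0_norm ?powR_ge0//.
  apply: pw => //; first exact: psup_ge0.
  apply: psup_le => // t tT; apply: (le_trans (ler_normB _ _)); apply: norm_le_double; last exact: Yb'.
  by apply: rootW => //; exact: h.
split.
- apply: (integ_le_ae (Y := fun w => 1 `^ p * Wp w)); last exact: integZ.
    by apply: (measurableT_comp (measurable_powR p)); exact: (psup_meas hP T0 hF).
  apply: filterS2 ae_good hW => w gw h; rewrite ger0_norm ?powR_ge0//.
  apply: pw => //; first exact: psup_ge0.
  by rewrite mul1r; apply: psup_le => // t tT; exact: Yb'.
- by move=> n; apply: (integ_le_ae (mYn n) _ i2); apply: filterS bn => w h; exact: h.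
- rewrite -[X in _ --> X](E0 P); apply: (E_dct mYn _ _ bn i2); first exact: measurable_cst.
  apply: filterS ae_converges => w cw.
  rewrite -[X in _ --> X](_ : 0 `^ p = 0); last by rewrite powR0// gt_eqF.
  apply: powR_cvg => //; first by move=> n; exact: psup_ge0.
  apply/cvgrPdist_le => e epos; have [N hN] := cY cw epos; exists N => // n /= Nn.
  rewrite sub0r normrN ger0_norm ?psup_ge0//; apply: psup_le => // t tT; exact: hN.
Qed.

Lemma Y_Spspace : Spspace P T F p Y.
Proof.
split; first exact: SY.
by have [i _ _] := Y_limit; rewrite (Snorm_EFin aYl i) ltry.
Qed.

Lemma Y_Snorm : (fun n => Snorm P T p (fun t w => Yn n t w - Y t w)) @ \oo --> 0%E.
Proof.
have [_ i c] := Y_limit.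
rewrite (_ : (fun n => _) = (fun n => ((\int[P]_w (psup T (fun t => Yn n t w - Y t w) `^ p)) `^ p^-1)%:E)).
  apply: (root_cvg0 p0 _ c) => n; apply: Rintegral_ge0 => w _; exact: powR_ge0.
apply/funext => n; apply: (Snorm_EFin (X := fun t w => Yn n t w - Y t w)); last exact: i.
exact: acprocB.
Qed.

Let q n := itproc (fun s w => enorm (Zn n s w - Z s w) ^+ 2).

Let lq n w : limit_path w -> li 0 T (fun s => enorm (Zn n s w - Z s w) ^+ 2).
Proof.
move=> lw; apply: (@li_le _ _ _ _ (fun s => 2 * enorm (Zn n s w) ^+ 2 + 2 * enorm (Z s w) ^+ 2)).
- exact: (progressive_lmeas T0 w (progressive_enorm2 (progressive_vecB (hZn n) pZ))).
- by move=> s _; rewrite ger0_norm ?sqr_ge0// -[enorm (Z s w)]enormN; exact: enorm_sqr_add.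
- by apply: liD; apply: liZ; [exact: (gZ (cgood (lconv lw)))|exact: lZ].
Qed.

Let itproc_meas (X : R -> Omega -> 'rV[R]_d) : progressive_vec T F X ->
  {ae P, forall w, li 0 T (fun s => enorm (X s w) ^+ 2)} ->
  measurable_fun setT (fun w => itproc (fun s w => enorm (X s w) ^+ 2) T w `^ r).
Proof.
move=> pX lX; apply: (measurableT_comp (measurable_powR r)).
have [|||h _] := @itproc_acproc _ _ _ P T F T0 (fun s w => enorm (X s w) ^+ 2).
- exact: progressive_enorm2.
- by move=> s w _; exact: sqr_ge0.
- by [].
- exact: (gmeas_measT hF TT (h T TT)).
Qed.

Let it_add (X1 X2 X3 : R -> R) : li 0 T X1 -> li 0 T X2 -> li 0 T X3 ->
  (forall s, X1 s <= 2 * X2 s + 2 * X3 s) ->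
  \int[leb]_(s in `[0, T]) X1 s <= 2 * \int[leb]_(s in `[0, T]) X2 s + 2 * \int[leb]_(s in `[0, T]) X3 s.
Proof.
move=> l1 l2 l3 h; have mIT := @cmeasurable_itv R `[0, T].
have e : \int[leb]_(s in `[0, T]) (2 * X2 s + 2 * X3 s) = 2 * \int[leb]_(s in `[0, T]) X2 s + 2 * \int[leb]_(s in `[0, T]) X3 s.
  rewrite RintegralD; [|exact: mIT|exact: (liZ 2 l2)|exact: (liZ 2 l3)].
  by rewrite RintegralZl; [rewrite RintegralZl; [by []|exact: mIT|exact: l3]|exact: mIT|exact: l2].
by rewrite -e; apply: lint_le => //; apply: liD; exact: liZ.
Qed.

Let mq n : measurable_fun setT (fun w => q n T w `^ r).
Proof.
apply: itproc_meas; first exact: progressive_vecB.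
by apply: filterS ae_limit_path => w lw; exact: lq.
Qed.

Let q_ge0 n w : 0 <= q n T w.
Proof. by apply: Rintegral_ge0 => s _; exact: sqr_ge0. Qed.

(** Fatou's lemma in the second index of [pair_Lp], along the subsequence. *)
Lemma Z_Lp e : 0 < e -> exists N0 : nat, forall n, (N0 <= n)%N ->
  integ (fun w => q n T w `^ r) /\ \int[P]_w (q n T w `^ r) <= e.
Proof.
move=> epos; have c0 : 0 < 2 `^ r :> R by exact: powR_gt0.
have ec : 0 < e / 2 `^ r by rewrite divr_gt0.
have [N hN] := pair_Lp ec; exists N => n Nn.
(* [q n] is at most [2 sQ] plus a term tending to 0 by [cZ0], so this minimum tends to [q n], while
   its power is bounded by that of [2 sQ]. The shift [j + n] keeps the second index at least [n]. *)
pose h j w := Num.min (q n T w) (2 * sQ n (nj (j + n)) T w).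
have nn j : (n <= nj (j + n))%N by exact: leq_trans (leq_addl _ _) (nj_ge _).
have sQ0 m w : 0 <= sQ n m T w by apply: Rintegral_ge0 => s _; exact: sqr_ge0.
have h0 j w : 0 <= h j w.
  by rewrite le_min; apply/andP; split; [exact: q_ge0|apply: mulr_ge0; [exact: ler0n|exact: sQ0]].
have hle j w : h j w `^ r <= 2 `^ r * sQ n (nj (j + n)) T w `^ r.
  rewrite -powRM; [|exact: ler0n|exact: sQ0].
  by apply: powR_le; [exact: ltW|exact: h0|rewrite ge_min lexx orbT].
have iS j := hN n (nj (j + n)) Nn (nn j).
have mh j : measurable_fun setT (fun w => h j w `^ r).
  apply: (measurableT_comp (measurable_powR r)); apply: measurable_minr; last first.
    by apply: measurable_funM => //; exact: mQ.
  have [|||hh _] := @itproc_acproc _ _ _ P T F T0 (fun s w => enorm (Zn n s w - Z s w) ^+ 2).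
  - by apply: progressive_enorm2; exact: progressive_vecB.
  - by move=> s w _; exact: sqr_ge0.
  - by apply: filterS ae_limit_path => w lw; exact: lq.
  - exact: (gmeas_measT hF TT (hh T TT)).
have ih j : integ (fun w => h j w `^ r).
  apply: (integ_le (mh j) _ (integZ (2 `^ r) (iS j).1)) => w.
  by rewrite ger0_norm ?powR_ge0.
apply: (E_fatou (f := fun j w => h j w `^ r) (b := fun=> e) ih (mq n)) => //.
- by move=> j w; exact: powR_ge0.
- by move=> w; exact: powR_ge0.
- apply: filterS ae_limit_path => w lw; apply: powR_cvg => //; have cw := lconv lw.
  have [c cc0 hc] := cZ0 cw; apply/cvgrPdist_le => e' e'0.
  have ec' : 0 < e' / (2 * (c + 1)) by rewrite divr_gt0// mulr_gt0// ltr_wpDl.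
  have [J hJ] := half_pow_small ec'; exists J => // j /= Jj.
  rewrite ger0_norm ?subr_ge0 ?ge_min ?lexx// lerBlDl -lerBlDr le_min lerBlDr lerDl (ltW e'0)/= lerBlDr.
  have [lz hz] := hc (j + n)%N.
  apply: (@le_trans _ _ (2 * sQ n (nj (j + n)) T w + 2 * \int[leb]_(s in `[0, T]) enorm (Zn (nj (j + n)) s w - Z s w) ^+ 2)).
    apply: it_add => //; [exact: lq|exact: ldZ (cgood cw)|].
    move=> s; rewrite (_ : Zn n s w - Z s w = (Zn n s w - Zn (nj (j + n)) s w) + (Zn (nj (j + n)) s w - Z s w)).
      exact: enorm_sqr_add.
    by rewrite addrA subrK.
  rewrite lerD2l; apply: (@le_trans _ _ (2 * (e' / (2 * (c + 1)) * c))).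
    by rewrite ler_wpM2l//; apply: (le_trans hz); rewrite ler_wpM2r// hJ// (leq_trans Jj)// leq_addr.
  exact: half_budget.
- move=> j; apply: (@le_trans _ _ (\int[P]_w (2 `^ r * sQ n (nj (j + n)) T w `^ r))).
    by apply: Ele => //; apply: integZ; exact: (iS j).1.
  rewrite EZ; last exact: (iS j).1.
  by rewrite mulrC -ler_pdivlMr//; exact: (iS j).2.
- exact: cvg_cst.
Qed.

Let addr_pow (a b c : R) : 0 <= a -> 0 <= b -> 0 <= c -> a <= 2 * b + 2 * c ->
  a `^ r <= 2 `^ r * (2 `^ r * (b `^ r + c `^ r)).
Proof.
move=> a0 b0 c0 h; rewrite -mulrDr in h; apply: (le_trans (powR_le (ltW r0) a0 h)).
rewrite powRM ?addr_ge0// ler_wpM2l ?powR_ge0//; exact: powR_add_le (ltW r0) b0 c0.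
Qed.

Let iQZ j : integ (fun w => QZ j T w `^ r).
Proof.
have [h1 _] := @Z_moment j 0 setT T00 F0T.
move: h1; congr integrable; apply/funext => w /=.
by rewrite indicT mul1r QZ0 subr0 ger0_norm.
Qed.

Let QZl := itproc (fun s w => enorm (Z s w) ^+ 2).
Let QZl_ge0 w : 0 <= QZl T w.
Proof. by apply: Rintegral_ge0 => s _; exact: sqr_ge0. Qed.
Let ae_lZ : {ae P, forall w, li 0 T (fun s => enorm (Z s w) ^+ 2)}.
Proof. by apply: filterS ae_limit_path => w lw; exact: lZ. Qed.

Lemma Z_integ : integ (fun w => QZl T w `^ r).
Proof.
have [N /(_ N (leqnn _)) [iq _]] := Z_Lp ltr01.
apply: (integ_le_ae (Y := fun w => 2 `^ r * (2 `^ r * (QZ N T w `^ r + q N T w `^ r)))).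
- exact: itproc_meas.
- apply: filterS ae_limit_path => w lw; rewrite ger0_norm ?powR_ge0//; apply: addr_pow => //.
  apply: it_add; [exact: lZ|exact: (gZ (cgood (lconv lw)))|exact: lq|].
  move=> s; rewrite {1}(_ : Z s w = Zn N s w + - (Zn N s w - Z s w)); last by rewrite opprB addrC subrK.
  by apply: (le_trans (enorm_sqr_add _ _)); rewrite enormN.
- exact: (integZ (2 `^ r) (integZ (2 `^ r) (integD (iQZ N) iq))).
Qed.

Lemma Z_Mpspace : Mpspace P T F p Z.
Proof. by split; [exact: pZ|rewrite (Mnorm_EFin pZ ae_lZ Z_integ) ltry]. Qed.

Lemma q_integ n : integ (fun w => q n T w `^ r).
Proof.
apply: (integ_le_ae (mq n) (Y := fun w => 2 `^ r * (2 `^ r * (QZ n T w `^ r + QZl T w `^ r)))).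
- apply: filterS ae_limit_path => w lw; rewrite ger0_norm ?powR_ge0//; apply: addr_pow => //.
  apply: it_add; [exact: lq|exact: (gZ (cgood (lconv lw)))|exact: lZ|].
  by move=> s; rewrite -[enorm (Z s w)]enormN; exact: enorm_sqr_add.
- exact: (integZ (2 `^ r) (integZ (2 `^ r) (integD (iQZ n) Z_integ))).
Qed.

Lemma Z_Mnorm : (fun n => Mnorm P T p (fun t w => Zn n t w - Z t w)) @ \oo --> 0%E.
Proof.
rewrite (_ : (fun n => _) = (fun n => ((\int[P]_w (q n T w `^ r)) `^ p^-1)%:E)).
  apply: (root_cvg0 (a := fun n => \int[P]_w (q n T w `^ r)) p0).
    by move=> n; apply: Rintegral_ge0 => w _; exact: powR_ge0.
  apply/cvgrPdist_le => e epos.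
  have [N hN] := Z_Lp epos; exists N => // n /= Nn; rewrite sub0r normrN ger0_norm; first exact: (hN n Nn).2.
  by apply: Rintegral_ge0 => w _; exact: powR_ge0.
apply/funext => n; apply: (Mnorm_EFin (X := fun t w => Zn n t w - Z t w)); last exact: q_integ.
  exact: progressive_vecB.
by apply: filterS ae_limit_path => w lw; exact: lq.
Qed.

(** Fatou's lemma along the subsequence, with the moments of [Kn]. *)
Lemma K_integ : integ (fun w => `|K T w - K 0 w| `^ p).
Proof.
have m (x : R -> Omega -> R) : acproc P T F x -> measurable_fun setT (fun w => `|x T w - x 0 w| `^ p).
  move=> [h _]; apply: (measurableT_comp (measurable_powR p)); apply: measurableT_comp => //.
  by apply: measurable_funB; exact: (gmeas_measT hF _ (h _ _)).
apply: (proj1 (E_fatou (f := fun j w => `|Kn (nj j) T w - Kn (nj j) 0 w| `^ p) (b := fun=> e0) (c := e0) _ (m _ aKl) _ _ _ _ _)).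
- by move=> j; exact: (K_moment (nj j)).1.
- by move=> j w; exact: powR_ge0.
- by move=> w; exact: powR_ge0.
- apply: filterS ae_limit_path => w lw; apply: powR_cvg => //.
  by apply: cvg_norm; apply: cvgB; exact: limK.
- by move=> j; exact: (K_moment (nj j)).2.
- exact: cvg_cst.
Qed.

Lemma K_Vincpspace : Vincpspace P T F p K.
Proof.
have [_ [_ [hK _ _ _]]] := limit_solution; split => //; split; first exact: SK.
- apply: filterS hK => w h; apply: nondecreasing_bounded_variation => s t; rewrite !in_itv/=.
  by move=> /andP[s0 _] /andP[_ tT] st; exact: h.
- rewrite (ae_int_EFin hP K_integ) ?ltry//; apply: filterS hK => w h.
  rewrite nondecreasing_total_variation//; last first.
    by move=> s t; rewrite !in_itv/= => /andP[s0 _] /andP[_ tT] st; exact: h.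
  by rewrite poweR_EFin ger0_norm// subr_ge0 h.
Qed.

Lemma K_subsequence : {ae P, forall w,
  (fun j => sup_from T 0 (fun t => `|Kn (nj j) t w - K t w|)) @ \oo --> 0%E}.
Proof.
apply: filterS ae_limit_path => w lw.
have uK j : ucont T (fun t => Kn (nj j) t w - K t w) by apply: ucontB; [exact: (gK (cgood (lconv lw)))|exact: lK].
rewrite (_ : (fun j => _) = (fun j => (psup T (fun t => Kn (nj j) t w - K t w))%:E)); last first.
  by apply/funext => j; have [C hC] := ucont_bounded T0 (uK j); exact: (psup_fin T0 hC).
apply: cvg_EFin; first exact: nearW.
apply/cvgrPdist_le => e epos; have [J hJ] := lKc lw epos; exists J => // j /= Jj.
by rewrite sub0r normrN ger0_norm ?psup_ge0//; apply: psup_le => // t tT; exact: hJ.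
Qed.

(** As for [Y], monotonicity in [n] makes [|Kn n - K|] decrease, so uniform convergence along [nj]
    extends to all [n]. The dominating variable combines [K T] and [Kn 0 T]: if [Kn] increases the
    error is at most [K], and if it decreases, at most [Kn 0]. *)
Lemma K_Snorm : increases P T Kn \/ decreases P T Kn ->
  (fun n => Snorm P T p (fun t w => Kn n t w - K t w)) @ \oo --> 0%E.
Proof.
move=> mono.
have mK : {ae P, forall w, (forall t, 0 <= t <= T -> forall n m, (n <= m)%N -> Kn n t w <= Kn m t w) \/
    (forall t, 0 <= t <= T -> forall n m, (n <= m)%N -> Kn m t w <= Kn n t w)}.
  case: mono => /ae_foralln; apply: filterS => w h; [left|right] => t tT.
    by apply/nondecreasing_seqP => n; exact: h.
  by apply/nonincreasing_seqP => n; exact: h.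
have key w : limit_path w -> ((forall t, 0 <= t <= T -> forall n m, (n <= m)%N -> Kn n t w <= Kn m t w) \/
    (forall t, 0 <= t <= T -> forall n m, (n <= m)%N -> Kn m t w <= Kn n t w)) ->
    (forall n m t, 0 <= t <= T -> (n <= m)%N -> `|Kn m t w - K t w| <= `|Kn n t w - K t w|) /\
    (forall n t, 0 <= t <= T -> `|Kn n t w - K t w| <= `|K T w - K 0 w| + `|Kn 0 T w - Kn 0 0 w|).
  move=> lw mw; have gw := cgood (lconv lw).
  have K0 : K 0 w = 0.
    apply: plimE; apply/cvgrPdist_le => e epos.
    by exists 0%N => // j _; rewrite (gK0 gw) subrr normr0 ltW.
  have Kge n t : 0 <= t <= T -> 0 <= Kn n t w.
    by move=> /andP[t0 tT]; rewrite -(gK0 gw n); apply: (gKm gw).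
  have KT t : 0 <= t <= T -> 0 <= K t w <= K T w.
    move=> tT; have /andP[t0 t1] := tT; apply/andP; split.
      rewrite -(cvg_lim _ (limK lw tT))//; apply: limr_ge; first by apply/cvg_ex; eexists; exact: (limK lw tT).
      by apply: nearW => j; exact: Kge.
    rewrite -subr_ge0.
    have c0 : (fun j => Kn (nj j) T w - Kn (nj j) t w) @ \oo --> K T w - K t w by apply: cvgB; exact: limK.
    rewrite -(cvg_lim _ c0)//; apply: limr_ge; first by apply/cvg_ex; eexists; exact: c0.
    by apply: nearW => j; rewrite subr_ge0; exact: (gKm gw).
  have ab : `|K T w - K 0 w| = K T w /\ `|Kn 0 T w - Kn 0 0 w| = Kn 0 T w.
    have /andP[h _] := KT T TT.
    by rewrite K0 (gK0 gw) !subr0 !ger0_norm//; exact: Kge.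
  rewrite ab.1 ab.2; case: mw => mw.
    have up n t : 0 <= t <= T -> Kn n t w <= K t w.
      move=> tT; rewrite -(cvg_lim _ (limK lw tT))//; apply: limr_ge; first by apply/cvg_ex; eexists; exact: (limK lw tT).
      by exists n => // j /= nj'; apply: mw => //; exact: leq_trans nj' (nj_ge j).
    split.
      move=> n m t tT nm; rewrite !ler0_norm ?subr_le0 ?up// lerN2 lerD2r; exact: mw.
    move=> n t tT; rewrite ler0_norm ?subr_le0 ?up// opprB; have /andP[_ h] := KT t tT.
    by apply: (@le_trans _ _ (K t w)); [rewrite lerBlDr lerDl Kge|rewrite ler_wpDr// Kge].
  have dn n t : 0 <= t <= T -> K t w <= Kn n t w.
    move=> tT; rewrite -(cvg_lim _ (limK lw tT))//; apply: limr_le; first by apply/cvg_ex; eexists; exact: (limK lw tT).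
    by exists n => // j /= nj'; apply: mw => //; exact: leq_trans nj' (nj_ge j).
  split.
    move=> n m t tT nm; rewrite !ger0_norm ?subr_ge0 ?dn// lerD2r; exact: mw.
  move=> n t tT; rewrite ger0_norm ?subr_ge0 ?dn//; have /andP[h _] := KT t tT.
  have /andP[hT _] := KT T TT.
  apply: (@le_trans _ _ (Kn 0 T w)); last by rewrite ler_wpDl.
  apply: (@le_trans _ _ (Kn 0 t w)); last by case/andP: tT => t0 t1; apply: (gKm gw).
  by rewrite lerBlDr ler_wpDr//; exact: mw.
pose D w := 2 `^ p * (`|K T w - K 0 w| `^ p + `|Kn 0 T w - Kn 0 0 w| `^ p).
have iD : integ D by apply: integZ; apply: integD; [exact: K_integ|exact: (K_moment 0).1].
have mKn n : measurable_fun setT (fun w => psup T (fun t => Kn n t w - K t w) `^ p).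
  apply: (measurableT_comp (measurable_powR p)).
  by apply: (psup_meas hP T0 hF (X := fun t w => Kn n t w - K t w)); exact: acprocB.
have bD : {ae P, forall w, forall n, `|psup T (fun t => Kn n t w - K t w) `^ p| <= D w}.
  apply: filterS2 ae_limit_path mK => w lw mw n; have [_ h] := key w lw mw.
  rewrite ger0_norm ?powR_ge0//; apply: le_trans (powR_add_le (ltW p0) (normr_ge0 _) (normr_ge0 _)).
  by apply: powR_le; [exact: ltW|exact: psup_ge0|apply: psup_le => // t tT; exact: h].
rewrite (_ : (fun n => _) = (fun n => ((\int[P]_w (psup T (fun t => Kn n t w - K t w) `^ p)) `^ p^-1)%:E)); last first.
  apply/funext => n; apply: (Snorm_EFin (X := fun t w => Kn n t w - K t w)); first exact: acprocB.
  by apply: (integ_le_ae (mKn n) _ iD); apply: filterS bD => w h; exact: h.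
apply: (root_cvg0 (a := fun n => \int[P]_w (psup T (fun t => Kn n t w - K t w) `^ p)) p0).
  by move=> n; apply: Rintegral_ge0 => w _; exact: powR_ge0.
rewrite -[X in _ --> X](E0 P); apply: (E_dct mKn _ _ bD iD); first exact: measurable_cst.
apply: filterS2 ae_limit_path mK => w lw mw; have [h _] := key w lw mw.
rewrite -[X in _ --> X](_ : 0 `^ p = 0); last by rewrite powR0// gt_eqF.
apply: powR_cvg => //; first by move=> n; exact: psup_ge0.
apply/cvgrPdist_le => e epos; have [J hJ] := lKc lw epos; exists (nj J) => // n /= Jn.
rewrite sub0r normrN ger0_norm ?psup_ge0//; apply: psup_le => // t tT.
exact: le_trans (h (nj J) n t tT Jn) (hJ J (leqnn _) t tT).
Qed.

Lemma subsequence_limit : [/\ Spspace P T F p Y, Mpspace P T F p Z & Vincpspace P T F p K] /\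
    [/\ rbsde_solution P T F B xi g V L Y Z K,
        (fun n => Snorm P T p (fun t w => Yn n t w - Y t w)%R
                  + Mnorm P T p (fun t w => Zn n t w - Z t w)%R)%E @ \oo --> 0%E,
        (exists2 nj : nat -> nat, (forall i j, (i < j)%N -> (nj i < nj j)%N) &
           {ae P, forall w,
             (fun j => sup_from T 0 (fun t => `|Kn (nj j) t w - K t w|)) @ \oo
               --> 0%E}) &
        increases P T Kn \/ decreases P T Kn ->
        (fun n => Snorm P T p (fun t w => Kn n t w - K t w)) @ \oo --> 0%E].
Proof.
split; first by split; [exact: Y_Spspace|exact: Z_Mpspace|exact: K_Vincpspace].
split; [exact: limit_solution| |by exists nj => //; exact: K_subsequence|exact: K_Snorm].
rewrite -[X in _ --> X]adde0; apply: cvgeD; [by []|exact: Y_Snorm|exact: Z_Mnorm].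
Qed.

End Subsequence.

Lemma rbsde_limit (g : R -> Omega -> R -> 'rV[R]_d -> R) : continuous_generator P T g ->
  tends_locally_uniformly P T gn g ->
  exists (Y : R -> Omega -> R) (Z : R -> Omega -> 'rV[R]_d) (K : R -> Omega -> R),
    [/\ Spspace P T F p Y, Mpspace P T F p Z & Vincpspace P T F p K] /\
    [/\ rbsde_solution P T F B xi g V L Y Z K,
        (fun n => Snorm P T p (fun t w => Yn n t w - Y t w)%R
                  + Mnorm P T p (fun t w => Zn n t w - Z t w)%R)%E @ \oo --> 0%E,
        (exists2 nj : nat -> nat, (forall i j, (i < j)%N -> (nj i < nj j)%N) &
           {ae P, forall w,
             (fun j => sup_from T 0 (fun t => `|Kn (nj j) t w - K t w|)) @ \oo
               --> 0%E}) &
        increases P T Kn \/ decreases P T Kn ->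
        (fun n => Snorm P T p (fun t w => Kn n t w - K t w)) @ \oo --> 0%E].
Proof.
move=> g_cont hlim; have [nj [hnj hsub]] := subsequence_exists.
do 3 eexists; exact: (subsequence_limit hnj hsub g_cont hlim).
Qed.

End Approximation.

Theorem proposition4 (R : realType) (T : R) (hT : 0 < T) (d : nat) (hd : (1 <= d)%N)
    (disp : measure_display) (Omega : measurableType disp)
    (P : probability Omega R) (hP : measure_is_complete P)
    (B : R -> Omega -> 'rV[R]_d) (hB : brownian_motion P T B)
    (F : R -> set (set Omega)) (hF : F = brownian_filtration P B)
    (hFT : forall A : set Omega, measurable A <-> F T A)
    (p : R) (hp : 1 < p)
    (gn : nat -> R -> Omega -> R -> 'rV[R]_d -> R)
    (hgn : forall n, generator T F (gn n))
    (g : R -> Omega -> R -> 'rV[R]_d -> R) (hg : generator T F g)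
    (g_cont : continuous_generator P T g)
    (lambda : R) (hlambda : 0 <= lambda)
    (f : R -> Omega -> R) (hf : Hpspace P T F p f)
    (hf0 : ae_PT P T (fun w t => 0 <= f t w))
    (psi : R -> Omega -> R -> R) (hpsi : Psispace P T F psi)
    (hbound : forall n, ae_PT P T (fun w t => forall y z,
       `|gn n t w y z| <= f t w + psi t w `|y| + lambda * enorm z))
    (V : R -> Omega -> R) (hV : Vpspace P T F p V)
    (xi : Omega -> R) (hxi : Lqspace P T F p xi)
    (L : R -> Omega -> R) (hL : Sspace P T F L)
    (hLxi : {ae P, forall w, L T w <= xi w})
    (Yn : nat -> R -> Omega -> R) (Zn : nat -> R -> Omega -> 'rV[R]_d)
    (Kn : nat -> R -> Omega -> R)
    (hYn : forall n, Spspace P T F p (Yn n))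
    (hZn : forall n, Mpspace P T F p (Zn n))
    (hKn : forall n, Vincpspace P T F p (Kn n))
    (hsol : forall n,
       rbsde_solution P T F B xi (gn n) V L (Yn n) (Zn n) (Kn n))
    (hYmono : increases P T Yn \/ decreases P T Yn)
    (hlim : tends_locally_uniformly P T gn g)
    (eta : Omega -> R) (heta : Lqspace P T F 1 eta)
    (hest : forall n t, 0 <= t <= T ->
       cond_exp_le P (F t)
         (fun w => sup_from T t (fun s => `|Yn n s w| `^ p)%R
                   + int_from T t (fun s => enorm (Zn n s w) ^+ 2)%R `^ (p / 2)
                   + (`|Kn n T w - Kn n t w| `^ p)%:E
                   + int_from T t (fun s => `|gn n s w (Yn n s w) (Zn n s w)|)%R `^ p)%E
         (fun w => (eta w)%:E)) :
  exists (Y : R -> Omega -> R) (Z : R -> Omega -> 'rV[R]_d) (K : R -> Omega -> R),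
    [/\ Spspace P T F p Y, Mpspace P T F p Z & Vincpspace P T F p K] /\
    [/\ rbsde_solution P T F B xi g V L Y Z K,
        (fun n => Snorm P T p (fun t w => Yn n t w - Y t w)%R
                  + Mnorm P T p (fun t w => Zn n t w - Z t w)%R)%E @ \oo --> 0%E,
        (exists2 nj : nat -> nat, (forall i j, (i < j)%N -> (nj i < nj j)%N) &
           {ae P, forall w,
             (fun j => sup_from T 0 (fun t => `|Kn (nj j) t w - K t w|)) @ \oo
               --> 0%E}) &
        increases P T Kn \/ decreases P T Kn ->
        (fun n => Snorm P T p (fun t w => Kn n t w - K t w)) @ \oo --> 0%E].
Proof.
have T0 : 0 <= T by exact: ltW.
subst F.
have hI n : exists I, ito_integral P T (brownian_filtration P B) B (Zn n) I /\
    {ae P, forall w, forall t, 0 <= t <= T ->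
          Yn n t w = xi w + (\int[@completed_lebesgue_measure R]_(s in `[t, T]) gn n s w (Yn n s w) (Zn n s w))
                  + (V T w - V t w) + (Kn n T w - Kn n t w) - (I T w - I t w)}.
  by have [_ [[_ _ [I h1 h2] _] _]] := hsol n; exists I.
(* The stochastic integrals, existentially quantified in each solution, are fixed as one
   sequence. *)
have [In hIn] := choice hI.
apply: (rbsde_limit hP T0 hB (In := In) hp hlambda hf hpsi hbound hL (fun n => (hYn n).1) (fun n => (hZn n).1) _
  (fun n => (hIn n).1) _ _ hYmono heta hest g_cont hlim).
- by move=> n; case: (hKn n) => -[].
- move=> n; have [_ [[h1 h2 _ h4] _]] := hsol n; split => //; exact: (hIn n).2.
- by move=> n; have [_ [_ [h1 h2 h3 h4]]] := hsol n.
Qed.
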